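(* Let $(M^{4n+3},\phi_\delta,\xi_\delta,\eta_\delta,g)$, $\delta\in\{1,2,3\}$, be a $3$-quasi-Sasakian manifold of rank $4l+3$ with $[\xi_\alpha,\xi_\beta]=c\,\xi_\gamma$ for every even permutation $(\alpha,\beta,\gamma)$ of $\{1,2,3\}$, $c\neq0$. Then $M^{4n+3}$ is locally the Riemannian product of a $3$-$\alpha$-Sasakian manifold $M^{4l+3}$, where $\alpha=\frac{c}{2}$, and a hyper-K\''ahler manifold $M^{4m}$, with $m=n-l$ (superscripts denote dimensions).
   Context: Conventions: for a $1$-form $\eta$, $2d\eta(X,Y)=X(\eta(Y))-Y(\eta(X))-\eta([X,Y])$. An almost contact metric structure $(\phi,\xi,\eta,g)$ consists of a $(1,1)$-tensor $\phi$, a vector field $\xi$, a $1$-form $\eta$ and a Riemannian metric $g$ with $\phi^2=-I+\eta\otimes\xi$, $\eta(\xi)=1$, $g(\phi X,\phi Y)=g(X,Y)-\eta(X)\eta(Y)$. Its fundamental $2$-form is $\Phi(X,Y)=g(X,\phi Y)$. It is normal if $[\phi,\phi]+2d\eta\otimes\xi=0$ ($[\phi,\phi]$ the Nijenhuis torsion), quasi-Sasakian if it is normal and $d\Phi=0$, and $\alpha$-Sasakian, for a real constant $\alpha\ne0$, if it is normal and $d\eta=\alpha\Phi$. A quasi-Sasakian structure has rank $2p+1$ if $\eta\wedge(d\eta)^p\neq0$ and $(d\eta)^{p+1}=0$ on $M$; only structures of constant rank are considered. An almost $3$-contact metric manifold is a $(4n+3)$-dimensional manifold with three almost contact metric structures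 $(\phi_\delta,\xi_\delta,\eta_\delta,g)$, $\delta=1,2,3$, with the same metric $g$, such that for every even permutation $(\alpha,\beta,\gamma)$ of $\{1,2,3\}$: $\phi_\gamma=\phi_\alpha\phi_\beta-\eta_\beta\otimes\xi_\alpha=-\phi_\beta\phi_\alpha+\eta_\alpha\otimes\xi_\beta$, $\xi_\gamma=\phi_\alpha\xi_\beta=-\phi_\beta\xi_\alpha$, $\eta_\gamma=\eta_\alpha\circ\phi_\beta=-\eta_\beta\circ\phi_\alpha$. It is $3$-quasi-Sasakian if each structure is quasi-Sasakian, and $3$-$\alpha$-Sasakian if each structure is $\alpha$-Sasakian (with the same real constant $\alpha\ne0$). On a $3$-quasi-Sasakian manifold it is known that there is $c\in\mathbb{R}$ with $[\xi_\alpha,\xi_\beta]=c\,\xi_\gamma$ for every even permutation, and that $\eta_1,\eta_2,\eta_3$ have the same rank, called the rank of $M$; it is $4l+1$ if $c=0$ and $4l+3$ if $c\ne0$, for some $0\le l\le n$. *)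

(* Defs.v *)
From HB Require Import structures.
From mathcomp Require Import all_boot all_order all_algebra all_fingroup.
From mathcomp Require Import all_classical all_reals all_analysis.

Set Implicit Arguments.
Unset Strict Implicit.
Unset Printing Implicit Defensive.

Import Order.TTheory GRing.Theory Num.Theory.
Import numFieldNormedType.Exports.

Local Open Scope classical_set_scope.
Local Open Scope ring_scope.

Section SmoothEuclidean.
Context {R : realType} {d : nat} {W : normedModType R}.
Implicit Types (f : 'rV[R]_d -> W) (U : set 'rV[R]_d).

Definition partial (i : 'I_d) f : 'rV[R]_d -> W := 'D_(delta_mx 0 i) f.

Definition iter_partial (s : seq 'I_d) f : 'rV[R]_d -> W := foldr partial f s.

(* C^oo on an open set U: all iterated partial derivatives exist and are
   continuous on U. *)
Definition smooth_on U f : Prop :=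
  forall (s : seq 'I_d) x, U x ->
    {for x, continuous (iter_partial s f)} /\
    forall i, derivable (iter_partial s f) x (delta_mx 0 i).

End SmoothEuclidean.

Record chart (R : realType) (T : topologicalType) (d : nat) := Chart {
  chart_fun :> T -> 'rV[R]_d;
  chart_inv : 'rV[R]_d -> T;
  chart_dom : set T;
  chart_dom_open : open chart_dom;
  chart_im_open : open (chart_fun @` chart_dom);
  chartK : forall x, chart_dom x -> chart_inv (chart_fun x) = x;
  chart_continuous : forall x, chart_dom x -> {for x, continuous chart_fun};
  chart_inv_continuous : forall u, (chart_fun @` chart_dom) u ->
    {for u, continuous chart_inv} }.

(* The atlas is indexed by the points of the manifold: chart_at p is a chart
   around p, and the charts (chart_at p) form the atlas.  Any smooth atlas
   yields such a family defining the same smooth structure. *)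
Record manifold (R : realType) (d : nat) := Manifold {
  manifold_sort :> topologicalType;
  chart_at : manifold_sort -> chart R manifold_sort d;
  chart_at_dom : forall p, chart_dom (chart_at p) p;
  chart_at_compat : forall p q,
    smooth_on (chart_at p @` (chart_dom (chart_at p) `&` chart_dom (chart_at q)))
      (chart_at q \o chart_inv (chart_at p));
  manifold_hausdorff : hausdorff_space manifold_sort;
  manifold_second_countable : @second_countable manifold_sort }.

Arguments chart_at {R d M} p : rename.

(* Tangent vectors at p are represented by their components in chart_at p, so
   every tangent space is 'rV[R]_d and a vector field is a function of type
   M -> 'rV[R]_d.  Passing to the components in another chart is tangent_coord. *)
Section Calculus.
Context {R : realType} {d : nat} {M : manifold R d}.
Implicit Types (p q : M) (f : M -> R) (X Y Z : M -> 'rV[R]_d).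

Definition chart_im p : set 'rV[R]_d := chart_at p @` chart_dom (chart_at p).

Definition tangent_coord p q (v : 'rV[R]_d) : 'rV[R]_d :=
  'D_v (chart_at p \o chart_inv (chart_at q)) (chart_at q q).

(* A vector field X read in the chart chart_at p. *)
Definition field_in_chart p X (u : 'rV[R]_d) : 'rV[R]_d :=
  let q := chart_inv (chart_at p) u in tangent_coord p q (X q).

Definition smooth_fun f : Prop :=
  forall p, smooth_on (chart_im p) (f \o chart_inv (chart_at p)).

Definition smooth_field X : Prop :=
  forall p, smooth_on (chart_im p) (field_in_chart p X).

Definition field_app X f : M -> R :=
  fun p => 'D_(X p) (f \o chart_inv (chart_at p)) (chart_at p p).

Definition bracket X Y : M -> 'rV[R]_d := fun p =>
  'D_(X p) (field_in_chart p Y) (chart_at p p)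
  - 'D_(Y p) (field_in_chart p X) (chart_at p p).

(* Tensors are pointwise (multi)linear; they are smooth when they send smooth
   vector fields to smooth functions or fields. *)
Definition smooth_endo (phi : M -> {linear 'rV[R]_d -> 'rV[R]_d}) : Prop :=
  forall X, smooth_field X -> smooth_field (fun p => phi p (X p)).

Definition smooth_one_form (eta : M -> {scalar 'rV[R]_d}) : Prop :=
  forall X, smooth_field X -> smooth_fun (fun p => eta p (X p)).

Definition smooth_metric (g : M -> {biscalar 'rV[R]_d}) : Prop :=
  forall X Y, smooth_field X -> smooth_field Y ->
    smooth_fun (fun p => g p (X p) (Y p)).

(* Normalisation 2 d w (X, Y) = X (w Y) - Y (w X) - w [X, Y]. *)
Definition d_form1 (w : M -> 'rV[R]_d -> R) X Y : M -> R := fun p =>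
  2^-1 * (field_app X (fun q => w q (Y q)) p
          - field_app Y (fun q => w q (X q)) p
          - w p (bracket X Y p)).

(* With the same normalisation, 3 d w (X, Y, Z) is the cyclic sum of
   X (w (Y, Z)) - w ([X, Y], Z). *)
Definition d_form2 (w : M -> 'rV[R]_d -> 'rV[R]_d -> R) X Y Z : M -> R :=
  fun p =>
  3^-1 * (field_app X (fun q => w q (Y q) (Z q)) p
          + field_app Y (fun q => w q (Z q) (X q)) p
          + field_app Z (fun q => w q (X q) (Y q)) p
          - w p (bracket X Y p) (Z p)
          - w p (bracket Y Z p) (X p)
          - w p (bracket Z X p) (Y p)).

(* A k-form, given by its values on k vector fields. *)
Definition form k := ('I_k -> M -> 'rV[R]_d) -> M -> R.

(* a /\ b = Alt (a (x) b), the wedge product matching the normalisation of the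
   exterior derivative above. *)
Definition wedge k l (a : form k) (b : form l) : form (k + l) := fun V p =>
  (k + l)`!%:R^-1 * \sum_(s : 'S_(k + l)) (-1) ^+ s
    * (a (fun i => V (s (lshift l i))) p * b (fun j => V (s (rshift k j))) p).

Fixpoint wedge_pow (a : form 2) (m : nat) : form (m * 2) :=
  if m is m'.+1 then wedge a (@wedge_pow a m') else fun _ _ => 1.

Definition form_zero k (a : form k) : Prop :=
  forall V, (forall i, smooth_field (V i)) -> forall p, a V p = 0.

Definition form_nowhere_zero k (a : form k) : Prop :=
  forall p, exists2 V, (forall i, smooth_field (V i)) & a V p <> 0.

Definition nijenhuis (phi : M -> {linear 'rV[R]_d -> 'rV[R]_d}) X Y :
    M -> 'rV[R]_d := fun p =>
  let phiX q := phi q (X q) in let phiY q := phi q (Y q) in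
  phi p (phi p (bracket X Y p)) + bracket phiX phiY p
  - phi p (bracket phiX Y p) - phi p (bracket X phiY p).

End Calculus.

Arguments wedge_pow {R d M} a m.

Record riemannian_metric (R : realType) d (M : manifold R d) :=
  RiemannianMetric {
  metric :> M -> {biscalar 'rV[R]_d};
  metric_smooth : smooth_metric metric;
  metric_sym : forall p u v, metric p u v = metric p v u;
  metric_pos : forall p u, u != 0 -> 0 < metric p u u }.

Record almost_contact_metric (R : realType) d (M : manifold R d)
    (g : riemannian_metric M) := AlmostContactMetric {
  acm_phi : M -> {linear 'rV[R]_d -> 'rV[R]_d};
  acm_xi : M -> 'rV[R]_d;
  acm_eta : M -> {scalar 'rV[R]_d};
  acm_phi_smooth : smooth_endo acm_phi;
  acm_xi_smooth : smooth_field acm_xi;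
  acm_eta_smooth : smooth_one_form acm_eta;
  acm_phi2 : forall p v,
    acm_phi p (acm_phi p v) = - v + acm_eta p v *: acm_xi p;
  acm_eta_xi : forall p, acm_eta p (acm_xi p) = 1;
  acm_compat : forall p u v,
    g p (acm_phi p u) (acm_phi p v) = g p u v - acm_eta p u * acm_eta p v }.

Section AlmostContact.
Context {R : realType} {d : nat} {M : manifold R d} {g : riemannian_metric M}.
Implicit Types S : almost_contact_metric g.

Definition fundamental_form S (p : M) (u v : 'rV[R]_d) : R :=
  g p u (acm_phi S p v).

Definition eta_form S : form 1 := fun V p => acm_eta S p (V 0 p).

Definition d_eta S : (M -> 'rV[R]_d) -> (M -> 'rV[R]_d) -> M -> R :=
  d_form1 (fun p u => acm_eta S p u).

Definition d_eta_form S : form 2 := fun V => d_eta S (V 0) (V 1).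

Definition normal S : Prop :=
  forall X Y, smooth_field X -> smooth_field Y -> forall p,
    nijenhuis (acm_phi S) X Y p + (2 * d_eta S X Y p) *: acm_xi S p = 0.

Definition quasi_sasakian S : Prop :=
  normal S /\
  forall X Y Z, smooth_field X -> smooth_field Y -> smooth_field Z ->
    forall p, d_form2 (fundamental_form S) X Y Z p = 0.

Definition alpha_sasakian (alpha : R) S : Prop :=
  [/\ alpha != 0, normal S
    & forall X Y, smooth_field X -> smooth_field Y -> forall p,
        d_eta S X Y p = alpha * fundamental_form S p (X p) (Y p)].

(* "eta /\ (d eta)^p <> 0 on M" means that it vanishes at no point: only
   structures of constant rank are considered. *)
Definition has_rank S (r : nat) : Prop :=
  exists p : nat, [/\ r = (2 * p).+1,
    form_nowhere_zero (wedge (eta_form S) (wedge_pow (d_eta_form S) p))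
    & form_zero (wedge_pow (d_eta_form S) p.+1)].

End AlmostContact.

(* The index set {1, 2, 3} is 'I_3 = {0, 1, 2}. *)
Definition for_even_perm (P : 'I_3 -> 'I_3 -> 'I_3 -> Prop) : Prop :=
  forall s : 'S_3, ~~ odd_perm s -> P (s 0) (s 1) (s 2).

Section ThreeStructures.
Context {R : realType} {d : nat} {M : manifold R d} {g : riemannian_metric M}.
Implicit Types S : 'I_3 -> almost_contact_metric g.

Definition almost_3_contact S : Prop :=
  for_even_perm (fun a b c => forall p : M,
    let phi i := acm_phi (S i) p in
    let xi i := acm_xi (S i) p in
    let eta i := acm_eta (S i) p in
    [/\ forall v, phi c v = phi a (phi b v) - eta b v *: xi a
               /\ phi c v = - phi b (phi a v) + eta a v *: xi b,
        xi c = phi a (xi b) /\ xi c = - phi b (xi a)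
      & forall v, eta c v = eta a (phi b v) /\ eta c v = - eta b (phi a v)]).

Definition three_quasi_sasakian S : Prop :=
  almost_3_contact S /\ forall i, quasi_sasakian (S i).

Definition three_alpha_sasakian (alpha : R) S : Prop :=
  almost_3_contact S /\ forall i, alpha_sasakian alpha (S i).

Definition three_rank S (r : nat) : Prop := forall i, has_rank (S i) r.

(* [xi_a, xi_b] = c xi_c for the even permutations (a, b, c). *)
Definition reeb_bracket_constant S (c : R) : Prop :=
  for_even_perm (fun a b e => forall p,
    bracket (acm_xi (S a)) (acm_xi (S b)) p = c *: acm_xi (S e) p).

(* Kaehler structure: an almost Hermitian structure that is integrable (zero
   Nijenhuis torsion) with closed fundamental form. *)
Definition kahler (J : M -> {linear 'rV[R]_d -> 'rV[R]_d}) : Prop :=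
  [/\ smooth_endo J,
      forall p v, J p (J p v) = - v,
      forall p u v, g p (J p u) (J p v) = g p u v,
      forall X Y, smooth_field X -> smooth_field Y ->
        forall p, nijenhuis J X Y p = 0
    & forall X Y Z, smooth_field X -> smooth_field Y -> smooth_field Z ->
        forall p, d_form2 (fun p u v => g p u (J p v)) X Y Z p = 0].

End ThreeStructures.

Definition hyper_kahler (R : realType) d (M : manifold R d)
    (g : riemannian_metric M) : Prop :=
  exists J : 'I_3 -> M -> {linear 'rV[R]_d -> 'rV[R]_d},
    (forall i, @kahler R d M g (J i)) /\
    for_even_perm (fun a b c => forall p v,
      J c p v = J a p (J b p v) /\ J c p v = - J b p (J a p v)).

Section Maps.
Context {R : realType} {d e : nat} {M : manifold R d} {N : manifold R e}.
Implicit Types (F : M -> N) (D : set M).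

Definition smooth_map_on D F : Prop :=
  (forall p, D p -> {for p, continuous F}) /\
  forall p q, smooth_on
    (chart_at p @` (chart_dom (chart_at p) `&` D
                    `&` F @^-1` chart_dom (chart_at q)))
    (chart_at q \o F \o chart_inv (chart_at p)).

Definition tangent_map F (p : M) (v : 'rV[R]_d) : 'rV[R]_e :=
  'D_v (chart_at (F p) \o F \o chart_inv (chart_at p)) (chart_at p p).

End Maps.

(* F is a diffeomorphism of the open set U onto N carrying the metric gM to gN. *)
Definition isometry_of_open (R : realType) d e
    (M : manifold R d) (N : manifold R e)
    (gM : M -> 'rV[R]_d -> 'rV[R]_d -> R) (gN : N -> 'rV[R]_e -> 'rV[R]_e -> R)
    (U : set M) (F : M -> N) : Prop :=
  [/\ smooth_map_on U F,
      exists G : N -> M,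
        [/\ smooth_map_on setT G, forall x, U (G x),
            forall x, F (G x) = x & forall p, U p -> G (F p) = p]
    & forall p, U p -> forall u v,
        gN (F p) (tangent_map F p u) (tangent_map F p v) = gM p u v].

Section ProductManifold.
Context {R : realType}.

Lemma cvg_row_mx (T : Type) (F : set_system T) (FF : Filter F) d e
    (f : T -> 'rV[R]_d) (h : T -> 'rV[R]_e)
    (a : 'rV[R]_d) (b : 'rV[R]_e) :
  f @ F --> a -> h @ F --> b -> (fun t => row_mx (f t) (h t)) @ F --> row_mx a b.
Proof.
move=> fa hb; apply/cvg_ballP => eps eps0.
move/cvg_ballP : fa => /(_ _ eps0) fa; move/cvg_ballP : hb => /(_ _ eps0) hb.
apply: filterS2 fa hb => t [_ fa] [_ hb]; split=> // i j; rewrite !mxE.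
by case: split_ordP => k _.
Qed.

Lemma smooth_onS d (W : normedModType R) (A B : set 'rV[R]_d)
    (f : 'rV[R]_d -> W) : A `<=` B -> smooth_on B f -> smooth_on A f.
Proof. by move=> AB sf s x /AB; exact: sf. Qed.

Lemma smooth_on_partial d (W : normedModType R) (A : set 'rV[R]_d)
    (f : 'rV[R]_d -> W) i : smooth_on A f -> smooth_on A (partial i f).
Proof.
move=> sf s x Ax; have := sf (rcons s i) x Ax.
by rewrite /iter_partial foldr_rcons.
Qed.

Lemma smooth_on0 d (W : normedModType R) (A : set 'rV[R]_d) :
  smooth_on A (fun=> 0 : W).
Proof.
move=> s x _; suff -> : iter_partial s (fun=> 0 : W) = cst 0 :> ('rV[R]_d -> W).
  by split=> [|i]; [exact: cst_continuous|exact: derivable_cst].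
elim: s => //= i s ->; apply/funext => y; exact: derive_cst.
Qed.

Section block.
Context {d e d' e' : nat} (A : set 'rV[R]_d) (B : set 'rV[R]_e).
Hypotheses (oA : open A) (oB : open B).
Let W : set 'rV[R]_(d + e) := [set u | A (lsubmx u) /\ B (rsubmx u)].
Let H (f : 'rV[R]_d -> 'rV[R]_d') (h : 'rV[R]_e -> 'rV[R]_e') u :=
  row_mx (f (lsubmx u)) (h (rsubmx u)).

Let oW : open W.
Proof.
apply: openI; first by apply: open_comp oA => u _; exact: continuous_lsubmx.
by apply: open_comp oB => u _; exact: continuous_rsubmx.
Qed.

Let block_quotient f h u t v :
  t^-1 *: (H f h (t *: v + u) - H f h u) =
  row_mx (t^-1 *: (f (t *: lsubmx v + lsubmx u) - f (lsubmx u)))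
         (t^-1 *: (h (t *: rsubmx v + rsubmx u) - h (rsubmx u))).
Proof. by rewrite /H !linearP/= opp_row_mx add_row_mx scale_row_mx. Qed.

Let block_derive f h u v :
  derivable f (lsubmx u) (lsubmx v) -> derivable h (rsubmx u) (rsubmx v) ->
  is_derive u v (H f h)
    (row_mx ('D_(lsubmx v) f (lsubmx u)) ('D_(rsubmx v) h (rsubmx u))).
Proof.
move=> df dh.
have cH : (fun t => t^-1 *: ((H f h \o shift u) (t *: v) - H f h u)) @ 0^' -->
    row_mx ('D_(lsubmx v) f (lsubmx u)) ('D_(rsubmx v) h (rsubmx u)).
  rewrite [X in X @ _](_ : _ = fun t =>
    row_mx (t^-1 *: ((f \o shift (lsubmx u)) (t *: lsubmx v) - f (lsubmx u)))
           (t^-1 *: ((h \o shift (rsubmx u)) (t *: rsubmx v) - h (rsubmx u)))).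
    exact: cvg_row_mx.
  by apply/funext => t /=; rewrite block_quotient.
by split; [apply/cvg_ex; eexists; exact: cH|exact: cvg_lim cH].
Qed.

Let block_derivable f h u v a b : lsubmx v = a -> rsubmx v = b ->
  derivable f (lsubmx u) a -> derivable h (rsubmx u) b ->
  derivable (H f h) u v.
Proof. by move=> <- <- df dh; have [] := block_derive df dh. Qed.

Let lsubmx_l i : lsubmx (delta_mx 0 (lshift e i) : 'rV[R]_(d + e)) = delta_mx 0 i.
Proof. by apply/rowP => x; rewrite !mxE eq_lshift. Qed.

Let rsubmx_l i : rsubmx (delta_mx 0 (lshift e i) : 'rV[R]_(d + e)) = 0.
Proof. by apply/rowP => x; rewrite !mxE eq_rlshift. Qed.

Let lsubmx_r j : lsubmx (delta_mx 0 (rshift d j) : 'rV[R]_(d + e)) = 0.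
Proof. by apply/rowP => x; rewrite !mxE eq_lrshift. Qed.

Let rsubmx_r j : rsubmx (delta_mx 0 (rshift d j) : 'rV[R]_(d + e)) = delta_mx 0 j.
Proof. by apply/rowP => x; rewrite !mxE eq_rshift. Qed.

Lemma smooth_on_block f h : smooth_on A f -> smooth_on B h ->
  smooth_on [set u : 'rV[R]_(d + e) | A (lsubmx u) /\ B (rsubmx u)]
    (fun u => row_mx (f (lsubmx u)) (h (rsubmx u)) : 'rV[R]_(d' + e')).
Proof.
move=> sf sh; change (smooth_on W (H f h)) => s.
have [f1 [h1 [sf1 sh1 Hs]]] : exists f1 h1, [/\ smooth_on A f1, smooth_on B h1 &
    forall u, W u -> iter_partial s (H f h) u = H f1 h1 u].
  elim: s => [|k s [f1 [h1 [sf1 sh1 IH]]]]; first by exists f, h.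
  have nearE u : W u -> \near u, iter_partial s (H f h) u = H f1 h1 u.
    by move=> Wu; near=> w; apply: IH; near: w; exact: open_nbhs_nbhs.
  have [i|j] := split_ordP k => ->.
    exists (partial i f1), (fun=> 0); split; [exact: smooth_on_partial|
      exact: smooth_on0|].
    move=> u Wu; rewrite /= /partial (near_eq_derive _ (nearE u Wu)).
    have [Au Bu] := Wu.
    have := @block_derive f1 h1 u (delta_mx 0 (lshift e i)).
    rewrite lsubmx_l rsubmx_l derive0 => /(_ ((sf1 [::] _ Au).2 i) (@derivable0 _ _ _ h1 _)) D.
    exact: derive_val.
  exists (fun=> 0), (partial j h1); split; [exact: smooth_on0|
    exact: smooth_on_partial|].
  move=> u Wu; rewrite /= /partial (near_eq_derive _ (nearE u Wu)).
  have [Au Bu] := Wu.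
  have := @block_derive f1 h1 u (delta_mx 0 (rshift d j)).
  rewrite lsubmx_r rsubmx_r derive0 => /(_ (@derivable0 _ _ _ f1 _) ((sh1 [::] _ Bu).2 j)) D.
  exact: derive_val.
move=> u Wu; have [Au Bu] := Wu.
have nearE : \near u, H f1 h1 u = iter_partial s (H f h) u.
  by near=> w; apply/esym/Hs; near: w; exact: open_nbhs_nbhs.
have [cf _] := sf1 [::] _ Au; have [ch _] := sh1 [::] _ Bu.
split=> [|k].
  rewrite /prop_for/continuous_at (Hs _ Wu); apply: cvg_trans (near_eq_cvg nearE) _.
  apply: cvg_row_mx.
    by apply: (cvg_comp _ _ (@continuous_lsubmx _ _ _ _ u)); exact: cf.
  by apply: (cvg_comp _ _ (@continuous_rsubmx _ _ _ _ u)); exact: ch.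
apply: (near_eq_derivable nearE).
have [i|j] := split_ordP k => ->.
  exact: (block_derivable (lsubmx_l i) (rsubmx_l i) ((sf1 [::] _ Au).2 i)
    (@derivable0 _ _ _ h1 _)).
exact: (block_derivable (lsubmx_r j) (rsubmx_r j) (@derivable0 _ _ _ f1 _)
  ((sh1 [::] _ Bu).2 j)).
Unshelve. all: by end_near. Qed.

End block.

Section prod_chart.
Context {S T : topologicalType} {d e : nat} (a : chart R S d) (b : chart R T e).

Definition prod_chart_fun (z : S * T) : 'rV[R]_(d + e) := row_mx (a z.1) (b z.2).
Definition prod_chart_inv (u : 'rV[R]_(d + e)) : S * T :=
  (chart_inv a (lsubmx u), chart_inv b (rsubmx u)).
Definition prod_chart_dom : set (S * T) := chart_dom a `*` chart_dom b.

Lemma prod_chart_imE (A : set S) (B : set T) :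
  prod_chart_fun @` (A `*` B) =
  [set u | (a @` A) (lsubmx u) /\ (b @` B) (rsubmx u)].
Proof.
apply/seteqP; split=> u /=.
  move=> [[x y] [/= Ax By] <-]; rewrite row_mxKl row_mxKr.
  by split; [exists x|exists y].
move=> [[x Ax xu] [y By yu]]; exists (x, y) => //=.
by rewrite /prod_chart_fun /= xu yu hsubmxK.
Qed.

Lemma open_setX (A : set S) (B : set T) : open A -> open B -> open (A `*` B).
Proof.
move=> oA oB; rewrite openE => -[x y] [/= Ax By]; exists (A, B) => //=.
by split; exact: open_nbhs_nbhs.
Qed.

Lemma prod_chart_dom_open : open prod_chart_dom.
Proof. by apply: open_setX; exact: chart_dom_open. Qed.

Lemma prod_chart_im_open : open (prod_chart_fun @` prod_chart_dom).
Proof.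
rewrite prod_chart_imE; apply: openI.
  apply: (@open_comp _ _ lsubmx (a @` chart_dom a)); last exact: chart_im_open.
  by move=> u _; exact: continuous_lsubmx.
apply: (@open_comp _ _ rsubmx (b @` chart_dom b)); last exact: chart_im_open.
by move=> u _; exact: continuous_rsubmx.
Qed.

Lemma prod_chartK x : prod_chart_dom x -> prod_chart_inv (prod_chart_fun x) = x.
Proof.
case: x => x y [/= ax bY].
by rewrite /prod_chart_inv /prod_chart_fun row_mxKl row_mxKr !chartK.
Qed.

Lemma prod_chart_continuous x :
  prod_chart_dom x -> {for x, continuous prod_chart_fun}.
Proof.
move=> [ax bx]; apply: cvg_row_mx.
  by apply: (cvg_comp _ _ (@cvg_fst _ _ (nbhs x.1) (nbhs x.2) _)); exact: chart_continuous.
by apply: (cvg_comp _ _ (@cvg_snd _ _ (nbhs x.1) (nbhs x.2) _)); exact: chart_continuous.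
Qed.

Lemma prod_chart_inv_continuous u : (prod_chart_fun @` prod_chart_dom) u ->
  {for u, continuous prod_chart_inv}.
Proof.
rewrite prod_chart_imE => -[au bu].
have ca : chart_inv a (lsubmx w) @[w --> u] --> chart_inv a (lsubmx u).
  exact: (cvg_comp _ _ (@continuous_lsubmx _ _ _ _ u) (chart_inv_continuous au)).
have cb : chart_inv b (rsubmx w) @[w --> u] --> chart_inv b (rsubmx u).
  exact: (cvg_comp _ _ (@continuous_rsubmx _ _ _ _ u) (chart_inv_continuous bu)).
exact: (cvg_pair ca cb).
Qed.

Definition prod_chart : chart R (S * T)%type (d + e) :=
  Chart prod_chart_dom_open prod_chart_im_open prod_chartK
    prod_chart_continuous prod_chart_inv_continuous.

End prod_chart.

Lemma chart_im_openS (S : topologicalType) d (a : chart R S d) (A : set S) :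
  open A -> open (a @` (chart_dom a `&` A)).
Proof.
move=> oA; rewrite openE => _ [x [ax Ax] <-].
have im : (a @` chart_dom a) (a x) by exists x.
have near_im : \forall u \near a x, (a @` chart_dom a) u.
  by apply: open_nbhs_nbhs; split=> //; exact: chart_im_open.
have : \forall u \near a x, A (chart_inv a u).
  have := chart_inv_continuous im; apply; rewrite chartK//.
  exact: open_nbhs_nbhs.
apply: filterS2 near_im => _ [y ay <-]; rewrite chartK// => Ay.
by exists y.
Qed.

Context {d e : nat} (M : manifold R d) (N : manifold R e).

Definition prod_chart_at (z : M * N) : chart R (M * N)%type (d + e) :=
  prod_chart (chart_at z.1) (chart_at z.2).

Lemma prod_chart_at_dom z : chart_dom (prod_chart_at z) z.
Proof. by split; exact: chart_at_dom. Qed.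

Lemma prod_chart_at_compat z w :
  smooth_on (prod_chart_at z @`
      (chart_dom (prod_chart_at z) `&` chart_dom (prod_chart_at w)))
    (prod_chart_at w \o chart_inv (prod_chart_at z)).
Proof.
rewrite [chart_dom _ `&` _](_ : _ =
  (chart_dom (chart_at z.1) `&` chart_dom (chart_at w.1)) `*`
  (chart_dom (chart_at z.2) `&` chart_dom (chart_at w.2))); last first.
  by apply/seteqP; split=> -[x y] /=; case=> -[? ?] [? ?].
rewrite prod_chart_imE.
exact: (smooth_on_block (chart_im_openS (chart_dom_open _))
  (chart_im_openS (chart_dom_open _)) (@chart_at_compat _ _ M z.1 w.1)
  (@chart_at_compat _ _ N z.2 w.2)).
Qed.

Lemma prod_hausdorff : hausdorff_space (M * N)%type.
Proof.
have nX (z : M * N) A B : nbhs z.1 A -> nbhs z.2 B -> nbhs z (A `*` B).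
  by move=> zA zB; exists (A, B).
move=> z w cl; rewrite [z]surjective_pairing [w]surjective_pairing.
congr pair.
  apply: (@manifold_hausdorff _ _ M) => A B zA wB.
  have [x [[Ax _] [Bx _]]] := cl _ _ (nX z _ _ zA filterT) (nX w _ _ wB filterT).
  by exists x.1.
apply: (@manifold_hausdorff _ _ N) => A B zA wB.
have [x [[_ Ax] [_ Bx]]] := cl _ _ (nX z _ _ filterT zA) (nX w _ _ filterT wB).
by exists x.2.
Qed.

Lemma prod_second_countable : @second_countable (M * N)%type.
Proof.
have [A cA [oA bA]] := @manifold_second_countable _ _ M.
have [B cB [oB bB]] := @manifold_second_countable _ _ N.
exists ((fun z => z.1 `*` z.2) @` (A `*` B)).
  by apply: card_le_trans (card_image_le _ _) _; exact: countableX.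
split=> [_ [[P Q] [/= AP BQ] <-]|[x y] C [[P Q] [/= xP yQ] PQC]].
  by apply: open_setX; [exact: oA|exact: oB].
have [P' [AP' P'x] P'P] := bA _ _ xP; have [Q' [BQ' Q'y] Q'Q] := bB _ _ yQ.
exists (P' `*` Q'); first by split=> //; exists (P', Q').
by move=> [u v] [/= /P'P Pu /Q'Q Qv]; exact: PQC.
Qed.

Definition prod_manifold : manifold R (d + e) :=
  Manifold prod_chart_at_dom prod_chart_at_compat prod_hausdorff
    prod_second_countable.

(* In the product charts, the tangent space of M x N at a point is the direct
   sum of the tangent spaces of M (left block) and N (right block). *)
Definition prod_metric (gM : riemannian_metric M) (gN : riemannian_metric N)
    (z : prod_manifold) (u v : 'rV[R]_(d + e)) : R :=
  gM z.1 (lsubmx u) (lsubmx v) + gN z.2 (rsubmx u) (rsubmx v).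

End ProductManifold.

(* M is locally the Riemannian product of manifolds of dimensions d and e whose
   metrics satisfy P and Q: every point has an open neighbourhood isometric to
   such a product (the factors may depend on the point). *)
Definition locally_riemannian_product (R : realType) k (M : manifold R k)
    (g : riemannian_metric M) d e
    (P : forall N : manifold R d, riemannian_metric N -> Prop)
    (Q : forall N : manifold R e, riemannian_metric N -> Prop) : Prop :=
  forall p : M, exists (U : set M)
    (N1 : manifold R d) (g1 : riemannian_metric N1)
    (N2 : manifold R e) (g2 : riemannian_metric N2)
    (F : M -> prod_manifold N1 N2),
    [/\ open U, U p, P N1 g1, Q N2 g2
      & @isometry_of_open R k (d + e) M (prod_manifold N1 N2)
          (fun q u v => g q u v) (@prod_metric R d e N1 N2 g1 g2) U F].

(* Main.v *)
(* In a chart, write d eta_a (v, w) = g (v, T_a w).  The Reeb fields are Killing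
   and preserve their own tensors; differentiating phi_2, phi_3 and the two-forms
   along xi_1 relates T_1, T_2, T_3, and shows that
   P = (2 / c) (- phi_a T_a + (c / 2) eta_a (x) xi_a) does not depend on a, is an
   orthogonal projection commuting with every phi_a, fixes every xi_a, and satisfies
   d eta_a (v, w) = (c / 2) g (P v, phi_a w).  Comparison with the definition of the
   rank gives rank P = 4 l + 3.

   The image of P is the kernel of the closed form Phi_a - (2 / c) d eta_a, and its
   kernel is the common kernel of the closed forms d eta_a, so both distributions are
   integrable; applying the Frobenius theorem twice yields coordinates (x, y) in which
   P is the projection onto the first block.  There closedness makes the restrictions
   of eta_a and d eta_a to the first block independent of y, and those of Phi_a to the
   second block independent of x.  The metric on each block is determined by these
   restrictions, hence it is a product metric; the slices y = 0 and x = 0 carry the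
   3-alpha-Sasakian and the hyper-Kaehler structures.

   The Frobenius theorem is proved without integrating differential equations: the
   flow is the limit of Euler polygons with 2 ^ n steps. *)
From HB Require Import structures.
Require Import Defs.
From mathcomp Require Import all_boot all_order all_algebra all_fingroup.
From mathcomp Require Import ring lra zify.
From mathcomp Require Import all_classical all_reals all_analysis.

Set Implicit Arguments.
Unset Strict Implicit.
Unset Printing Implicit Defensive.

Import Order.TTheory GRing.Theory Num.Theory.
Import numFieldNormedType.Exports.

Local Open Scope classical_set_scope.
Local Open Scope ring_scope.

(** * Differentiability of smooth maps *)

Section Differentiability.
Context {R : realType}.
Implicit Types (V W : normedModType R).

Lemma is_diff_eps V W (f : V -> W) (L : {linear V -> W}) x : continuous L ->
  (forall e, 0 < e -> \forall h \near 0, `|f (h + x) - f x - L h| <= e * `|h|) ->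
  is_diff x f L.
Proof.
move=> cL fL.
have fE : f \o shift x = cst (f x) + L +o_ 0 id.
  apply/eqaddoP => e e0; move: (fL e e0); apply: filterS => h.
  by rewrite !fctE /= -addrA -opprD.
have dE := diff_unique cL fE.
by apply: DiffDef => //; apply/diff_locallyP; rewrite dE.
Qed.

Lemma is_derive_scale V W (f : V -> W) x v df (k : R) :
  is_derive x v f df -> is_derive x (k *: v) f (k *: df).
Proof.
have [->|k0] := eqVneq k 0; first by rewrite !scale0r => _; exact: is_derive0.
move=> [dv <-].
have kk : (fun t : R => t * k) @ 0^' --> 0^'.
  move=> A /= /nbhs_ballP[e /= e0 eA]; apply/nbhs_ballP.
  exists (e / `|k|); first by rewrite /= divr_gt0 ?normr_gt0.
  move=> t /=; rewrite /ball /= !sub0r !normrN => te t0; apply: eA.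
    by rewrite /ball /= sub0r normrN normrM -ltr_pdivlMr ?normr_gt0.
  by rewrite /= mulf_neq0.
have cE : (fun t : R => t^-1 *: ((f \o shift x) (t *: (k *: v)) - f x)) @ 0^' -->
    k *: 'D_v f x.
  rewrite [X in X @ _](_ : _ = fun t =>
    k *: ((t * k)^-1 *: ((f \o shift x) ((t * k) *: v) - f x))).
    by apply: cvgZr; exact: (cvg_comp _ _ kk dv).
  apply/funext => t; rewrite !scalerA invfM mulrCA divff// mulr1.
  by [].
by split; [apply/cvg_ex; eexists; exact: cE|exact: cvg_lim cE].
Qed.

Lemma mean_value_line V (f : V -> R) x v :
  (forall t, 0 <= t <= 1 -> derivable f (x + t *: v) v) ->
  exists2 t, 0 <= t <= 1 & f (x + v) - f x = 'D_v f (x + t *: v).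
Proof.
move=> df; pose h t := f (x + t *: v).
have dh (t : R) : 0 <= t <= 1 -> is_derive t 1 h ('D_v f (x + t *: v)).
  move=> t01; have := df _ t01.
  have E : (fun s : R => s^-1 *: ((h \o shift t) s%:A - h t)) =
           (fun s => s^-1 *: ((f \o shift (x + t *: v)) (s *: v) - f (x + t *: v))).
    apply/funext => s; rewrite /h /=; congr (_ *: (f _ - _)).
    by rewrite [_%:A]mulr1 scalerDl addrCA.
  by move=> d; split; rewrite /derivable /derive E.
have [||t t01 E] := @MVT_segment R h (fun t => 'D_v f (x + t *: v)) 0 1 ler01.
- by move=> t; rewrite in_itv/= => /andP[t0 t1]; apply: dh; rewrite !ltW.
- apply: derivable_within_continuous => t; rewrite in_itv/= => t01.
  by have [] := dh _ t01.
- exists t; first by rewrite in_itv/= in t01.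
  by move: E; rewrite /h scale1r scale0r addr0 subr0 mulr1.
Qed.

Lemma mxnorm_coord m n (A : 'M[R]_(m, n)) i j : `|A i j| <= `|A|.
Proof.
rewrite [leRHS]/Num.Def.normr/= mx_normrE.
exact: (le_bigmax _ (fun k => `|A k.1 k.2|) (i, j)).
Qed.

Lemma mxnorm_le m n (A : 'M[R]_(m, n)) (e : R) :
  0 <= e -> (forall i j, `|A i j| <= e) -> `|A| <= e.
Proof.
move=> e0 Ae; rewrite [leLHS]/Num.Def.normr/= mx_normrE bigmax_le// => -[i j] _ /=.
Qed.

Lemma linear_mx_continuous m n W (L : {linear 'M[R]_(m, n) -> W}) :
  continuous L.
Proof.
apply: bounded_linear_continuous.
pose K := \sum_i \sum_j `|L (delta_mx i j)|.
apply/linear_boundedP; near=> k => h.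
apply: (@le_trans _ _ (K * `|h|)); last first.
  by apply: ler_wpM2r => //; near: k; exact: nbhs_pinfty_ge.
rewrite {1}[h]matrix_sum_delta linear_sum mulr_suml.
apply: le_trans (ler_norm_sum _ _ _) _; apply: ler_sum => i _.
rewrite linear_sum mulr_suml.
apply: le_trans (ler_norm_sum _ _ _) _; apply: ler_sum => j _.
by rewrite linearZ normrZ mulrC ler_wpM2l// mxnorm_coord.
Unshelve. all: by end_near. Qed.

End Differentiability.

Section PartialDerivatives.
Context {R : realType} {d : nat}.
Implicit Types (f : 'rV[R]_d -> R) (x : 'rV[R]_d).

Local Notation e_ i := (delta_mx 0 i : 'rV[R]_d).

Let trunc (j : nat) (h : 'rV[R]_d) : 'rV[R]_d :=
  \row_i (if (i < j)%N then h 0 i else 0).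

Let truncS (j : 'I_d) h : trunc j.+1 h = trunc j h + h 0 j *: e_ j.
Proof.
apply/rowP => i; rewrite !mxE eqxx /= ltnS leq_eqVlt.
have [->|ij] := eqVneq i j; first by rewrite eqxx ltnn add0r mulr1.
by rewrite (negbTE (_ : (i : nat) != j))// mulr0 addr0.
Qed.

Lemma C1_is_diff f x :
  (forall i, \forall y \near x, derivable f y (e_ i)) ->
  (forall i, {for x, continuous (partial i f)}) ->
  is_diff x f (fun h => \sum_i h 0 i * partial i f x).
Proof.
move=> df cf; pose L (h : 'rV[R]_d) := \sum_i h 0 i * partial i f x.
have linL : linear L.
  move=> a u v; rewrite /L scaler_sumr -big_split/=; apply: eq_bigr => i _.
  by rewrite !mxE mulrDl scalerAl.
pose mL := GRing.isLinear.Build R _ _ _ L linL.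
pose LL : {linear 'rV[R]_d -> R} := HB.pack L mL.
apply: (@is_diff_eps R _ _ f LL x).
  exact: linear_mx_continuous.
move=> e e0; pose e' := e / d.+1%:R.
have e'0 : 0 < e' by rewrite divr_gt0.
have : \forall y \near x, forall i, derivable f y (e_ i) /\
    `|partial i f x - partial i f y| <= e'.
  apply: (@filter_forall _ _ (fun i y => derivable f y (e_ i) /\
    `|partial i f x - partial i f y| <= e') (nbhs x)) => i.
  near=> y; split; first by near: y; exact: df.
  by near: y; move/cvgrPdist_le : (cf i) => /(_ _ e'0).
move=> /nbhs_ballP[r /= r0 rP]; apply/nbhs_ballP; exists r => //= h.
rewrite mx_norm_ball /ball_ /= sub0r normrN => hr.
have trunc_near (j : 'I_d) t : 0 <= t <= 1 ->
    ball x r (x + trunc j h + t *: (h 0 j *: e_ j)).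
  move=> /andP[t0 t1]; rewrite mx_norm_ball /ball_ /= opprD addrA opprD addrA.
  rewrite subrr sub0r -opprD normrN; apply: le_lt_trans hr.
  apply: mxnorm_le => // k i; rewrite ord1 !mxE eqxx /=.
  have [->|ij] := eqVneq i j.
    rewrite ltnn add0r mulr1 normrM ger0_norm//.
    by apply: le_trans (mxnorm_coord h 0 j); exact: ler_piMl.
  rewrite !mulr0 addr0; case: ifP => _; first exact: mxnorm_coord.
  by rewrite normr0.
have step (j : 'I_d) : `|f (x + trunc j.+1 h) - f (x + trunc j h)
    - h 0 j * partial j f x| <= e' * `|h|.
  rewrite truncS addrA.
  have [t t01|t t01 ->] := @mean_value_line R _ f (x + trunc j h) (h 0 j *: e_ j).
    have [dj _] := rP _ (trunc_near j t t01) j.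
    by have [] := is_derive_scale (h 0 j) (derivableP dj).
  have [dj pj] := rP _ (trunc_near j t t01) j.
  have [_ ->] := is_derive_scale (h 0 j) (derivableP dj).
  rewrite -mulrBr normrM mulrC distrC ler_pM//.
  exact: mxnorm_coord.
have -> : f (h + x) - f x - LL h =
    \sum_(j < d) (f (x + trunc j.+1 h) - f (x + trunc j h) - h 0 j * partial j f x).
  rewrite sumrB -(big_mkord xpredT (fun j => f (x + trunc j.+1 h) - f (x + trunc j h))).
  rewrite telescope_sumr//; congr (f _ - f _ - _).
    rewrite addrC; congr (_ + _); apply/rowP => i; by rewrite mxE ltn_ord.
  by rewrite [trunc 0 h](_ : _ = 0) ?addr0//; apply/rowP => i; rewrite !mxE.
apply: le_trans (ler_norm_sum _ _ _) _.
apply: le_trans (ler_sum _ (fun j _ => step j)) _.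
rewrite sumr_const card_ord -mulr_natl mulrA ler_wpM2r//.
rewrite /e' mulrCA ler_piMr ?(ltW e0)//.
by rewrite ler_pdivrMr// mul1r ler_nat.
Unshelve. all: by end_near. Qed.

(* Both mixed derivatives are limits of the same second difference quotient. *)
Lemma mixed_difference f x i j (U : set 'rV[R]_d) : open U -> U x ->
  (forall y, U y -> derivable f y (e_ i)) ->
  (forall y, U y -> derivable (partial i f) y (e_ j)) ->
  {for x, continuous (partial j (partial i f))} ->
  forall e, 0 < e -> \forall s \near 0^'+,
  `|f (x + s *: e_ i + s *: e_ j) - f (x + s *: e_ i) - (f (x + s *: e_ j) - f x)
   - s ^+ 2 * partial j (partial i f) x| <= e * s ^+ 2.
Proof.
move=> oU Ux di dji cji e e0.
have : \forall y \near x, U y /\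
    `|partial j (partial i f) x - partial j (partial i f) y| <= e.
  near=> y; split; first by near: y; exact: open_nbhs_nbhs.
  by near: y; move/cvgrPdist_le : cji => /(_ _ e0).
move=> /nbhs_ballP[r /= r0 rP].
have ne k : `|e_ k| <= 1 :> R.
  apply: mxnorm_le => // a b; rewrite mxE; case: (_ && _); first by rewrite normr1.
  by rewrite normr0.
near=> s; have s0 : 0 < s by near: s; exact: nbhs_right_gt.
have s2r : s + s < r.
  rewrite -mulr2n -mulr_natr -ltr_pdivlMr//; near: s; apply: nbhs_right_lt.
  by rewrite divr_gt0.
have inb a b : 0 <= a <= s -> 0 <= b <= s -> ball x r (x + a *: e_ i + b *: e_ j).
  move=> /andP[a0 as'] /andP[b0 bs]; rewrite mx_norm_ball /ball_ /=.
  rewrite -addrA opprD addrA subrr sub0r normrN; apply: le_lt_trans s2r.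
  apply: le_trans (ler_normD _ _) _; rewrite !normrZ !ger0_norm//.
  by apply: lerD; [apply: le_trans as'|apply: le_trans bs]; apply: ler_piMr.
have s_i t : 0 <= t <= 1 -> 0 <= t * s <= s.
  by move=> /andP[t0 t1]; rewrite mulr_ge0 ?(ltW s0)//= ler_piMl// ltW.
have ss : 0 <= s <= s by rewrite lexx ltW.
have s00 : 0 <= (0 : R) <= s by rewrite lexx ltW.
pose g y := f (y + s *: e_ j) - f y.
have dshift y : derivable f (y + s *: e_ j) (e_ i) ->
    is_derive y (e_ i) (fun y => f (y + s *: e_ j)) (partial i f (y + s *: e_ j)).
  have E : (fun t : R => t^-1 *: (((fun y => f (y + s *: e_ j)) \o shift y) (t *: e_ i) - f (y + s *: e_ j))) = (fun t => t^-1 *: ((f \o shift (y + s *: e_ j)) (t *: e_ i) - f (y + s *: e_ j))).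
    by apply/funext => t /=; rewrite addrA.
  by move=> d0; split; rewrite /partial /derivable /derive E.
have dg t : 0 <= t <= 1 -> is_derive (x + t *: (s *: e_ i)) (s *: e_ i) g
    (s * (partial i f (x + t *: (s *: e_ i) + s *: e_ j) - partial i f (x + t *: (s *: e_ i)))).
  move=> t01; apply: is_derive_scale; rewrite scalerA.
  have U1 := (rP _ (inb _ _ (s_i _ t01) ss)).1.
  have U0 := (rP _ (inb _ _ (s_i _ t01) s00)).1; rewrite scale0r addr0 in U0.
  apply: is_deriveB; last exact/derivableP/di.
  by apply: dshift; exact: di.
have [t t01|t t01] := @mean_value_line R _ g x (s *: e_ i).
  by have [] := dg t t01.
have [_ ->] := dg t t01; rewrite scalerA.
have [t' t01'|t' t01'] := @mean_value_line R _ (partial i f) (x + (t * s) *: e_ i) (s *: e_ j).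
  have U1 := (rP _ (inb _ _ (s_i _ t01) (s_i _ t01'))).1; rewrite -[(t' * s) *: _]scalerA in U1.
  by have [] := is_derive_scale s (derivableP (dji _ U1)).
have [U1 b1] := rP _ (inb _ _ (s_i _ t01) (s_i _ t01')).
rewrite -[(t' * s) *: _]scalerA in U1; rewrite -[(t' * s) *: _]scalerA in b1.
have [_ ->] := is_derive_scale s (derivableP (dji _ U1)) => E1 E2.
rewrite /g E1 in E2; rewrite E2 expr2 mulrA -mulrBr normrM distrC.
by rewrite ger0_norm ?mulr_ge0 ?(ltW s0)// mulrC ler_wpM2r// mulr_ge0// ltW.
Unshelve. all: by end_near. Qed.

Let second_differences (A B C D p q t e : R) : 0 < t ->
  `|A - C - (B - D) - t * q| <= e / 2 * t ->
  `|A - B - (C - D) - t * p| <= e / 2 * t -> `|p - q| <= e.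
Proof.
move=> t0 h1 h2; rewrite -(@ler_pM2r _ t)// -[X in _ * X]ger0_norm ?(ltW t0)//.
rewrite -normrM (_ : (p - q) * t =
  (A - C - (B - D) - t * q) - (A - B - (C - D) - t * p)); last by ring.
apply: le_trans (ler_normB _ _) _.
by rewrite [e in leRHS]splitr mulrDl lerD.
Qed.

Lemma partialC f x i j (U : set 'rV[R]_d) : open U -> U x ->
  (forall k y, U y -> derivable f y (e_ k)) ->
  (forall k l y, U y -> derivable (partial k f) y (e_ l)) ->
  (forall k l, {for x, continuous (partial l (partial k f))}) ->
  partial i (partial j f) x = partial j (partial i f) x.
Proof.
move=> oU Ux d1 d2 c2; apply/eqP; rewrite -subr_eq0 -normr_le0.
apply/ler_addgt0Pl => e e0; rewrite addr0.
have e20 : 0 < e / 2 by rewrite divr_gt0.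
have Hi := mixed_difference oU Ux (d1 i) (d2 i j) (c2 i j) e20.
have Hj := mixed_difference oU Ux (d1 j) (d2 j i) (c2 j i) e20.
have [s [+ [+ s0]]] := filter_ex (filterI Hi (filterI Hj (nbhs_right_gt 0))).
by rewrite [x + s *: e_ j + _]addrAC; exact: second_differences (exprn_gt0 2 s0).
Qed.

End PartialDerivatives.

(** * Closure properties of smooth maps *)

Section ChainRule.
Context {R : realType}.
Implicit Types (V W : normedModType R).

Lemma is_derive1P V W (f : V -> W) x v df :
  is_derive x v f df <-> is_derive (0 : R) 1 (fun t : R => f (t *: v + x)) df.
Proof.
have E : (fun t : R => t^-1 *: (((fun t : R => f (t *: v + x)) \o shift 0) (t *: 1)
    - f (0 *: v + x))) = (fun t => t^-1 *: ((f \o shift x) (t *: v) - f x)).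
  by apply/funext => t /=; rewrite scale0r add0r addr0 [_%:A]mulr1.
by split=> -[d0 <-]; split; move: d0; rewrite /derivable /derive E.
Qed.

Lemma is_derive_comp_diff V W1 W2 (h : V -> W1) (f : W1 -> W2) x v dh :
  is_derive x v h dh -> differentiable f (h x) ->
  is_derive x v (f \o h) ('D_dh f (h x)).
Proof.
move=> /is_derive1P[dh0 dhE] df; apply/is_derive1P.
have dc : differentiable (fun t : R => h (t *: v + x)) 0.
  exact/derivable1_diffP.
have df' : differentiable f (h (0 *: v + x)) by rewrite scale0r add0r.
have dfc := differentiable_comp dc df'.
split; first exact: diff_derivable.
rewrite deriveE// (_ : (fun t : R => (f \o h) (t *: v + x)) =
  f \o (fun t : R => h (t *: v + x)))// diff_comp//=.
by rewrite -(deriveE _ dc) dhE deriveE// scale0r add0r.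
Qed.

Lemma is_derive_linear V W (L : {linear V -> W}) x v :
  continuous L -> is_derive x v L (L v).
Proof.
move=> cL; have dL := linear_differentiable x (cL).
split; first exact: diff_derivable.
by rewrite deriveE// diff_lin.
Qed.

Lemma derive_sum_partial d W (f : 'rV[R]_d -> W) x v : differentiable f x ->
  'D_v f x = \sum_i v 0 i *: partial i f x.
Proof.
move=> df; rewrite deriveE// {1}[v]row_sum_delta linear_sum; apply: eq_bigr => i _.
by rewrite linearZ /= /partial deriveE.
Qed.

Lemma continuous_mx V m n (F : V -> 'M[R]_(m, n)) x :
  (forall i j, {for x, continuous (fun y => F y i j)}) -> {for x, continuous F}.
Proof.
move=> cF; apply/cvgrPdist_le => e e0.
have : \forall y \near x, forall k : 'I_m * 'I_n, `|F x k.1 k.2 - F y k.1 k.2| <= e.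
  apply: (@filter_forall _ _ (fun k y => `|F x k.1 k.2 - F y k.1 k.2| <= e) (nbhs x)).
  by move=> k; have /cvgrPdist_le := cF k.1 k.2; exact.
apply: filterS => y ye; apply: mxnorm_le => [|i j]; first exact: ltW.
by have := ye (i, j); rewrite !mxE.
Qed.

Lemma continuous_mx_entry V m n (F : V -> 'M[R]_(m, n)) x i j :
  {for x, continuous F} -> {for x, continuous (fun y => F y i j)}.
Proof.
move=> cF; apply: (@continuous_comp _ _ _ F (fun A : 'M[R]_(m, n) => A i j)) => //.
exact: coord_continuous.
Qed.

Lemma differentiable_mx V m n (F : V -> 'M[R]_(m, n)) x :
  (forall i j, differentiable (fun y => F y i j) x) -> differentiable F x.
Proof.
move=> dF.
rewrite (_ : F = \sum_(i < m) \sum_(j < n) (fun y => F y i j *: delta_mx i j)).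
  apply: differentiable_sum => i; apply: differentiable_sum => j.
  exact: differentiableZl.
apply/funext => y; rewrite {1}[F y]matrix_sum_delta fct_sumE.
by apply: eq_bigr => i _; rewrite fct_sumE.
Qed.

Lemma is_derive_mxP V m n (F : V -> 'M[R]_(m, n)) x v dF :
  is_derive x v F dF <-> forall i j, is_derive x v (fun y => F y i j) (dF i j).
Proof.
split=> [[d0 <-] i j|dFij].
  by have /derivable_mxP d1 := d0; split; [exact: d1|rewrite derive_mx// mxE].
have d0 : derivable F x v by apply/derivable_mxP => i j; have [] := dFij i j.
split=> //; rewrite derive_mx//; apply/matrixP => i j; rewrite mxE.
by have [] := dFij i j.
Qed.

Lemma is_derive_big V (I : Type) (r : seq I) (f : I -> V -> R) df x v :
  (forall i, is_derive x v (f i) (df i)) ->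
  is_derive x v (fun y => \sum_(i <- r) f i y) (\sum_(i <- r) df i).
Proof.
move=> dfi; elim: r => [|i r IH].
  under eq_fun do rewrite big_nil; rewrite big_nil; exact: is_derive_cst.
by under eq_fun do rewrite big_cons; rewrite big_cons; exact: is_deriveD.
Qed.

Lemma is_derive_mulmx V m n p (F : V -> 'M[R]_(m, n)) (G : V -> 'M[R]_(n, p))
    x v dF dG :
  is_derive x v F dF -> is_derive x v G dG ->
  is_derive x v (fun y => F y *m G y) (dF *m G x + F x *m dG).
Proof.
move=> /is_derive_mxP dF1 /is_derive_mxP dG1; apply/is_derive_mxP => i j.
under eq_fun do rewrite mxE.
rewrite !mxE -big_split /=; apply: is_derive_big => k.
have H : is_derive x v (fun y => F y i k * G y k j)
    (F x i k *: dG k j + G x k j *: dF i k) :=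
  @is_deriveM _ _ (fun y => F y i k : R) (fun y => G y k j : R) x v _ _ (dF1 i k) (dG1 k j).
apply: (is_derive_eq H).
by rewrite addrC; congr (_ + _); exact: mulrC.
Qed.

Lemma is_derive_row_mx V m n1 n2 (F : V -> 'M[R]_(m, n1)) (G : V -> 'M[R]_(m, n2))
    x v dF dG :
  is_derive x v F dF -> is_derive x v G dG ->
  is_derive x v (fun y => row_mx (F y) (G y)) (row_mx dF dG).
Proof.
move=> /is_derive_mxP dF1 /is_derive_mxP dG1; apply/is_derive_mxP => i j.
under eq_fun do rewrite mxE.
by rewrite mxE; case: split_ordP => k _.
Qed.

Lemma is_derive_trmx V m n (F : V -> 'M[R]_(m, n)) x v dF :
  is_derive x v F dF -> is_derive x v (fun y => (F y)^T) dF^T.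
Proof.
move=> /is_derive_mxP dF1; apply/is_derive_mxP => i j.
by under eq_fun do rewrite mxE; rewrite mxE.
Qed.

Lemma is_derive_linear_mx V m n p q (L : {linear 'M[R]_(m, n) -> 'M[R]_(p, q)})
    (F : V -> 'M[R]_(m, n)) x v dF :
  is_derive x v F dF -> is_derive x v (L \o F) (L dF).
Proof.
move=> dF1; have cL := @linear_mx_continuous R m n 'M[R]_(p, q) L.
have [_ <-] := is_derive_linear (F x) dF cL.
apply: is_derive_comp_diff => //.
exact: linear_differentiable.
Qed.

Lemma norm_mulmx m n p (A : 'M[R]_(m, n)) (B : 'M[R]_(n, p)) :
  `|A *m B| <= n%:R * `|A| * `|B|.
Proof.
apply: mxnorm_le => [|i j]; first by rewrite !mulr_ge0.
rewrite mxE; apply: le_trans (ler_norm_sum _ _ _) _.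
rewrite -mulrA mulr_natl -[X in _ *+ X](card_ord n) -sumr_const.
by apply: ler_sum => k _; rewrite normrM ler_pM// mxnorm_coord.
Qed.

End ChainRule.

Section SmoothBasics.
Context {R : realType} {d : nat}.
Implicit Types (W : normedModType R) (U : set 'rV[R]_d).
Local Notation e_ i := (delta_mx 0 i : 'rV[R]_d).

Lemma near_open W U (f g : 'rV[R]_d -> W) x : open U -> U x ->
  (forall y, U y -> f y = g y) -> \near x, f x = g x.
Proof.
by move=> oU Ux fg; near=> y; apply: fg; near: y; exact: open_nbhs_nbhs.
Unshelve. all: by end_near. Qed.

Lemma smooth_on_coind W U (C : ('rV[R]_d -> W) -> Prop) : open U ->
  (forall f, C f -> (forall x, U x -> {for x, continuous f}) /\
    forall i, (forall x, U x -> derivable f x (e_ i)) /\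
      exists2 g, C g & forall x, U x -> partial i f x = g x) ->
  forall f, C f -> smooth_on U f.
Proof.
move=> oU stepC f Cf s.
have [g Cg fg] : exists2 g, C g & forall x, U x -> iter_partial s f x = g x.
  elim: s => [|i s [g Cg fg]]; first by exists f.
  have [_ /(_ i)[_ [g' Cg' gg']]] := stepC _ Cg; exists g' => // x Ux.
  rewrite -gg'//= /partial; apply: near_eq_derive; exact: near_open Ux fg.
have [cg dg] := stepC _ Cg => x Ux.
have gf : \near x, g x = iter_partial s f x.
  by apply: near_open Ux _ => // y Uy; rewrite fg.
split=> [|i]; last exact: near_eq_derivable gf ((dg i).1 _ Ux).
rewrite /prop_for /continuous_at fg//.
exact: cvg_trans (near_eq_cvg gf) (cg _ Ux).
Qed.

Lemma smooth_on_eq W U (f g : 'rV[R]_d -> W) : open U ->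
  (forall x, U x -> f x = g x) -> smooth_on U f -> smooth_on U g.
Proof.
move=> oU fg sf.
pose C (h : 'rV[R]_d -> W) := exists2 k, smooth_on U k & forall x, U x -> k x = h x.
apply: (@smooth_on_coind _ _ C oU); last by exists f.
move=> h [k sk kh]; split=> [x Ux|i].
  rewrite /prop_for /continuous_at -kh//.
  exact: cvg_trans (near_eq_cvg (near_open oU Ux kh)) (sk [::] _ Ux).1.
split=> [x Ux|].
  exact: near_eq_derivable (near_open oU Ux kh) ((sk [::] _ Ux).2 i).
exists (partial i h); last by [].
exists (partial i k); first exact: (smooth_on_partial i sk).
by move=> x Ux; rewrite /partial; apply: near_eq_derive; exact: near_open Ux kh.
Qed.

Lemma smooth_on_local W U (f : 'rV[R]_d -> W) :
  (forall x, U x -> exists2 V, V x & smooth_on V f) -> smooth_on U f.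
Proof. by move=> Uf s x /Uf[V Vx]; exact. Qed.

Lemma smooth_on_continuous W U (f : 'rV[R]_d -> W) x :
  smooth_on U f -> U x -> {for x, continuous f}.
Proof. by move=> sf /(sf [::])[]. Qed.

Lemma smooth_on_derivable W U (f : 'rV[R]_d -> W) x i :
  smooth_on U f -> U x -> derivable f x (e_ i).
Proof. by move=> sf /(sf [::])[_]. Qed.

Lemma smooth_on_entry m n U (F : 'rV[R]_d -> 'M[R]_(m, n)) i j : open U ->
  smooth_on U F -> smooth_on U (fun x => F x i j).
Proof.
move=> oU sF.
pose C (h : 'rV[R]_d -> R) := exists2 K : 'rV[R]_d -> 'M[R]_(m, n),
  smooth_on U K & h = fun x => K x i j.
apply: (@smooth_on_coind _ _ C oU); last by exists F.
move=> _ [K sK ->]; split=> [x Ux|k].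
  exact/continuous_mx_entry/(smooth_on_continuous sK).
split=> [x Ux|].
  by have /derivable_mxP := @smooth_on_derivable _ _ K x k sK Ux; exact.
exists (fun x => partial k K x i j).
  exact: (ex_intro2 _ _ (partial k K) (smooth_on_partial k sK) erefl).
move=> x Ux; have dK := @smooth_on_derivable _ _ K x k sK Ux.
by rewrite /partial (derive_mx dK) mxE.
Qed.

Lemma smooth_on_mx m n U (F : 'rV[R]_d -> 'M[R]_(m, n)) : open U ->
  (forall i j, smooth_on U (fun x => F x i j)) -> smooth_on U F.
Proof.
move=> oU sF.
pose C (K : 'rV[R]_d -> 'M[R]_(m, n)) := forall i j, smooth_on U (fun x => K x i j).
apply: (@smooth_on_coind _ _ C oU) => // K sK; split=> [x Ux|k].
  by apply: continuous_mx => i j; exact: smooth_on_continuous (sK i j) Ux.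
have dK x : U x -> derivable K x (e_ k).
  by move=> Ux; apply/derivable_mxP => i j; exact: smooth_on_derivable (sK i j) Ux.
split=> //; exists (fun x => \matrix_(i, j) partial k (fun x => K x i j) x).
  move=> i j; apply: (smooth_on_eq oU _ (smooth_on_partial k (sK i j))).
  by move=> x _; rewrite mxE.
by by move=> x Ux; rewrite /partial (derive_mx (dK x Ux)).
Qed.

Lemma smooth_on_diff U (f : 'rV[R]_d -> R) x : open U -> smooth_on U f -> U x ->
  differentiable f x.
Proof.
move=> oU sf Ux; have [] // := @C1_is_diff R d f x.
  move=> i; near=> y; apply: (@smooth_on_derivable _ U) => //; near: y.
  exact: open_nbhs_nbhs.
by move=> i; exact: smooth_on_continuous (smooth_on_partial i sf) Ux.
Unshelve. all: by end_near. Qed.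

Lemma smooth_on_diff_mx m n U (F : 'rV[R]_d -> 'M[R]_(m, n)) x :
  open U -> smooth_on U F -> U x -> differentiable F x.
Proof.
move=> oU sF Ux; apply: differentiable_mx => i j.
exact: smooth_on_diff (smooth_on_entry _ _ oU sF) Ux.
Qed.

Lemma smooth_on_cst W U (w : W) : open U -> smooth_on U (fun=> w).
Proof.
move=> oU; pose C (f : 'rV[R]_d -> W) := exists w, f = fun=> w.
apply: (@smooth_on_coind _ _ C oU); last by exists w.
move=> _ [k ->]; split=> [x _|i]; first exact: cst_continuous.
split=> [x _|]; first exact: derivable_cst.
by exists (fun=> 0) => [|x _]; [exists 0|exact: derive_cst].
Qed.

End SmoothBasics.

Opaque smooth_on.

(* The class is stable under partial derivatives, whence every member is
   smooth. *)
Inductive smooth_closure (R : realType) d (U : set 'rV[R]_d) :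
    ('rV[R]_d -> R) -> Prop :=
| smooth_closure_base f : smooth_on U f -> smooth_closure U f
| smooth_closure_add f g : smooth_closure U f -> smooth_closure U g ->
    smooth_closure U (fun x => f x + g x)
| smooth_closure_mul f g : smooth_closure U f -> smooth_closure U g ->
    smooth_closure U (fun x => f x * g x)
| smooth_closure_inv f : smooth_closure U f -> (forall x, U x -> f x != 0) ->
    smooth_closure U (fun x => (f x)^-1)
| smooth_closure_comp e (V : set 'rV[R]_e) (h : 'rV[R]_d -> 'rV[R]_e) f :
    open V -> smooth_on V f -> (forall j, smooth_closure U (fun x => h x 0 j)) ->
    (forall x, U x -> V (h x)) -> smooth_closure U (fun x => f (h x)).

Section SmoothClosure.
Context {R : realType} {d : nat}.
Implicit Types (U : set 'rV[R]_d).
Local Notation e_ i := (delta_mx 0 i : 'rV[R]_d).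

Let C U (f : 'rV[R]_d -> R) := exists2 g, smooth_closure U g & forall x, U x -> f x = g x.

Let closure_step U f : open U -> smooth_closure U f ->
  (forall x, U x -> {for x, continuous f}) /\
  forall i, (forall x, U x -> derivable f x (e_ i)) /\ C U (partial i f).
Proof.
move=> oU; elim=> {f}.
- move=> f sf; split=> [x|i]; first exact: smooth_on_continuous.
  split=> [x|]; first exact: smooth_on_derivable.
  exists (partial i f); last by [].
  exact: (smooth_closure_base (smooth_on_partial i sf)).
- move=> f g sf [cf df] sg [cg dg]; split=> [x Ux|i].
    by apply: continuousD; [exact: cf|exact: cg].
  have [{}df [f' sf' ff']] := df i; have [{}dg [g' sg' gg']] := dg i.
  split=> [x Ux|]; first by apply: derivableD; [exact: df|exact: dg].
  exists (fun x => f' x + g' x); first exact: smooth_closure_add.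
  move=> x Ux; rewrite -ff'// -gg'// /partial.
  by rewrite -deriveD//; [exact: df|exact: dg].
- move=> f g sf [cf df] sg [cg dg]; split=> [x Ux|i].
    by apply: continuousM; [exact: cf|exact: cg].
  have [{}df [f' sf' ff']] := df i; have [{}dg [g' sg' gg']] := dg i.
  split=> [x Ux|]; first by apply: derivableM; [exact: df|exact: dg].
  exists (fun x => f x * g' x + g x * f' x).
    by apply: smooth_closure_add; exact: smooth_closure_mul.
  move=> x Ux; rewrite -ff'// -gg'// /partial.
  have := @deriveM _ _ f g x (e_ i) (df x Ux) (dg x Ux).
  by rewrite /= => ->.
- move=> f sf [cf df] f0; split=> [x Ux|i].
    by apply: continuousV; [exact: f0|exact: cf].
  have [{}df [f' sf' ff']] := df i.
  split=> [x Ux|]; first by apply: derivableV; [exact: f0|exact: df].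
  exists (fun x => -1 * (f' x * ((f x)^-1 * (f x)^-1))).
    apply: smooth_closure_mul; first exact/smooth_closure_base/smooth_on_cst.
    by do 2![apply: smooth_closure_mul => //]; exact: smooth_closure_inv.
  move=> x Ux; rewrite -ff'// /partial.
  have := @deriveV _ _ f x (e_ i) (f0 x Ux) (df x Ux).
  rewrite /= => ->; rewrite mulN1r scaleNr -mulrC -invfM.
  by rewrite expr2 -[_ *: _]/(_ * _).
- move=> e V h f oV sf sh ih hUV; split=> [x Ux|i].
    apply: continuous_comp; last exact: smooth_on_continuous sf (hUV _ Ux).
    by apply: continuous_mx => a j; rewrite ord1; exact: (ih j).1.
  have dh x : U x -> derivable h x (e_ i).
    move=> Ux; apply/derivable_mxP => a j; rewrite ord1.
    exact: ((ih j).2 i).1.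
  have dfh x (Ux : U x) := is_derive_comp_diff (derivableP (dh x Ux))
    (smooth_on_diff oV sf (hUV _ Ux)).
  split=> [x Ux|]; first by have [] := dfh x Ux.
  have /choice[h' h'P] : forall j, exists g, smooth_closure U g /\
      forall x, U x -> partial i (fun x => h x 0 j) x = g x.
    by move=> j; have [_ [g sg hg]] := (ih j).2 i; exists g.
  exists (fun x => \sum_j h' j x * partial j f (h x)).
    have : forall r : seq 'I_e,
        smooth_closure U (fun x => \sum_(j <- r) h' j x * partial j f (h x)).
      elim=> [|j r IH].
        under eq_fun do rewrite big_nil.
        exact/smooth_closure_base/smooth_on_cst.
      under eq_fun do rewrite big_cons.
      apply: smooth_closure_add => //; apply: smooth_closure_mul.
        by have [] := h'P j.
      exact: smooth_closure_comp oV (smooth_on_partial j sf) sh hUV.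
    exact.
  move=> x Ux; have [_] := dfh x Ux; rewrite /partial => ->.
  rewrite derive_sum_partial; last exact: smooth_on_diff oV sf (hUV _ Ux).
  apply: eq_bigr => j _; have [_ <-//] := h'P j.
  by rewrite (derive_mx (dh x Ux)) mxE.
Qed.

Lemma smooth_closureP U f : open U -> smooth_closure U f -> smooth_on U f.
Proof.
move=> oU sf; apply: (@smooth_on_coind _ _ _ _ (C U) oU); last by exists f.
move=> h [k /(closure_step oU)[ck dk] hk].
have kh x (Ux : U x) : \near x, k x = h x.
  by apply: near_open oU Ux _ => y Uy; rewrite hk.
split=> [x Ux|i].
  rewrite /prop_for /continuous_at hk//.
  by apply: cvg_trans (near_eq_cvg (kh _ Ux)) _; exact: ck.
have [{}dk [k' sk' kk']] := dk i.
split=> [x Ux|]; first exact: near_eq_derivable (kh _ Ux) (dk _ Ux).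
exists k'; first by exists k'.
by move=> x Ux; rewrite -kk'// /partial; apply/esym/near_eq_derive; exact: kh.
Qed.

End SmoothClosure.

Section SmoothOperations.
Context {R : realType} {d : nat} (U : set 'rV[R]_d) (oU : open U).
Implicit Types (f g : 'rV[R]_d -> R).
Local Notation base := smooth_closure_base.

Lemma smooth_onD f g : smooth_on U f -> smooth_on U g ->
  smooth_on U (fun x => f x + g x).
Proof. by move=> sf sg; apply/smooth_closureP => //; apply/smooth_closure_add; exact/base. Qed.

Lemma smooth_onM f g : smooth_on U f -> smooth_on U g ->
  smooth_on U (fun x => f x * g x).
Proof. by move=> sf sg; apply/smooth_closureP => //; apply/smooth_closure_mul; exact/base. Qed.

Lemma smooth_onV f : smooth_on U f -> (forall x, U x -> f x != 0) ->
  smooth_on U (fun x => (f x)^-1).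
Proof. by move=> sf f0; apply/smooth_closureP => //; apply/smooth_closure_inv => //; exact/base. Qed.

Lemma smooth_on_sum I (r : seq I) (P : pred I) (f : I -> 'rV[R]_d -> R) :
  (forall i, P i -> smooth_on U (f i)) ->
  smooth_on U (fun x => \sum_(i <- r | P i) f i x).
Proof.
move=> sf; elim: r => [|i r IH].
  by under eq_fun do rewrite big_nil; exact: smooth_on_cst.
under eq_fun do rewrite big_cons.
case: (boolP (P i)) => Pi; last exact: IH.
by apply: smooth_onD; [exact: sf|exact: IH].
Qed.

Lemma smooth_on_prod I (r : seq I) (P : pred I) (f : I -> 'rV[R]_d -> R) :
  (forall i, P i -> smooth_on U (f i)) ->
  smooth_on U (fun x => \prod_(i <- r | P i) f i x).
Proof.
move=> sf; elim: r => [|i r IH].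
  by under eq_fun do rewrite big_nil; exact: smooth_on_cst.
under eq_fun do rewrite big_cons.
case: (boolP (P i)) => Pi; last exact: IH.
by apply: smooth_onM; [exact: sf|exact: IH].
Qed.

Lemma smooth_on_comp e (V : set 'rV[R]_e) m n (F : 'rV[R]_e -> 'M[R]_(m, n))
    (h : 'rV[R]_d -> 'rV[R]_e) : open V ->
  smooth_on V F -> smooth_on U h -> (forall x, U x -> V (h x)) ->
  smooth_on U (F \o h).
Proof.
move=> oV sF sh hUV; apply: (smooth_on_mx oU) => i j; apply: smooth_closureP => //=.
apply: (@smooth_closure_comp _ _ _ _ _ h (fun y => F y i j) oV) => //.
  exact: smooth_on_entry.
by move=> k; exact/base/smooth_on_entry.
Qed.

Lemma smooth_on_comp1 e (V : set 'rV[R]_e) (f : 'rV[R]_e -> R)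
    (h : 'rV[R]_d -> 'rV[R]_e) : open V ->
  smooth_on V f -> smooth_on U h -> (forall x, U x -> V (h x)) ->
  smooth_on U (f \o h).
Proof.
move=> oV sf sh hUV; apply: smooth_closureP => //=.
apply: (@smooth_closure_comp _ _ _ _ _ h f oV) => //.
by move=> k; exact/base/smooth_on_entry.
Qed.

Lemma smooth_on_coord m n (L : 'rV[R]_d -> 'M[R]_(m, n)) : linear L -> smooth_on U L.
Proof.
move=> linL; pose mL := GRing.isLinear.Build R _ _ _ L linL.
pose LL : {linear 'rV[R]_d -> 'M[R]_(m, n)} := HB.pack L mL.
pose C (f : 'rV[R]_d -> 'M[R]_(m, n)) := f = L \/ exists w, f = fun=> w.
apply: (@smooth_on_coind _ _ _ _ C oU); last by left.
have cL : continuous LL by exact: linear_mx_continuous.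
move=> _ [->|[w ->]].
  split=> [x _|i]; first exact: cL.
  split=> [x _|]; first by have [] := is_derive_linear x (delta_mx 0 i) cL.
  exists (fun=> L (delta_mx 0 i)); first by right; eexists.
  by move=> x _; have [] := is_derive_linear x (delta_mx 0 i) cL.
split=> [x _|i]; first exact: cst_continuous.
split=> [x _|]; first exact: derivable_cst.
by exists (fun=> 0) => [|x _]; [right; exists 0|exact: derive_cst].
Qed.

Lemma smooth_on_mulmx m n p (F : 'rV[R]_d -> 'M[R]_(m, n))
    (G : 'rV[R]_d -> 'M[R]_(n, p)) :
  smooth_on U F -> smooth_on U G -> smooth_on U (fun x => F x *m G x).
Proof.
move=> sF sG; apply: (smooth_on_mx oU) => i j.
under eq_fun do rewrite mxE.
by apply: smooth_on_sum => k _; apply: smooth_onM; exact: smooth_on_entry.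
Qed.

Lemma smooth_on_mxD m n (F G : 'rV[R]_d -> 'M[R]_(m, n)) :
  smooth_on U F -> smooth_on U G -> smooth_on U (fun x => F x + G x).
Proof.
move=> sF sG; apply: (smooth_on_mx oU) => i j.
under eq_fun do rewrite mxE.
by apply: smooth_onD; exact: smooth_on_entry.
Qed.

Lemma smooth_on_mxZ m n f (F : 'rV[R]_d -> 'M[R]_(m, n)) :
  smooth_on U f -> smooth_on U F -> smooth_on U (fun x => f x *: F x).
Proof.
move=> sF sG; apply: (smooth_on_mx oU) => i j.
under eq_fun do rewrite mxE.
by apply: (smooth_onM sF); exact: smooth_on_entry.
Qed.

Lemma smooth_on_mxN m n (F : 'rV[R]_d -> 'M[R]_(m, n)) :
  smooth_on U F -> smooth_on U (fun x => - F x).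
Proof.
move=> sF; under eq_fun do rewrite -scaleN1r.
exact: smooth_on_mxZ (smooth_on_cst _ oU) sF.
Qed.

Lemma smooth_on_mxB m n (F G : 'rV[R]_d -> 'M[R]_(m, n)) :
  smooth_on U F -> smooth_on U G -> smooth_on U (fun x => F x - G x).
Proof. by move=> sF sG; apply: (smooth_on_mxD sF); exact: smooth_on_mxN. Qed.

Lemma smooth_on_trmx m n (F : 'rV[R]_d -> 'M[R]_(m, n)) :
  smooth_on U F -> smooth_on U (fun x => (F x)^T).
Proof.
move=> sF; apply: (smooth_on_mx oU) => i j.
by under eq_fun do rewrite mxE; exact: smooth_on_entry.
Qed.

Lemma smooth_on_row_mx m n1 n2 (F : 'rV[R]_d -> 'M[R]_(m, n1))
    (G : 'rV[R]_d -> 'M[R]_(m, n2)) :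
  smooth_on U F -> smooth_on U G -> smooth_on U (fun x => row_mx (F x) (G x)).
Proof.
move=> sF sG; apply: (smooth_on_mx oU) => i j; under eq_fun do rewrite mxE.
by case: split_ordP => k _; exact: smooth_on_entry.
Qed.

Lemma smooth_on_det n (F : 'rV[R]_d -> 'M[R]_n) :
  smooth_on U F -> smooth_on U (fun x => \det (F x)).
Proof.
move=> sF; apply: smooth_on_sum => s _; apply: smooth_onM; first exact: smooth_on_cst.
by apply: smooth_on_prod => i _; exact: smooth_on_entry.
Qed.

Lemma smooth_on_invmx n (F : 'rV[R]_d -> 'M[R]_n) :
  (forall x, U x -> F x \in unitmx) -> smooth_on U F ->
  smooth_on U (fun x => invmx (F x)).
Proof.
move=> uF sF; apply: (@smooth_on_eq _ _ _ _ (fun x => (\det (F x))^-1 *: \adj (F x)) _ oU).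
  by move=> x Ux; rewrite /invmx uF.
apply: smooth_on_mxZ.
  apply: smooth_onV; first exact: smooth_on_det.
  by move=> x Ux; rewrite -unitfE -[_ \is a _]/(F x \in unitmx) uF.
apply: (smooth_on_mx oU) => i j; under eq_fun do rewrite mxE.
apply: smooth_onM; first exact: smooth_on_cst.
apply: smooth_on_det; apply: smooth_on_mx => // a b.
by under eq_fun do rewrite !mxE; exact: smooth_on_entry.
Qed.

Lemma smooth_on_derive m n (F : 'rV[R]_d -> 'M[R]_(m, n)) (X : 'rV[R]_d -> 'rV[R]_d) :
  smooth_on U F -> smooth_on U X -> smooth_on U (fun x => 'D_(X x) F x).
Proof.
move=> sF sX.
apply: (@smooth_on_eq _ _ _ _ (fun x => \matrix_(i, j) \sum_k X x 0 k * partial k F x i j) _ oU).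
  move=> x Ux; rewrite derive_sum_partial; last exact: smooth_on_diff_mx oU sF Ux.
  by apply/matrixP => i j; rewrite mxE summxE; apply: eq_bigr => k _; rewrite mxE.
apply: (smooth_on_mx oU) => i j; under eq_fun do rewrite mxE.
apply: smooth_on_sum => k _; apply: smooth_onM; first exact: smooth_on_entry.
exact/smooth_on_entry/smooth_on_partial.
Qed.

Lemma smooth_on_derive1 f (X : 'rV[R]_d -> 'rV[R]_d) :
  smooth_on U f -> smooth_on U X -> smooth_on U (fun x => 'D_(X x) f x).
Proof.
move=> sf sX.
apply: (@smooth_on_eq _ _ _ _ (fun x => \sum_k X x 0 k * partial k f x) _ oU).
  by move=> x Ux; rewrite derive_sum_partial//; exact: smooth_on_diff oU sf Ux.
apply: smooth_on_sum => k _; apply: smooth_onM; first exact: smooth_on_entry.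
exact: smooth_on_partial.
Qed.

End SmoothOperations.

(** * Flows by Euler polygons *)

Section BallEstimates.
Context {R : realType} {d : nat}.
Implicit Types (x y v : 'rV[R]_d).

Lemma norm_segment x v (rho t : R) : `|x| <= rho -> `|x + v| <= rho ->
  0 <= t <= 1 -> `|x + t *: v| <= rho.
Proof.
move=> xr yr /andP[t0 t1].
rewrite (_ : x + t *: v = (1 - t) *: x + t *: (x + v)); last first.
  by rewrite scalerDr scalerBl scale1r addrA subrK.
apply: le_trans (ler_normD _ _) _; rewrite !normrZ !ger0_norm ?subr_ge0//.
rewrite (_ : rho = (1 - t) * rho + t * rho); last by rewrite mulrBl mul1r subrK.
by rewrite lerD// ler_wpM2l// subr_ge0.
Qed.

Lemma smooth_bounded_ball (f : 'rV[R]_d -> R) (rho : R) : smooth_on setT f ->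
  exists2 K, 0 <= K & forall x, `|x| <= rho -> `|f x| <= K.
Proof.
move=> sf; have [rho0|rho0] := ltP rho 0.
  exists 0 => // x xr; have := le_lt_trans xr rho0.
  by rewrite ltNge normr_ge0.
pose A : set 'rV[R]_d := [set x | `|x| <= rho].
have cA : compact A.
  apply: bounded_closed_compact.
    exists rho; split; first exact: num_real.
    by move=> r rr x /= xr; rewrite (le_trans xr)// ltW.
  apply: (closed_comp (f := fun x => `|x|) (D := [set r : R | r <= rho])).
    by move=> x _; exact: norm_continuous.
  exact: closed_le.
have [||c _ cP] := @EVT_max_rV R d (fun x => `|f x|) A _ cA.
- by exists 0; rewrite /A /= normr0.
- apply: continuous_subspaceT => x.
  apply: (@continuous_comp _ _ _ f (fun r : R => `|r|)).
    exact: smooth_on_continuous sf _.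
  exact: norm_continuous.
- by exists `|f c| => // x xr; apply: cP; rewrite inE.
Qed.

Lemma smooth_derive_bound1 (f : 'rV[R]_d -> R) (rho : R) : smooth_on setT f ->
  exists2 L, 0 <= L & forall x v, `|x| <= rho -> `|'D_v f x| <= L * `|v|.
Proof.
move=> sf.
have /choice[K KP] : forall i, exists K, 0 <= K /\
    forall x, `|x| <= rho -> `|partial i f x| <= K.
  move=> i; have [K K0 KP] := smooth_bounded_ball rho (smooth_on_partial i sf).
  by exists K.
exists (\sum_i K i); first by apply: sumr_ge0 => i _; have [] := KP i.
move=> x v xr; rewrite derive_sum_partial; last exact: smooth_on_diff openT sf _.
rewrite mulr_suml; apply: le_trans (ler_norm_sum _ _ _) _.
apply: ler_sum => i _; rewrite normrZ mulrC; have [K0 Ki] := KP i.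
by apply: ler_pM => //; [exact: Ki|exact: mxnorm_coord].
Qed.

Lemma smooth_derive_bound m n (F : 'rV[R]_d -> 'M[R]_(m, n)) (rho : R) :
  smooth_on setT F ->
  exists2 L, 0 <= L & forall x v, `|x| <= rho -> `|'D_v F x| <= L * `|v|.
Proof.
move=> sF.
have /choice[K KP] : forall k : 'I_m * 'I_n, exists K, 0 <= K /\
    forall x v, `|x| <= rho -> `|'D_v (fun y => F y k.1 k.2) x| <= K * `|v|.
  move=> k; have sk := smooth_on_entry k.1 k.2 openT sF.
  by have [K K0 KP] := smooth_derive_bound1 rho sk; exists K.
have S0 : 0 <= \sum_k K k by apply: sumr_ge0 => k _; have [] := KP k.
exists (\sum_k K k) => // x v xr; apply: mxnorm_le; first by rewrite mulr_ge0.
move=> i j; have dF := smooth_on_diff_mx openT sF (I : setT x).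
rewrite derive_mx ?mxE; last exact: diff_derivable.
have [K0 Kij] := KP (i, j); apply: le_trans (Kij _ _ xr) _.
rewrite ler_wpM2r// (bigD1 (i, j))//= lerDl; apply: sumr_ge0 => k _.
by have [] := KP k.
Qed.

Lemma smooth_lipschitz m n (F : 'rV[R]_d -> 'M[R]_(m, n)) (rho : R) :
  smooth_on setT F ->
  exists2 L, 0 <= L & forall x y, `|x| <= rho -> `|y| <= rho ->
    `|F x - F y| <= L * `|x - y|.
Proof.
move=> sF; have [L L0 LP] := smooth_derive_bound rho sF; exists L => // x y xr yr.
apply: mxnorm_le => [|i j]; first by rewrite mulr_ge0.
have sk := smooth_on_entry i j openT sF.
have [|t t01 E] := @mean_value_line R _ (fun z => F z i j) y (x - y).
  by move=> t _; apply/diff_derivable; exact: smooth_on_diff openT sk _.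
rewrite (_ : y + (x - y) = x) in E; last by rewrite addrC subrK.
rewrite !mxE E.
have dF := smooth_on_diff_mx openT sF (I : setT (y + t *: (x - y))).
have dFE : 'D_(x - y) (fun z => F z i j) (y + t *: (x - y)) =
    'D_(x - y) F (y + t *: (x - y)) i j.
  by rewrite derive_mx ?mxE//; exact: diff_derivable.
rewrite dFE; apply: le_trans (mxnorm_coord _ _ _) _; apply: LP.
by apply: norm_segment; rewrite // addrC subrK.
Qed.

Lemma smooth_taylor1 (f : 'rV[R]_d -> R) (rho : R) : smooth_on setT f ->
  exists2 C, 0 <= C & forall x v, `|x| <= rho -> `|x + v| <= rho ->
    `|f (x + v) - f x - 'D_v f x| <= C * `|v| ^+ 2.
Proof.
move=> sf.
pose F x : 'rV[R]_d := \row_i partial i f x.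
have sF : smooth_on setT F.
  apply: (smooth_on_mx openT) => a i; under eq_fun do rewrite mxE.
  exact: smooth_on_partial.
have [L L0 LP] := smooth_lipschitz rho sF.
exists (d%:R * L); first by rewrite mulr_ge0.
move=> x v xr xvr.
have [|t t01 ->] := @mean_value_line R _ f x v.
  by move=> t _; apply/diff_derivable; exact: smooth_on_diff openT sf _.
rewrite !derive_sum_partial; [|exact: smooth_on_diff openT sf _..].
rewrite -sumrB -mulrA mulr_natl -[X in _ *+ X](card_ord d) -sumr_const.
apply: le_trans (ler_norm_sum _ _ _) _; apply: ler_sum => i _.
rewrite -scalerBr normrZ expr2 mulrCA.
apply: ler_pM => //; first exact: mxnorm_coord.
have E : partial i f (x + t *: v) - partial i f x = (F (x + t *: v) - F x) 0 i.
  by rewrite !mxE.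
rewrite E; apply: le_trans (mxnorm_coord _ _ _) _.
apply: le_trans (LP _ _ (norm_segment xr xvr t01) xr) _.
have /andP[t0 t1] := t01.
by rewrite addrC addKr normrZ ger0_norm// ler_wpM2l// ler_piMl.
Qed.

Lemma smooth_taylor m n (F : 'rV[R]_d -> 'M[R]_(m, n)) (rho : R) :
  smooth_on setT F ->
  exists2 C, 0 <= C & forall x v, `|x| <= rho -> `|x + v| <= rho ->
    `|F (x + v) - F x - 'D_v F x| <= C * `|v| ^+ 2.
Proof.
move=> sF.
have /choice[K KP] : forall k : 'I_m * 'I_n, exists K, 0 <= K /\
    forall x v, `|x| <= rho -> `|x + v| <= rho ->
    `|F (x + v) k.1 k.2 - F x k.1 k.2 - 'D_v (fun y => F y k.1 k.2) x| <= K * `|v| ^+ 2.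
  move=> k; have sk := smooth_on_entry k.1 k.2 openT sF.
  by have [K K0 KP] := smooth_taylor1 rho sk; exists K.
have S0 : 0 <= \sum_k K k by apply: sumr_ge0 => k _; have [] := KP k.
exists (\sum_k K k) => // x v xr xvr.
apply: mxnorm_le; first by rewrite mulr_ge0 ?exprn_ge0.
move=> i j; have dF := smooth_on_diff_mx openT sF (I : setT x).
rewrite derive_mx ?mxE; last exact: diff_derivable.
have [K0 Kij] := KP (i, j); apply: le_trans (Kij _ _ xr xvr) _.
rewrite ler_wpM2r ?exprn_ge0// (bigD1 (i, j))//= lerDl; apply: sumr_ge0 => k _.
by have [] := KP k.
Qed.

Lemma norm_row_mx m n (a : 'rV[R]_m) (b : 'rV[R]_n) (K : R) :
  (`|row_mx a b| <= K) = (`|a| <= K) && (`|b| <= K).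
Proof.
have [K0|K0] := ltP K 0.
  have F p (c : 'rV[R]_p) : (`|c| <= K) = false.
    by apply/negbTE; rewrite -ltNge (lt_le_trans K0).
  by rewrite !F.
apply/idP/andP => [ab|[aK bK]].
  split; apply: mxnorm_le => // i j.
    by rewrite -(row_mxEl a b); apply: le_trans ab; exact: mxnorm_coord.
  by rewrite -(row_mxEr a b); apply: le_trans ab; exact: mxnorm_coord.
apply: mxnorm_le => // i j; rewrite mxE; case: split_ordP => k _.
  by apply: le_trans aK; exact: mxnorm_coord.
by apply: le_trans bK; exact: mxnorm_coord.
Qed.

End BallEstimates.

Section DyadicLimits.
Context {R : realType}.

Lemma le_dyadic_error (a b K : R) : (forall n, a <= b + K * 2 ^- n) -> a <= b.
Proof.
move=> ab; have cK : (fun n => b + K * 2 ^- n) @ \oo --> b.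
  rewrite -[X in _ --> X]addr0; apply: cvgD; first exact: cvg_cst.
  rewrite -[X in _ --> X](mulr0 K); apply: cvgM; first exact: cvg_cst.
  under eq_fun do rewrite -exprVn.
  by apply: cvg_expr; rewrite ger0_norm ?invr_ge0// invf_lt1// ltr1n.
by apply: (ler_cvg_to (cvg_cst a) cK); near=> n; exact: ab.
Unshelve. all: by end_near. Qed.

Lemma dyadic_cauchy1 (u : nat -> R) (K : R) :
  (forall n, `|u n.+1 - u n| <= K * 2 ^- n) ->
  exists l, forall n, `|l - u n| <= 2 * K * 2 ^- n.
Proof.
move=> uK.
have half n : 2 ^- n = 2 * 2 ^- n.+1 :> R.
  by rewrite exprS invfM mulrA divff ?mul1r.
pose a n := u n - 2 * K * 2 ^- n; pose b n := u n + 2 * K * 2 ^- n.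
have a_ni : nondecreasing_seq a.
  apply/nondecreasing_seqP => n; rewrite /a.
  have := uK n; rewrite ler_norml => /andP[+ _]; rewrite (half n); lra.
have b_ni : nonincreasing_seq b.
  apply/nonincreasing_seqP => n; rewrite /b.
  have := uK n; rewrite ler_norml => /andP[_]; rewrite (half n); lra.
have K0 : 0 <= K.
  by have := uK 0; rewrite expr0 invr1 mulr1; exact: le_trans.
have ab n : a n <= b n.
  rewrite /a /b lerD2l; apply: (@le_trans _ _ 0).
    by rewrite oppr_le0 !mulr_ge0// invr_ge0 exprn_ge0.
  by rewrite !mulr_ge0// invr_ge0 exprn_ge0.
have a_le_b m n : a m <= b n.
  apply: le_trans (a_ni _ _ (leq_maxl m n)) _.
  exact: le_trans (ab _) (b_ni _ _ (leq_maxr m n)).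
have ca : cvgn a.
  apply: nondecreasing_is_cvgn => //; exists (b 0) => _ [n _ <-]; exact: a_le_b.
exists (limn a) => n; rewrite ler_distl; apply/andP; split.
  exact: nondecreasing_cvgn_le.
by apply: limr_le => //; near=> m; exact: a_le_b.
Unshelve. all: by end_near. Qed.

Lemma dyadic_cauchy d (u : nat -> 'rV[R]_d) (K : R) : 0 <= K ->
  (forall n, `|u n.+1 - u n| <= K * 2 ^- n) ->
  exists l, forall n, `|l - u n| <= 2 * K * 2 ^- n.
Proof.
move=> K0 uK.
have /choice[l lP] : forall i, exists l, forall n, `|l - u n 0 i| <= 2 * K * 2 ^- n.
  move=> i; apply: dyadic_cauchy1 => n.
  have -> : u n.+1 0 i - u n 0 i = (u n.+1 - u n) 0 i by rewrite !mxE.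
  exact: le_trans (mxnorm_coord _ _ _) (uK n).
exists (\row_i l i) => n; apply: mxnorm_le => [|a i].
  by rewrite !mulr_ge0// invr_ge0 exprn_ge0.
by rewrite ord1 !mxE; exact: lP.
Qed.

Lemma dyadic_error_cvg d (u : nat -> 'rV[R]_d) (l : 'rV[R]_d) (K : R) :
  (forall n, `|l - u n| <= K * 2 ^- n) -> u @ \oo --> l.
Proof.
move=> uK; apply/cvgrPdist_le => e e0.
have cK : (fun n => K * 2 ^- n) @ \oo --> (0 : R).
  rewrite -[X in _ --> X](mulr0 K); apply: cvgM; first exact: cvg_cst.
  under eq_fun do rewrite -exprVn.
  by apply: cvg_expr; rewrite ger0_norm ?invr_ge0// invf_lt1// ltr1n.
move/cvgrPdist_le : cK => /(_ e e0); apply: filterS => n.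
rewrite sub0r normrN => Ke; apply: le_trans (uK n) _.
exact: le_trans (ler_norm _) Ke.
Qed.

Lemma is_derive_quadratic (V W : normedModType R) (F : V -> W) z v w (C : R) :
  (forall t, `|t| <= 1 -> `|F (t *: v + z) - F z - t *: w| <= C * t ^+ 2) ->
  is_derive z v F w.
Proof.
move=> FC.
have C0 : 0 <= C.
  by have := FC 1; rewrite normr1 expr1n mulr1 => /(_ (lexx _)); exact: le_trans.
have cF : (fun t => t^-1 *: ((F \o shift z) (t *: v) - F z)) @ 0^' --> w.
  apply/cvgrPdist_le => e e0; near=> t.
  have t0 : t != 0 by near: t; exact: nbhs_dnbhs_neq.
  have t1 : `|t| <= 1 by near: t; exact: dnbhs0_le.
  have te : `|t| <= e / (C + 1).
    by near: t; apply: dnbhs0_le; rewrite divr_gt0// ltr_wpDl.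
  rewrite -[X in `|X - _|](scalerK t0) -scalerBr normrZ normfV.
  rewrite ler_pdivrMl ?normr_gt0// distrC.
  apply: le_trans (FC t t1) _.
  rewrite -[t ^+ 2]real_normK ?num_real// expr2 mulrCA.
  apply: ler_wpM2l => //.
  rewrite ler_pdivlMr ?ltr_wpDl// in te.
  by apply: le_trans te; rewrite mulrC ler_wpM2l// lerDl.
by split; [apply/cvg_ex; exists w|exact: cvg_lim cF].
Unshelve. all: by end_near. Qed.

End DyadicLimits.

Section EulerFlow.
Context {R : realType}.

Definition euler N (f : 'rV[R]_N -> 'rV[R]_N) (h : R) z := z + h *: f z.

(* Time-one flow, approximated by 2 ^ n explicit Euler steps of length 2 ^- n. *)
Definition euler_steps N (f : 'rV[R]_N -> 'rV[R]_N) n z :=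
  iter (2 ^ n) (euler f (2 ^- n)) z.

Definition flow N (f : 'rV[R]_N -> 'rV[R]_N) z : 'rV[R]_N :=
  lim (euler_steps f n z @[n --> \oo]).

Definition tame N (f : 'rV[R]_N -> 'rV[R]_N) : Prop :=
  smooth_on setT f /\
  forall rho, exists rho', forall n j z, (j <= 2 ^ n)%N -> `|z| <= rho ->
    `|iter j (euler f (2 ^- n)) z| <= rho'.

Let dyadic_ge0 n : 0 <= 2 ^- n :> R.
Proof. by rewrite invr_ge0 exprn_ge0. Qed.

Let dyadic_le1 j n : (j <= 2 ^ n)%N -> j%:R * 2 ^- n <= 1 :> R.
Proof. by move=> jn; rewrite ler_pdivrMr ?exprn_gt0// mul1r -natrX ler_nat. Qed.

Let dyadicS n : 2 ^- n = 2 ^- n.+1 + 2 ^- n.+1 :> R.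
Proof. by rewrite exprS invfM -mulrDl -[X in X + X]mulr1 -mulrDr; field. Qed.

Lemma pow_1Dle_expR (L h : R) n j : 0 <= L -> (j <= 2 ^ n)%N ->
  h = 2 ^- n -> (1 + h * L) ^+ j <= expR L.
Proof.
move=> L0 jn ->.
have hL0 : 0 <= 2 ^- n * L by rewrite mulr_ge0.
apply: (@le_trans _ _ (expR (2 ^- n * L) ^+ j)).
  by apply: lerXn2r; rewrite ?nnegrE ?addr_ge0 ?expR_ge0// expR_ge1Dx.
rewrite -expRM_natl ler_expR mulrA ler_piMl//.
exact: dyadic_le1.
Qed.

Section Stability.
Context {N : nat} (f : 'rV[R]_N -> 'rV[R]_N) (rho L : R).
Hypotheses (L0 : 0 <= L)
  (fL : forall x y, `|x| <= rho -> `|y| <= rho -> `|f x - f y| <= L * `|x - y|).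

Let euler_lip h x y : 0 <= h -> `|x| <= rho -> `|y| <= rho ->
  `|euler f h x - euler f h y| <= (1 + h * L) * `|x - y|.
Proof.
move=> h0 xr yr; rewrite /euler opprD addrACA -scalerBr.
apply: le_trans (ler_normD _ _) _; rewrite mulrDl mul1r lerD2l normrZ ger0_norm//.
by rewrite -mulrA ler_wpM2l// fL.
Qed.

Lemma euler_stability n C (c z : nat -> 'rV[R]_N) : 0 <= C ->
  (forall j, (j <= 2 ^ n)%N -> `|c j| <= rho) ->
  (forall j, (j <= 2 ^ n)%N -> `|z j| <= rho) ->
  (forall j, (j < 2 ^ n)%N ->
     `|c j.+1 - euler f (2 ^- n) (c j)| <= C * (2 ^- n) ^+ 2) ->
  (forall j, (j < 2 ^ n)%N -> z j.+1 = euler f (2 ^- n) (z j)) ->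
  forall j, (j <= 2 ^ n)%N ->
  `|c j - z j| <= (`|c 0%N - z 0%N| + C * 2 ^- n) * expR L.
Proof.
move=> C0 cr zr cS zS; set h := 2 ^- n; set d0 := `|c 0%N - z 0%N|.
have h0 : 0 <= h by exact: dyadic_ge0.
have hL : 1 <= 1 + h * L by rewrite lerDl mulr_ge0.
have step j : (j <= 2 ^ n)%N ->
    `|c j - z j| <= (d0 + j%:R * (C * h ^+ 2)) * (1 + h * L) ^+ j.
  elim: j => [|j IH] jn; first by rewrite mul0r addr0 expr0 mulr1.
  have jn' := ltnW jn; rewrite zS//.
  rewrite -(subrK (euler f h (c j)) (c j.+1)) -addrA.
  apply: le_trans (ler_normD _ _) _.
  apply: le_trans (lerD (cS j jn) (euler_lip h0 (cr _ jn') (zr _ jn'))) _.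
  set e := C * h ^+ 2; set q := 1 + h * L; set p := q ^+ j.
  have e0 : 0 <= e by rewrite mulr_ge0// exprn_ge0.
  rewrite exprS -/p (_ : (d0 + j.+1%:R * e) * (q * p) =
    e * (q * p) + q * ((d0 + j%:R * e) * p)); last by rewrite -natr1; ring.
  apply: lerD; last by rewrite ler_wpM2l ?IH// (le_trans ler01).
  by rewrite ler_peMr// /p -exprS exprn_ege1.
move=> j jn; apply: le_trans (step j jn) _.
apply: ler_pM.
- by apply: addr_ge0; rewrite ?normr_ge0// !mulr_ge0// exprn_ge0.
- by rewrite exprn_ge0// (le_trans ler01).
- by rewrite lerD2l mulrCA ler_wpM2l// expr2 mulrA ler_piMl// dyadic_le1.
- exact: (pow_1Dle_expR L0 jn).
Qed.

End Stability.

Section FlowLimit.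
Context {N : nat} (f : 'rV[R]_N -> 'rV[R]_N).
Hypothesis tf : tame f.

Let sf : smooth_on setT f. Proof. by case: tf. Qed.

Lemma euler_steps_bound (rho : R) : exists2 r, rho <= r &
  forall n j z, (j <= 2 ^ n)%N -> `|z| <= rho ->
    `|iter j (euler f (2 ^- n)) z| <= r.
Proof.
have [r rP] := tf.2 rho; exists (Num.max rho r); first by rewrite le_max lexx.
by move=> n j z jn zr; rewrite le_max rP ?orbT.
Qed.

Lemma euler_steps_lipschitz (rho : R) : exists2 L, 0 <= L &
  forall n x y, `|x| <= rho -> `|y| <= rho ->
    `|euler_steps f n x - euler_steps f n y| <= L * `|x - y|.
Proof.
have [r rhor rP] := euler_steps_bound rho.
have [L L0 LP] := smooth_lipschitz r sf.
exists (expR L); first exact: expR_ge0.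
move=> n x y xr yr.
pose c w j := iter j (euler f (2 ^- n)) w.
have cr w : `|w| <= rho -> forall j, (j <= 2 ^ n)%N -> `|c w j| <= r.
  by move=> wr j jn; exact: rP.
have cS w j : (j < 2 ^ n)%N -> `|c w j.+1 - euler f (2 ^- n) (c w j)| <= 0 * (2 ^- n) ^+ 2.
  by move=> _; rewrite /c iterS subrr normr0 mul0r.
have := euler_stability L0 LP (lexx 0) (cr x xr) (cr y yr) (cS x) (fun j _ => erefl) (leqnn _).
by rewrite mul0r addr0 mulrC.
Qed.

Lemma flow_error (rho : R) : exists2 K, 0 <= K &
  forall z, `|z| <= rho -> forall n, `|flow f z - euler_steps f n z| <= K * 2 ^- n.
Proof.
have [r rhor rP] := euler_steps_bound rho.
have [L L0 LP] := smooth_lipschitz r sf.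
have [M M0 MP] : exists2 M, 0 <= M & forall x, `|x| <= r -> `|f x| <= M.
  exists (`|f 0| + L * `|r|) => [|x xr]; first by rewrite addr_ge0// mulr_ge0.
  have r0 : 0 <= r by exact: le_trans xr.
  rewrite -[f x](subrK (f 0)) addrC; apply: le_trans (ler_normD _ _) _.
  rewrite lerD2l; apply: le_trans (LP _ _ xr _) _; first by rewrite normr0.
  by rewrite subr0 ler_wpM2l// ger0_norm.
pose K := L * M * expR L.
have K0 : 0 <= K by rewrite !mulr_ge0 ?expR_ge0.
have step z n : `|z| <= rho -> `|euler_steps f n.+1 z - euler_steps f n z| <= K * 2 ^- n.
  move=> zr; pose h : R := 2 ^- n.+1.
  have h0 : 0 <= h by exact: dyadic_ge0.
  have jj j : (j <= 2 ^ n)%N -> (j.*2 <= 2 ^ n.+1)%N.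
    by move=> jn; rewrite expnS mul2n leq_double.
  pose c j := iter j.*2 (euler f h) z; pose c' j := iter j (euler f (2 ^- n)) z.
  have cr j : (j <= 2 ^ n)%N -> `|c j| <= r by move=> jn; apply: rP => //; exact: jj.
  have cr' j : (j <= 2 ^ n)%N -> `|c' j| <= r by move=> jn; exact: rP.
  have cS j : (j < 2 ^ n)%N ->
      `|c j.+1 - euler f (2 ^- n) (c j)| <= L * M * (2 ^- n) ^+ 2; last first.
    have := euler_stability L0 LP (mulr_ge0 L0 M0) cr cr' cS (fun j _ => erefl) (leqnn _).
    by rewrite /c -mul2n -expnS subrr normr0 add0r mulrAC.
  rewrite /c.
  move=> jn; rewrite doubleS 2!iterS; set y := iter j.*2 _ _.
  have yr : `|y| <= r by apply: rP => //; apply: jj; exact: ltnW.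
  have eyr : `|euler f h y| <= r.
    rewrite /y -iterS; apply: rP => //; rewrite -[(_ < _)%N]/(j.*2 < 2 ^ n.+1)%N.
    by rewrite expnS mul2n ltn_double.
  rewrite (_ : _ - _ = h *: (f (euler f h y) - f y)); last first.
    have eE h' w : euler f h' w = w + h' *: f w by [].
    rewrite (eE h (euler f h y)) (eE (2 ^- n) y) {1}(eE h y) (dyadicS n) -/h.
    by apply/rowP => i; rewrite !mxE; ring.
  rewrite normrZ ger0_norm//.
  apply: le_trans (ler_wpM2l h0 (LP _ _ eyr yr)) _.
  rewrite /euler addrC addKr normrZ ger0_norm//.
  rewrite (dyadicS n) -/h.
  have fM := MP _ yr; have nf0 := normr_ge0 (f y).
  apply: (@le_trans _ _ (h * (L * (h * M)))).
    by rewrite !ler_wpM2l.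
  have : 0 <= L * M * h ^+ 2 by rewrite !mulr_ge0// sqr_ge0.
  rewrite !expr2; lra.
exists (2 * K); first by rewrite mulr_ge0.
move=> z zr; have [l lP] := dyadic_cauchy K0 (fun n => step z n zr).
suff -> : flow f z = l by [].
by apply: cvg_lim => //; exact: dyadic_error_cvg lP.
Qed.

Lemma euler_steps_cvg z : euler_steps f n z @[n --> \oo] --> flow f z.
Proof.
by have [K K0 /(_ z (lexx _)) zK] := flow_error `|z|; exact: dyadic_error_cvg zK.
Qed.

Lemma flow_lipschitz (rho : R) : exists2 L, 0 <= L &
  forall x y, `|x| <= rho -> `|y| <= rho -> `|flow f x - flow f y| <= L * `|x - y|.
Proof.
have [L L0 LP] := euler_steps_lipschitz rho; exists L => // x y xr yr.
have [K K0 KP] := flow_error rho; apply: (@le_dyadic_error _ _ _ (2 * K)) => n.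
rewrite (_ : flow f x - flow f y = (flow f x - euler_steps f n x)
  - (flow f y - euler_steps f n y) + (euler_steps f n x - euler_steps f n y)).
  apply: le_trans (ler_normD _ _) _; rewrite addrC lerD ?LP//.
  apply: le_trans (ler_normB _ _) _.
  by rewrite mulrDl mul1r mulrDl lerD ?KP.
by apply/rowP => i; rewrite !mxE; ring.
Qed.

Lemma flow_continuous (z : 'rV[R]_N) : {for z, continuous (flow f)}.
Proof.
have [L L0 LP] := flow_lipschitz (`|z| + 1).
apply/(@cvgrPdist_le _ _ _ (nbhs z)) => e e0; apply/nbhs_ballP.
exists (Num.min 1 (e / (L + 1))).
  by rewrite /= lt_min ltr01 divr_gt0// ltr_wpDl.
move=> y; rewrite mx_norm_ball /ball_ /= lt_min => /andP[/ltW y1 /ltW ye].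
apply: le_trans (LP _ _ _ _) _; first by rewrite lerDl.
  rewrite -[y](addrNK z) addrC; apply: le_trans (ler_normD _ _) _.
  by rewrite lerD2l distrC.
rewrite ler_pdivlMr ?ltr_wpDl// in ye; apply: le_trans ye.
by rewrite mulrC ler_wpM2l// lerDl.
Qed.

(* An approximate Euler polygon with local errors O(h ^ 2) tracks the flow;
   this replaces both existence and uniqueness of integral curves. *)
Lemma flow_consistent (rho C : R) (c : nat -> nat -> 'rV[R]_N) z l :
  (forall n j, (j <= 2 ^ n)%N -> `|c n j| <= rho) -> `|z| <= rho ->
  (forall n, `|c n 0%N - z| <= C * 2 ^- n) ->
  (forall n j, (j < 2 ^ n)%N ->
     `|c n j.+1 - euler f (2 ^- n) (c n j)| <= C * (2 ^- n) ^+ 2) ->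
  c n (2 ^ n)%N @[n --> \oo] --> l -> flow f z = l.
Proof.
move=> cr zr c0 cS cl.
have C0 : 0 <= C.
  by have := cS 0%N 0%N isT; rewrite expr0 invr1 expr1n mulr1; exact: le_trans.
have [r rhor rP] := euler_steps_bound rho.
have [L L0 LP] := smooth_lipschitz r sf.
have ce n : `|c n (2 ^ n)%N - euler_steps f n z| <= (C + C) * expR L * 2 ^- n.
  pose c' j := iter j (euler f (2 ^- n)) z.
  have cr1 j : (j <= 2 ^ n)%N -> `|c n j| <= r.
    by move=> jn; exact: le_trans (cr _ _ jn) rhor.
  have cr2 j : (j <= 2 ^ n)%N -> `|c' j| <= r by move=> jn; exact: rP.
  have := euler_stability L0 LP C0 cr1 cr2 (cS n) (fun j _ => erefl) (leqnn _).
  move/le_trans; apply; rewrite mulrAC ler_wpM2r ?expR_ge0// mulrDl lerD2r.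
  exact: c0.
have d0 : (fun n => c n (2 ^ n)%N - euler_steps f n z) @ \oo --> (0 : 'rV[R]_N).
  by apply: (@dyadic_error_cvg _ _ _ _ ((C + C) * expR L)) => n; rewrite sub0r normrN.
have el : euler_steps f n z @[n --> \oo] --> l - 0.
  rewrite [X in X @ _ --> _](_ : _ = (fun n => c n (2 ^ n)%N)
      - (fun n => c n (2 ^ n)%N - euler_steps f n z)); first exact: cvgB.
  by apply/funext => n; rewrite !fctE subKr.
by rewrite subr0 in el; exact: cvg_lim el.
Qed.

End FlowLimit.

Section FlowSmooth.

Definition tangent_field N (f : 'rV[R]_N -> 'rV[R]_N) (w : 'rV[R]_(N + N)) :
    'rV[R]_(N + N) :=
  row_mx (f (lsubmx w)) ('D_(rsubmx w) f (lsubmx w)).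

Lemma smooth_tangent_field N (f : 'rV[R]_N -> 'rV[R]_N) :
  smooth_on setT f -> smooth_on setT (tangent_field f).
Proof.
move=> sf.
have sl : smooth_on setT (fun w : 'rV[R]_(N + N) => lsubmx w).
  by apply: (smooth_on_coord openT) => a u v; exact: linearP.
have sr : smooth_on setT (fun w : 'rV[R]_(N + N) => rsubmx w).
  by apply: (smooth_on_coord openT) => a u v; exact: linearP.
apply: (smooth_on_row_mx openT).
  exact: (smooth_on_comp openT openT sf sl).
apply: (@smooth_on_eq _ _ _ _ (fun w => \matrix_(i, j)
    \sum_k rsubmx w 0 k * partial k f (lsubmx w) i j) _ openT).
  move=> w _; rewrite derive_sum_partial; last exact: smooth_on_diff_mx openT sf _.
  by apply/matrixP => i j; rewrite mxE summxE; apply: eq_bigr => k _; rewrite [in RHS]mxE.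
apply: (smooth_on_mx openT) => i j; under eq_fun do rewrite mxE.
apply: (smooth_on_sum openT) => k _; apply: (smooth_onM openT).
  exact: (smooth_on_entry _ _ openT sr).
apply: (smooth_on_entry i j openT).
exact: (smooth_on_comp openT openT (smooth_on_partial k sf) sl).
Qed.

Let is_derive_iter N (f : 'rV[R]_N -> 'rV[R]_N) h j z v : smooth_on setT f ->
  is_derive z v (iter j (euler f h))
    (rsubmx (iter j (euler (tangent_field f) h) (row_mx z v))) /\
  lsubmx (iter j (euler (tangent_field f) h) (row_mx z v)) = iter j (euler f h) z.
Proof.
move=> sf; elim: j => [|j [IHd IHl]].
  by rewrite /= row_mxKl row_mxKr; split=> //; exact: is_derive_id.
rewrite !iterS; set w := iter j _ (row_mx z v) in IHd IHl *.
rewrite /euler /tangent_field scale_row_mx -[w in w + _]hsubmxK add_row_mx.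
rewrite row_mxKl row_mxKr IHl; split=> //.
have df := smooth_on_diff_mx openT sf (I : setT (iter j (euler f h) z)).
apply: is_deriveD; apply: is_deriveZ; exact: is_derive_comp_diff.
Qed.

Lemma tame_tangent N (f : 'rV[R]_N -> 'rV[R]_N) : tame f -> tame (tangent_field f).
Proof.
move=> tf; have sf := tf.1; split; first exact: smooth_tangent_field.
move=> rho; have [r rhor rP] := euler_steps_bound tf rho.
have [L L0 LP] := smooth_derive_bound r sf.
exists (Num.max r (expR L * rho)) => n j w jn wr.
have [wl wr'] : `|lsubmx w| <= rho /\ `|rsubmx w| <= rho.
  by apply/andP; rewrite -norm_row_mx hsubmxK.
have rho0 : 0 <= rho by exact: le_trans wr.
have h0 := dyadic_ge0 n.
have lE i : lsubmx (iter i (euler (tangent_field f) (2 ^- n)) w) =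
    iter i (euler f (2 ^- n)) (lsubmx w).
  by rewrite -{1}[w]hsubmxK; have [] := is_derive_iter (2 ^- n) i (lsubmx w) (rsubmx w) sf.
have rE i : (i <= j)%N -> `|rsubmx (iter i (euler (tangent_field f) (2 ^- n)) w)| <=
    (1 + 2 ^- n * L) ^+ i * rho.
  elim: i => [|i IH] ij; first by rewrite mul1r.
  rewrite iterS {1}/euler linearD linearZ /= /tangent_field row_mxKr lE.
  apply: le_trans (ler_normD _ _) _; rewrite normrZ ger0_norm//.
  have ir : `|iter i (euler f (2 ^- n)) (lsubmx w)| <= r.
    by apply: rP => //; exact: leq_trans (ltnW ij) jn.
  apply: le_trans (lerD (lexx _) (ler_wpM2l h0 (LP _ _ ir))) _.
  rewrite mulrA -{1}[`|_|]mul1r -mulrDl exprS -mulrA ler_wpM2l ?IH ?(ltnW ij)//.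
  by rewrite addr_ge0// mulr_ge0.
rewrite -[iter _ _ _]hsubmxK norm_row_mx lE !le_max rP//=.
apply/orP; right; apply: le_trans (rE j (leqnn _)) _.
by rewrite ler_wpM2r//; exact: (pow_1Dle_expR L0 jn).
Qed.

Lemma is_derive_flow N (f : 'rV[R]_N -> 'rV[R]_N) z v : tame f ->
  is_derive z v (flow f) (rsubmx (flow (tangent_field f) (row_mx z v))).
Proof.
move=> tf; have sf := tf.1; have tf' := tame_tangent tf.
pose rho := `|z| + `|v|.
have zvr t : `|t| <= 1 -> `|t *: v + z| <= rho.
  move=> t1; apply: le_trans (ler_normD _ _) _; rewrite addrC lerD2l normrZ.
  exact: ler_piMl.
have zr : `|z| <= rho by rewrite lerDl.
have vr : `|v| <= rho by rewrite lerDr.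
have [L L0 LP] := euler_steps_lipschitz tf' rho.
have [K K0 KP] := flow_error tf rho; have [K' K'0 KP'] := flow_error tf' rho.
apply: (@is_derive_quadratic _ _ _ _ _ _ _ (L * `|v|)) => t t1.
apply: (@le_dyadic_error _ _ _ (2 * K + K')) => n.
pose W n x := euler_steps (tangent_field f) n (row_mx x v).
have dE x := (is_derive_iter (2 ^- n) (2 ^ n) x v sf).1.
have main : `|euler_steps f n (t *: v + z) - euler_steps f n z - t *: rsubmx (W n z)|
    <= L * `|v| * t ^+ 2.
  apply: mxnorm_le => [|a i]; first by rewrite mulr_ge0 ?sqr_ge0// mulr_ge0.
  rewrite ord1 !mxE.
  have dEi x : is_derive x v (fun y => euler_steps f n y 0 i) (rsubmx (W n x) 0 i).
    have [d0 dW] := dE x; have /derivable_mxP d1 := d0; split; first exact: d1.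
    by rewrite /W /euler_steps -dW derive_mx// mxE.
  have [s _|s s01 E] := @mean_value_line R _ (fun y => euler_steps f n y 0 i) z (t *: v).
    by have [] := is_derive_scale t (dEi (z + s *: (t *: v))).
  have [_ dF] := is_derive_scale t (dEi (z + s *: (t *: v))).
  rewrite [t *: v + z]addrC E dF; set A := rsubmx _ _ _; set B := W n z _ _.
  rewrite -[t ^+ 2]real_normK ?num_real// expr2 mulrCA.
  rewrite (_ : t *: A - t * B = t * (A - B)); last by rewrite mulrBr.
  rewrite normrM ler_wpM2l//.
  have -> : A - B = (W n (z + s *: (t *: v)) - W n z) 0 (rshift N i) by rewrite /A /B !mxE.
  apply: le_trans (mxnorm_coord _ _ _) _.
  have st1 : `|s * t| <= 1.
    have /andP[s0 s1] := s01; rewrite normrM ger0_norm//.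
    by rewrite -[1]mulr1 ler_pM.
  apply: le_trans (LP _ _ _ _ _) _; rewrite ?norm_row_mx ?vr ?zr ?andbT//.
    by rewrite addrC scalerA zvr.
  rewrite opp_row_mx add_row_mx subrr addrC addKr scalerA.
  rewrite -mulrA ler_wpM2l// norm_row_mx normr0 mulr_ge0// andbT.
  rewrite normrZ mulrC ler_wpM2l// normrM ler_piMl//.
  by have /andP[s0 s1] := s01; rewrite ger0_norm.
have wr : `|row_mx z v| <= rho by rewrite norm_row_mx zr.
set a := flow f _; set b := flow f z; set w := rsubmx _.
rewrite (_ : a - b - t *: w = (a - euler_steps f n (t *: v + z))
   - (b - euler_steps f n z) - t *: rsubmx (flow (tangent_field f) (row_mx z v) - W n z)
   + (euler_steps f n (t *: v + z) - euler_steps f n z - t *: rsubmx (W n z))).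
  apply: le_trans (ler_normD _ _) _; rewrite addrC lerD// mulrDl.
  apply: le_trans (ler_normB _ _) _; rewrite lerD//.
    apply: le_trans (ler_normB _ _) _; rewrite mulrDl mul1r mulrDl.
    by rewrite lerD// KP// zvr.
  rewrite normrZ -[X in _ <= X]mul1r ler_pM//.
  have := KP' _ wr n; rewrite -[X in `|X| <= _]hsubmxK norm_row_mx.
  by case/andP.
by rewrite /w; apply/rowP => i; rewrite !mxE; ring.
Qed.

Lemma flow_smooth N (f : 'rV[R]_N -> 'rV[R]_N) : tame f -> smooth_on setT (flow f).
Proof.
move=> tf; apply: (smooth_on_mx openT) => a j; rewrite ord1.
pose C (g : 'rV[R]_N -> R) := exists N' (f' : 'rV[R]_N' -> 'rV[R]_N') B b j,
  tame f' /\ g = fun x => flow f' (x *m B + b) 0 j.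
apply: (@smooth_on_coind _ _ _ _ C openT); last first.
  exists N, f, 1%:M, 0, j; split=> //.
  by apply/funext => x; rewrite mulmx1 addr0.
move=> _ [N' [f' [B [b [k [tf' ->]]]]]].
have dg x i : is_derive x (delta_mx 0 i : 'rV[R]_N) (fun x => flow f' (x *m B + b) 0 k)
   (flow (tangent_field f') (row_mx (x *m B + b) (delta_mx 0 i *m B)) 0 (rshift N' k)).
  have /is_derive1P[d0 dE] := is_derive_flow (x *m B + b) (delta_mx 0 i *m B) tf'.
  apply/is_derive1P.
  have E : (fun t : R => flow f' ((t *: delta_mx 0 i + x) *m B + b) 0 k) =
    (fun t : R => flow f' (t *: (delta_mx 0 i *m B) + (x *m B + b)) 0 k).
    by apply/funext => t; rewrite mulmxDl -scalemxAl addrA.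
  have /derivable_mxP d1 := d0; rewrite E; split; first exact: d1.
  have := congr1 (fun A : 'rV[R]_N' => A 0 k) dE.
  by rewrite derive_mx// !mxE.
split=> [x _|i].
  apply: continuous_mx_entry.
  apply: (@continuous_comp _ _ _ (fun x : 'rV[R]_N => x *m B + b) (flow f')).
    apply: continuousD; last exact: cst_continuous.
    exact: (@linear_mx_continuous R 1 N 'rV[R]_N' (mulmxr B) x).
  exact: flow_continuous.
split=> [x _|]; first by have [] := dg x i.
exists (fun x => flow (tangent_field f')
  (x *m row_mx B 0 + row_mx b (delta_mx 0 i *m B)) 0 (rshift N' k)).
  by exists (N' + N')%N, (tangent_field f'), (row_mx B 0), (row_mx b (delta_mx 0 i *m B)),
    (rshift N' k); split=> //; exact: tame_tangent.
move=> x _; have [_] := dg x i; rewrite /partial => ->.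
by rewrite mul_mx_row mulmx0 add_row_mx add0r.
Qed.

End FlowSmooth.

End EulerFlow.

(** * The Frobenius theorem for graph distributions *)

Section Straightening.
Context {R : realType} {k e : nat} (A : 'rV[R]_(k + e) -> 'M[R]_(k, e)) (K : R).
Hypotheses (sA : smooth_on setT A) (K0 : 0 <= K)
  (AK : forall z (x : 'rV[R]_k), `|x *m A z| <= K * `|x|).

Implicit Types (p x v : 'rV[R]_k) (y : 'rV[R]_e).

(* The lift [y' = x A(p, y)] of the straight line [p' = x] with constant speed. *)
Let field (w : 'rV[R]_(k + (k + e))) : 'rV[R]_(k + (k + e)) :=
  let x := lsubmx (rsubmx w) in
  row_mx x (row_mx 0 (x *m A (row_mx (lsubmx w) (rsubmx (rsubmx w))))).

Let pack p x y : 'rV[R]_(k + (k + e)) := row_mx p (row_mx x y).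

Let polygon p x y h : nat -> 'rV[R]_e :=
  fix F j := if j is i.+1 then F i + h *: (x *m A (row_mx (p + (i%:R * h) *: x) (F i)))
             else y.

Let polygonS p x y h j : polygon p x y h j.+1 = polygon p x y h j +
  h *: (x *m A (row_mx (p + (j%:R * h) *: x) (polygon p x y h j))).
Proof. by []. Qed.

Let fieldE p x y : field (pack p x y) = pack x 0 (x *m A (row_mx p y)).
Proof. by rewrite /field /pack !(row_mxKl, row_mxKr). Qed.

Let packD p x y p' x' y' : pack p x y + pack p' x' y' = pack (p + p') (x + x') (y + y').
Proof. by rewrite /pack !add_row_mx. Qed.

Let packB p x y p' x' y' : pack p x y - pack p' x' y' = pack (p - p') (x - x') (y - y').
Proof. by rewrite /pack !opp_row_mx !add_row_mx. Qed.

Let packZ a p x y : a *: pack p x y = pack (a *: p) (a *: x) (a *: y).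
Proof. by rewrite /pack !scale_row_mx. Qed.

Let norm_pack p x y (r : R) : (`|pack p x y| <= r) = [&& `|p| <= r, `|x| <= r & `|y| <= r].
Proof. by rewrite /pack !norm_row_mx. Qed.

Let iter_polygon p x y h j : iter j (euler field h) (pack p x y) =
  pack (p + (j%:R * h) *: x) x (polygon p x y h j).
Proof.
elim: j => [|j IH]; first by rewrite /= mul0r scale0r addr0.
rewrite iterS IH /euler fieldE packZ packD scaler0 addr0 polygonS.
by congr pack; rewrite -addrA -scalerDl -natr1 mulrDl mul1r.
Qed.

Let polygon_bound p x y n j : (j <= 2 ^ n)%N ->
  `|polygon p x y (2 ^- n) j| <= `|y| + K * `|x|.
Proof.
move=> jn; have h0 : 0 <= 2 ^- n :> R by rewrite invr_ge0 exprn_ge0.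
have step : `|polygon p x y (2 ^- n) j| <= `|y| + j%:R * 2 ^- n * (K * `|x|).
  elim: j {jn} => [|j IH]; first by rewrite !mul0r addr0.
  rewrite polygonS; apply: le_trans (ler_normD _ _) _.
  rewrite -[j.+1%:R]natr1 !mulrDl mul1r addrA lerD// normrZ ger0_norm//.
  by rewrite ler_wpM2l.
apply: le_trans step _; rewrite lerD2l ler_piMl ?mulr_ge0//.
by rewrite ler_pdivrMr ?exprn_gt0// mul1r -natrX ler_nat.
Qed.

Let base_bound p x n j : (j <= 2 ^ n)%N ->
  `|p + (j%:R * 2 ^- n) *: x| <= `|p| + `|x|.
Proof.
move=> jn; apply: le_trans (ler_normD _ _) _; rewrite lerD2l normrZ ler_piMl//.
rewrite ger0_norm ?mulr_ge0 ?invr_ge0 ?exprn_ge0//.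
by rewrite ler_pdivrMr ?exprn_gt0// mul1r -natrX ler_nat.
Qed.

Let sA_at : smooth_on setT (fun w : 'rV[R]_(k + (k + e)) =>
  A (row_mx (lsubmx w) (rsubmx (rsubmx w)))).
Proof.
apply: (smooth_on_comp openT openT sA).
  apply: (smooth_on_coord openT) => a u v.
  by rewrite !linearP /= scale_row_mx add_row_mx.
by [].
Qed.

Let sx : smooth_on setT (fun w : 'rV[R]_(k + (k + e)) => lsubmx (rsubmx w)).
Proof. by apply: (smooth_on_coord openT) => a u v; rewrite !linearP. Qed.

Let tame_field : tame field.
Proof.
split.
  apply: (smooth_on_row_mx openT sx); apply: (smooth_on_row_mx openT).
    exact: smooth_on_cst openT.
  exact: (smooth_on_mulmx openT sx sA_at).
move=> rho; exists (rho + rho + K * rho) => n j z jn.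
rewrite -[z]hsubmxK -[rsubmx z]hsubmxK; move: (lsubmx z) => p.
move: (lsubmx (rsubmx z)) (rsubmx (rsubmx z)) => x y; rewrite -/(pack p x y).
rewrite norm_pack => /and3P[pr xr yr]; rewrite iter_polygon norm_pack.
have r0 : 0 <= rho by exact: le_trans pr.
have Kr : 0 <= K * rho by rewrite mulr_ge0.
have Kx : K * `|x| <= K * rho by rewrite ler_wpM2l.
apply/and3P; split.
- by apply: le_trans (base_bound _ _ jn) _; lra.
- lra.
- by apply: le_trans (polygon_bound _ _ _ jn) _; lra.
Qed.

Let lift_end p x y : 'rV[R]_e := rsubmx (rsubmx (flow field (pack p x y))).

Let linear_cvg m n (L : 'rV[R]_m -> 'rV[R]_n) (u : nat -> 'rV[R]_m) l :
  linear L -> u @ \oo --> l -> (L \o u) @ \oo --> L l.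
Proof.
move=> linL ul; apply: (cvg_comp _ _ ul).
exact: (@smooth_on_continuous _ _ _ setT _ _ (smooth_on_coord openT linL) I).
Qed.

Let linl : linear (fun w : 'rV[R]_(k + (k + e)) => lsubmx w).
Proof. by move=> a u v; rewrite linearP. Qed.

Let linrl : linear (fun w : 'rV[R]_(k + (k + e)) => lsubmx (rsubmx w)).
Proof. by move=> a u v; rewrite !linearP. Qed.

Let linrr : linear (fun w : 'rV[R]_(k + (k + e)) => rsubmx (rsubmx w)).
Proof. by move=> a u v; rewrite !linearP. Qed.

Let polygon_cvg p x y :
  polygon p x y (2 ^- n) (2 ^ n)%N @[n --> \oo] --> lift_end p x y.
Proof.
have := linear_cvg linrr (@euler_steps_cvg _ _ _ tame_field (pack p x y)).
rewrite (_ : _ \o _ = (fun n => polygon p x y (2 ^- n) (2 ^ n)%N))//.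
by apply/funext => n; rewrite /= /euler_steps iter_polygon /pack !row_mxKr.
Qed.

Let polygon_error p x y : exists2 C, 0 <= C & forall n,
  `|polygon p x y (2 ^- n) (2 ^ n)%N - lift_end p x y| <= C * 2 ^- n.
Proof.
have [C C0 CP] := flow_error tame_field `|pack p x y|.
exists C => // n; have := CP _ (lexx _) n.
rewrite -[X in `|X| <= _ -> _]hsubmxK -[rsubmx (_ - _)]hsubmxK norm_pack.
move=> /and3P[_ _]; rewrite distrC !linearB /= /euler_steps iter_polygon.
by rewrite /pack !row_mxKr.
Qed.

Let flow_fieldE p x y : flow field (pack p x y) = pack (p + x) x (lift_end p x y).
Proof.
have E n : (2 ^ n)%:R * 2 ^- n = 1 :> R by rewrite natrX mulfV// expf_neq0.
rewrite -[LHS]hsubmxK -[rsubmx (flow _ _)]hsubmxK /pack -/(lift_end p x y).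
have cl := linear_cvg linl (@euler_steps_cvg _ _ _ tame_field (pack p x y)).
have cr := linear_cvg linrl (@euler_steps_cvg _ _ _ tame_field (pack p x y)).
congr (row_mx _ (row_mx _ _)).
  rewrite -(cvg_lim _ cl)// (_ : _ \o _ = cst (p + x)) ?lim_cst//.
  apply/funext => n; rewrite /= /euler_steps iter_polygon /pack row_mxKl.
  by rewrite E scale1r.
rewrite -(cvg_lim _ cr)// (_ : _ \o _ = cst x) ?lim_cst//.
by apply/funext => n; rewrite /= /euler_steps iter_polygon /pack row_mxKr row_mxKl.
Qed.

(* Running the Euler polygon backwards. *)
Let lift_end_rev p x y : lift_end (p + x) (- x) (lift_end p x y) = y.
Proof.
have [C1 C10 C1P] := polygon_error p x y.
pose rho := `|p| + `|x| + `|y| + K * `|x|.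
have [L L0 LP] := smooth_lipschitz rho sA.
have x0 := normr_ge0 x; have y0 := normr_ge0 y; have p0 := normr_ge0 p.
have Kx0 : 0 <= K * `|x| by rewrite mulr_ge0.
pose C2 := k%:R * `|x| * (L * (`|x| + K * `|x|)).
have C20 : 0 <= C2 by rewrite !mulr_ge0// addr_ge0.
pose q n j := row_mx (p + (j%:R * 2 ^- n) *: x) (polygon p x y (2 ^- n) j).
have qr n j : (j <= 2 ^ n)%N -> `|q n j| <= rho.
  move=> jn; rewrite /q norm_row_mx /rho.
  by apply/andP; split; [apply: le_trans (base_bound _ _ jn) _|
    apply: le_trans (polygon_bound _ _ _ jn) _]; lra.
pose c n j := let m := (2 ^ n - j)%N in
  pack (p + (m%:R * 2 ^- n) *: x) (- x) (polygon p x y (2 ^- n) m).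
have E n : (2 ^ n)%:R * 2 ^- n = 1 :> R by rewrite natrX mulfV// expf_neq0.
pose z := pack (p + x) (- x) (lift_end p x y).
suff : flow field z = pack p (- x) y.
  by rewrite /z flow_fieldE => /(congr1 (fun w => rsubmx (rsubmx w))); rewrite /pack !row_mxKr.
apply: (@flow_consistent _ _ _ tame_field (rho + `|z|) (C1 + C2) c).
- move=> n j jn; have z0 := normr_ge0 z.
  have := qr n (2 ^ n - j)%N (leq_subr _ _); rewrite /q norm_row_mx => /andP[q1 q2].
  rewrite /c norm_pack normrN; apply/and3P; split.
  + by apply: le_trans q1 _; rewrite lerDl.
  + rewrite /rho; lra.
  + by apply: le_trans q2 _; rewrite lerDl.
- by rewrite lerDr /rho; lra.
- move=> n; rewrite /c subn0 E scale1r /z packB !subrr norm_pack !normr0.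
  have h0 : 0 <= 2 ^- n :> R by rewrite invr_ge0 exprn_ge0.
  have C12 : 0 <= (C1 + C2) * 2 ^- n by rewrite mulr_ge0// addr_ge0.
  rewrite C12/=; apply: le_trans (C1P n) _; rewrite ler_wpM2r//; lra.
- move=> n j jn; rewrite /c /euler fieldE packZ packD scaler0 addr0.
  have h0 : 0 <= 2 ^- n :> R by rewrite invr_ge0 exprn_ge0.
  have mS : (2 ^ n - j = (2 ^ n - j.+1).+1)%N by rewrite subnSK.
  rewrite mS; set m := (2 ^ n - j.+1)%N; set h := 2 ^- n in h0 *.
  have mn : (m < 2 ^ n)%N by rewrite /m -mS leq_subr.
  rewrite packB subrr.
  have -> : p + (m%:R * h) *: x - (p + (m.+1%:R * h) *: x + h *: - x) = 0.
    by apply/rowP => i; rewrite !mxE -natr1; ring.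
  rewrite norm_pack normr0 mulr_ge0 ?exprn_ge0 ?addr_ge0// !andTb.
  set a := polygon _ _ _ _ m; set b := polygon _ _ _ _ m.+1.
  have bE : b = a + h *: (x *m A (q n m)) by rewrite /b polygonS.
  have qE : q n m.+1 = q n m + row_mx (h *: x) (h *: (x *m A (q n m))).
    rewrite /q add_row_mx -/h -/a -/b bE; congr row_mx.
    by rewrite -addrA -scalerDl -natr1 mulrDl mul1r.
  have -> : a - (b + h *: (- x *m A (row_mx (p + (m.+1%:R * h) *: x) b))) =
      h *: (x *m (A (q n m.+1) - A (q n m))).
    rewrite -/(q n m.+1) bE mulNmx mulmxBr.
    by apply/rowP => i; rewrite !mxE; ring.
  rewrite normrZ ger0_norm// expr2 mulrCA ler_wpM2l//.
  apply: (@le_trans _ _ (C2 * h)); last by rewrite ler_wpM2r// lerDr.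
  apply: le_trans (norm_mulmx _ _) _; rewrite /C2 -!mulrA ler_wpM2l// ler_wpM2l//.
  apply: le_trans (LP _ _ (qr _ _ mn) (qr _ _ (ltnW mn))) _.
  rewrite ler_wpM2l// qE addrC addKr norm_row_mx !normrZ ger0_norm//.
  rewrite mulrC ler_wpM2r//=; last by rewrite lerDl.
  by rewrite mulrC ler_wpM2r//; apply: le_trans (AK _ _) _; rewrite lerDr.
- rewrite (_ : (fun n => _) = cst (pack p (- x) y)); first exact: cvg_cst.
  by apply/funext => n; rewrite /c subnn mul0r scale0r addr0.
Qed.

Let lift_end0 p y : lift_end p 0 y = y.
Proof.
have P n : polygon p 0 y (2 ^- n) (2 ^ n)%N = y.
  by elim: (2 ^ n)%N => // j IH; rewrite polygonS IH mul0mx scaler0 addr0.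
have := @polygon_cvg p 0 y.
rewrite (_ : (fun n => _) = cst y); last by apply/funext.
by move=> /(cvg_lim (@norm_hausdorff _ _)) <-; rewrite lim_cst.
Qed.

Section Integrable.
Context (r0 : R).
Hypothesis integrable : forall z, `|z| <= r0 -> forall u v : 'rV[R]_k,
  u *m 'D_(row_mx v (v *m A z)) A z = v *m 'D_(row_mx u (u *m A z)) A z.

Let derive_field p x y dp dx dy :
  'D_(pack dp dx dy) field (pack p x y) =
  pack dx 0 (dx *m A (row_mx p y) + x *m 'D_(row_mx dp dy) A (row_mx p y)).
Proof.
have dl : is_derive (pack p x y) (pack dp dx dy) (fun w => lsubmx w) dp.
  rewrite -{2}[dp](row_mxKl dp (row_mx dx dy)).
  exact: is_derive_linear_mx (is_derive_id _ _).
have dr : is_derive (pack p x y) (pack dp dx dy) (fun w => rsubmx w) (row_mx dx dy).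
  rewrite -[X in is_derive _ _ _ X](row_mxKr dp).
  exact: is_derive_linear_mx (is_derive_id _ _).
have drl : is_derive (pack p x y) (pack dp dx dy) (fun w => lsubmx (rsubmx w)) dx.
  rewrite -[X in is_derive _ _ _ X](row_mxKl dx dy).
  exact: is_derive_linear_mx dr.
have drr : is_derive (pack p x y) (pack dp dx dy) (fun w => rsubmx (rsubmx w)) dy.
  rewrite -[X in is_derive _ _ _ X](row_mxKr dx).
  exact: is_derive_linear_mx dr.
have dA := is_derive_comp_diff (is_derive_row_mx dl drr)
  (smooth_on_diff_mx openT sA I).
have dM := is_derive_mulmx drl dA.
have [_ ->] := is_derive_row_mx drl (is_derive_row_mx
  (is_derive_cst (0 : 'rV[R]_k) (pack p x y) (pack dp dx dy)) dM).
by rewrite /pack /= !(row_mxKr, row_mxKl).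
Qed.

(* Integrability makes [t (v, v A)] the variation of the lifted line [t x] in
   the direction [v]. *)
Let flow_variation x v y : `|x| <= r0 -> `|y| + K * `|x| <= r0 ->
  flow (tangent_field field) (row_mx (pack 0 x y) (pack 0 v 0)) =
  row_mx (pack x x (lift_end 0 x y))
    (pack v v (v *m A (row_mx x (lift_end 0 x y)))).
Proof.
move=> xr yr.
have [L L0 LP] := smooth_lipschitz r0 sA.
have [L' L'0 LP'] := smooth_derive_bound r0 sA.
have x0 := normr_ge0 x; have y0 := normr_ge0 y; have v0 := normr_ge0 v.
have Kx0 : 0 <= K * `|x| by rewrite mulr_ge0.
have Kv0 : 0 <= K * `|v| by rewrite mulr_ge0.
pose q n j := row_mx ((j%:R * 2 ^- n) *: x) (polygon 0 x y (2 ^- n) j).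
have jh n j : (j <= 2 ^ n)%N -> 0 <= (j%:R * 2 ^- n : R) <= 1.
  move=> jn; rewrite mulr_ge0 ?invr_ge0 ?exprn_ge0//=.
  by rewrite ler_pdivrMr ?exprn_gt0// mul1r -natrX ler_nat.
have qr n j : (j <= 2 ^ n)%N -> `|q n j| <= r0.
  move=> jn; rewrite /q norm_row_mx; apply/andP; split.
    have /andP[j0 j1] := jh n j jn.
    by rewrite normrZ ger0_norm//; apply: le_trans xr; exact: ler_piMl.
  exact: le_trans (polygon_bound _ _ _ jn) yr.
have [T T0 TP] := smooth_taylor r0 sA.
pose s := Num.max `|x| (K * `|x|).
have s0 : 0 <= s by rewrite le_max x0.
pose C1 := k%:R * `|v| * (T * s ^+ 2).
pose C2 := k%:R * `|v| * (L' * s).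
have C10 : 0 <= C1 by rewrite !mulr_ge0// sqr_ge0.
have C20 : 0 <= C2 by rewrite !mulr_ge0.
pose c n j := row_mx (pack ((j%:R * 2 ^- n) *: x) x (polygon 0 x y (2 ^- n) j))
  (pack ((j%:R * 2 ^- n) *: v) v ((j%:R * 2 ^- n) *: (v *m A (q n j)))).
pose rho := r0 + `|v| + K * `|v|.
have qB n j : (j <= 2 ^ n)%N -> `|c n j| <= rho.
  move=> jn; have /andP[j0 j1] := jh n j jn.
  have := qr n j jn; rewrite /q norm_row_mx => /andP[q1 q2].
  rewrite /c norm_row_mx !norm_pack.
  have vb : `|(j%:R * 2 ^- n) *: v| <= `|v|.
    by rewrite normrZ ger0_norm//; exact: ler_piMl.
  have Ab : `|(j%:R * 2 ^- n) *: (v *m A (q n j))| <= K * `|v|.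
    by rewrite normrZ ger0_norm//; apply: le_trans (AK (q n j) v); exact: ler_piMl.
  have rA : r0 <= rho by rewrite /rho -addrA lerDl addr_ge0.
  have r00 : 0 <= r0 by exact: le_trans xr.
  have rv : `|v| <= rho by rewrite /rho addrAC lerDr addr_ge0.
  have rK : K * `|v| <= rho by rewrite /rho lerDr addr_ge0.
  by rewrite (le_trans q1 rA) (le_trans xr rA) (le_trans q2 rA) (le_trans vb rv) rv (le_trans Ab rK).
have c0 n : c n 0%N = row_mx (pack 0 x y) (pack 0 v 0).
  by rewrite /c !mul0r !scale0r.
apply: (@flow_consistent _ _ _ (tame_tangent tame_field) rho (C1 + C2) c).
- exact: qB.
- by rewrite -(c0 0%N); exact: qB.
- by move=> n; rewrite c0 subrr normr0 mulr_ge0 ?addr_ge0// invr_ge0 exprn_ge0.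
- move=> n j jn; set h := 2 ^- n.
  have h0 : 0 <= h by rewrite invr_ge0 exprn_ge0.
  rewrite /euler /tangent_field {2 3}/c row_mxKl row_mxKr derive_field fieldE.
  rewrite -/h -/(q n j); set t := j%:R * h.
  have /andP[t0 t1] : 0 <= t <= 1 by exact: jh (ltnW jn).
  have t'E : j.+1%:R * h = t + h by rewrite -natr1 mulrDl mul1r.
  have /andP[t'0 t'1] : 0 <= t + h <= 1 by rewrite -t'E; exact: jh jn.
  pose d := row_mx (h *: x) (h *: (x *m A (q n j))).
  have qE : q n j.+1 = q n j + d.
    by rewrite /q add_row_mx -/h t'E polygonS scalerDl add0r.
  have ds : `|d| <= h * s.
    rewrite norm_row_mx !normrZ ger0_norm// ler_wpM2l ?le_max ?lexx//.
    rewrite ler_wpM2l//.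
    by apply: le_trans (AK _ _) _; rewrite le_max lexx orbT.
  pose B := 'D_(row_mx x (x *m A (q n j))) A (q n j).
  have dA : differentiable A (q n j) by exact: smooth_on_diff_mx openT sA I.
  have DZ (a : R) w : 'D_(a *: w) A (q n j) = a *: 'D_w A (q n j).
    by rewrite !deriveE// linearZ.
  have -> : row_mx (t *: v) (t *: (v *m A (q n j))) = t *: row_mx v (v *m A (q n j)).
    by rewrite scale_row_mx.
  rewrite DZ -scalemxAr (integrable (qr _ _ (ltnW jn)) x v) -/B.
  pose E := A (q n j.+1) - A (q n j) - h *: B.
  have Es : `|E| <= T * (h * s) ^+ 2.
    have DB : 'D_d A (q n j) = h *: B by rewrite -DZ scale_row_mx.
    have := TP (q n j) d (qr _ _ (ltnW jn)); rewrite -qE DB => /(_ (qr _ _ jn)).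
    move/le_trans; apply; apply: ler_wpM2l => //; apply: lerXn2r => //.
      by rewrite nnegrE.
    by rewrite nnegrE mulr_ge0.
  have Bs : `|B| <= L' * s.
    apply: le_trans (LP' _ _ (qr _ _ (ltnW jn))) _; rewrite ler_wpM2l//.
    rewrite norm_row_mx /s !le_max lexx /=; apply/orP; right.
    exact: AK.
  rewrite (_ : _ - _ = row_mx 0 (pack 0 0
      ((h ^+ 2) *: (v *m B) + (t + h) *: (v *m E)))); last first.
    rewrite /c -/h t'E scale_row_mx !packZ add_row_mx !packD.
    rewrite opp_row_mx add_row_mx !packB polygonS -/h add0r -/(q n j).
    rewrite -/t !scaler0 !addr0 -!scalerDl !subrr; congr row_mx; first by rewrite /pack !row_mx0.
    congr pack.
    have -> : A (q n j.+1) = A (q n j) + h *: B + E.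
      by rewrite /E; apply/matrixP => a b; rewrite !mxE; ring.
    rewrite !mulmxDr -scalemxAr; move: (v *m A _) (v *m B) (v *m E) => a b f.
    by apply/rowP => i; rewrite !mxE; ring.
  have C12 : 0 <= (C1 + C2) * h ^+ 2 by rewrite mulr_ge0 ?exprn_ge0 ?addr_ge0.
  rewrite norm_row_mx norm_pack !normr0 C12 !andTb.
  apply: le_trans (ler_normD _ _) _; rewrite !normrZ !ger0_norm ?exprn_ge0//.
  rewrite [X in _ <= X]mulrDl [X in _ <= X]addrC; apply: lerD.
    rewrite mulrC ler_wpM2r ?mulr_ge0//.
    by apply: le_trans (norm_mulmx _ _) _; rewrite /C2 ler_wpM2l ?mulr_ge0.
  apply: (@le_trans _ _ `|v *m E|); first exact: ler_piMl.
  apply: le_trans (norm_mulmx _ _) _; rewrite /C1 -[X in _ <= X]mulrA ler_wpM2l ?mulr_ge0//.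
  by apply: le_trans Es _; rewrite exprMn mulrA mulrAC.
- pose F z := row_mx (pack x x z) (pack v v (v *m A (row_mx x z))).
  have sF : smooth_on setT F.
    have sc m (w : 'rV[R]_m) : smooth_on setT (fun _ : 'rV[R]_e => w).
      exact: smooth_on_cst openT.
    have si : smooth_on setT (fun z : 'rV[R]_e => z) by exact: (smooth_on_coord openT).
    have sl := smooth_on_row_mx openT (sc _ x) (smooth_on_row_mx openT (sc _ x) si).
    have sxz := smooth_on_comp openT openT sA (smooth_on_row_mx openT (sc _ x) si) (fun _ _ => I).
    have sr := smooth_on_row_mx openT (sc _ v)
      (smooth_on_row_mx openT (sc _ v) (smooth_on_mulmx openT (sc _ v) sxz)).
    exact: (smooth_on_row_mx openT sl sr).
  rewrite (_ : (fun n => _) = F \o (fun n => polygon 0 x y (2 ^- n) (2 ^ n)%N)).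
    apply: (cvg_comp _ _ (@polygon_cvg 0 x y)).
    exact: (@smooth_on_continuous _ _ _ setT _ _ sF I).
  by apply/funext => n; rewrite /c /F /= natrX mulfV ?expf_neq0// !scale1r /q
    natrX mulfV ?expf_neq0// scale1r.
Qed.

Lemma derive_lift_end x v y : `|x| <= r0 -> `|y| + K * `|x| <= r0 ->
  is_derive x v (fun x => lift_end 0 x y) (v *m A (row_mx x (lift_end 0 x y))).
Proof.
move=> xr yr.
have dF := is_derive_flow (pack 0 x y) (pack 0 v 0) tame_field.
rewrite flow_variation// row_mxKr in dF.
have lp : is_derive x v (fun x => pack 0 x y) (pack 0 v 0).
  apply: (@is_derive_row_mx _ _ _ _ _ (fun=> 0) (fun x => row_mx x y)).
  by apply: (@is_derive_row_mx _ _ _ _ _ id (fun=> y)).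
have df : differentiable (flow field) (pack 0 x y).
  exact: smooth_on_diff_mx openT (flow_smooth tame_field) I.
have := is_derive_comp_diff lp df; have [_ ->] := dF => dFp.
have := is_derive_linear_mx rsubmx (is_derive_linear_mx rsubmx dFp).
by rewrite /pack /= !row_mxKr.
Qed.

End Integrable.

(* The lifted lines straighten the graph distribution [dy = dx A] to the
   horizontal one, without moving the first block of coordinates. *)
Lemma frobenius_straightening (r0 : R) : 0 < r0 ->
  (forall z, `|z| <= r0 -> forall u v : 'rV[R]_k,
    u *m 'D_(row_mx v (v *m A z)) A z = v *m 'D_(row_mx u (u *m A z)) A z) ->
  exists Psi Psi' : 'rV[R]_(k + e) -> 'rV[R]_(k + e),
    [/\ smooth_on setT Psi, smooth_on setT Psi', cancel Psi Psi' & cancel Psi' Psi] /\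
    [/\ forall z, lsubmx (Psi z) = lsubmx z, Psi 0 = 0 &
      exists2 r, 0 < r & forall z, `|z| <= r -> forall v : 'rV[R]_k,
        'D_(row_mx v 0) Psi z = row_mx v (v *m A (Psi z))].
Proof.
move=> r00 intA.
pose G s (z : 'rV[R]_(k + e)) := row_mx (lsubmx z) (rsubmx (rsubmx (flow field
  (pack (if s then lsubmx z else 0) (if s then - lsubmx z else lsubmx z) (rsubmx z))))).
have sl : smooth_on setT (fun w : 'rV[R]_(k + e) => lsubmx w).
  by apply: (smooth_on_coord openT) => a u v; exact: linearP.
have sr : smooth_on setT (fun w : 'rV[R]_(k + e) => rsubmx w).
  by apply: (smooth_on_coord openT) => a u v; exact: linearP.
have srr := smooth_on_coord openT linrr.
have sG s : smooth_on setT (G s).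
  apply: (smooth_on_row_mx openT sl).
  apply: (smooth_on_comp openT openT srr); last by [].
  apply: (smooth_on_comp openT openT (flow_smooth tame_field)); last by [].
  apply: (smooth_on_row_mx openT).
    by case: s; [exact: sl|exact: smooth_on_cst openT].
  apply: (smooth_on_row_mx openT _ sr).
  by case: s; [exact: (smooth_on_mxN openT sl)|exact: sl].
exists (G false), (G true); split; split.
- exact: sG.
- exact: sG.
- move=> z; rewrite /G !row_mxKl !row_mxKr -[RHS]hsubmxK; congr row_mx.
  by have := lift_end_rev 0 (lsubmx z) (rsubmx z); rewrite add0r.
- move=> z; rewrite /G !row_mxKl !row_mxKr -[RHS]hsubmxK; congr row_mx.
  by have := lift_end_rev (lsubmx z) (- lsubmx z) (rsubmx z); rewrite subrr opprK.
- by move=> z; rewrite /G row_mxKl.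
- rewrite /G !linear0 -[RHS]row_mx0; congr row_mx; exact: lift_end0.
exists (r0 / (1 + K)); first by rewrite divr_gt0// ltr_pwDl.
move=> z; rewrite -{1}[z]hsubmxK norm_row_mx => /andP[].
rewrite !ler_pdivlMr ?ltr_pwDl// !mulrDr !mulr1 => xr yr v.
have Kx := mulr_ge0 (normr_ge0 (lsubmx z)) K0.
have Ky := mulr_ge0 (normr_ge0 (rsubmx z)) K0.
have x0 := normr_ge0 (lsubmx z).
have xr0 : `|lsubmx z| <= r0 by lra.
have yr0 : `|rsubmx z| + K * `|lsubmx z| <= r0.
  have [xy|/ltW yx] := leP `|lsubmx z| `|rsubmx z|.
    by apply: le_trans yr; rewrite lerD2l mulrC ler_wpM2r.
  by apply: le_trans xr; rewrite lerD// mulrC.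
have dG := @derive_lift_end r0 intA (lsubmx z) v (rsubmx z) xr0 yr0.
have [_ ->] : is_derive z (row_mx v 0) (G false) (row_mx v (v *m A (G false z))); last by [].
apply/is_derive1P.
have := is_derive_row_mx (is_derive_id (lsubmx z) v) dG => /is_derive1P.
rewrite (_ : (fun t => G false _) = (fun t : R => row_mx (t *: v + lsubmx z)
  (lift_end 0 (t *: v + lsubmx z) (rsubmx z))))//.
apply/funext => t; rewrite /G -[z in _ *: _ + z]hsubmxK scale_row_mx add_row_mx.
by rewrite !row_mxKl !row_mxKr scaler0 add0r.
Qed.

End Straightening.

(** * Bump functions *)

Section SmoothBump.
Context {R : realType}.

Let flat (k : nat) (t : R) : R := if 0 < t then (t^-1) ^+ k * expR (- t^-1) else 0.

Let expR_ge_pow n (x : R) : 0 <= x -> x ^+ n <= n%:R ^+ n * expR x.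
Proof.
case: n => [|n] x0; first by rewrite !expr0 mul1r -expR0 ler_expR.
have xy : x <= n.+1%:R * expR (x / n.+1%:R).
  rewrite mulrC -ler_pdivrMr ?ltr0n//; apply: le_trans (expR_ge1Dx _).
  by rewrite lerDr.
have -> : expR x = expR (x / n.+1%:R) ^+ n.+1.
  by rewrite -expRM_natl mulrC divfK// pnatr_eq0.
by rewrite -exprMn; apply: lerXn2r xy; rewrite nnegrE ?mulr_ge0 ?expR_ge0.
Qed.

Let flat_quadratic k t : `|flat k t| <= k.+2%:R ^+ k.+2 * t ^+ 2.
Proof.
have C0 : 0 <= k.+2%:R ^+ k.+2 :> R by rewrite exprn_ge0.
rewrite /flat; case: ifPn => t0; last by rewrite normr0 mulr_ge0// sqr_ge0.
have ti0 : 0 <= t^-1 by rewrite invr_ge0 ltW.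
rewrite ger0_norm ?mulr_ge0 ?exprn_ge0 ?expR_ge0//.
rewrite expRN ler_pdivrMr ?expR_gt0// mulrAC -ler_pdivrMr ?exprn_gt0//.
by rewrite -exprVn -exprD addn2; exact: expR_ge_pow.
Qed.

Let is_derive_flat k (t : R) :
  is_derive t (1 : R) (flat k : R -> R) (- k%:R * flat k.+1 t + flat k.+2 t).
Proof.
have [t0|t0|->] := ltgtP t 0.
- have fE : \near t, (fun=> 0 : R) t = flat k t.
    near=> s; have s0 : s < 0 by near: s; exact: lt_nbhsl.
    by rewrite /flat ltNge (ltW s0).
  apply: (near_eq_is_derive fE).
  have -> : - k%:R * flat k.+1 t + flat k.+2 t = 0.
    by rewrite /flat ltNge (ltW t0)/= mulr0 addr0.
  exact: is_derive_cst.
- have fE : \near t, (t^-1) ^+ k * expR (- t^-1) = flat k t.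
    near=> s; rewrite /flat ifT//; near: s; exact: lt_nbhsr.
  apply: (near_eq_is_derive fE).
  rewrite /flat t0; have tn0 : t != 0 by rewrite gt_eqF.
  have dV : is_derive t (1 : R) (fun s : R => s^-1) (- t ^- 2).
    by apply: (is_derive_eq (@is_deriveV R id t 1 1 tn0 (is_derive_id t 1))); exact: mulr1.
  have dk : is_derive t (1 : R) (fun s : R => (s^-1) ^+ k) (- k%:R * (t^-1) ^+ k.+1).
    have H := @is_deriveX _ _ (fun s : R => s^-1) k _ _ _ dV.
    rewrite [X in is_derive _ _ X _](_ : _ = (fun s : R => s^-1) ^+ k); last by apply/funext => s; rewrite fctE.
    apply: (is_derive_eq H).
    rewrite -[_ *: _]/(_ * _) -exprVn; case: k {fE H} => [|k]; first by rewrite !oppr0 !mul0r.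
    by rewrite /= !exprS; ring.
  have de : is_derive t (1 : R) (fun s : R => expR (- s^-1)) (t ^- 2 * expR (- t^-1)).
    have dN := is_deriveN dV.
    have := @is_derive1_comp R expR (fun s => - s^-1) t _ _ (is_derive_expR _) dN.
    by move=> H; apply: (is_derive_eq H); rewrite opprK mulrC.
  have H : is_derive t (1 : R) (fun s : R => (s^-1) ^+ k * expR (- s^-1)) _ :=
    @is_deriveM _ _ (fun s : R => (s^-1) ^+ k : R) (fun s => expR (- s^-1)) _ _ _ _ dk de.
  apply: (is_derive_eq H).
  rewrite -[_ *: _]/(_ * _) -[X in _ + X]/(_ * _) -exprVn !exprS; ring.
- have -> : - k%:R * flat k.+1 0 + flat k.+2 0 = 0 by rewrite /flat ltxx mulr0 addr0.
  apply: (@is_derive_quadratic _ _ _ _ _ _ _ (k.+2%:R ^+ k.+2)) => s _.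
  rewrite [s *: 1]mulr1 addr0 scaler0 subr0 (_ : flat k 0 = 0) ?subr0; last by rewrite /flat ltxx.
  exact: flat_quadratic.
Unshelve. all: by end_near. Qed.

Let flat_span : ('rV[R]_1 -> R) -> Prop := fun f => exists s : seq (R * nat),
  f = fun x => \sum_(p <- s) p.1 * flat p.2 (x 0 0).

Let smooth_flat : smooth_on setT (fun x : 'rV[R]_1 => flat 0 (x 0 0)).
Proof.
apply: (@smooth_on_coind _ _ _ _ flat_span openT); last first.
  by exists [:: (1, 0%N)]; apply/funext => x; rewrite big_seq1 mul1r.
move=> _ [s ->].
have d1 x i k : is_derive x (delta_mx 0 i : 'rV[R]_1) (fun x : 'rV[R]_1 => flat k (x 0 0))
    (- k%:R * flat k.+1 (x 0 0) + flat k.+2 (x 0 0)).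
  have dc : is_derive x (delta_mx 0 i : 'rV[R]_1) (fun x : 'rV[R]_1 => x 0 0) 1.
    have := (is_derive_mxP id x (delta_mx 0 i) (delta_mx 0 i)).1 (is_derive_id _ _) 0 0.
    by rewrite !ord1 mxE !eqxx.
  have [df <-] := is_derive_flat k (x 0 0).
  by apply: (is_derive_comp_diff dc); exact/derivable1_diffP.
have ds x i : is_derive x (delta_mx 0 i : 'rV[R]_1)
    (fun x : 'rV[R]_1 => \sum_(p <- s) p.1 * flat p.2 (x 0 0))
    (\sum_(p <- s) p.1 * (- p.2%:R * flat p.2.+1 (x 0 0) + flat p.2.+2 (x 0 0))).
  by apply: is_derive_big => p; exact: (is_deriveZ p.1 (d1 x i p.2)).
split=> [x _|i].
  have cE : {for x, continuous (fun x : 'rV[R]_1 => \sum_(p <- s) p.1 * flat p.2 (x 0 0))}.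
    apply: (@continuous_comp _ _ _ (fun x : 'rV[R]_1 => x 0 0)
      (fun t : R => \sum_(p <- s) p.1 * flat p.2 t)); first exact: coord_continuous.
    apply/differentiable_continuous/derivable1_diffP.
    have := @is_derive_big _ _ _ s (fun p t => p.1 * flat p.2 t)
      (fun p => p.1 * (- p.2%:R * flat p.2.+1 (x 0 0) + flat p.2.+2 (x 0 0))) (x 0 0) 1.
    by case=> // p; exact: (@is_deriveZ _ _ _ (flat p.2 : R -> R) p.1 _ _ _ (is_derive_flat p.2 (x 0 0))).
  exact: cE.
split=> [x _|]; first by have [] := ds x i.
exists (fun x => \sum_(p <- flatten [seq [:: (- p.2%:R * p.1, p.2.+1); (p.1, p.2.+2)] | p <- s])
  p.1 * flat p.2 (x 0 0)); first by eexists.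
move=> x _; have [_] := ds x i; rewrite /partial => ->.
rewrite big_flatten big_map; apply: eq_bigr => p _.
by rewrite big_cons big_seq1 /=; ring.
Qed.

Let smooth_flat_comp d (u : 'rV[R]_d -> R) : smooth_on setT u ->
  smooth_on setT (fun x => flat 0 (u x)).
Proof.
move=> su; pose h x : 'rV[R]_1 := \row__ u x.
have sh : smooth_on setT h.
  by apply: (smooth_on_mx openT) => i j; under eq_fun do rewrite mxE.
have := smooth_on_comp1 openT openT smooth_flat sh (fun _ _ => I).
by apply: (smooth_on_eq openT) => x _; rewrite /= mxE.
Qed.

Lemma smooth_bump d (x0 : 'rV[R]_d) (rho : R) : 0 < rho ->
  exists chi : 'rV[R]_d -> R, [/\ smooth_on setT chi,
    forall x, 0 <= chi x <= 1,
    forall x, `|x - x0| <= rho -> chi x = 1 &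
    forall x, chi x != 0 -> `|x - x0| <= 2 * rho].
Proof.
move=> rho0; pose u i (x : 'rV[R]_d) := 2 - ((x - x0) 0 i) ^+ 2 / rho ^+ 2.
have r20 : 0 < rho ^+ 2 by rewrite exprn_gt0.
have su i : smooth_on setT (u i).
  have sx : smooth_on setT (fun x : 'rV[R]_d => x - x0).
    apply: (smooth_on_mxD openT); last exact: smooth_on_cst openT.
    exact: (smooth_on_coord openT).
  have sxi := smooth_on_entry 0 i openT sx.
  apply: (smooth_onD openT); first exact: (smooth_on_cst _ openT).
  have := smooth_onM openT (smooth_on_cst (- (rho ^+ 2)^-1) openT) (smooth_onM openT sxi sxi).
  by apply: (smooth_on_eq openT) => x _; rewrite mulNr mulrC expr2.
have flat0 t : 0 <= flat 0 t.
  by rewrite /flat; case: ifP => // _; rewrite expr0 mul1r expR_ge0.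
have flat_pos t : 0 < t -> 0 < flat 0 t.
  by move=> t0; rewrite /flat t0 expr0 mul1r expR_gt0.
have den t : 0 < flat 0 t + flat 0 (1 - t).
  have [t0|t0] := ltP 0 t; first by rewrite ltr_pwDl// flat_pos.
  by rewrite ltr_wpDl// flat_pos// subr_gt0 (le_lt_trans t0).
pose st t := flat 0 t / (flat 0 t + flat 0 (1 - t)).
have sst i : smooth_on setT (fun x => st (u i x)).
  have s1 := smooth_flat_comp (su i).
  have s2 : smooth_on setT (fun x => flat 0 (1 - u i x)).
    apply: smooth_flat_comp; apply: (smooth_onD openT (smooth_on_cst (1 : R) openT)).
    have := smooth_onM openT (smooth_on_cst (-1 : R) openT) (su i).
    by apply: (smooth_on_eq openT) => x _; rewrite mulN1r.
  apply: (smooth_onM openT s1); apply: (smooth_onV openT (smooth_onD openT s1 s2)).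
  by move=> x _; rewrite gt_eqF.
have st01 t : 0 <= st t <= 1.
  by rewrite /st divr_ge0 ?(ltW (den _))//= ler_pdivrMr// mul1r lerDl.
exists (fun x => \prod_i st (u i x)); split.
- exact: (smooth_on_prod openT).
- move=> x; apply/andP; split; first by apply: prodr_ge0 => i _; have /andP[] := st01 (u i x).
  by apply: prodr_ile1 => i _; exact: st01.
- move=> x xr; apply: big1 => i _; rewrite /st.
  have u1 : 1 <= u i x.
    rewrite /u -subr_ge0 (_ : _ - _ = (rho ^+ 2 - (x - x0) 0 i ^+ 2) / rho ^+ 2).
      rewrite divr_ge0 ?subr_ge0 ?(ltW r20)// -(real_normK (num_real ((x - x0) 0 i))).
      by rewrite ler_sqr ?nnegrE ?(ltW rho0)//; exact: le_trans (mxnorm_coord _ _ _) xr.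
    by rewrite mulrBl divff ?gt_eqF//; ring.
  have -> : flat 0 (1 - u i x) = 0 by rewrite /flat ltNge subr_le0 u1.
  by rewrite addr0 divff// gt_eqF// flat_pos// (lt_le_trans ltr01).
- move=> x /prodf_neq0 chi0; apply: mxnorm_le => [|a i]; first by rewrite mulr_ge0 ?ltW.
  rewrite ord1; have := chi0 i isT; rewrite /st mulf_eq0 negb_or => /andP[f0 _].
  have ui0 : 0 < u i x by move: f0; rewrite /flat; case: ifP => //; rewrite eqxx.
  rewrite -ler_sqr ?nnegrE ?mulr_ge0 ?(ltW rho0)// real_normK ?num_real// exprMn.
  move: ui0; rewrite subr_gt0 ltr_pdivrMr// => /ltW /le_trans; apply.
  by rewrite ler_wpM2r ?(ltW r20)// expr2; lra.
Qed.

End SmoothBump.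

(** * Almost 3-contact structures on a vector space *)

Section PointwiseAlgebra.
Context {R : realType} {V : lmodType R}.

Definition cyclic3 (a b c : 'I_3) : Prop :=
  [\/ [/\ a = 0, b = 1 & c = 2%:R], [/\ a = 1, b = 2%:R & c = 0]
    | [/\ a = 2%:R, b = 0 & c = 1]].

Lemma cyclic3_rot a b c : cyclic3 a b c -> cyclic3 b c a.
Proof.
by case=> -[-> -> ->]; [apply: Or32|apply: Or33|apply: Or31]; split.
Qed.

Lemma cyclic3_ex a : exists b c, cyclic3 a b c.
Proof.
have [->|[->|->]] : a = 0 \/ a = 1 \/ a = 2%:R.
  by case: a => -[|[|[|//]]] i; [left|right; left|right; right]; apply/val_inj.
- by exists 1, 2%:R; apply: Or31.
- by exists 2%:R, 0; apply: Or32.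
- by exists 0, 1; apply: Or33.
Qed.

Variables (g : V -> V -> R) (phi : 'I_3 -> V -> V) (xi : 'I_3 -> V).
Let eta a v := g (xi a) v.

(* No unit condition is imposed on the [xi i]: with [xi = 0] these are the
   quaternionic Hermitian structures, so that both factors are covered. *)
Record contact3 : Prop := Contact3 {
  c3_linl : forall a u v w, g (a *: u + v) w = a * g u w + g v w;
  c3_sym : forall u v, g u v = g v u;
  c3_pos : forall u, u != 0 -> 0 < g u u;
  c3_lin : forall i, linear (phi i);
  c3_phi2 : forall i v, phi i (phi i v) = - v + eta i v *: xi i;
  c3_skew : forall i u v, g (phi i u) v = - g u (phi i v);
  c3_xi : forall a b c, cyclic3 a b c -> phi a (xi b) = xi c /\ phi b (xi a) = - xi c;
  c3_phi : forall a b c, cyclic3 a b c -> forall v,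
    phi a (phi b v) = phi c v + eta b v *: xi a /\
    phi b (phi a v) = - phi c v + eta a v *: xi b }.

Hypothesis C : contact3.

Lemma c3_Dl u v w : g (u + v) w = g u w + g v w.
Proof. by rewrite -{1}[u]scale1r (c3_linl C) mul1r. Qed.
Lemma c3_Dr u v w : g w (u + v) = g w u + g w v.
Proof. by rewrite (c3_sym C w) c3_Dl !(c3_sym C w). Qed.
Lemma c3_0l v : g 0 v = 0.
Proof. by apply: (addrI (g 0 v)); rewrite -c3_Dl !addr0. Qed.
Lemma c3_Zl a u w : g (a *: u) w = a * g u w.
Proof. by rewrite -[a *: u]addr0 (c3_linl C) c3_0l addr0. Qed.
Lemma c3_Zr a u w : g w (a *: u) = a * g w u.
Proof. by rewrite (c3_sym C) c3_Zl (c3_sym C). Qed.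
Lemma c3_Nl u w : g (- u) w = - g u w.
Proof. by rewrite -scaleN1r c3_Zl mulN1r. Qed.
Lemma c3_Nr u w : g w (- u) = - g w u.
Proof. by rewrite (c3_sym C) c3_Nl (c3_sym C). Qed.

Lemma c3_nondeg u v : (forall w, g u w = g v w) -> u = v.
Proof.
move=> uv; apply/eqP; rewrite -subr_eq0; apply/negPn/negP => /(c3_pos C).
by rewrite {1}c3_Dl c3_Nl uv subrr ltxx.
Qed.

Lemma c3_phiD i u v : phi i (u + v) = phi i u + phi i v.
Proof. by have := c3_lin C i 1 u v; rewrite !scale1r. Qed.
Lemma c3_phi0 i : phi i 0 = 0.
Proof. by apply: (addrI (phi i 0)); rewrite -c3_phiD !addr0. Qed.
Lemma c3_phiZ i a u : phi i (a *: u) = a *: phi i u.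
Proof. by have := c3_lin C i a u 0; rewrite c3_phi0 !addr0. Qed.
Lemma c3_phiN i u : phi i (- u) = - phi i u.
Proof. by rewrite -scaleN1r c3_phiZ scaleN1r. Qed.

Lemma c3_eta_phil a b c v : cyclic3 a b c -> eta b (phi a v) = - eta c v.
Proof.
by move=> /(c3_xi C) [E _]; rewrite /eta -[LHS]opprK -(c3_skew C) E.
Qed.

Lemma c3_eta_phir a b c v : cyclic3 a b c -> eta a (phi b v) = eta c v.
Proof.
by move=> /(c3_xi C) [_ E]; rewrite /eta -[LHS]opprK -(c3_skew C) E c3_Nl opprK.
Qed.

Hypothesis unit1 : forall i, g (xi i) (xi i) = 1.

Lemma c3_phi_xi i : phi i (xi i) = 0.
Proof.
have E : phi i (phi i (phi i (xi i))) = - phi i (xi i).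
  rewrite (c3_phi2 C i (phi i (xi i))) /eta -(opprK (g _ _)) -(c3_skew C).
  have -> : g (phi i (xi i)) (xi i) = 0.
    have := c3_skew C i (xi i) (xi i); rewrite (c3_sym C (xi i)) => /eqP.
    by rewrite -addr_eq0 -mulr2n mulrn_eq0 => /eqP.
  by rewrite oppr0 scale0r addr0.
move: E; rewrite (c3_phi2 C i (xi i)) /eta unit1 scale1r addNr c3_phi0.
by move/eqP; rewrite eq_sym oppr_eq0 => /eqP.
Qed.

Lemma c3_eta_phi i v : eta i (phi i v) = 0.
Proof. by rewrite /eta -[LHS]opprK -(c3_skew C) c3_phi_xi c3_0l oppr0. Qed.

Lemma c3_compat i u v : g (phi i u) (phi i v) = g u v - eta i u * eta i v.
Proof.
by rewrite (c3_skew C) (c3_phi2 C) c3_Dr c3_Nr c3_Zr /eta (c3_sym C u (xi i)); ring.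
Qed.

Lemma c3_xi_ortho a b c : cyclic3 a b c -> g (xi a) (xi b) = 0.
Proof.
move=> abc; have [_ E] := c3_xi C (cyclic3_rot (cyclic3_rot abc)).
by rewrite -[xi b]opprK -E c3_Nr -/(eta a _) c3_eta_phi oppr0.
Qed.

Section Projection.
Variables (T : 'I_3 -> V -> V) (h : R).
Hypothesis h0 : h != 0.
Hypothesis T_skew : forall i u v, g (T i u) v = - g u (T i v).
Hypothesis T_xi : forall i, T i (xi i) = 0.
Hypothesis T_xir : forall a b c, cyclic3 a b c ->
  T a (xi b) = h *: xi c /\ T a (xi c) = - (h *: xi b).
Hypothesis T_left : forall a b c, cyclic3 a b c -> forall v,
  T b v = - phi a (T c v) + (h * eta c v) *: xi a.
Hypothesis T_right : forall a b c, cyclic3 a b c -> forall v,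
  T b v = T c (phi a v) - (h * eta a v) *: xi c.
Hypothesis T_square : forall a b c, cyclic3 a b c -> forall v,
  T c (T c v) = h *: T a (phi a v) + (h ^+ 2 * eta c v) *: xi c
                - (h ^+ 2 * eta a v) *: xi a.

Let eta_T a v : eta a (T a v) = 0.
Proof. by rewrite /eta -[LHS]opprK -T_skew T_xi c3_0l oppr0. Qed.

Let eta_Tb a b c v : cyclic3 a b c -> eta b (T a v) = - (h * eta c v).
Proof.
by move=> /T_xir [E _]; rewrite /eta -[LHS]opprK -T_skew E c3_Zl.
Qed.

Let eta_Tc a b c v : cyclic3 a b c -> eta c (T a v) = h * eta b v.
Proof.
by move=> /T_xir [_ E]; rewrite /eta -[LHS]opprK -T_skew E c3_Nl c3_Zl opprK.
Qed.

Definition c3_proj v := h^-1 *: (- phi 0 (T 0 v) + (h * eta 0 v) *: xi 0).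
Let A v := - phi 0 (T 0 v) + (h * eta 0 v) *: xi 0.

Let cyc012 : cyclic3 0 1 2%:R. Proof. by apply: Or31. Qed.

Let T_A i v : T i v = phi i (A v).
Proof.
have E0 : T 0 v = phi 0 (A v).
  by rewrite /A c3_phiD c3_phiN c3_phiZ c3_phi_xi (c3_phi2 C) eta_T; rewrite scale0r addr0 opprK scaler0 addr0.
have E2 : T 2%:R v = - phi 1 (T 0 v) + (h * eta 0 v) *: xi 1.
  exact: T_left (cyclic3_rot cyc012) v.
have F2 : T 2%:R v = phi 2%:R (A v).
  have [E _] := c3_phi C (cyclic3_rot (cyclic3_rot cyc012)) (T 0 v).
  have [E' _] := c3_xi C (cyclic3_rot (cyclic3_rot cyc012)).
  by rewrite E2 /A c3_phiD c3_phiN c3_phiZ E E' eta_T scale0r addr0.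
have F1 : T 1 v = phi 1 (A v).
  have [_ E] := c3_phi C cyc012 (T 0 v); have [_ E'] := c3_xi C cyc012.
  have [E4 _] := c3_phi C cyc012 (T 0 v); have [E5 _] := c3_xi C cyc012.
  rewrite (T_left cyc012) E2 /A !c3_phiD !c3_phiN !c3_phiZ E E' E4 E5.
  rewrite eta_T (eta_Tb _ cyc012) scale0r addr0 !opprK scalerN opprD opprK.
  by rewrite scaleNr addrAC subrK.
have [->|[->|->]] // : i = 0 \/ i = 1 \/ i = 2%:R.
by case: i => -[|[|[|//]]] i; [left|right; left|right; right]; apply/val_inj.
Qed.

Let eta_A i v : eta i (A v) = h * eta i v.
Proof.
have EA x : eta x (A v) = - eta x (phi 0 (T 0 v)) + h * eta 0 v * eta x (xi 0).
  by rewrite /eta /A c3_Dr c3_Nr c3_Zr.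
have [->|[->|->]] : i = 0 \/ i = 1 \/ i = 2%:R.
  by case: i => -[|[|[|//]]] i; [left|right; left|right; right]; apply/val_inj.
- by rewrite EA c3_eta_phi oppr0 add0r /eta unit1 mulr1.
- rewrite EA (c3_eta_phil _ cyc012) opprK (eta_Tc _ cyc012) /eta (c3_sym C (xi 1) (xi 0)).
  by rewrite (c3_xi_ortho cyc012) mulr0 addr0.
- have cyc := cyclic3_rot (cyclic3_rot cyc012).
  by rewrite EA (c3_eta_phir _ cyc) (eta_Tb _ cyc012) opprK /eta (c3_xi_ortho cyc) mulr0 addr0.
Qed.

Let A_phi i v : A (phi i v) = phi i (A v).
Proof.
have [b [c abc]] := cyclic3_ex i.
have := congr1 (phi c) (T_right abc v); rewrite !T_A c3_phiD c3_phiN c3_phiZ c3_phi_xi.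
rewrite scaler0 subr0 (c3_phi2 C) eta_A (c3_eta_phir v (cyclic3_rot (cyclic3_rot abc))).
have [_ ->] := c3_phi C (cyclic3_rot abc) (A v).
by rewrite eta_A => /addIr /oppr_inj.
Qed.

Let A_sym u v : g (A u) v = g u (A v).
Proof.
rewrite {1}/A c3_Dl c3_Nl c3_Zl (c3_skew C) opprK T_skew T_A A_phi (c3_phi2 C) eta_A.
by rewrite c3_Dr c3_Nr c3_Zr /eta (c3_sym C u (xi 0)); ring.
Qed.

Let AZ a u : A (a *: u) = a *: A u.
Proof. by apply: c3_nondeg => w; rewrite A_sym !c3_Zl A_sym. Qed.

Let A2 v : A (A v) = h *: A v.
Proof.
have := T_square cyc012 v; rewrite !T_A !A_phi !(c3_phi2 C) !eta_A.
rewrite scalerDr scalerN scalerA expr2 -!mulrA addrAC addrK.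
by move=> /addIr /oppr_inj.
Qed.

Lemma c3_proj_idem v : c3_proj (c3_proj v) = c3_proj v.
Proof.
have PE u : c3_proj u = h^-1 *: A u by [].
by rewrite !PE AZ A2 !scalerA mulfVK.
Qed.

Lemma c3_proj_sym u v : g (c3_proj u) v = g u (c3_proj v).
Proof. by rewrite /c3_proj c3_Zl c3_Zr -!/(A _) A_sym. Qed.

Lemma c3_proj_phi i v : c3_proj (phi i v) = phi i (c3_proj v).
Proof. by rewrite /c3_proj c3_phiZ -!/(A _) A_phi. Qed.

Lemma c3_proj_xi i : c3_proj (xi i) = xi i.
Proof.
apply: c3_nondeg => w; rewrite c3_proj_sym /c3_proj c3_Zr -/(A w) -/(eta i (A w)) eta_A.
by rewrite mulKf.
Qed.

Lemma c3_proj_T i v : T i v = h *: phi i (c3_proj v).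
Proof. by rewrite T_A /c3_proj c3_phiZ scalerA divff// scale1r. Qed.

End Projection.
End PointwiseAlgebra.

Lemma c3_unique (R : realType) (V : lmodType R) (g g' : V -> V -> R)
    (phi phi' : 'I_3 -> V -> V) (xi xi' : 'I_3 -> V) :
  contact3 g phi xi -> contact3 g' phi' xi' ->
  (forall a v, g (xi a) v = g' (xi' a) v) ->
  (forall a u v, g u (phi a v) = g' u (phi' a v)) ->
  forall u v, g u v = g' u v.
Proof.
move=> C C' eE oE.
have cyc : cyclic3 0 1 2%:R by apply: Or31.
have phiE x : phi 0 x = phi' 0 x.
  apply/eqP; rewrite -subr_eq0; set z := _ - _.
  have z1 y : g z (phi 1 y) = 0.
    rewrite /z (c3_Dl C) (c3_Nl C) [X in _ - X]oE (c3_skew C) (c3_skew C').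
    have [-> _] := c3_phi C cyc y; have [-> _] := c3_phi C' cyc y.
    rewrite (c3_Dr C) (c3_Dr C') (c3_Zr C) (c3_Zr C') oE eE.
    by rewrite (c3_sym C x (xi 0)) (c3_sym C' x (xi' 0)) eE subrr.
  have phiz : phi 1 z = 0.
    by apply: (c3_nondeg C) => y; rewrite (c3_skew C) z1 (c3_0l C) oppr0.
  have etaz : g (xi 1) z = 0.
    rewrite /z (c3_Dr C) (c3_Nr C) (c3_eta_phil C _ cyc) 2!eE (c3_eta_phil C' _ cyc).
    by rewrite opprK addNr.
  have := c3_phi2 C 1 z; rewrite phiz (c3_phi0 C) etaz scale0r addr0.
  by move=> /eqP; rewrite eq_sym oppr_eq0.
move=> u v; have := oE 0 u (phi 0 v); rewrite (c3_phi2 C) (phiE v) (c3_phi2 C').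
rewrite (c3_Dr C) (c3_Dr C') (c3_Nr C) (c3_Nr C') (c3_Zr C) (c3_Zr C').
rewrite (c3_sym C u (xi 0)) (c3_sym C' u (xi' 0)) !eE.
by move=> /addIr /oppr_inj.
Qed.

(** * Vector fields and Lie derivatives in coordinates *)

Section LieCalculus.
Context {R : realType} {d : nat}.
Implicit Types (U : set 'rV[R]_d) (u v w : 'rV[R]_d).

Lemma smooth_is_derive U m n (F : 'rV[R]_d -> 'M[R]_(m, n)) u v :
  open U -> smooth_on U F -> U u -> is_derive u v F ('D_v F u).
Proof.
move=> oU sF Uu; have dF := smooth_on_diff_mx oU sF Uu.
by apply: DeriveDef; [exact: diff_derivable|].
Qed.

Lemma derive_congr U (W : normedModType R) (F G : 'rV[R]_d -> W) u v :
  open U -> U u -> (forall z, U z -> F z = G z) -> 'D_v F u = 'D_v G u.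
Proof. by move=> oU Uu FG; apply: near_eq_derive; exact: near_open FG. Qed.

Lemma derive_mulmx U m n p (F : 'rV[R]_d -> 'M[R]_(m, n))
    (G : 'rV[R]_d -> 'M[R]_(n, p)) u v :
  open U -> smooth_on U F -> smooth_on U G -> U u ->
  'D_v (fun z => F z *m G z) u = 'D_v F u *m G u + F u *m 'D_v G u.
Proof.
move=> oU sF sG Uu.
have [_ ->] := is_derive_mulmx (smooth_is_derive v oU sF Uu) (smooth_is_derive v oU sG Uu).
by [].
Qed.

Lemma derive_addmx U m n (F G : 'rV[R]_d -> 'M[R]_(m, n)) u v :
  open U -> smooth_on U F -> smooth_on U G -> U u ->
  'D_v (fun z => F z + G z) u = 'D_v F u + 'D_v G u.
Proof.
move=> oU sF sG Uu.
have [dF _] := smooth_is_derive v oU sF Uu; have [dG _] := smooth_is_derive v oU sG Uu.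
exact: (deriveD dF dG).
Qed.

Lemma derive_scalemx U m n (F : 'rV[R]_d -> 'M[R]_(m, n)) (a : R) u v :
  open U -> smooth_on U F -> U u ->
  'D_v (fun z => a *: F z) u = a *: 'D_v F u.
Proof.
move=> oU sF Uu; have [dF _] := smooth_is_derive v oU sF Uu.
exact: (deriveZ a dF).
Qed.

Lemma derive_oppmx U m n (F : 'rV[R]_d -> 'M[R]_(m, n)) u v :
  open U -> smooth_on U F -> U u -> 'D_v (fun z => - F z) u = - 'D_v F u.
Proof.
move=> oU sF Uu; have [dF _] := smooth_is_derive v oU sF Uu.
exact: (deriveN dF).
Qed.

Lemma derive_trmx U m n (F : 'rV[R]_d -> 'M[R]_(m, n)) u v :
  open U -> smooth_on U F -> U u -> 'D_v (fun z => (F z)^T) u = ('D_v F u)^T.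
Proof.
move=> oU sF Uu.
by have [_ ->] := is_derive_trmx (smooth_is_derive v oU sF Uu).
Qed.

Lemma derive_entry U m n (F : 'rV[R]_d -> 'M[R]_(m, n)) u v i j :
  open U -> smooth_on U F -> U u -> 'D_v (fun z => F z i j) u = ('D_v F u) i j.
Proof.
move=> oU sF Uu.
by have [_ ->] := (is_derive_mxP F u v _).1 (smooth_is_derive v oU sF Uu) i j.
Qed.

Lemma jacobianE U n (F : 'rV[R]_d -> 'rV[R]_n) u v :
  open U -> smooth_on U F -> U u -> 'D_v F u = v *m 'J F u.
Proof.
move=> oU sF Uu; apply: deriveEjacobian; exact: smooth_on_diff_mx oU sF Uu.
Qed.

Lemma smooth_on_jacobian U n (F : 'rV[R]_d -> 'rV[R]_n) :
  open U -> smooth_on U F -> smooth_on U (fun z => 'J F z).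
Proof.
move=> oU sF; apply: (smooth_on_mx oU) => i j.
apply: (@smooth_on_eq _ _ _ _ (fun z => ('D_(delta_mx 0 i) F z) 0 j) _ oU).
  by move=> z Uz; rewrite (jacobianE _ oU sF Uz) -rowE mxE.
exact: (smooth_on_entry 0 j oU (smooth_on_derive oU sF (smooth_on_cst _ oU))).
Qed.

Lemma derive2_sym U n (F : 'rV[R]_d -> 'rV[R]_n) u v w :
  open U -> smooth_on U F -> U u ->
  'D_v (fun z => 'D_w F z) u = 'D_w (fun z => 'D_v F z) u.
Proof.
move=> oU sF Uu; apply/rowP => k.
have sD w' : smooth_on U (fun z => 'D_w' F z).
  exact: (smooth_on_derive oU sF (smooth_on_cst _ oU)).
pose f (z : 'rV[R]_d) : R := F z 0 k; have sf : smooth_on U f := smooth_on_entry 0 k oU sF.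
have sp i : smooth_on U (partial i f).
  exact: (smooth_on_derive1 oU sf (smooth_on_cst _ oU)).
have E v' w' : ('D_v' (fun z => 'D_w' F z) u) 0 k =
    \sum_i \sum_j v' 0 i * w' 0 j * partial i (partial j f) u.
  rewrite -(derive_entry _ 0 k oU (sD w') Uu).
  have -> : 'D_v' (fun z => ('D_w' F z) 0 k) u =
      'D_v' (fun z => \sum_j w' 0 j * partial j f z) u.
    apply: (derive_congr _ oU Uu) => z Uz; rewrite -(derive_entry _ 0 k oU sF Uz).
    exact: (derive_sum_partial w' (smooth_on_diff oU sf Uz)).
  have dp j : is_derive u v' (fun z => w' 0 j * partial j f z)
      (w' 0 j * 'D_v' (partial j f) u).
    have dj : is_derive u v' (partial j f) ('D_v' (partial j f) u).
      by apply: DeriveDef => //; exact: diff_derivable (smooth_on_diff oU (sp j) Uu).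
    exact: (@is_deriveZ _ _ _ (partial j f) (w' 0 j) _ _ _ dj).
  have [_ ->] := is_derive_big (index_enum 'I_d) dp.
  rewrite exchange_big /=; apply: eq_bigr => j _.
  rewrite (derive_sum_partial _ (smooth_on_diff oU (sp j) Uu)) mulr_sumr.
  by apply: eq_bigr => i _; rewrite -[_ *: _]/(_ * _); ring.
apply: (etrans (E v w)); apply: (etrans _ (esym (E w v))).
rewrite exchange_big /=.
apply: eq_bigr => i _; apply: eq_bigr => j _.
suff P : partial j (partial i f) u = partial i (partial j f) u.
  exact: (congr2 (fun a b => a * b) (mulrC (v 0 j) (w 0 i)) P).
apply: (@partialC R d f u j i U oU Uu).
- by move=> i' y Uy; exact: smooth_on_derivable sf Uy.
- by move=> i' j' y Uy; exact: smooth_on_derivable (sp i') Uy.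
- move=> i' j'; apply: (smooth_on_continuous _ Uu).
  exact: (smooth_on_derive1 oU (sp i') (smooth_on_cst _ oU)).
Qed.

Definition lbr (X Y : 'rV[R]_d -> 'rV[R]_d) u : 'rV[R]_d :=
  'D_(X u) Y u - 'D_(Y u) X u.

Lemma derive_commutator U n (F : 'rV[R]_d -> 'rV[R]_n) X Y u :
  open U -> smooth_on U F -> smooth_on U X -> smooth_on U Y -> U u ->
  'D_(X u) (fun z => 'D_(Y z) F z) u - 'D_(Y u) (fun z => 'D_(X z) F z) u =
  'D_(lbr X Y u) F u.
Proof.
move=> oU sF sX sY Uu; have sJ := smooth_on_jacobian oU sF.
have E Z Z' : smooth_on U Z' -> 'D_(Z u) (fun z => 'D_(Z' z) F z) u =
    'D_(Z u) Z' u *m 'J F u + Z' u *m 'D_(Z u) (fun z => 'J F z) u.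
  move=> sZ'; rewrite -(derive_mulmx _ oU sZ' sJ Uu).
  by apply: (derive_congr _ oU Uu) => z Uz; exact: jacobianE oU sF Uz.
have C v w : w *m 'D_v (fun z => 'J F z) u = 'D_v (fun z => 'D_w F z) u.
  rewrite (E (fun=> v) (fun=> w) (smooth_on_cst _ oU)).
  by rewrite derive_cst mul0mx add0r.
have S : Y u *m 'D_(X u) (fun z => 'J F z) u = X u *m 'D_(Y u) (fun z => 'J F z) u.
  exact: etrans (C _ _) (etrans (derive2_sym (X u) (Y u) oU sF Uu) (esym (C _ _))).
apply: (etrans (congr2 (fun a b => a - b) (E X Y sY) (E Y X sX))).
rewrite S; apply: etrans (esym (jacobianE _ oU sF Uu)).
rewrite /lbr mulmxBl opprD; move: (_ *m _) (X u *m _) (_ *m _) => a b c.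
by rewrite addrACA subrr addr0.
Qed.

Lemma mx_bil_eq (m n : nat) (A B : 'M[R]_(m, n)) :
  (forall (v : 'rV_m) (w : 'rV_n), v *m A *m w^T = v *m B *m w^T) -> A = B.
Proof.
move=> AB; apply/matrixP => i j.
have := congr1 (fun M : 'M[R]_1 => M 0 0) (AB (delta_mx 0 i) (delta_mx 0 j)).
by rewrite -!rowE trmx_delta -!colE !mxE.
Qed.

Lemma mx_row_eq (m n : nat) (A B : 'M[R]_(m, n)) :
  (forall v : 'rV_m, v *m A = v *m B) -> A = B.
Proof. by move=> AB; apply/row_matrixP => i; rewrite !rowE. Qed.

(* The matrix of the exterior derivative of the one-form with coefficients [n]. *)
Definition curl (n : 'rV[R]_d -> 'rV[R]_d) u : 'M[R]_d :=
  2^-1 *: ('J n u - ('J n u)^T).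

Lemma smooth_on_curl U n : open U -> smooth_on U n -> smooth_on U (curl n).
Proof.
move=> oU sn; have sJ := smooth_on_jacobian oU sn.
apply: (smooth_on_mxZ oU (smooth_on_cst (2^-1 : R) oU)).
exact: (smooth_on_mxB oU sJ (smooth_on_trmx oU sJ)).
Qed.

Lemma curl_tr n u : (curl n u)^T = - curl n u.
Proof. by rewrite /curl linearZ/= linearB/= trmxK -scalerN opprB. Qed.

Lemma curl_congr U n n' u : open U -> U u -> (forall z, U z -> n z = n' z) ->
  smooth_on U n -> curl n u = curl n' u.
Proof.
move=> oU Uu nn' sn.
have sn' : smooth_on U n' := smooth_on_eq oU nn' sn.
suff E : 'J n u = 'J n' u by rewrite /curl E.
apply: mx_row_eq => v; apply: (etrans (esym (jacobianE v oU sn Uu))).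
apply: etrans (jacobianE v oU sn' Uu); exact: derive_congr oU Uu nn'.
Qed.

Lemma curlZ U n (a : R) u : open U -> U u -> smooth_on U n ->
  curl (fun z => a *: n z) u = a *: curl n u.
Proof.
move=> oU Uu sn.
have san : smooth_on U (fun z => a *: n z).
  exact: (smooth_on_mxZ oU (smooth_on_cst (a : R) oU) sn).
have -> : curl (fun z => a *: n z) u = 2^-1 *: ('J (fun z => a *: n z) u - ('J (fun z => a *: n z) u)^T) by [].
have -> : 'J (fun z => a *: n z) u = a *: 'J n u.
  apply: mx_row_eq => v; rewrite -(jacobianE _ oU san Uu) -scalemxAr -(jacobianE _ oU sn Uu).
  exact: derive_scalemx oU sn Uu.
by rewrite linearZ/= -scalerBr scalerA mulrC -scalerA.
Qed.

(* Lie derivatives of vector fields, one-forms, endomorphisms and bilinear forms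
   along a field with Jacobian [X] are obtained for the pairs [(0, X)],
   [(0, - X^T)], [(X, X)] and [(X, - X^T)]. *)
Definition Ld v u m n (A : 'M[R]_m) (B : 'M[R]_n) (F : 'rV[R]_d -> 'M[R]_(m, n)) :
  'M[R]_(m, n) := 'D_v F u + A *m F u - F u *m B.

Section Derivation.
Variables (U : set 'rV[R]_d) (u v : 'rV[R]_d).
Hypotheses (oU : open U) (Uu : U u).

Lemma Ld_mulmx m n p (A : 'M[R]_m) (B : 'M[R]_n) (C : 'M[R]_p) F G :
  smooth_on U F -> smooth_on U G ->
  Ld v u A C (fun z => F z *m G z) = Ld v u A B F *m G u + F u *m Ld v u B C G.
Proof.
move=> sF sG; rewrite /Ld (derive_mulmx v oU sF sG Uu).
rewrite !mulmxDl !mulmxDr !mulNmx !mulmxN !mulmxA.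
move: ('D_v F u *m G u) (F u *m 'D_v G u) (A *m F u *m G u) (F u *m G u *m C) (F u *m B *m G u) => a b c e f.
by apply/matrixP => i j; rewrite !mxE; ring.
Qed.

Lemma Ld_add m n (A : 'M[R]_m) (B : 'M[R]_n) F G :
  smooth_on U F -> smooth_on U G ->
  Ld v u A B (fun z => F z + G z) = Ld v u A B F + Ld v u A B G.
Proof.
move=> sF sG; rewrite /Ld (derive_addmx v oU sF sG Uu) mulmxDr mulmxDl.
move: ('D_v F u) ('D_v G u) (A *m F u) (A *m G u) (F u *m B) (G u *m B) => a b c e f h.
by apply/matrixP => i j; rewrite !mxE; ring.
Qed.

Lemma Ld_scale m n (A : 'M[R]_m) (B : 'M[R]_n) F (a : R) : smooth_on U F ->
  Ld v u A B (fun z => a *: F z) = a *: Ld v u A B F.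
Proof.
move=> sF; rewrite /Ld (derive_scalemx a v oU sF Uu) scalerBr scalerDr.
by rewrite scalemxAr scalemxAl.
Qed.

Lemma Ld_opp m n (A : 'M[R]_m) (B : 'M[R]_n) F : smooth_on U F ->
  Ld v u A B (fun z => - F z) = - Ld v u A B F.
Proof.
move=> sF; rewrite /Ld (derive_oppmx v oU sF Uu) mulmxN mulNmx.
by rewrite !opprD.
Qed.

Lemma Ld_sub m n (A : 'M[R]_m) (B : 'M[R]_n) F G :
  smooth_on U F -> smooth_on U G ->
  Ld v u A B (fun z => F z - G z) = Ld v u A B F - Ld v u A B G.
Proof.
by move=> sF sG; rewrite (Ld_add _ _ sF (smooth_on_mxN oU sG)) (Ld_opp _ _ sG).
Qed.

Lemma Ld_tr m n (A : 'M[R]_m) (B : 'M[R]_n) F : smooth_on U F ->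
  Ld v u (- B^T) (- A^T) (fun z => (F z)^T) = (Ld v u A B F)^T.
Proof.
move=> sF; rewrite /Ld (derive_trmx v oU sF Uu) !linearD/= mulmxN !trmx_mul.
have -> : (- (F u *m B))^T = - (B^T *m (F u)^T) by rewrite linearN/= trmx_mul.
by rewrite mulNmx opprK addrAC.
Qed.

Lemma Ld_congr m n (A : 'M[R]_m) (B : 'M[R]_n) F G :
  (forall z, U z -> F z = G z) -> Ld v u A B F = Ld v u A B G.
Proof. by move=> FG; rewrite /Ld (FG _ Uu) (derive_congr v oU Uu FG). Qed.

Lemma Ld_cst0 m n (A : 'M[R]_m) (B : 'M[R]_n) : Ld v u A B (fun=> 0) = 0.
Proof. by rewrite /Ld derive_cst mulmx0 mul0mx subr0 addr0. Qed.

End Derivation.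

Lemma Ld_curl U xi n u : open U -> U u -> smooth_on U xi -> smooth_on U n ->
  Ld (xi u) u ('J xi u) (- ('J xi u)^T) (curl n) =
  curl (fun z => Ld (xi z) z (0 : 'M[R]_1) (- ('J xi z)^T) n) u.
Proof.
move=> oU Uu sxi sn.
pose X := 'J xi u; pose N := 'J n u; pose DN := 'D_(xi u) (fun z => 'J n z) u.
have sJ := smooth_on_jacobian oU sxi; have sJn := smooth_on_jacobian oU sn.
have sJT := smooth_on_trmx oU sJ.
pose th z := 'D_(xi z) n z + n z *m ('J xi z)^T.
have s1 := smooth_on_derive oU sn sxi.
have s2 := smooth_on_mulmx oU sn sJT.
have sth : smooth_on U th := smooth_on_mxD oU s1 s2.
have -> : curl (fun z => Ld (xi z) z (0 : 'M[R]_1) (- ('J xi z)^T) n) u = curl th u.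
  have thE z : U z -> th z = Ld (xi z) z (0 : 'M[R]_1) (- ('J xi z)^T) n.
    by move=> _; rewrite /Ld mul0mx addr0 mulmxN opprK.
  by rewrite -(curl_congr oU Uu thE sth).
have D_cst w z F : smooth_on U F -> U z ->
    'D_w (fun z => F z) z = w *m 'J F z :> 'rV[R]_d := fun sF Uz => jacobianE w oU sF Uz.
have thJ v : v *m 'J th u = v *m (DN + X *m N + N *m X^T) +
    n u *m ('D_v (fun z => 'J xi z) u)^T.
  rewrite -(jacobianE v oU sth Uu) (derive_addmx v oU s1 s2 Uu).
  rewrite (derive_mulmx v oU sn sJT Uu) (derive_trmx v oU sJ Uu) (jacobianE v oU sn Uu).
  have -> : 'D_v (fun z => 'D_(xi z) n z) u = v *m DN + v *m X *m N.
    have := @derive_commutator U d n (fun=> v) xi u oU sn (smooth_on_cst _ oU) sxi Uu.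
    rewrite /lbr derive_cst subr0 (jacobianE v oU sxi Uu) (jacobianE _ oU sn Uu) => /eqP.
    rewrite subr_eq addrC => /eqP ->; congr (_ + _).
    have -> : 'D_(xi u) (fun z => 'D_v n z) u = 'D_(xi u) (fun z => v *m 'J n z) u.
      by apply: (derive_congr _ oU Uu) => z Uz; exact: jacobianE oU sn Uz.
    by rewrite (derive_mulmx _ oU (smooth_on_cst v oU) sJn Uu) derive_cst mul0mx add0r.
  by rewrite !mulmxDr !mulmxA !addrA.
have sym v w : n u *m ('D_v (fun z => 'J xi z) u)^T *m w^T =
               n u *m ('D_w (fun z => 'J xi z) u)^T *m v^T.
  have E v' w' : w' *m 'D_v' (fun z => 'J xi z) u = 'D_v' (fun z => 'D_w' xi z) u.
    have -> : 'D_v' (fun z => 'D_w' xi z) u = 'D_v' (fun z => w' *m 'J xi z) u.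
      by apply: (derive_congr _ oU Uu) => z Uz; exact: jacobianE oU sxi Uz.
    by rewrite (derive_mulmx _ oU (smooth_on_cst w' oU) sJ Uu) derive_cst mul0mx add0r.
  have H (M : 'M[R]_d) (x : 'rV_d) : n u *m M^T *m x^T = n u *m (x *m M)^T.
    by rewrite -mulmxA -trmx_mul.
  apply: (etrans (H _ _)); apply: etrans (esym (H _ _)); apply: (congr1 (fun x => n u *m x^T)).
  exact: etrans (E v w) (etrans (derive2_sym v w oU sxi Uu) (esym (E w v))).
have tr1 (a : 'M[R]_1) : a^T = a by apply/matrixP => i j; rewrite mxE !ord1.
apply: mx_bil_eq => v w.
have DC : 'D_(xi u) (curl n) u = 2^-1 *: (DN - DN^T).
  have s3 := smooth_on_trmx oU sJn.
  rewrite [LHS](derive_scalemx _ _ oU (smooth_on_mxB oU sJn s3) Uu).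
  rewrite (derive_addmx _ oU sJn (smooth_on_mxN oU s3) Uu) (derive_oppmx _ oU s3 Uu).
  by rewrite (derive_trmx _ oU sJn Uu).
have curlE : curl th u = 2^-1 *: ('J th u - ('J th u)^T) := erefl.
have curlnE : curl n u = 2^-1 *: (N - N^T) := erefl.
rewrite /Ld DC curlE curlnE -/X mulmxN opprK -!scalemxAr -scalemxAl -!scalerDr.
rewrite -!scalemxAr -!scalemxAl; congr (_ *: _).
have trB (M : 'M[R]_d) : v *m (M - M^T) *m w^T = v *m M *m w^T - w *m M *m v^T.
  by rewrite mulmxBr mulmxBl; congr (_ - _); rewrite -[RHS]tr1 !trmx_mul trmxK mulmxA.
have BB (D x M : 'M[R]_d) : D - D^T + x *m (M - M^T) + (M - M^T) *m x^T =
    (D + x *m M + M *m x^T) - (D + x *m M + M *m x^T)^T.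
  rewrite mulmxBr mulmxBl !linearD/= !trmx_mul trmxK.
  move: (x *m M) (M *m x^T) (x *m M^T) (M^T *m x^T) => a b c e.
  by apply/matrixP => i j; rewrite !mxE; ring.
rewrite (BB DN X N) !trB; move: (DN + _ + _) thJ sym => B thJ sym.
have [e thJ' sym'] : exists2 e : 'rV[R]_d -> 'rV[R]_d,
    forall v, v *m 'J th u = v *m B + e v & forall v w, e v *m w^T = e w *m v^T.
  by exists (fun v => n u *m ('D_v (fun z => 'J xi z) u)^T).
move: ('J th u) thJ' => K thJ'; rewrite !thJ' !mulmxDl (sym' v w).
by rewrite opprD addrACA subrr addr0.
Qed.

End LieCalculus.

(** * The projection of a 3-quasi-Sasakian structure *)

Section EuclideanForms.
Context {R : realType} {d : nat}.
Implicit Types (U W : set 'rV[R]_d) (u v w : 'rV[R]_d).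
Implicit Types (X Y Z xi n : 'rV[R]_d -> 'rV[R]_d).

Definition bil (G : 'M[R]_d) v w : R := (v *m G *m w^T) 0 0.

Definition nijE (phi : 'rV[R]_d -> 'M[R]_d) X Y u : 'rV[R]_d :=
  let phiX z := X z *m phi z in let phiY z := Y z *m phi z in
  lbr X Y u *m phi u *m phi u + lbr phiX phiY u
  - lbr phiX Y u *m phi u - lbr X phiY u *m phi u.

Definition d1E (a : 'rV[R]_d -> 'rV[R]_d -> R) X Y u : R :=
  2^-1 * ('D_(X u) (fun z => a z (Y z)) u - 'D_(Y u) (fun z => a z (X z)) u
          - a u (lbr X Y u)).

Definition d2E (a : 'rV[R]_d -> 'rV[R]_d -> 'rV[R]_d -> R) X Y Z u : R :=
  3^-1 * ('D_(X u) (fun z => a z (Y z) (Z z)) u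
          + 'D_(Y u) (fun z => a z (Z z) (X z)) u
          + 'D_(Z u) (fun z => a z (X z) (Y z)) u
          - a u (lbr X Y u) (Z u) - a u (lbr Y Z u) (X u) - a u (lbr Z X u) (Y u)).

Definition pairing (n v : 'rV[R]_d) : R := (n *m v^T) 0 0.

Lemma tr11 (a : 'M[R]_1) : a^T = a.
Proof. by apply/matrixP => i j; rewrite mxE !ord1. Qed.

Lemma bilC G v w : bil G v w = bil G^T w v.
Proof. by rewrite /bil -[v *m G *m w^T]tr11 !trmx_mul trmxK mulmxA. Qed.

Lemma bil_eq (A B : 'M[R]_d) : (forall v w, bil A v w = bil B v w) -> A = B.
Proof.
move=> AB; apply: mx_bil_eq => v w; apply/matrixP => i j; rewrite !ord1.
exact: AB.
Qed.

Lemma bilDl G v v' w : bil G (v + v') w = bil G v w + bil G v' w.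
Proof. by rewrite /bil !mulmxDl mxE. Qed.
Lemma bilDr G v w w' : bil G v (w + w') = bil G v w + bil G v w'.
Proof. by rewrite bilC bilDl -!(bilC G). Qed.
Lemma bilNl G v w : bil G (- v) w = - bil G v w.
Proof. by rewrite /bil !mulNmx mxE. Qed.
Lemma bilNr G v w : bil G v (- w) = - bil G v w.
Proof. by rewrite bilC bilNl -(bilC G). Qed.
Lemma bilZl G a v w : bil G (a *: v) w = a * bil G v w.
Proof. by rewrite /bil -!scalemxAl mxE. Qed.
Lemma bilZr G a v w : bil G v (a *: w) = a * bil G v w.
Proof. by rewrite bilC bilZl -(bilC G). Qed.
Lemma bil0l G w : bil G 0 w = 0.
Proof. by rewrite /bil !mul0mx mxE. Qed.
Lemma bil0r G w : bil G w 0 = 0.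
Proof. by rewrite bilC bil0l. Qed.
Lemma bilM G M v w : bil (M *m G) v w = bil G (v *m M) w.
Proof. by rewrite /bil !mulmxA. Qed.
Lemma bilMT G M v w : bil (G *m M^T) v w = bil G v (w *m M).
Proof. by rewrite /bil trmx_mul !mulmxA. Qed.

Lemma bilD A B v w : bil (A + B) v w = bil A v w + bil B v w.
Proof. by rewrite /bil mulmxDr mulmxDl mxE. Qed.

Lemma bilZ a A v w : bil (a *: A) v w = a * bil A v w.
Proof. by rewrite /bil -scalemxAr -scalemxAl mxE. Qed.

Lemma mulmx_trC v w : v *m w^T = w *m v^T.
Proof. by rewrite -[LHS]tr11 trmx_mul trmxK. Qed.

Lemma bil_asym M v w : bil (M - M^T) v w = pairing (v *m M) w - pairing (w *m M) v.
Proof.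
have -> : pairing (w *m M) v = bil M^T v w by rewrite bilC trmxK.
by rewrite bilD; congr (_ + _); rewrite /bil mulmxN mulNmx mxE.
Qed.

Lemma derive_bil U (G : 'rV[R]_d -> 'M[R]_d) X Y u v :
  open U -> smooth_on U G -> smooth_on U X -> smooth_on U Y -> U u ->
  'D_v (fun z => bil (G z) (X z) (Y z)) u =
  bil ('D_v G u) (X u) (Y u) + bil (G u) ('D_v X u) (Y u) + bil (G u) (X u) ('D_v Y u).
Proof.
move=> oU sG sX sY Uu; have sYT := smooth_on_trmx oU sY; have sXG := smooth_on_mulmx oU sX sG.
apply: (etrans (derive_entry v 0 0 oU (smooth_on_mulmx oU sXG sYT) Uu)).
rewrite (derive_mulmx v oU sXG sYT Uu) (derive_mulmx v oU sX sG Uu) (derive_trmx v oU sY Uu).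
rewrite /bil; move: ('D_v X u) ('D_v G u) ('D_v Y u) => dX dG dY.
by rewrite mulmxDl !mxE; congr (_ + _); exact: addrC.
Qed.

Lemma derive_pairing U n X u v :
  open U -> smooth_on U n -> smooth_on U X -> U u ->
  'D_v (fun z => pairing (n z) (X z)) u =
  pairing ('D_v n u) (X u) + pairing (n u) ('D_v X u).
Proof.
move=> oU sn sX Uu; have sXT := smooth_on_trmx oU sX.
apply: (etrans (derive_entry v 0 0 oU (smooth_on_mulmx oU sn sXT) Uu)).
rewrite (derive_mulmx v oU sn sXT Uu) (derive_trmx v oU sX Uu).
by move: ('D_v X u) ('D_v n u) => a b; rewrite mxE.
Qed.

Lemma pairingE (n v : 'rV[R]_d) : pairing n v = (v *m n^T) 0 0.
Proof. by rewrite /pairing -[n *m v^T]tr11 trmx_mul trmxK. Qed.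

Lemma mulmx_pairing (n v w : 'rV[R]_d) : v *m (n^T *m w) = pairing n v *: w.
Proof. by rewrite mulmxA [v *m n^T]mx11_scalar mul_scalar_mx -pairingE. Qed.

Lemma bil_pairing G v w : bil G v w = pairing (v *m G) w.
Proof. by []. Qed.

Lemma d1E_curl U n X Y u : open U -> smooth_on U n -> smooth_on U X ->
  smooth_on U Y -> U u ->
  d1E (fun z v => pairing (n z) v) X Y u = bil (curl n u) (X u) (Y u).
Proof.
move=> oU sn sX sY Uu.
have E (J : 'M[R]_d) (x y a b m : 'rV[R]_d) :
    2^-1 * (pairing (x *m J) y + pairing m a - (pairing (y *m J) x + pairing m b)
      - pairing m (a - b)) = bil (2^-1 *: (J - J^T)) x y.
  rewrite /bil -scalemxAr -scalemxAl mxE; congr (_ * _).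
  rewrite mulmxBr mulmxBl.
  have -> : x *m J^T *m y^T = y *m J *m x^T by rewrite -[RHS]tr11 !trmx_mul trmxK mulmxA.
  by rewrite /pairing linearB/= mulmxBr !mxE; ring.
rewrite /d1E (derive_pairing _ oU sn sY Uu) (derive_pairing _ oU sn sX Uu).
rewrite (jacobianE _ oU sn Uu) (jacobianE _ oU sn Uu).
exact: E.
Qed.

Lemma jacobian_cst v u : 'J (fun=> v) u = 0 :> 'M[R]_d.
Proof.
apply: mx_row_eq => x; rewrite mulmx0.
apply: (etrans (esym (jacobianE x openT (smooth_on_cst v openT) I))); exact: derive_cst.
Qed.

Lemma curl0 u : curl (fun=> 0) u = 0 :> 'M[R]_d.
Proof. by rewrite /curl jacobian_cst trmx0 subrr scaler0. Qed.

Lemma lbr_cst U X v u : open U -> smooth_on U X -> U u ->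
  lbr X (fun=> v) u = - (v *m 'J X u).
Proof.
by move=> oU sX Uu; rewrite /lbr derive_cst sub0r (jacobianE v oU sX Uu).
Qed.

Lemma lbr_cstl U X v u : open U -> smooth_on U X -> U u ->
  lbr (fun=> v) X u = v *m 'J X u.
Proof.
by move=> oU sX Uu; rewrite /lbr derive_cst subr0 (jacobianE v oU sX Uu).
Qed.

(* Cartan's formula for the Lie derivative of a closed two-form. *)
Lemma Ld_closed U xi (F : 'rV[R]_d -> 'M[R]_d) u :
  open U -> U u -> smooth_on U xi -> smooth_on U F -> (forall z, U z -> (F z)^T = - F z) ->
  (forall v w, d2E (fun z => bil (F z)) xi (fun=> v) (fun=> w) u = 0) ->
  Ld (xi u) u ('J xi u) (- ('J xi u)^T) F = 2 *: curl (fun z => xi z *m F z) u.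
Proof.
move=> oU Uu sxi sF skF dF; apply: bil_eq => v w.
have sc v := smooth_on_cst (v : 'rV[R]_d) oU.
have sm := smooth_on_mulmx oU sxi sF.
move: (dF v w); rewrite /d2E (lbr_cst v oU sxi Uu) (lbr_cstl w oU sxi Uu).
rewrite (lbr_cst w oU (sc v) Uu).
rewrite (derive_bil _ oU sF (sc v) (sc w) Uu) !derive_cst.
have -> : 'D_v (fun z => bil (F z) w (xi z)) u = - pairing (v *m 'J (fun z => xi z *m F z) u) w.
  rewrite -(jacobianE v oU sm Uu).
  have H : 'D_v (fun z => pairing (xi z *m F z) w) u = _ := derive_pairing v oU sm (sc w) Uu.
  rewrite derive_cst [pairing _ 0]/pairing trmx0 mulmx0 mxE addr0 in H; rewrite -H.
  have dP : derivable (fun z => pairing (xi z *m F z) w) u v.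
    apply: diff_derivable; apply: (smooth_on_diff oU _ Uu).
    exact: (smooth_on_entry 0 0 oU (smooth_on_mulmx oU sm (smooth_on_cst (w^T : 'cV[R]_d) oU))).
  apply: etrans (deriveN dP); apply: (derive_congr v oU Uu) => z Uz.
  by rewrite bilC (skF _ Uz) /bil mulmxN mulNmx mxE.
have -> : 'D_w (fun z => bil (F z) (xi z) v) u = pairing (w *m 'J (fun z => xi z *m F z) u) v.
  rewrite -(jacobianE w oU sm Uu); apply: (etrans (derive_pairing w oU sm (sc v) Uu)).
  by rewrite derive_cst [pairing _ 0]/pairing trmx0 mulmx0 mxE addr0.
rewrite jacobian_cst.
rewrite /Ld /curl scalerA divff ?pnatr_eq0// scale1r mulmxN opprK mulmx0 oppr0.
rewrite !bil0l bil0r !addr0 subr0 bilNl opprK.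
have K (A B C D : R) : 3^-1 * (A + - B + C + D - bil (F u) (w *m 'J xi u) v) = 0 ->
   A + D + bil (F u) v (w *m 'J xi u) = B - C.
  rewrite bilC (skF _ Uu) [bil (- _) _ _]/bil mulmxN mulNmx mxE -/(bil _ _ _).
  by move=> /eqP; rewrite mulf_eq0 invr_eq0 pnatr_eq0/= => /eqP; lra.
move/K; move: ('D_(xi u) F u) ('J xi u) ('J (fun z => xi z *m F z) u) => D X M H.
by rewrite bil_asym -H !bilD bilM bilMT.
Qed.

Record contact_data U (g : 'rV[R]_d -> 'M[R]_d) (phi : 'I_3 -> 'rV[R]_d -> 'M[R]_d)
    (xi : 'I_3 -> 'rV[R]_d -> 'rV[R]_d) : Prop := ContactData {
  cd_g : smooth_on U g;
  cd_phi : forall i, smooth_on U (phi i);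
  cd_xi : forall i, smooth_on U (xi i);
  cd_contact : forall u, U u -> contact3 (bil (g u)) (fun i v => v *m phi i u) (xi^~ u);
  cd_unit : forall u i, U u -> bil (g u) (xi i u) (xi i u) = 1;
  cd_normal : forall i W X Y u, open W -> W `<=` U -> W u ->
    smooth_on W X -> smooth_on W Y ->
    nijE (phi i) X Y u
    + (2 * d1E (fun z v => pairing (xi i z *m g z) v) X Y u) *: xi i u = 0;
  cd_closed : forall i W X Y Z u, open W -> W `<=` U -> W u ->
    smooth_on W X -> smooth_on W Y -> smooth_on W Z ->
    d2E (fun z v w => bil (g z) v (w *m phi i z)) X Y Z u = 0 }.

End EuclideanForms.

Section ContactMatrices.
Context {R : realType} {d : nat}.
Variables (G : 'M[R]_d) (phi : 'I_3 -> 'M[R]_d) (xi : 'I_3 -> 'rV[R]_d).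
Hypothesis C : contact3 (bil G) (fun i v => v *m phi i) xi.
Hypothesis unit1 : forall i, bil G (xi i) (xi i) = 1.
Let n i := xi i *m G.

Lemma cm_sym : G^T = G.
Proof. by apply: bil_eq => v w; rewrite -bilC (c3_sym C). Qed.

Lemma cm_unitmx : G \in unitmx.
Proof.
rewrite -row_free_unit; apply: inj_row_free => v vG.
apply: (c3_nondeg C) => w; by rewrite /bil vG !mul0mx.
Qed.

Lemma cm_skew i : phi i *m G = - (G *m (phi i)^T).
Proof.
apply: bil_eq => v w; rewrite bilM (c3_skew C) -bilMT.
by rewrite /bil mulmxN mulNmx [RHS]mxE.
Qed.

Lemma cm_phi2 i : phi i *m phi i = - 1%:M + (n i)^T *m xi i.
Proof.
apply: mx_row_eq => v; rewrite mulmxA (c3_phi2 C) mulmxDr mulmxN mulmx1.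
by rewrite mulmx_pairing.
Qed.

Lemma cm_nxi i : n i *m (xi i)^T = 1%:M.
Proof. by rewrite [LHS]mx11_scalar; congr (_%:M); exact: unit1. Qed.

Lemma cm_xin i : xi i *m (n i)^T = 1%:M.
Proof. by rewrite -[LHS]tr11 trmx_mul trmxK cm_nxi. Qed.

Lemma cm_xi_phi i : xi i *m phi i = 0.
Proof. exact: c3_phi_xi C unit1 i. Qed.

Lemma cm_phi_n i : phi i *m (n i)^T = 0.
Proof.
by rewrite trmx_mul cm_sym mulmxA cm_skew mulNmx -mulmxA -trmx_mul cm_xi_phi trmx0 mulmx0 oppr0.
Qed.

Lemma cm_xi a b c : cyclic3 a b c -> xi b *m phi a = xi c /\ xi a *m phi b = - xi c.
Proof. exact: (c3_xi C). Qed.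

Lemma cm_phi a b c : cyclic3 a b c ->
  phi c = phi b *m phi a - (n b)^T *m xi a /\
  phi c = - (phi a *m phi b) + (n a)^T *m xi b.
Proof.
move=> abc; split; apply: mx_row_eq => v; have [E F] := c3_phi C abc v.
  by rewrite mulmxBr mulmxA E mulmx_pairing addrK.
by rewrite mulmxDr mulmxN mulmx_pairing (mulmxA v) F opprD opprK subrK.
Qed.

Lemma cm_ortho a b c : cyclic3 a b c -> n a *m (xi b)^T = 0 /\ n b *m (xi a)^T = 0.
Proof.
move=> abc; have E := c3_xi_ortho C unit1 abc.
have Z (M : 'M[R]_1) : M 0 0 = 0 -> M = 0.
  by move=> M0; apply/matrixP => i j; rewrite !ord1 mxE.
by split; apply: Z; [exact: E|rewrite -[LHS]/(bil G (xi b) (xi a)) (c3_sym C)].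
Qed.

End ContactMatrices.

Section QuasiSasakian.
Context {R : realType} {d : nat}.
Variables (U : set 'rV[R]_d) (g : 'rV[R]_d -> 'M[R]_d).
Variables (phi : 'I_3 -> 'rV[R]_d -> 'M[R]_d) (xi : 'I_3 -> 'rV[R]_d -> 'rV[R]_d).
Variable c : R.
Hypothesis oU : open U.
Hypothesis S : contact_data U g phi xi.
Hypothesis c0 : c != 0.
Hypothesis xi_lbr : forall a b e, cyclic3 a b e -> forall u, U u ->
  lbr (xi a) (xi b) u = c *: xi e u.
Let n i z := xi i z *m g z.
Let h := c / 2.

Let sg := cd_g S.
Let sphi := cd_phi S.
Let sxi := cd_xi S.
Let sn i : smooth_on U (n i). Proof. exact: (smooth_on_mulmx oU (sxi i) sg). Qed.
Let sJ i := smooth_on_jacobian oU (sxi i).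

Let T i z := - (curl (n i) z *m invmx (g z)).

Let omegaE i u : U u -> curl (n i) u = g u *m (T i u)^T.
Proof.
move=> Uu; have C := cd_contact S Uu.
rewrite /T linearN/= trmx_mul trmx_inv (cm_sym C) mulmxN mulKVmx.
  by rewrite curl_tr opprK.
exact: cm_unitmx C.
Qed.

Section AtPoint.
Variable u : 'rV[R]_d.
Hypothesis Uu : U u.
Let X i := 'J (xi i) u.
Let LE i := Ld (xi i u) u (X i) (X i).
Let LV i := Ld (xi i u) u (0 : 'M[R]_1) (X i).
Let LC i := Ld (xi i u) u (0 : 'M[R]_1) (- (X i)^T).
Let LB i := Ld (xi i u) u (X i) (- (X i)^T).
Let C z (Uz : U z) := cd_contact S Uz.
Let unit1 z (Uz : U z) i := cd_unit S i Uz.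

Let LC_curl i j : (exists a : 'M[R]_1, forall z, U z -> n j z *m (xi i z)^T = a) ->
  LC i (n j) = 2 *: (xi i u *m curl (n j) u).
Proof.
move=> [a na]; have sT := smooth_on_trmx oU (sxi i).
have E v : v *m 'J (n j) u *m (xi i u)^T = - (n j u *m (v *m X i)^T).
  apply/eqP; rewrite -addr_eq0; apply/eqP.
  have H := derive_mulmx v oU (sn j) sT Uu.
  have D0 : 'D_v (fun z => n j z *m (xi i z)^T) u = 0.
    apply: (etrans (derive_congr v oU Uu na)); exact: derive_cst.
  move: H; rewrite D0 (derive_trmx v oU (sxi i) Uu) (jacobianE v oU (sn j) Uu).
  by rewrite (jacobianE v oU (sxi i) Uu).
have F : 'J (n j) u *m (xi i u)^T = - (X i *m (n j u)^T).
  apply: mx_row_eq => v; rewrite mulmxA E mulmxN; congr (- _).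
  exact: etrans (mulmx_trC _ _) (esym (mulmxA _ _ _)).
rewrite /LC /Ld mul0mx addr0 mulmxN opprK (jacobianE _ oU (sn j) Uu).
have -> : curl (n j) u = 2^-1 *: ('J (n j) u - ('J (n j) u)^T) := erefl.
move: ('J (n j) u) F => J F.
rewrite -scalemxAr scalerA divff ?pnatr_eq0// scale1r mulmxBr; congr (_ + _).
have -> : xi i u *m J^T = (J *m (xi i u)^T)^T by rewrite trmx_mul trmxK.
by rewrite F linearN/= trmx_mul trmxK opprK.
Qed.

Let LC_cst i j (b : R) : (forall z, U z -> n j z *m (xi i z)^T = b%:M) ->
  LC i (n j) = 2 *: (xi i u *m curl (n j) u).
Proof. by move=> E; apply: LC_curl; exists b%:M. Qed.

Let LV_xi a b e : cyclic3 a b e -> LV a (xi b) = c *: xi e u /\ LV a (xi e) = - (c *: xi b u).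
Proof.
have LVE i j : LV i (xi j) = lbr (xi i) (xi j) u.
  by rewrite /LV /Ld mul0mx addr0 /lbr; congr (_ - _); rewrite (jacobianE _ oU (sxi i) Uu).
move=> abe; split; first by rewrite LVE (xi_lbr abe Uu).
have lbrC Z Y : lbr Z Y u = - lbr Y Z u by rewrite /lbr opprB.
by rewrite LVE lbrC (xi_lbr (cyclic3_rot (cyclic3_rot abe)) Uu).
Qed.

Let LV_self i : LV i (xi i) = 0.
Proof. by rewrite /LV /Ld mul0mx addr0 (jacobianE _ oU (sxi i) Uu) subrr. Qed.

Let LE_LC_self i : LE i (phi i) = 0 /\ LC i (n i) = 0.
Proof.
have nn : LC i (n i) = 2 *: (xi i u *m curl (n i) u).
  by apply: (@LC_cst _ _ 1) => z Uz; exact: cm_nxi (unit1 Uz) i.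
have sc v := smooth_on_cst (v : 'rV[R]_d) oU.
have N (v : 'rV[R]_d) : v *m (LE i (phi i) *m phi i u) = v *m ((LC i (n i))^T *m xi i u).
  have := cd_normal S i oU (fun _ H => H) Uu (sxi i) (sc v).
  rewrite (d1E_curl oU (sn i) (sxi i) (sc v) Uu) /nijE.
  have sphiv : smooth_on U (fun z => v *m phi i z) := smooth_on_mulmx oU (sc v) (sphi i).
  have E0 z : U z -> xi i z *m phi i z = (fun=> 0 : 'rV[R]_d) z.
    by move=> Uz; exact: cm_xi_phi (C Uz) (unit1 Uz) i.
  have L1 Y : lbr (fun z => xi i z *m phi i z) Y u = 0.
    rewrite /lbr (E0 _ Uu) derive0 (derive_congr _ oU Uu E0) derive_cst subrr.
    by [].
  rewrite !L1 mul0mx subr0 addr0 (lbr_cst v oU (sxi i) Uu).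
  have -> : lbr (xi i) (fun z => v *m phi i z) u =
      v *m 'D_(xi i u) (phi i) u - v *m phi i u *m X i.
    rewrite /lbr (derive_mulmx _ oU (sc v) (sphi i) Uu) derive_cst mul0mx add0r.
    by rewrite (jacobianE _ oU (sxi i) Uu).
  rewrite mulmx_pairing nn /LE /Ld -/(X i).
  have -> : pairing (2 *: (xi i u *m curl (n i) u)) v = 2 * bil (curl (n i) u) (xi i u) v.
    by rewrite /pairing -scalemxAl mxE.
  have alg (D Y P : 'M[R]_d) (s : 'rV[R]_d) :
      - (v *m Y) *m P *m P - (v *m D - v *m P *m Y) *m P + s = 0 ->
      v *m ((D + Y *m P - P *m Y) *m P) = s.
    move=> /eqP; rewrite addrC addr_eq0 => /eqP ->.
    rewrite !(mulmxDl, mulmxBl, mulmxDr, mulmxBr, mulNmx, mulmxN, mulmxA).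
    move: (v *m D *m P) (v *m Y *m P *m P) (v *m P *m Y *m P) => a b e.
    by apply/rowP => k; rewrite !mxE; ring.
  exact: alg.
have {}N := mx_row_eq N.
have phin : phi i u *m (n i u)^T = 0 := cm_phi_n (C Uu) (unit1 Uu) i.
have L0 : LC i (n i) = 0.
  have := congr1 (mulmx^~ (n i u)^T) N; rewrite -!mulmxA phin !mulmx0.
  rewrite (cm_xin (unit1 Uu)) mulmx1 => /(congr1 trmx).
  by rewrite trmx0 trmxK.
split=> //.
have L1 : LE i (phi i) *m (n i u)^T = 0.
  have snT := smooth_on_trmx oU (sn i).
  have := Ld_mulmx (xi i u) oU Uu (X i) (X i) (0 : 'M[R]_1) (sphi i) snT.
  have E0 z : U z -> phi i z *m (n i z)^T = (fun=> 0 : 'M[R]_(d, 1)) z.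
    by move=> Uz; exact: cm_phi_n (C Uz) (unit1 Uz) i.
  rewrite (Ld_congr _ oU Uu _ _ E0) Ld_cst0.
  have := Ld_tr (xi i u) oU Uu (0 : 'M[R]_1) (- (X i)^T) (sn i).
  rewrite linearN/= trmxK opprK trmx0 oppr0 -/(LC i (n i)) L0 trmx0 => ->.
  by rewrite mulmx0 addr0 => <-.
move: N; rewrite L0 trmx0 mul0mx => N.
have := congr1 (mulmx^~ (phi i u)) N; rewrite mul0mx -mulmxA (cm_phi2 (C Uu)).
rewrite mulmxDr mulmxN mulmx1 mulmxA L1 mul0mx addr0 => /eqP.
by rewrite oppr_eq0 => /eqP.
Qed.

Let skew_phi i z : U z -> (g z *m (phi i z)^T)^T = - (g z *m (phi i z)^T).
Proof.
by move=> Uz; rewrite trmx_mul trmxK (cm_sym (C Uz)) (cm_skew (C Uz)).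
Qed.

Let sPhi i : smooth_on U (fun z => g z *m (phi i z)^T).
Proof. exact: (smooth_on_mulmx oU sg (smooth_on_trmx oU (sphi i))). Qed.

Let LB_Phi i j : LB i (fun z => g z *m (phi j z)^T) =
  2 *: curl (fun z => xi i z *m (g z *m (phi j z)^T)) u.
Proof.
apply: (Ld_closed oU Uu (sxi i) (sPhi j) (@skew_phi j)) => v w.
have sc v' := smooth_on_cst (v' : 'rV[R]_d) oU.
have := cd_closed S j oU (fun _ H => H) Uu (sxi i) (sc v) (sc w).
have -> : (fun z v w => bil (g z) v (w *m phi j z)) = (fun z => bil (g z *m (phi j z)^T)) :> ('rV[R]_d -> 'rV[R]_d -> 'rV[R]_d -> R).
  by apply/funext => z; apply/funext => v'; apply/funext => w'; rewrite bilMT.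
by [].
Qed.

Let xi_Phi i j z : U z -> xi i z *m (g z *m (phi j z)^T) = - (xi i z *m phi j z *m g z).
Proof. by move=> Uz; rewrite -mulmxA (cm_skew (C Uz)) mulmxN opprK. Qed.

Let LB_Phi_eq i j m : (forall z, U z -> xi i z *m (g z *m (phi j z)^T) = m z) ->
  LB i (fun z => g z *m (phi j z)^T) = 2 *: curl m u.
Proof.
move=> E; apply: (etrans (LB_Phi i j)).
have sm := smooth_on_mulmx oU (sxi i) (sPhi j).
exact: (congr1 (fun M => 2 *: M) (curl_congr oU Uu E sm)).
Qed.

Let LB_split i j : LB i (fun z => g z *m (phi j z)^T) =
  LB i g *m (phi j u)^T + g u *m (LE i (phi j))^T.
Proof.
rewrite /LB (Ld_mulmx _ oU Uu _ (- (X i)^T) _ sg (smooth_on_trmx oU (sphi j))).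
by rewrite (Ld_tr _ oU Uu _ _ (sphi j)).
Qed.

Let LB_g i : LB i g = 0.
Proof.
have [L0 N0] := LE_LC_self i.
have P0 : LB i g *m (phi i u)^T = 0.
  have := LB_split i i; rewrite L0 trmx0 mulmx0 addr0 => <-.
  rewrite (@LB_Phi_eq i i (fun=> 0)) ?curl0 ?scaler0// => z Uz.
  by rewrite (xi_Phi _ _ Uz) (cm_xi_phi (C Uz) (unit1 Uz)) mul0mx oppr0.
have X0 : LB i g *m (xi i u)^T = 0.
  have sT := smooth_on_trmx oU (sxi i); have sgT := smooth_on_trmx oU sg.
  have E z : U z -> g z *m (xi i z)^T = (n i z)^T.
    by move=> Uz; rewrite /n trmx_mul (cm_sym (C Uz)).
  have := Ld_mulmx (xi i u) oU Uu (X i) (- (X i)^T) (0 : 'M[R]_1) sg sT.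
  rewrite (Ld_congr _ oU Uu _ _ E).
  have := Ld_tr (xi i u) oU Uu (0 : 'M[R]_1) (- (X i)^T) (sn i).
  rewrite linearN/= trmxK opprK trmx0 oppr0 -/(LC i (n i)) N0 trmx0 => ->.
  have := Ld_tr (xi i u) oU Uu (0 : 'M[R]_1) (X i) (sxi i).
  by rewrite trmx0 oppr0 -/(LV i (xi i)) LV_self trmx0 => ->; rewrite mulmx0 addr0.
have := congr1 (mulmx^~ (phi i u)^T) P0; rewrite mul0mx -mulmxA -trmx_mul.
rewrite (cm_phi2 (C Uu)) linearD/= linearN/= trmx1 trmx_mul trmxK mulmxDr mulmxN mulmx1.
by rewrite mulmxA X0 mul0mx addr0 => /eqP; rewrite oppr_eq0 => /eqP.
Qed.

Let LC_n a b e : cyclic3 a b e -> LC a (n b) = c *: n e u /\ LC a (n e) = - (c *: n b u).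
Proof.
move=> abe; have [E1 E2] := LV_xi abe.
have E j : LC a (n j) = LV a (xi j) *m g u.
  rewrite /LC (Ld_mulmx _ oU Uu _ (X a) _ (sxi j) sg).
  by rewrite -/(LB a g) LB_g mulmx0 addr0.
by rewrite !E E1 E2 mulNmx -!scalemxAl.
Qed.

Lemma qs_LE_phi a b e : cyclic3 a b e ->
  Ld (xi a u) u ('J (xi a) u) ('J (xi a) u) (phi b) = 2 *: T e u /\
  Ld (xi a u) u ('J (xi a) u) ('J (xi a) u) (phi e) = - (2 *: T b u).
Proof.
move=> abe; have gu := cm_unitmx (C Uu).
have H j k (s : R) : LB a (fun z => g z *m (phi j z)^T) = s *: curl (n k) u ->
    LE a (phi j) = s *: T k u.
  rewrite LB_split LB_g mul0mx add0r (omegaE _ Uu) scalemxAr => /(congr1 (mulmx (invmx (g u)))).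
  by rewrite !mulKmx// -linearZ => /trmx_inj.
split; first by apply: H; apply: LB_Phi_eq => z Uz; rewrite (xi_Phi _ _ Uz) (cm_xi (C Uz) abe).2 mulNmx opprK.
rewrite -scaleNr; apply: H; rewrite scaleNr -scalerN.
have -> : - curl (n b) u = curl (fun z => -1 *: n b z) u by rewrite (curlZ _ oU Uu (sn b)) scaleN1r.
apply: LB_Phi_eq => z Uz; rewrite (xi_Phi _ _ Uz) (cm_xi (C Uz) (cyclic3_rot (cyclic3_rot abe))).1.
by rewrite scaleN1r.
Qed.

Lemma qs_LC_n a b e : cyclic3 a b e ->
  Ld (xi a u) u 0 (- ('J (xi a) u)^T) (n b) = c *: n e u /\
  Ld (xi a u) u 0 (- ('J (xi a) u)^T) (n e) = - (c *: n b u).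
Proof. exact: LC_n. Qed.

Lemma qs_LC_self a : Ld (xi a u) u 0 (- ('J (xi a) u)^T) (n a) = 0.
Proof. exact: (LE_LC_self a).2. Qed.

Lemma qs_xi_curl i j (b : R) : (forall z, U z -> n j z *m (xi i z)^T = b%:M) ->
  2 *: (xi i u *m curl (n j) u) = Ld (xi i u) u 0 (- ('J (xi i) u)^T) (n j).
Proof. by move=> H; rewrite -(LC_cst H). Qed.

Let LE_nxi a b i : LE a (fun z => (n b z)^T *m xi i z) =
  (LC a (n b))^T *m xi i u + (n b u)^T *m LV a (xi i).
Proof.
have snT := smooth_on_trmx oU (sn b).
rewrite /LE (Ld_mulmx _ oU Uu _ (0 : 'M[R]_1) _ snT (sxi i)).
have := Ld_tr (xi a u) oU Uu (0 : 'M[R]_1) (- (X a)^T) (sn b).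
by rewrite linearN/= trmxK opprK trmx0 oppr0 => ->.
Qed.

Lemma qs_T_left a b e : cyclic3 a b e ->
  T b u = - (T e u *m phi a u) + h *: ((n e u)^T *m xi a u).
Proof.
move=> abe; have [E1 E2] := qs_LE_phi abe; have [N1 _] := LC_n abe.
have sp := smooth_on_mulmx oU (sphi b) (sphi a).
have sq := smooth_on_mulmx oU (smooth_on_trmx oU (sn b)) (sxi a).
have E z : U z -> phi e z = phi b z *m phi a z - (n b z)^T *m xi a z.
  by move=> Uz; exact: (cm_phi (C Uz) abe).1.
move: E2; rewrite (Ld_congr _ oU Uu _ _ E) (Ld_sub _ oU Uu _ _ sp sq).
rewrite (Ld_mulmx _ oU Uu _ (X a) _ (sphi b) (sphi a)) E1 -!/(LE a _).
rewrite (LE_LC_self a).1 mulmx0 addr0 LE_nxi N1 LV_self mulmx0 addr0.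
rewrite -scalemxAl linearZ/= -scalemxAl.
move: (T e u *m _) ((n e u)^T *m _) => A B /eqP; rewrite eq_sym eqr_oppLR => /eqP E3.
apply: (@scalerI _ _ (2 : R)); first by rewrite pnatr_eq0.
by rewrite E3 scalerDr scalerN scalerA /h mulrCA divff ?pnatr_eq0// mulr1 opprB addrC.
Qed.

Lemma qs_T_right a b e : cyclic3 a b e ->
  T b u = phi a u *m T e u - h *: ((n a u)^T *m xi e u).
Proof.
move=> abe; have [E1 E2] := qs_LE_phi abe.
have sp := smooth_on_mulmx oU (sphi a) (sphi b).
have sq := smooth_on_mulmx oU (smooth_on_trmx oU (sn a)) (sxi b).
have E z : U z -> phi e z = - (phi a z *m phi b z) + (n a z)^T *m xi b z.
  by move=> Uz; exact: (cm_phi (C Uz) abe).2.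
move: E2; rewrite (Ld_congr _ oU Uu _ _ E) (Ld_add _ oU Uu _ _ (smooth_on_mxN oU sp) sq).
rewrite (Ld_opp _ oU Uu _ _ sp) (Ld_mulmx _ oU Uu _ (X a) _ (sphi a) (sphi b)) E1 -!/(LE a _).
have [L0 N0] := LE_LC_self a; have [V1 _] := LV_xi abe.
rewrite L0 mul0mx add0r LE_nxi N0 V1 trmx0 mul0mx add0r -!scalemxAr.
move: (phi a u *m _) ((n a u)^T *m _) => A B /eqP; rewrite eq_sym eqr_oppLR => /eqP E3.
apply: (@scalerI _ _ (2 : R)); first by rewrite pnatr_eq0.
by rewrite E3 scalerBr scalerA /h mulrCA divff ?pnatr_eq0// mulr1 opprD opprK.
Qed.

End AtPoint.

Let nT j u : U u -> (n j u)^T = g u *m (xi j u)^T.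
Proof. by move=> Uu; rewrite /n trmx_mul (cm_sym (cd_contact S Uu)). Qed.

Let omega_rel a b e u : cyclic3 a b e -> U u ->
  curl (n b) u = curl (n e) u *m (phi a u)^T - h *: ((n e u)^T *m n a u).
Proof.
move=> abe Uu; rewrite (omegaE b Uu) (omegaE e Uu) (qs_T_right Uu abe) (nT e Uu).
have alg (G M P : 'M[R]_d) (x y : 'rV[R]_d) :
    G *m (P *m M - h *: (x^T *m y))^T = G *m M^T *m P^T - h *: (G *m y^T *m x).
  by rewrite linearB/= linearZ/= !trmx_mul trmxK mulmxBr -scalemxAr !mulmxA.
exact: alg.
Qed.

Let Ld_curl_n i j m u : U u -> smooth_on U m ->
  (forall z, U z -> Ld (xi i z) z 0 (- ('J (xi i) z)^T) (n j) = m z) ->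
  Ld (xi i u) u ('J (xi i) u) (- ('J (xi i) u)^T) (curl (n j)) = curl m u.
Proof.
move=> Uu sm E; rewrite (Ld_curl oU Uu (sxi i) (sn j)).
by apply/esym/(curl_congr oU Uu _ sm) => z Uz; rewrite E.
Qed.

Let T_square a b e u : cyclic3 a b e -> U u ->
  T e u *m T e u = h *: (phi a u *m T a u) + (h ^+ 2) *: ((n e u)^T *m xi e u)
    - (h ^+ 2) *: ((n a u)^T *m xi a u).
Proof.
move=> abe Uu; have C := cd_contact S Uu.
have bea := cyclic3_rot abe; have gu := cm_unitmx C.
pose X := 'J (xi b) u.
have [_ LEa] := qs_LE_phi Uu bea; have [LCe LCa] := qs_LC_n Uu bea.
have Lb : Ld (xi b u) u X (- X^T) (curl (n b)) = curl (fun=> 0 : 'rV[R]_d) u.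
  apply: (Ld_curl_n Uu (smooth_on_cst _ oU)) => z Uz; exact: qs_LC_self Uz b.
have Le : Ld (xi b u) u X (- X^T) (curl (n e)) = c *: curl (n a) u.
  apply: etrans (curlZ c oU Uu (sn a)).
  apply: (Ld_curl_n Uu (smooth_on_mxZ oU (smooth_on_cst (c : R) oU) (sn a))) => z Uz.
  exact: (qs_LC_n Uz bea).1.
rewrite curl0 in Lb.
have sphiT := smooth_on_trmx oU (sphi a); have scn := smooth_on_curl oU (sn e).
have snT := smooth_on_trmx oU (sn e).
have s1 := smooth_on_mulmx oU scn sphiT; have s2 := smooth_on_mulmx oU snT (sn a).
have s3 := smooth_on_mxZ oU (smooth_on_cst (h : R) oU) s2.
have Er z (Uz : U z) := omega_rel abe Uz.
move: Lb; rewrite (Ld_congr _ oU Uu _ _ Er) (Ld_sub _ oU Uu _ _ s1 s3).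
rewrite (Ld_scale _ oU Uu _ _ _ s2) (Ld_mulmx _ oU Uu _ (- X^T) _ scn sphiT).
rewrite (Ld_mulmx _ oU Uu _ (0 : 'M[R]_1) _ snT (sn a)) Le LCa (Ld_tr _ oU Uu _ _ (sphi a)).
rewrite LEa; have := Ld_tr (xi b u) oU Uu (0 : 'M[R]_1) (- X^T) (sn e).
rewrite linearN/= trmxK opprK trmx0 oppr0 LCe => ->.
rewrite (omegaE a Uu) (omegaE e Uu).
have eqs (Ta Te P G : 'M[R]_d) (xa xe na ne : 'rV[R]_d) : G \in unitmx ->
    na^T = G *m xa^T -> ne^T = G *m xe^T ->
    c *: (G *m Ta^T) *m P^T + G *m Te^T *m (- (2 *: Te))^T
    - h *: ((c *: na)^T *m na + ne^T *m - (c *: ne)) = 0 ->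
    Te *m Te = h *: (P *m Ta) + h ^+ 2 *: (ne^T *m xe) - h ^+ 2 *: (na^T *m xa).
  move=> Gu nae nee; rewrite linearN/= !linearZ/= nae nee => H; rewrite -nae -nee; have : G *m (c *: (Ta^T *m P^T) - 2 *: (Te^T *m Te^T) -
      h *: (c *: (xa^T *m na) - c *: (xe^T *m ne))) = 0.
    rewrite -H !(mulmxBr, mulmxN) -!scalemxAr -!scalemxAl !(mulmxBr, mulmxN, mulmxA).
    rewrite -!scalemxAr !mulmxA.
    move: (G *m Ta^T *m P^T) (G *m Te^T *m Te^T) (G *m xa^T *m na) (G *m xe^T *m ne) => A B E D.
    by apply/matrixP => i j; rewrite !mxE; ring.
  move/(congr1 (mulmx (invmx G))); rewrite mulKmx// mulmx0 => /(congr1 trmx).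
  have tx (x y : 'rV[R]_d) : x^T *m y = (y^T *m x)^T by rewrite trmx_mul trmxK.
  rewrite -!trmx_mul (tx xa na) (tx xe ne).
  move: (P *m Ta) (Te *m Te) (na^T *m xa) (ne^T *m xe) => A B D E /matrixP H'.
  apply/matrixP => i j; have := H' i j; rewrite !mxE /h => ?; lra.
exact: eqs gu (nT a Uu) (nT e Uu).
Qed.

Lemma quasi_sasakian_projection : exists P : 'rV[R]_d -> 'M[R]_d,
  smooth_on U P /\ forall u, U u ->
    [/\ P u *m P u = P u, P u *m g u = g u *m (P u)^T,
        forall i, P u *m phi i u = phi i u *m P u,
        forall i, xi i u *m P u = xi i u &
        forall i, curl (n i) u = h *: (P u *m g u *m (phi i u)^T)].
Proof.
have h0 : h != 0 by rewrite mulf_neq0 ?invr_eq0 ?pnatr_eq0.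
pose P z := h^-1 *: (- (T 0 z *m phi 0 z) + h *: ((n 0 z)^T *m xi 0 z)).
have sT : smooth_on U (T 0).
  apply: (smooth_on_mxN oU (smooth_on_mulmx oU (smooth_on_curl oU (sn 0)) _)).
  by apply: (smooth_on_invmx oU _ sg) => z Uz; exact: cm_unitmx (cd_contact S Uz).
exists P; split.
  apply: (smooth_on_mxZ oU (smooth_on_cst (h^-1 : R) oU)).
  apply: (smooth_on_mxD oU (smooth_on_mxN oU (smooth_on_mulmx oU sT (sphi 0)))).
  apply: (smooth_on_mxZ oU (smooth_on_cst (h : R) oU)).
  exact: (smooth_on_mulmx oU (smooth_on_trmx oU (sn 0)) (sxi 0)).
move=> u Uu; have C := cd_contact S Uu; have unit1 i := cd_unit S i Uu.
have gu := cm_unitmx C.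
pose Tv i (v : 'rV[R]_d) := v *m T i u.
have PE v : v *m P u = c3_proj (bil (g u)) (fun i v => v *m phi i u) (xi^~ u) Tv h v.
  by rewrite -scalemxAr mulmxDr mulmxN mulmxA -scalemxAr mulmx_pairing scalerA.
have T_skew i v w : bil (g u) (Tv i v) w = - bil (g u) v (Tv i w).
  rewrite -bilMT -(omegaE i Uu) -bilM /T mulNmx mulmxKV//.
  by rewrite /bil mulmxN mulNmx mxE.
have xT j i (b s : R) m : (forall z, U z -> n j z *m (xi i z)^T = b%:M) ->
    Ld (xi i u) u 0 (- ('J (xi i) u)^T) (n j) = (2 * s) *: (m *m g u) ->
    Tv j (xi i u) = - (s *: m).
  move=> H E; have := qs_xi_curl Uu H; rewrite E -scalerA => /scalerI E2.
  rewrite /Tv /T mulmxN mulmxA E2 ?pnatr_eq0// -scalemxAl -mulmxA mulmxV// mulmx1.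
  by [].
have T_xi i : Tv i (xi i u) = 0.
  rewrite (@xT i i 1 0 0) ?scaler0 ?oppr0//.
    by move=> z Uz; exact: cm_nxi (fun j => cd_unit S j Uz) i.
  by rewrite qs_LC_self// mul0mx scaler0.
have T_xir a b e : cyclic3 a b e ->
    Tv a (xi b u) = h *: xi e u /\ Tv a (xi e u) = - (h *: xi b u).
  move=> abe; have ort x y z : cyclic3 x y z -> forall w, U w ->
      n x w *m (xi y w)^T = 0%:M /\ n y w *m (xi x w)^T = 0%:M.
    by move=> xyz w Uw; rewrite raddf0; exact: cm_ortho (cd_contact S Uw) (fun j => cd_unit S j Uw) _ _ _ xyz.
  split.
    rewrite -[RHS]opprK -scaleNr; apply: (@xT _ _ 0); first by move=> z /(ort _ _ _ abe) [].
    rewrite (qs_LC_n Uu (cyclic3_rot abe)).2 -scaleNr; congr (_ *: _).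
    by rewrite mulrN /h mulrCA divff ?pnatr_eq0// mulr1.
  apply: (@xT _ _ 0); first by move=> z /(ort _ _ _ (cyclic3_rot (cyclic3_rot abe))) [].
  rewrite (qs_LC_n Uu (cyclic3_rot (cyclic3_rot abe))).1; congr (_ *: _).
  by rewrite /h mulrCA divff ?pnatr_eq0// mulr1.
have T_left a b e : cyclic3 a b e -> forall v,
    Tv b v = - (Tv e v *m phi a u) + (h * bil (g u) (xi e u) v) *: xi a u.
  move=> abe v; rewrite /Tv (qs_T_left Uu abe) mulmxDr mulmxN mulmxA -scalemxAr.
  by rewrite mulmx_pairing scalerA.
have T_right a b e : cyclic3 a b e -> forall v,
    Tv b v = Tv e (v *m phi a u) - (h * bil (g u) (xi a u) v) *: xi e u.
  move=> abe v; rewrite /Tv (qs_T_right Uu abe) mulmxBr mulmxA -scalemxAr.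
  by rewrite mulmx_pairing scalerA.
have T_sq a b e : cyclic3 a b e -> forall v, Tv e (Tv e v) = h *: Tv a (v *m phi a u)
    + (h ^+ 2 * bil (g u) (xi e u) v) *: xi e u - (h ^+ 2 * bil (g u) (xi a u) v) *: xi a u.
  move=> abe v; rewrite /Tv -mulmxA (T_square abe Uu) mulmxBr mulmxDr -!scalemxAr !mulmx_pairing.
  by rewrite !scalerA mulmxA.
have idem := c3_proj_idem C unit1 h0 T_skew T_xi T_xir T_left T_right T_sq.
have psym := c3_proj_sym C unit1 T_skew T_xi T_xir T_left T_right.
have pphi := c3_proj_phi C unit1 T_skew T_xi T_xir T_left T_right.
have pxi := c3_proj_xi C unit1 h0 T_skew T_xi T_xir T_left T_right.
have pT := c3_proj_T C unit1 h0 T_skew T_xi T_xir T_left.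
split.
- by apply: mx_row_eq => v; rewrite mulmxA !PE idem.
- by apply: bil_eq => v w; rewrite bilM bilMT !PE psym.
- by move=> i; apply: mx_row_eq => v; rewrite !mulmxA !PE pphi.
- by move=> i; rewrite PE pxi.
- move=> i; rewrite (omegaE i Uu); apply: bil_eq => v w.
  rewrite bilMT -/(Tv i w) pT bilZr -pphi -psym.
  by rewrite bilZ bilMT bilM PE.
Qed.

End QuasiSasakian.

(** * Transition maps *)

Section RelatedFields.
Context {R : realType}.

Lemma derive_chain d e m n (U : set 'rV[R]_d) (V : set 'rV[R]_e)
    (F : 'rV[R]_d -> 'rV[R]_e) (G : 'rV[R]_e -> 'M[R]_(m, n)) u v :
  open U -> open V -> smooth_on U F -> smooth_on V G -> U u -> V (F u) ->
  'D_v (G \o F) u = 'D_('D_v F u) G (F u).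
Proof.
move=> oU oV sF sG Uu Vu.
have [_ ->] := is_derive_comp_diff (smooth_is_derive v oU sF Uu) (smooth_on_diff_mx oV sG Vu).
by [].
Qed.

Lemma derive_chain1 d e (U : set 'rV[R]_d) (V : set 'rV[R]_e)
    (F : 'rV[R]_d -> 'rV[R]_e) (f : 'rV[R]_e -> R) u v :
  open U -> open V -> smooth_on U F -> smooth_on V f -> U u -> V (F u) ->
  'D_v (f \o F) u = 'D_('D_v F u) f (F u).
Proof.
move=> oU oV sF sf Uu Vu.
have [_ ->] := is_derive_comp_diff (smooth_is_derive v oU sF Uu) (smooth_on_diff oV sf Vu).
by [].
Qed.

Lemma lbr_related d e (U : set 'rV[R]_d) (V : set 'rV[R]_e)
    (F : 'rV[R]_d -> 'rV[R]_e) X Y (X' Y' : 'rV[R]_e -> 'rV[R]_e) u :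
  open U -> open V -> smooth_on U F -> (forall z, U z -> V (F z)) ->
  smooth_on U X -> smooth_on U Y -> smooth_on V X' -> smooth_on V Y' ->
  (forall z, U z -> X' (F z) = 'D_(X z) F z) ->
  (forall z, U z -> Y' (F z) = 'D_(Y z) F z) -> U u ->
  lbr X' Y' (F u) = 'D_(lbr X Y u) F u.
Proof.
move=> oU oV sF FV sX sY sX' sY' XX YY Uu.
have E Z Z' (W W' : 'rV[R]_e -> 'rV[R]_e) : smooth_on V W' -> (forall z, U z -> W (F z) = 'D_(Z z) F z) ->
    (forall z, U z -> W' (F z) = 'D_(Z' z) F z) ->
    'D_(W (F u)) W' (F u) = 'D_(Z u) (fun z => 'D_(Z' z) F z) u.
  move=> sW' E E'; rewrite (E _ Uu).
  apply: (etrans (esym (derive_chain (Z u) oU oV sF sW' Uu (FV _ Uu)))).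
  exact: derive_congr oU Uu E'.
apply: (etrans (congr2 (fun a b => a - b) (E X Y X' Y' sY' XX YY) (E Y X Y' X' sX' YY XX))).
exact: derive_commutator oU sF sX sY Uu.
Qed.

Lemma lbr_congr d (U : set 'rV[R]_d) X Y X' Y' u : open U -> U u ->
  (forall z, U z -> X z = X' z) -> (forall z, U z -> Y z = Y' z) ->
  lbr X Y u = lbr X' Y' u.
Proof.
move=> oU Uu XX YY; rewrite /lbr (XX _ Uu) (YY _ Uu).
by rewrite (derive_congr _ oU Uu XX) (derive_congr _ oU Uu YY).
Qed.

Lemma nijE_congr d (U : set 'rV[R]_d) (phi phi' : 'rV[R]_d -> 'M[R]_d) X Y X' Y' u :
  open U -> U u -> (forall z, U z -> phi z = phi' z) ->
  (forall z, U z -> X z = X' z) -> (forall z, U z -> Y z = Y' z) ->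
  nijE phi X Y u = nijE phi' X' Y' u.
Proof.
move=> oU Uu pp XX YY.
have pX z : U z -> X z *m phi z = X' z *m phi' z by move=> Uz; rewrite XX// pp.
have pY z : U z -> Y z *m phi z = Y' z *m phi' z by move=> Uz; rewrite YY// pp.
rewrite /nijE (lbr_congr oU Uu XX YY) (lbr_congr oU Uu pX pY).
by rewrite (lbr_congr oU Uu pX YY) (lbr_congr oU Uu XX pY) (pp _ Uu).
Qed.

Lemma d1E_congr d (U : set 'rV[R]_d) (a a' : 'rV[R]_d -> 'rV[R]_d -> R) X Y X' Y' u :
  open U -> U u -> (forall z v, U z -> a z v = a' z v) ->
  (forall z, U z -> X z = X' z) -> (forall z, U z -> Y z = Y' z) ->
  d1E a X Y u = d1E a' X' Y' u.
Proof.
move=> oU Uu aa XX YY; rewrite /d1E (lbr_congr oU Uu XX YY) (XX _ Uu) (YY _ Uu) (aa _ _ Uu).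
have E Z Z' v : (forall z, U z -> Z z = Z' z) ->
    'D_v (fun z => a z (Z z)) u = 'D_v (fun z => a' z (Z' z)) u.
  by move=> ZZ; apply: (derive_congr v oU Uu) => z Uz; rewrite (aa _ _ Uz) (ZZ _ Uz).
by rewrite (E Y Y' _ YY) (E X X' _ XX).
Qed.

Lemma congr_d1 (k a b c a' b' c' : R) : a = a' -> b = b' -> c = c' ->
  k * (a - b - c) = k * (a' - b' - c').
Proof. by move=> -> -> ->. Qed.

Lemma congr_d2 (k a b c e f h a' b' c' e' f' h' : R) :
  a = a' -> b = b' -> c = c' -> e = e' -> f = f' -> h = h' ->
  k * (a + b + c - e - f - h) = k * (a' + b' + c' - e' - f' - h').
Proof. by move=> -> -> -> -> -> ->. Qed.

Lemma d2E_congr d (U : set 'rV[R]_d) (a a' : 'rV[R]_d -> 'rV[R]_d -> 'rV[R]_d -> R)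
    X Y Z X' Y' Z' u :
  open U -> U u -> (forall z v w, U z -> a z v w = a' z v w) ->
  (forall z, U z -> X z = X' z) -> (forall z, U z -> Y z = Y' z) ->
  (forall z, U z -> Z z = Z' z) -> d2E a X Y Z u = d2E a' X' Y' Z' u.
Proof.
move=> oU Uu aa XX YY ZZ.
have E A B A' B' v v' : v = v' -> (forall z, U z -> A z = A' z) -> (forall z, U z -> B z = B' z) ->
    'D_v (fun z => a z (A z) (B z)) u = 'D_v' (fun z => a' z (A' z) (B' z)) u.
  by move=> <- AA BB; apply: (derive_congr v oU Uu) => z Uz; rewrite (aa _ _ _ Uz) (AA _ Uz) (BB _ Uz).
have F A B C A' B' C' : (forall z, U z -> A z = A' z) -> (forall z, U z -> B z = B' z) ->
    (forall z, U z -> C z = C' z) -> a u (lbr A B u) (C u) = a' u (lbr A' B' u) (C' u).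
  move=> AA BB CC; apply: (etrans (aa _ _ _ Uu)).
  exact: (congr2 (a' u) (lbr_congr oU Uu AA BB) (CC _ Uu)).
apply: congr_d2; [exact: (E _ _ _ _ _ _ (XX _ Uu) YY ZZ)|exact: (E _ _ _ _ _ _ (YY _ Uu) ZZ XX)
 |exact: (E _ _ _ _ _ _ (ZZ _ Uu) XX YY)|exact: F|exact: F|exact: F].
Qed.

End RelatedFields.

Section Transition.
Context {R : realType} {d : nat} {M : manifold R d}.
Implicit Types (p q r x : M) (X Y Z : M -> 'rV[R]_d) (u v : 'rV[R]_d).

Definition trans q p := chart_at p \o chart_inv (chart_at q).
Definition trans_dom q p : set 'rV[R]_d :=
  chart_at q @` (chart_dom (chart_at q) `&` chart_dom (chart_at p)).

Lemma trans_dom_open q p : open (trans_dom q p).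
Proof. exact: chart_im_openS (chart_dom_open _). Qed.

Lemma chart_im_open' p : open (chart_im p).
Proof. exact: chart_im_open. Qed.

Lemma smooth_trans q p : smooth_on (trans_dom q p) (trans q p).
Proof. exact: chart_at_compat. Qed.

Lemma trans_dom_im q p u : trans_dom q p u -> chart_im q u.
Proof. by move=> [x [qx px] <-]; exists x. Qed.

Lemma chart_im_dom p u : chart_im p u -> chart_dom (chart_at p) (chart_inv (chart_at p) u).
Proof. by move=> [x px <-]; rewrite chartK. Qed.

Lemma chart_invK p u : chart_im p u -> chart_at p (chart_inv (chart_at p) u) = u.
Proof. by move=> [x px <-]; rewrite chartK. Qed.

Lemma trans_domE q p u : trans_dom q p u <->
  chart_im q u /\ chart_dom (chart_at p) (chart_inv (chart_at q) u).
Proof.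
split=> [[x [qx px] <-]|[[x qx <-]]].
  by split; [exists x|rewrite chartK].
by rewrite chartK// => px; exists x.
Qed.

Lemma trans_chart q p x : chart_dom (chart_at q) x -> trans q p (chart_at q x) = chart_at p x.
Proof. by move=> qx; rewrite /trans /= chartK. Qed.

Lemma trans_im q p u : trans_dom q p u -> trans_dom p q (trans q p u).
Proof. by move=> [x [qx px] <-]; rewrite trans_chart//; exists x. Qed.

Lemma tangent_coordE p q v : tangent_coord p q v = 'D_v (trans q p) (chart_at q q).
Proof. by []. Qed.

Lemma trans_dom_self q p : chart_dom (chart_at p) q -> trans_dom q p (chart_at q q).
Proof. by move=> pq; exists q => //; split=> //; exact: chart_at_dom. Qed.

Lemma derive_trans p q r x v : chart_dom (chart_at p) x -> chart_dom (chart_at q) x ->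
  chart_dom (chart_at r) x ->
  'D_v (trans p r) (chart_at p x) =
  'D_('D_v (trans p q) (chart_at p x)) (trans q r) (chart_at q x).
Proof.
move=> px qx rx.
pose U := trans_dom p q `&` trans_dom p r.
have oU : open U := openI (@trans_dom_open p q) (@trans_dom_open p r).
have Ux : U (chart_at p x) by split; exists x.
have s1 : smooth_on U (trans p q).
  exact: (@smooth_onS R d _ U _ _ (fun _ H => H.1) (@smooth_trans p q)).
rewrite -[in RHS](trans_chart q px).
rewrite -(derive_chain v oU (@trans_dom_open q r) s1 (@smooth_trans q r) Ux); last first.
  by rewrite trans_chart//; exists x.
apply: (derive_congr v oU Ux) => z [pq _].
by rewrite /= /trans /=; case: pq => y [py qy] <-; rewrite !chartK.
Qed.

Lemma derive_trans_id p x v : chart_dom (chart_at p) x ->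
  'D_v (trans p p) (chart_at p x) = v.
Proof.
move=> px; have Ux : trans_dom p p (chart_at p x) by exists x.
apply: (etrans (@derive_congr R d _ _ _ id _ v (@trans_dom_open p p) Ux _)).
  by move=> z [y [py _] <-]; rewrite trans_chart.
exact: derive_id.
Qed.

Lemma tangent_coord_id p v : tangent_coord p p v = v.
Proof. by rewrite tangent_coordE derive_trans_id//; exact: chart_at_dom. Qed.

Definition tangent_of p q v := 'D_v (trans p q) (chart_at p q).

Lemma tangent_ofK p q v : chart_dom (chart_at p) q -> tangent_coord p q (tangent_of p q v) = v.
Proof.
move=> pq; have qq := chart_at_dom q.
by rewrite tangent_coordE -(derive_trans v pq qq pq) derive_trans_id.
Qed.

Lemma tangent_coordK p q v : chart_dom (chart_at p) q -> tangent_of p q (tangent_coord p q v) = v.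
Proof.
move=> pq; have qq := chart_at_dom q.
by rewrite /tangent_of tangent_coordE -(derive_trans v qq pq qq) derive_trans_id.
Qed.

Lemma tangent_coord_mx p q : chart_dom (chart_at p) q ->
  forall v, tangent_coord p q v = v *m 'J (trans q p) (chart_at q q).
Proof.
move=> pq v; rewrite tangent_coordE.
exact: jacobianE (@trans_dom_open q p) (@smooth_trans q p) (trans_dom_self pq).
Qed.

Lemma tangent_of_mx p q : chart_dom (chart_at p) q ->
  forall v, tangent_of p q v = v *m 'J (trans p q) (chart_at p q).
Proof.
move=> pq v; apply: jacobianE (@trans_dom_open p q) (@smooth_trans p q) _.
by exists q => //; split=> //; exact: chart_at_dom.
Qed.

Lemma field_at p X : field_in_chart p X (chart_at p p) = X p.
Proof.
by rewrite /field_in_chart chartK ?tangent_coord_id//; exact: chart_at_dom.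
Qed.

Lemma field_in_chart_trans p r X u : trans_dom p r u ->
  field_in_chart r X (trans p r u) = 'D_(field_in_chart p X u) (trans p r) u.
Proof.
move=> [x [px rx] <-]; rewrite (trans_chart r px) /field_in_chart (chartK px) (chartK rx).
exact: derive_trans (chart_at_dom x) px rx.
Qed.

Lemma bracket_in_chart p X Y q : smooth_field X -> smooth_field Y ->
  chart_dom (chart_at p) q ->
  tangent_coord p q (bracket X Y q) =
  lbr (field_in_chart p X) (field_in_chart p Y) (chart_at p q).
Proof.
move=> sX sY pq; have qq := chart_at_dom q.
have -> : bracket X Y q = lbr (field_in_chart q X) (field_in_chart q Y) (chart_at q q).
  by rewrite /lbr !field_at.
rewrite tangent_coordE -[in RHS](trans_chart p qq); apply/esym.
have sS Z r s : smooth_field Z -> smooth_on (trans_dom r s) (field_in_chart r Z).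
  move=> sZ; exact: (@smooth_onS R d _ _ _ _ (@trans_dom_im r s) (sZ r)).
apply: (lbr_related (@trans_dom_open q p) (@trans_dom_open p q) (@smooth_trans q p)
  (@trans_im q p) (sS X _ _ sX) (sS Y _ _ sY) (sS X _ _ sX) (sS Y _ _ sY)).
- by move=> z; exact: field_in_chart_trans.
- by move=> z; exact: field_in_chart_trans.
- exact: trans_dom_self.
Qed.

Lemma field_app_in_chart p X f q : smooth_fun f -> chart_dom (chart_at p) q ->
  field_app X f q =
  'D_(field_in_chart p X (chart_at p q)) (f \o chart_inv (chart_at p)) (chart_at p q).
Proof.
move=> sf pq; have qq := chart_at_dom q.
have Uq := trans_dom_self pq; have oU := @trans_dom_open q p.
have := derive_chain1 (X q) oU (@chart_im_open' p) (@smooth_trans q p) (sf p) Uq.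
rewrite trans_chart// => /(_ (ex_intro2 _ _ q pq erefl)) E.
rewrite /field_app; apply: etrans (etrans _ E) _.
  apply: (derive_congr _ oU Uq) => z [x [qx px] <-].
  by rewrite /= trans_chart// !chartK.
by rewrite /field_in_chart chartK.
Qed.

Lemma nijenhuis_in_chart p (phi : M -> {linear 'rV[R]_d -> 'rV[R]_d})
    (P : 'rV[R]_d -> 'M[R]_d) X Y q :
  (forall x v, chart_dom (chart_at p) x ->
     tangent_coord p x (phi x v) = tangent_coord p x v *m P (chart_at p x)) ->
  smooth_endo phi -> smooth_field X -> smooth_field Y -> chart_dom (chart_at p) q ->
  tangent_coord p q (nijenhuis phi X Y q) =
  nijE P (field_in_chart p X) (field_in_chart p Y) (chart_at p q).
Proof.
move=> phiP sphi sX sY pq.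
have FP Z z : chart_im p z -> field_in_chart p (fun x => phi x (Z x)) z = field_in_chart p Z z *m P z.
  by move=> [x px <-]; rewrite /field_in_chart chartK// phiP.
have B A A' B' B'' : smooth_field A -> smooth_field B' ->
    (forall z, chart_im p z -> field_in_chart p A z = A' z) ->
    (forall z, chart_im p z -> field_in_chart p B' z = B'' z) ->
    tangent_coord p q (bracket A B' q) = lbr A' B'' (chart_at p q).
  move=> sA sB AA BB; rewrite (bracket_in_chart sA sB pq).
  by apply: (lbr_congr (@chart_im_open' p) _ AA BB); exists q.
have lin (x y : 'rV[R]_d) : tangent_coord p q (x + y) = tangent_coord p q x + tangent_coord p q y.
  by rewrite !(tangent_coord_mx pq) mulmxDl.
have linN (x : 'rV[R]_d) : tangent_coord p q (- x) = - tangent_coord p q x.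
  by rewrite !(tangent_coord_mx pq) mulNmx.
have lin4 a b c e : tangent_coord p q (a + b - c - e) =
    tangent_coord p q a + tangent_coord p q b - tangent_coord p q c - tangent_coord p q e.
  by rewrite !lin !linN.
have congr4 (a b c e a' b' c' e' : 'rV[R]_d) : a = a' -> b = b' -> c = c' -> e = e' ->
    a + b - c - e = a' + b' - c' - e' by move=> -> -> -> ->.
have sp Z : smooth_field Z -> smooth_field (fun x => phi x (Z x)) := sphi Z.
have phiB v w : tangent_coord p q v = w ->
    tangent_coord p q (phi q v) = w *m P (chart_at p q) by move=> <-; exact: phiP.
apply: (etrans (lin4 _ _ _ _)); apply: congr4.
- exact: (phiB _ _ (phiB _ _ (bracket_in_chart sX sY pq))).
- exact: (B _ _ _ _ (sp _ sX) (sp _ sY) (@FP X) (@FP Y)).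
- exact: (phiB _ _ (B _ _ _ _ (sp _ sX) sY (@FP X) (fun _ _ => erefl))).
- exact: (phiB _ _ (B _ _ _ _ sX (sp _ sY) (fun _ _ => erefl) (@FP Y))).
Qed.

Lemma field_chart p X q : chart_dom (chart_at p) q ->
  field_in_chart p X (chart_at p q) = tangent_coord p q (X q).
Proof. by move=> pq; rewrite /field_in_chart chartK. Qed.

Lemma d_form1_in_chart p (w : M -> 'rV[R]_d -> R) (a : 'rV[R]_d -> 'rV[R]_d -> R) X Y q :
  (forall x v, chart_dom (chart_at p) x ->
     w x v = a (chart_at p x) (tangent_coord p x v)) ->
  (forall Z, smooth_field Z -> smooth_fun (fun x => w x (Z x))) ->
  smooth_field X -> smooth_field Y -> chart_dom (chart_at p) q ->
  d_form1 w X Y q = d1E a (field_in_chart p X) (field_in_chart p Y) (chart_at p q).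
Proof.
move=> wa sw sX sY pq; have Ip : chart_im p (chart_at p q) by exists q.
have E A B : smooth_field B -> field_app A (fun x => w x (B x)) q =
    'D_(field_in_chart p A (chart_at p q)) (fun z => a z (field_in_chart p B z)) (chart_at p q).
  move=> sB; apply: (etrans (field_app_in_chart A (sw _ sB) pq)).
  apply: (derive_congr _ (@chart_im_open' p) Ip) => z [x px <-] /=; rewrite chartK//.
  by apply: etrans (wa _ _ px) _; rewrite (field_chart B px).
apply: congr_d1; [exact: (E X Y sY)|exact: (E Y X sX)|].
exact: etrans (wa _ _ pq) (congr1 (a _) (bracket_in_chart sX sY pq)).
Qed.

Lemma d_form2_in_chart p (w : M -> 'rV[R]_d -> 'rV[R]_d -> R)
    (a : 'rV[R]_d -> 'rV[R]_d -> 'rV[R]_d -> R) X Y Z q :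
  (forall x v v', chart_dom (chart_at p) x ->
     w x v v' = a (chart_at p x) (tangent_coord p x v) (tangent_coord p x v')) ->
  (forall Z Z', smooth_field Z -> smooth_field Z' -> smooth_fun (fun x => w x (Z x) (Z' x))) ->
  smooth_field X -> smooth_field Y -> smooth_field Z -> chart_dom (chart_at p) q ->
  d_form2 w X Y Z q =
  d2E a (field_in_chart p X) (field_in_chart p Y) (field_in_chart p Z) (chart_at p q).
Proof.
move=> wa sw sX sY sZ pq; have Ip : chart_im p (chart_at p q) by exists q.
have E A B C : smooth_field B -> smooth_field C -> field_app A (fun x => w x (B x) (C x)) q =
    'D_(field_in_chart p A (chart_at p q))
      (fun z => a z (field_in_chart p B z) (field_in_chart p C z)) (chart_at p q).
  move=> sB sC; apply: (etrans (field_app_in_chart A (sw _ _ sB sC) pq)).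
  apply: (derive_congr _ (@chart_im_open' p) Ip) => z [x px <-] /=; rewrite chartK//.
  by apply: etrans (wa _ _ _ px) _; rewrite (field_chart B px) (field_chart C px).
have F A B C : smooth_field A -> smooth_field B -> w q (bracket A B q) (C q) =
    a (chart_at p q) (lbr (field_in_chart p A) (field_in_chart p B) (chart_at p q))
      (field_in_chart p C (chart_at p q)).
  move=> sA sB; apply: (etrans (wa _ _ _ pq)).
  exact: (congr2 (a _) (bracket_in_chart sA sB pq) (esym (field_chart C pq))).
apply: congr_d2; [exact: (E X Y Z sY sZ)|exact: (E Y Z X sZ sX)|exact: (E Z X Y sX sY)
  |exact: (F X Y Z sX sY)|exact: (F Y Z X sY sZ)|exact: (F Z X Y sZ sX)].
Qed.

End Transition.

(** * From the manifold to a chart *)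

Lemma continuous_dist (R : realType) (V : normedModType R) (u0 : V) :
  continuous (fun u => `|u - u0|).
Proof. by move=> x; apply: cvg_norm; apply: cvgB; [exact: cvg_id|exact: cvg_cst]. Qed.

Lemma smooth_cutoff (R : realType) d m n (W : set 'rV[R]_d) (Y : 'rV[R]_d -> 'M[R]_(m, n))
    (chi : 'rV[R]_d -> R) u0 (e : R) :
  open W -> (forall u, `|u - u0| <= e -> W u) -> smooth_on setT chi ->
  (forall u, chi u != 0 -> `|u - u0| <= e) -> smooth_on W Y ->
  smooth_on setT (fun u => chi u *: Y u).
Proof.
move=> oW ballW schi chi0 sY; apply: smooth_on_local => u _.
have [Wu|nWu] := pselect (W u).
  exists W; first exact: Wu.
  exact: (smooth_on_mxZ oW (@smooth_onS R d _ W setT chi (fun _ _ => I) schi) sY).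
have oV : open [set u | e < `|u - u0|].
  apply: (@open_comp _ _ (fun u : 'rV[R]_d => `|u - u0|) [set t | e < t]).
    by move=> x _; exact: continuous_dist.
  exact: open_gt.
exists [set u | e < `|u - u0|].
  by rewrite /= ltNge; apply/negP => /ballW.
apply: (@smooth_on_eq R d _ _ (fun=> 0) _ oV); last exact: smooth_on0.
move=> x /= xr; have [->|/chi0] := eqVneq (chi x) 0; first by rewrite scale0r.
by rewrite leNgt xr.
Qed.

Section Extension.
Context {R : realType} {d : nat} {M : manifold R d}.
Implicit Types (p q r x : M) (u v : 'rV[R]_d).

Lemma smooth_transport_field p r (Y : 'rV[R]_d -> 'rV[R]_d) :
  smooth_on (trans_dom p r) Y ->
  smooth_on (trans_dom r p) (fun z => 'D_(Y (trans r p z)) (trans p r) (trans r p z)).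
Proof.
move=> sY.
exact: (smooth_on_comp (@trans_dom_open _ _ _ r p) (@trans_dom_open _ _ _ p r)
  (smooth_on_derive (@trans_dom_open _ _ _ p r) (@smooth_trans _ _ _ p r) sY)
  (@smooth_trans _ _ _ r p) (@trans_im _ _ _ r p)).
Qed.

(* A local field is extended by zero after multiplication by a bump function
   supported in a closed ball, whose image is closed since M is Hausdorff. *)
Lemma extend_field p (W : set 'rV[R]_d) (Y : 'rV[R]_d -> 'rV[R]_d) u0 :
  open W -> W `<=` chart_im p -> W u0 -> smooth_on W Y ->
  exists X, smooth_field X /\ exists W', [/\ open W', W' u0, W' `<=` W &
    forall u, W' u -> field_in_chart p X u = Y u].
Proof.
move=> oW Wp Wu0 sY.
have [rho rho0 ballW] : exists2 rho, 0 < rho & forall u, `|u - u0| <= 2 * rho -> W u.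
  have /nbhs_ballP[e /= e0 eW] := open_nbhs_nbhs (conj oW Wu0).
  exists (e / 4); first by rewrite divr_gt0.
  move=> u ue; apply: eW; rewrite mx_norm_ball /ball_ /= distrC.
  by apply: le_lt_trans ue _; lra.
have [chi [schi _ chi1 chi0]] := smooth_bump u0 rho0.
pose Y' u := chi u *: Y u.
have sY' : smooth_on setT Y' := smooth_cutoff oW ballW schi chi0 sY.
have Y'0 u : ~ `|u - u0| <= 2 * rho -> Y' u = 0.
  by rewrite /Y' => nu; have [->|/chi0 /nu//] := eqVneq (chi u) 0; rewrite scale0r.
pose B := [set u : 'rV[R]_d | `|u - u0| <= 2 * rho].
pose K := chart_inv (chart_at p) @` B.
have cB : closed B.
  apply: (@closed_comp _ _ (fun u : 'rV[R]_d => `|u - u0|) [set t | t <= 2 * rho]).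
    move=> x _; exact: continuous_dist.
  exact: closed_le.
have clK : closed K.
  apply: (compact_closed (@manifold_hausdorff _ _ M)); apply: continuous_compact.
    apply: continuous_in_subspaceT => u; rewrite inE => /ballW /Wp pu.
    exact: (@chart_inv_continuous _ _ _ (chart_at p) u pu).
  apply: bounded_closed_compact => //.
  exists (`|u0| + 2 * rho); split; first exact: num_real.
  move=> m hm u /= ur; apply: le_trans (ltW hm).
  rewrite -[u](subrK u0) addrC; apply: le_trans (ler_normD _ _) _.
  by rewrite lerD2l.
pose X q := if asbool (chart_dom (chart_at p) q) then tangent_of p q (Y' (chart_at p q)) else 0.
have XE q : chart_dom (chart_at p) q -> X q = tangent_of p q (Y' (chart_at p q)).
  by move=> pq; rewrite /X asboolT.
have X0 q : ~ K q -> X q = 0.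
  move=> nK; rewrite /X; case: asboolP => // pq.
  rewrite Y'0 /tangent_of ?derive0// => Bq; apply: nK.
  by exists (chart_at p q) => //; rewrite chartK.
have Xp u : chart_im p u -> field_in_chart p X u = Y' u.
  by move=> [q pq <-]; rewrite (field_chart X pq) XE// tangent_ofK.
exists X; split; last first.
  exists [set u | `|u - u0| < rho]; split.
  - apply: (@open_comp _ _ (fun u : 'rV[R]_d => `|u - u0|) [set t | t < rho]).
      move=> x _; exact: continuous_dist.
    exact: open_lt.
  - by rewrite /= subrr normr0.
  - by move=> u /= ur; apply: ballW; apply: le_trans (ltW ur) _; lra.
  - move=> u /= ur; rewrite Xp; last by apply: Wp; apply: ballW; apply: le_trans (ltW ur) _; lra.
    by rewrite /Y' chi1 ?scale1r// ltW.
move=> r; apply: smooth_on_local => _ [q rq <-].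
have [pq|npq] := pselect (chart_dom (chart_at p) q).
  exists (trans_dom r p); first by exists q.
  have sV := smooth_transport_field (@smooth_onS R d _ (trans_dom p r) setT Y' (fun _ _ => I) sY').
  apply: smooth_on_eq sV; first exact: trans_dom_open.
  move=> _ [x [rx px] <-]; rewrite (trans_chart p rx) (field_chart X rx) XE//.
  rewrite tangent_coordE /tangent_of; exact: derive_trans px (chart_at_dom x) rx.
exists (chart_at r @` (chart_dom (chart_at r) `&` ~` K)).
  by exists q => //; split=> // -[u /ballW /Wp pu uq]; apply: npq; rewrite -uq; exact: chart_im_dom.
have oV := @chart_im_openS R _ d (chart_at r) (~` K) (closed_openC clK).
apply: (@smooth_on_eq R d _ _ (fun=> 0) _ oV); last exact: smooth_on0.
move=> _ [x [rx nKx] <-]; rewrite (field_chart X rx) X0//.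
by rewrite tangent_coordE derive0.
Qed.

End Extension.

Section EvenPermutations.

Lemma I3_cases (i : 'I_3) : [\/ i = 0, i = 1 | i = 2%:R].
Proof.
by case: i => -[|[|[|//]]] i; [apply: Or31|apply: Or32|apply: Or33]; apply/val_inj.
Qed.

Lemma even_perm_cyclic3 (P : 'I_3 -> 'I_3 -> 'I_3 -> Prop) :
  for_even_perm P <-> (forall a b c, cyclic3 a b c -> P a b c).
Proof.
split=> [PP a b c|PP s es].
  case=> -[-> -> ->].
  - by have := PP 1%g; rewrite odd_perm1 !perm1; exact.
  - have := PP (mulg (tperm 0 1) (tperm 0 2%:R)).
    by rewrite odd_permM !odd_tperm !permM !permE /=; exact.
  - have := PP (mulg (tperm 0 2%:R) (tperm 0 1)).
    by rewrite odd_permM !odd_tperm !permM !permE /=; exact.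
apply: PP; have n01 : s 0 != s 1 by rewrite (inj_eq perm_inj).
have n02 : s 0 != s 2%:R by rewrite (inj_eq perm_inj).
have n12 : s 1 != s 2%:R by rewrite (inj_eq perm_inj).
have odd_t x y : x != y -> s = tperm x y -> False.
  by move=> xy sE; move: es; rewrite sE odd_tperm xy.
have ext x y : tperm x y 0 = s 0 -> tperm x y 1 = s 1 -> tperm x y 2%:R = s 2%:R -> s = tperm x y.
  by move=> E0 E1 E2; apply/permP => z; case: (I3_cases z) => ->.
case: (I3_cases (s 0)) (I3_cases (s 1)) (I3_cases (s 2%:R)) => E0 [] E1 [] E2;
  move: n01 n02 n12; rewrite E0 E1 E2 // => _ _ _.
- by apply: Or31.
- by exfalso; apply: (@odd_t 1 2%:R) => //; apply: ext; rewrite ?E0 ?E1 ?E2 !permE.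
- by exfalso; apply: (@odd_t 0 1) => //; apply: ext; rewrite ?E0 ?E1 ?E2 !permE.
- by apply: Or32.
- by apply: Or33.
- by exfalso; apply: (@odd_t 0 2%:R) => //; apply: ext; rewrite ?E0 ?E1 ?E2 !permE.
Qed.

End EvenPermutations.

Lemma contact3_transport (R : realType) (V V' : lmodType R) (L : V -> V') (L' : V' -> V)
    (g : V -> V -> R) phi xi (g' : V' -> V' -> R) phi' xi' :
  cancel L' L -> linear L -> injective L ->
  (forall v w, g' (L v) (L w) = g v w) -> (forall i v, phi' i (L v) = L (phi i v)) ->
  (forall i, xi' i = L (xi i)) -> contact3 g phi xi -> contact3 g' phi' xi'.
Proof.
move=> LK lL iL gg pp xx C.
have LD u v : L (u + v) = L u + L v by have := lL 1 u v; rewrite !scale1r.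
have L0 : L 0 = 0 by apply: (addrI (L 0)); rewrite -LD !addr0.
have LZ a v : L (a *: v) = a *: L v by have := lL a v 0; rewrite L0 !addr0.
have LN v : L (- v) = - L v by rewrite -scaleN1r LZ scaleN1r.
split.
- by move=> a u v w; rewrite -(LK u) -(LK v) -(LK w) -lL !gg (c3_linl C).
- by move=> u v; rewrite -(LK u) -(LK v) !gg (c3_sym C).
- move=> u u0; rewrite -(LK u) gg; apply: (c3_pos C).
  by apply: contra_neq u0 => E; rewrite -(LK u) E L0.
- by move=> i a u v; rewrite -(LK u) -(LK v) -lL !pp (c3_lin C) lL.
- by move=> i v; rewrite -(LK v) xx !pp gg (c3_phi2 C) LD LN LZ.
- by move=> i u v; rewrite -(LK u) -(LK v) !pp !gg (c3_skew C).
- by move=> a b c abc; have [E F] := c3_xi C abc; rewrite !xx !pp E F LN.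
- move=> a b c abc v; rewrite -(LK v) !xx !pp !gg; have [E F] := c3_phi C abc (L' v).
  by rewrite E F !LD !LZ LN.
Qed.

Section ManifoldData.
Context {R : realType} {d : nat} {M : manifold R d}.
Implicit Types (p q : M) (u v w : 'rV[R]_d).

Definition loc_endo p (phi : M -> {linear 'rV[R]_d -> 'rV[R]_d}) u : 'M[R]_d :=
  let q := chart_inv (chart_at p) u in
  'J (trans p q) u *m lin1_mx (phi q) *m 'J (trans q p) (chart_at q q).

Definition loc_bil p (g : M -> {biscalar 'rV[R]_d}) u : 'M[R]_d :=
  let q := chart_inv (chart_at p) u in
  'J (trans p q) u *m (\matrix_(i, j) g q (delta_mx 0 i) (delta_mx 0 j))
    *m ('J (trans p q) u)^T.

Lemma jacobian_transK p q : chart_dom (chart_at p) q ->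
  'J (trans q p) (chart_at q q) *m 'J (trans p q) (chart_at p q) = 1%:M.
Proof.
move=> pq; apply: mx_row_eq => v.
by rewrite mulmxA -(tangent_coord_mx pq) -(tangent_of_mx pq) tangent_coordK// mulmx1.
Qed.

Lemma loc_endoE p (phi : M -> {linear 'rV[R]_d -> 'rV[R]_d}) q v : chart_dom (chart_at p) q ->
  tangent_coord p q (phi q v) = tangent_coord p q v *m loc_endo p phi (chart_at p q).
Proof.
move=> pq; rewrite !(tangent_coord_mx pq) /loc_endo (chartK pq).
have alg (A B L : 'M[R]_d) (x y : 'rV[R]_d) : A *m B = 1%:M -> x *m L = y ->
    y *m A = x *m A *m (B *m L *m A).
  by move=> AB <-; rewrite !mulmxA -(mulmxA x A) AB mulmx1.
by apply: alg (jacobian_transK pq) _; exact: mul_rV_lin1.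
Qed.

Lemma biscalar_mx (b : {biscalar 'rV[R]_d}) v w :
  b v w = bil (\matrix_(i, j) b (delta_mx 0 i) (delta_mx 0 j)) v w.
Proof.
rewrite {1}(row_sum_delta v) linear_sumlz /bil -mulmxA mxE; apply: eq_bigr => i _.
rewrite linearZl_LR; congr (_ * _); rewrite {1}(row_sum_delta w) linear_sumr mxE.
by apply: eq_bigr => j _; rewrite linearZr_LR !mxE mulrC.
Qed.

Lemma loc_bilE p (g : M -> {biscalar 'rV[R]_d}) q v w : chart_dom (chart_at p) q ->
  g q v w = bil (loc_bil p g (chart_at p q)) (tangent_coord p q v) (tangent_coord p q w).
Proof.
move=> pq; rewrite /loc_bil chartK// bilMT bilM.
rewrite -!(tangent_of_mx pq) !tangent_coordK//; exact: biscalar_mx.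
Qed.

Lemma extend_cst p u w : chart_im p u -> exists X, smooth_field X /\
  exists W, [/\ open W, W u, W `<=` chart_im p & forall z, W z -> field_in_chart p X z = w].
Proof.
move=> pu; have sc : smooth_on (chart_im p) (fun=> w) := smooth_on_cst w (@chart_im_open' _ _ _ p).
exact: (extend_field (@chart_im_open' _ _ _ p) (fun _ H => H) pu sc).
Qed.

Lemma smooth_loc_endo p phi : smooth_endo phi -> smooth_on (chart_im p) (loc_endo p phi).
Proof.
move=> sphi; apply: (smooth_on_mx (@chart_im_open' _ _ _ p)) => i j.
apply: smooth_on_local => u pu.
have [X [sX [W [oW Wu Wp WX]]]] := extend_cst (delta_mx 0 i) pu.
exists W; first exact: Wu.
have sF := smooth_on_entry 0 j oW (@smooth_onS R d _ _ _ _ Wp (sphi _ sX p)).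
apply: (smooth_on_eq oW _ sF) => z Wz; have [q pq qz] := Wp _ Wz.
rewrite -qz (field_chart _ pq) loc_endoE// -(field_chart X pq) qz WX//.
by rewrite -rowE mxE.
Qed.

Lemma smooth_loc_bil p (g : M -> {biscalar 'rV[R]_d}) :
  smooth_metric g -> smooth_on (chart_im p) (loc_bil p g).
Proof.
move=> sg; apply: (smooth_on_mx (@chart_im_open' _ _ _ p)) => i j.
apply: smooth_on_local => u pu.
have [X [sX [W [oW Wu Wp WX]]]] := extend_cst (delta_mx 0 i) pu.
have [Y [sY [W' [oW' Wu' Wp' WY]]]] := extend_cst (delta_mx 0 j) pu.
exists (W `&` W'); first by split.
have oWW := openI oW oW'.
have sF := @smooth_onS R d _ (W `&` W') _ _ (fun z H => Wp z H.1) (sg _ _ sX sY p).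
apply: (smooth_on_eq oWW _ sF) => z [Wz Wz']; have [q pq qz] := Wp _ Wz.
rewrite -qz /= chartK// (loc_bilE _ _ _ pq) -(field_chart X pq) -(field_chart Y pq).
by rewrite qz WX// WY// /bil -rowE trmx_delta -colE !mxE.
Qed.

End ManifoldData.

Section ThreeQuasiSasakianData.
Context {R : realType} {d : nat} {M : manifold R d} {g : riemannian_metric M}.
Implicit Types (p q : M) (u v w : 'rV[R]_d).

Section AlmostContactPoint.
Variables (A : almost_contact_metric g) (q : M).
Let phi := acm_phi A q.
Let xi := acm_xi A q.
Let eta := acm_eta A q.

Lemma acm_phi_xi : phi xi = 0.
Proof.
have E : phi (phi xi) = 0 by rewrite /phi acm_phi2 acm_eta_xi scale1r addNr.
have := acm_phi2 A q (acm_phi A q (acm_xi A q)); rewrite -/phi -/xi E linear0.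
move/eqP; rewrite eq_sym addrC subr_eq0 => /eqP F.
have := congr1 phi F; rewrite E linearZ/= -/phi -/xi => /eqP.
by rewrite scaler_eq0 => /orP[/eqP e0|/eqP ->//]; rewrite -F e0 scale0r.
Qed.

Lemma acm_eta_phi v : eta (phi v) = 0.
Proof.
have E1 : phi (phi v) = - v + eta v *: xi := acm_phi2 A q v.
have E2 : phi (phi (phi v)) = - phi v.
  by rewrite E1 linearD linearN linearZ/= acm_phi_xi scaler0 addr0.
have E3 : phi (phi (phi v)) = - phi v + eta (phi v) *: xi := acm_phi2 A q (phi v).
move: E3; rewrite E2 => /eqP; rewrite -subr_eq0 opprD addrA subrr sub0r oppr_eq0.
rewrite scaler_eq0 => /orP[/eqP //|/eqP x0].
by have := acm_eta_xi A q; rewrite -/xi x0 linear0 => /eqP; rewrite eq_sym oner_eq0.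
Qed.

Lemma acm_etaE v : eta v = g q xi v.
Proof.
have := acm_compat A q xi v; rewrite -/phi -/xi -/eta acm_phi_xi linear0l.
by rewrite /eta acm_eta_xi mul1r => /eqP; rewrite eq_sym subr_eq0 => /eqP.
Qed.

Lemma acm_skew u v : g q (phi u) v = - g q u (phi v).
Proof.
have := acm_compat A q u (phi v); rewrite -/phi acm_phi2 linearDr linearNr linearZr_LR/=.
have e1 : acm_eta A q (phi v) = 0 := acm_eta_phi v.
have e2 : g q (phi u) (acm_xi A q) = 0 by rewrite Defs.metric_sym -acm_etaE; exact: acm_eta_phi.
by rewrite e1 e2 !mulr0 addr0 subr0 => <-; rewrite opprK.
Qed.

End AlmostContactPoint.

Variable (S : 'I_3 -> almost_contact_metric g).
Hypothesis S3 : almost_3_contact S.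

Lemma acm_contact3 q : contact3 (g q) (fun i => acm_phi (S i) q) (fun i => acm_xi (S i) q).
Proof.
have A3 := (even_perm_cyclic3 _).1 S3.
split.
- by move=> a u v w; rewrite linearPl.
- exact: Defs.metric_sym.
- exact: metric_pos.
- by move=> i a u v; rewrite linearP.
- by move=> i v; rewrite acm_phi2 acm_etaE.
- by move=> i u v; rewrite acm_skew.
- by move=> a b c /A3 /(_ q) /= [_ [E F] _]; split; [exact: esym E|rewrite F opprK].
- move=> a b c /A3 /(_ q) /= [E _ _] v; have [F G] := E v.
  rewrite -!acm_etaE F; split; first by rewrite subrK.
  by rewrite -F G opprD opprK subrK.
Qed.

Lemma acm_unit q i : g q (acm_xi (S i) q) (acm_xi (S i) q) = 1.
Proof. by rewrite -acm_etaE acm_eta_xi. Qed.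

Variable p : M.
Let O := chart_im p.
Definition loc_g := loc_bil p g.
Definition loc_phi i := loc_endo p (acm_phi (S i)).
Definition loc_xi i := field_in_chart p (acm_xi (S i)).

Lemma loc_eta i q v : chart_dom (chart_at p) q ->
  acm_eta (S i) q v = pairing (loc_xi i (chart_at p q) *m loc_g (chart_at p q)) (tangent_coord p q v).
Proof.
by move=> pq; rewrite acm_etaE (loc_bilE _ _ _ pq) /loc_xi (field_chart _ pq).
Qed.

Lemma loc_fundamental i q v w : chart_dom (chart_at p) q ->
  fundamental_form (S i) q v w = bil (loc_g (chart_at p q)) (tangent_coord p q v)
    (tangent_coord p q w *m loc_phi i (chart_at p q)).
Proof.
by move=> pq; rewrite /fundamental_form (loc_bilE _ _ _ pq) loc_endoE.
Qed.

Lemma smooth_field_phi i X : smooth_field X -> smooth_field (fun x => acm_phi (S i) x (X x)).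
Proof. exact: (@acm_phi_smooth _ _ _ _ (S i)). Qed.

Hypothesis Q : forall i, quasi_sasakian (S i).

Lemma manifold_contact_data : contact_data O loc_g loc_phi loc_xi.
Proof.
have oO := @chart_im_open' _ _ _ p.
split.
- exact: (smooth_loc_bil (@metric_smooth _ _ _ g)).
- move=> i; exact: (smooth_loc_endo (@acm_phi_smooth _ _ _ _ (S i))).
- move=> i; exact: (@acm_xi_smooth _ _ _ _ (S i)).
- move=> _ [q pq <-]; apply: (@contact3_transport _ _ _ (tangent_coord p q) (tangent_of p q)
    (g q) (fun i => acm_phi (S i) q) (fun i => acm_xi (S i) q)) (acm_contact3 q).
  + by move=> v; rewrite tangent_ofK.
  + by move=> a u v; rewrite !(tangent_coord_mx pq) mulmxDl scalemxAl.
  + by apply: (can_inj (g := tangent_of p q)) => v; rewrite tangent_coordK.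
  + by move=> v w; rewrite -loc_bilE.
  + by move=> i v; rewrite loc_endoE.
  + by move=> i; rewrite /loc_xi (field_chart _ pq).
- move=> _ i [q pq <-].
  by rewrite /loc_xi (field_chart _ pq) -loc_bilE// acm_unit.
- move=> i W X Y u oW WO Wu sX sY.
  have [X' [sX' [W1 [oW1 W1u W1W WX]]]] := extend_field oW WO Wu sX.
  have [Y' [sY' [W2 [oW2 W2u W2W WY]]]] := extend_field oW WO Wu sY.
  have [q pq qu] := WO _ Wu.
  have := (Q i).1 X' Y' sX' sY' q => /(congr1 (tangent_coord p q)).
  have -> : tangent_coord p q 0 = 0 by rewrite (tangent_coord_mx pq) mul0mx.
  rewrite (tangent_coord_mx pq) mulmxDl -scalemxAl -!(tangent_coord_mx pq).
  move=> H; apply: etrans H; have Ou := WO _ Wu.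
  have oWW := openI oW1 oW2; have WWu : (W1 `&` W2) u by split.
  have n1 := nijenhuis_in_chart (fun x v (px : chart_dom (chart_at p) x) =>
    loc_endoE (acm_phi (S i)) v px) (@acm_phi_smooth _ _ _ _ (S i)) sX' sY' pq.
  have n2 := nijE_congr oWW WWu (fun z _ => erefl (loc_phi i z)) (fun z H => WX z H.1) (fun z H => WY z H.2).
  have d1 : d_eta (S i) X' Y' q = d1E (fun z v => pairing (loc_xi i z *m loc_g z) v)
      (field_in_chart p X') (field_in_chart p Y') (chart_at p q).
    apply: (d_form1_in_chart _ _ sX' sY' pq); first by move=> x v; exact: loc_eta.
    exact: acm_eta_smooth.
  have d2 := d1E_congr oWW WWu (fun z v _ => erefl (pairing (loc_xi i z *m loc_g z) v))
    (fun z H => WX z H.1) (fun z H => WY z H.2).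
  have x1 : tangent_coord p q (acm_xi (S i) q) = loc_xi i u.
    by rewrite -qu /loc_xi (field_chart _ pq).
  rewrite qu in n1 d1.
  exact: (congr2 (fun a b => a + b) (esym (etrans n1 n2))
    (congr2 (fun a b => (2 * a) *: b) (esym (etrans d1 d2)) (esym x1))).
- move=> i W X Y Z u oW WO Wu sX sY sZ.
  have [X' [sX' [W1 [oW1 W1u W1W WX]]]] := extend_field oW WO Wu sX.
  have [Y' [sY' [W2 [oW2 W2u W2W WY]]]] := extend_field oW WO Wu sY.
  have [Z' [sZ' [W3 [oW3 W3u W3W WZ]]]] := extend_field oW WO Wu sZ.
  have [q pq qu] := WO _ Wu.
  have := (Q i).2 X' Y' Z' sX' sY' sZ' q.
  move=> H; apply: etrans H.
  have oWW := openI (openI oW1 oW2) oW3; have WWu : (W1 `&` W2 `&` W3) u by split.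
  have d1 : d_form2 (fundamental_form (S i)) X' Y' Z' q = d2E (fun z v w => bil (loc_g z) v (w *m loc_phi i z))
      (field_in_chart p X') (field_in_chart p Y') (field_in_chart p Z') (chart_at p q).
    apply: (d_form2_in_chart _ _ sX' sY' sZ' pq); first by move=> x v v'; exact: loc_fundamental.
    by move=> A B sA sB; exact: (@metric_smooth _ _ _ g _ _ sA (smooth_field_phi i sB)).
  rewrite qu in d1; apply/esym/(etrans d1).
  exact: (d2E_congr oWW WWu (fun _ _ _ _ => erefl) (fun z H => WX z H.1.1)
    (fun z H => WY z H.1.2) (fun z H => WZ z H.2)).
Qed.

Lemma loc_reeb_bracket c : reeb_bracket_constant S c ->
  forall a b e, cyclic3 a b e -> forall u, O u -> lbr (loc_xi a) (loc_xi b) u = c *: loc_xi e u.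
Proof.
move=> /even_perm_cyclic3 B a b e abe _ [q pq <-].
rewrite -bracket_in_chart//; [|exact: acm_xi_smooth..].
rewrite (B _ _ _ abe q) /loc_xi (field_chart _ pq).
by rewrite !(tangent_coord_mx pq) scalemxAl.
Qed.

Lemma d_eta_at i X Y : smooth_field X -> smooth_field Y ->
  d_eta (S i) X Y p = bil (curl (fun z => loc_xi i z *m loc_g z) (chart_at p p)) (X p) (Y p).
Proof.
move=> sX sY; have pp := chart_at_dom p; have oO := @chart_im_open' _ _ _ p.
have sn : smooth_on O (fun z => loc_xi i z *m loc_g z).
  apply: (smooth_on_mulmx oO (@acm_xi_smooth _ _ _ _ (S i) p)).
  exact: (smooth_loc_bil (@metric_smooth _ _ _ g)).
have d1 : d_eta (S i) X Y p = d1E (fun z v => pairing (loc_xi i z *m loc_g z) v)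
      (field_in_chart p X) (field_in_chart p Y) (chart_at p p).
  apply: d_form1_in_chart => //; first by move=> x v; exact: loc_eta.
  exact: acm_eta_smooth.
by rewrite d1 (d1E_curl oO sn (sX p) (sY p)) ?field_at//; exists p.
Qed.

End ThreeQuasiSasakianData.

Arguments loc_g {R d M} g p _.

(** * The rank *)

Section ExtendPermutation.
Variable N : nat.

Definition ext_perm (t : 'S_N) : 'S_(2 + N) := lift_perm 0 0 (lift_perm 0 0 t).

Lemma ext_perm_odd t : odd_perm (ext_perm t) = odd_perm t.
Proof. by rewrite /ext_perm !odd_lift_perm. Qed.

Lemma ext_perm_rshift t j : ext_perm t (rshift 2 j) = rshift 2 (t j).
Proof.
have rE (l : 'I_N) : rshift 2 l = lift 0 (lift 0 l) by apply/val_inj; rewrite /= /bump.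
by rewrite !rE /ext_perm !lift_perm_lift.
Qed.

Lemma ext_perm_lshift t i : ext_perm t (lshift N i) = lshift N i.
Proof.
have l0 : lshift N (0 : 'I_2) = 0 by apply/val_inj.
have l1 : lshift N (1 : 'I_2) = lift 0 (0 : 'I_N.+1) by apply/val_inj.
have [->|->] : i = 0 \/ i = 1 by case: i => -[|[|//]] ?; [left|right]; apply/val_inj.
  by rewrite l0 /ext_perm lift_perm_id.
by rewrite l1 /ext_perm lift_perm_lift lift_perm_id.
Qed.

Lemma ext_perm_ex (s : 'S_(2 + N)) : (forall i, s (lshift N i) = lshift N i) ->
  exists t, s = ext_perm t.
Proof.
move=> sl; have sr j : exists j', s (rshift 2 j) = rshift 2 j'.
  have [i E|j' ->] := split_ordP (s (rshift 2 j)); last by exists j'.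
  by move: E; rewrite -sl => /perm_inj /eqP; rewrite eq_rlshift.
have [f fE] := choice sr.
have fi : injective f.
  by move=> j j' ff; apply: (@rshift_inj 2 N); apply: (@perm_inj _ s); rewrite !fE ff.
exists (perm fi); apply/permP => x; have [i ->|j ->] := split_ordP x.
  by rewrite ext_perm_lshift sl.
by rewrite ext_perm_rshift permE fE.
Qed.

End ExtendPermutation.

Section Alternating.
Context {R : realType} {V : lmodType R}.
Implicit Types (k m : nat).

Definition upd k (v : 'I_k -> V) i z : 'I_k -> V := fun j => if j == i then z else v j.

Definition slot_linear k (f : ('I_k -> V) -> R) :=
  forall v i a x y, f (upd v i (a *: x + y)) = a * f (upd v i x) + f (upd v i y).

Definition alt k (f : ('I_k -> V) -> R) (v : 'I_k -> V) : R :=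
  \sum_(s : 'S_k) (-1) ^+ s * f (fun i => v (s i)).

Lemma upd_perm k (v : 'I_k -> V) i z (s : 'S_k) :
  (fun j => upd v i z (s j)) = upd (fun j => v (s j)) (s^-1%g i) z.
Proof.
apply/funext => j; rewrite /upd; congr (if _ then _ else _).
by rewrite -{1}(permKV s i) (inj_eq perm_inj).
Qed.

Lemma slot_linear_prod k l (f : ('I_k -> V) -> R) (h : ('I_l -> V) -> R) :
  slot_linear f -> slot_linear h ->
  slot_linear (fun v : 'I_(k + l) -> V =>
    f (fun i => v (lshift l i)) * h (fun j => v (rshift k j))).
Proof.
move=> lf lh v i a x y; case: (split_ordP i) => j ->.
  have El z : (fun i' => upd v (lshift l j) z (lshift l i')) = upd (fun i' => v (lshift l i')) j z.
    by apply/funext => i'; rewrite /upd (inj_eq (@lshift_inj _ _)).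
  have Er z : (fun i' => upd v (lshift l j) z (rshift k i')) = (fun i' => v (rshift k i')).
    by apply/funext => i'; rewrite /upd eq_rlshift.
  by rewrite !El !Er lf mulrDl mulrA.
have El z : (fun i' => upd v (rshift k j) z (lshift l i')) = (fun i' => v (lshift l i')).
  by apply/funext => i'; rewrite /upd eq_lrshift.
have Er z : (fun i' => upd v (rshift k j) z (rshift k i')) = upd (fun i' => v (rshift k i')) j z.
  by apply/funext => i'; rewrite /upd (inj_eq (@rshift_inj _ _)).
by rewrite !El !Er lh mulrDr mulrCA.
Qed.

Lemma slot_linear_alt k (f : ('I_k -> V) -> R) : slot_linear f -> slot_linear (alt f).
Proof.
move=> lf v i a x y; rewrite /alt mulr_sumr -big_split; apply: eq_bigr => s _.
by rewrite !upd_perm lf mulrDr; congr (_ + _); exact: mulrCA.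
Qed.

Lemma slot_linearZ k (c : R) (f : ('I_k -> V) -> R) : slot_linear f ->
  slot_linear (fun v => c * f v).
Proof. by move=> lf v i a x y; rewrite lf; ring. Qed.

Lemma alt_perm k (f : ('I_k -> V) -> R) v (t : 'S_k) :
  alt f (fun i => v (t i)) = (-1) ^+ t * alt f v.
Proof.
rewrite /alt mulr_sumr (reindex_inj (mulIg t^-1%g)) /=; apply: eq_bigr => s _.
rewrite odd_permM odd_permV mulrA addbC signr_addb; congr (_ * f _).
by apply/funext => i; rewrite permM permKV.
Qed.

Lemma alt_eq0 k (f : ('I_k -> V) -> R) v i j : i != j -> v i = v j -> alt f v = 0.
Proof.
move=> ij vij; have := alt_perm f v (tperm i j); rewrite odd_tperm ij expr1 mulN1r.
have -> : (fun l => v (tperm i j l)) = v.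
  by apply/funext => l; case: tpermP => [->|->|].
by move/eqP; rewrite -addr_eq0 -mulr2n mulrn_eq0 => /eqP.
Qed.

Lemma alt_dependent k (f : ('I_k -> V) -> R) v (x : 'I_k -> R) i0 :
  slot_linear f -> x i0 != 0 -> \sum_i x i *: v i = 0 -> alt f v = 0.
Proof.
move=> lf xi0 xv; have la := slot_linear_alt lf.
have updv : upd v i0 (v i0) = v by apply/funext => j; rewrite /upd; case: eqP => // ->.
have l0 : alt f (upd v i0 0) = 0.
  have := la v i0 1 0 0; rewrite scaler0 addr0 mul1r => /eqP.
  by rewrite eq_sym -subr_eq0 addrK => /eqP.
have lZ a z : alt f (upd v i0 (a *: z)) = a * alt f (upd v i0 z).
  by have := la v i0 a z 0; rewrite addr0 l0 addr0.
have lD (y z : V) : alt f (upd v i0 (y + z)) = alt f (upd v i0 y) + alt f (upd v i0 z).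
  by have := la v i0 1 y z; rewrite scale1r mul1r.
have : alt f (upd v i0 (\sum_i x i *: v i)) = 0 by rewrite xv.
rewrite (big_morph (fun z => alt f (upd v i0 z)) lD l0) (bigD1 i0)//= lZ updv big1 ?addr0.
  by move/eqP; rewrite mulf_eq0 (negbTE xi0) => /eqP.
move=> i ii0; rewrite lZ (@alt_eq0 _ _ _ i i0) ?mulr0// /upd eqxx.
by rewrite (negbTE ii0).
Qed.

Variable w : V -> V -> R.
Hypothesis w_linl : forall a x y z, w (a *: x + y) z = a * w x z + w y z.
Hypothesis w_skew : forall x y, w x y = - w y x.

Definition pairform : ('I_2 -> V) -> R := fun v => w (v 0) (v 1).

Fixpoint alt_pow m : ('I_(m * 2) -> V) -> R :=
  if m is m'.+1 then fun v =>
    (2 + m' * 2)`!%:R^-1 * alt (fun v : 'I_(2 + m' * 2) -> V =>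
      pairform (fun i => v (lshift (m' * 2) i)) * @alt_pow m' (fun j => v (rshift 2 j))) v
  else fun _ => 1.

Fixpoint pair_prod m : ('I_(m * 2) -> V) -> R :=
  if m is m'.+1 then fun v : 'I_(2 + m' * 2) -> V =>
    pairform (fun i => v (lshift (m' * 2) i)) * @pair_prod m' (fun j => v (rshift 2 j))
  else fun _ => 1.

Lemma slot_linear_pairform : slot_linear pairform.
Proof.
have lr a x y z : w z (a *: x + y) = a * w z x + w z y.
  by rewrite w_skew w_linl (w_skew x) (w_skew y); ring.
move=> v i a x y; rewrite /pairform /upd.
have [->|->] : i = 0 \/ i = 1 by case: i => -[|[|//]] ?; [left|right]; apply/val_inj.
  exact: w_linl.
exact: lr.
Qed.

Lemma slot_linear_alt_pow m : slot_linear (@alt_pow m).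
Proof.
elim: m => [v [] //|m IH]; apply: slot_linearZ; apply: slot_linear_alt.
exact: slot_linear_prod slot_linear_pairform IH.
Qed.

Lemma alt_powE m v : @alt_pow m v = (m * 2)`!%:R^-1 * alt (@pair_prod m) v.
Proof.
elim: m v => [|m IH] v.
  rewrite /alt /= (eq_bigr (fun=> 1)) => [|s _]; last first.
    have -> : s = 1%g by apply/permP => -[].
    by rewrite odd_perm1 mulr1.
  rewrite big_const card_Sn iter_addr_0 /=.
  by rewrite fact0 invr1 mul1r.
rewrite [LHS]/=; congr (_ * _); rewrite /alt.
pose N := (m * 2)%N; pose ext := @ext_perm N.
pose F (s : 'S_(2 + N)) := @pair_prod m.+1 (fun i => v (s i)).
transitivity (N`!%:R^-1 * \sum_(t : 'S_N) \sum_(s : 'S_(2 + N)) (-1) ^+ s * F s).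
  transitivity (N`!%:R^-1 * \sum_(t : 'S_N) \sum_(s : 'S_(2 + N)) (-1) ^+ s * (-1) ^+ t * F (ext t * s)%g).
    rewrite exchange_big mulr_sumr; apply: eq_bigr => s _.
    rewrite IH /alt mulrCA mulrA mulrCA mulr_sumr; congr (_ * _); apply: eq_bigr => t _.
    have -> : F (ext t * s)%g = pairform (fun i => v (s (lshift N i))) *
        pair_prod (fun j => v (s (rshift 2 (t j)))).
      rewrite -[LHS]/(pairform (fun i => v ((ext t * s)%g (lshift N i))) *
        pair_prod (fun j => v ((ext t * s)%g (rshift 2 j)))).
      by apply: (congr2 (fun a b => pairform a * pair_prod b)); apply/funext => i;
        rewrite permM ?ext_perm_lshift ?ext_perm_rshift.
    have alg (A B C D : R) : A * B * (C * D) = B * C * (A * D) by ring.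
    exact: alg.
  congr (_ * _); apply: eq_bigr => t _.
  rewrite (reindex_inj (mulgI (ext t)^-1%g)) /=; apply: eq_bigr => s _.
  rewrite mulgA mulgV mul1g odd_permM odd_permV ext_perm_odd -signr_addb.
  by rewrite addbC addbA addbb addFb.
by rewrite sumr_const card_Sn -[X in _ * X]mulr_natl mulrA mulVf ?mul1r// pnatr_eq0 -lt0n fact_gt0.
Qed.

Definition symplectic_pairs m (v : 'I_(m * 2) -> V) := forall i j : 'I_(m * 2),
  (i./2 != j./2 -> w (v i) (v j) = 0) /\
  (i./2 = j./2 -> ~~ odd i -> odd j -> 0 < w (v i) (v j)).

Lemma pair_prod_ge0 m v (s : 'S_(m * 2)) : symplectic_pairs v ->
  0 <= (-1) ^+ s * pair_prod (fun i => v (s i)).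
Proof.
elim: m v s => [|m IH] v s PS.
  have -> : s = 1%g by apply/permP => -[].
  by rewrite odd_perm1 mulr1.
pose N := (m * 2)%N.
pose i0 : 'I_(2 + N) := lshift N (0 : 'I_2); pose i1 : 'I_(2 + N) := lshift N (1 : 'I_2).
have prodE (u : 'I_(2 + N) -> V) :
  @pair_prod m.+1 u = w (u i0) (u i1) * @pair_prod m (fun j => u (rshift 2 j)) by [].
have i01 : i0 != i1 by [].
have w0 x : w x x = 0.
  by have /eqP := w_skew x x; rewrite -addr_eq0 -mulr2n mulrn_eq0 => /eqP.
wlog s01 : s / (s i0 < s i1)%N.
  move=> H; have [/H //|s10] := ltnP (s i0) (s i1).
  have := H (tperm i0 i1 * s)%g; rewrite !permM tpermL tpermR.
  have s10' : (s i1 < s i0)%N.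
    by rewrite ltn_neqAle s10 andbT (inj_eq val_inj) (inj_eq perm_inj) eq_sym.
  move=> /(_ s10'); rewrite odd_permM odd_tperm i01 addTb signrN !prodE !permM tpermL tpermR.
  have -> : (fun j => v ((tperm i0 i1 * s)%g (rshift 2 j))) = (fun j => v (s (rshift 2 j))).
    by apply/funext => j; rewrite permM tpermD.
  by rewrite w_skew !mulNr mulrN opprK.
rewrite prodE; move: s01; move Ea : (s i0) => a; move Eb : (s i1) => b s01.
have [ab|nab] := eqVneq a./2 b./2; last by rewrite (PS a b).1// mul0r mulr0.
have [ea ob] : ~~ odd a /\ odd b by move: s01 ab; lia.
have a2 : (a : nat) = (a./2).*2 by lia.
have b2 : (b : nat) = (a./2).*2.+1 by move: ab; lia.
pose tau := (tperm i0 a * tperm i1 b)%g.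
have ne (x y : 'I_(2 + N)) : (x : nat) <> y -> x != y by move=> H; apply/eqP => E; apply: H; rewrite E.
have ab' : a != b by apply/eqP => E; move: ea; rewrite E ob.
have i1a : i1 != a by apply/eqP => E; move: ea; rewrite -E.
have i0b : i0 != b by apply/eqP => E; move: ob; rewrite -E.
have t0 : tau i0 = a by rewrite permM tpermL tpermD// eq_sym.
have t1 : tau i1 = b by rewrite permM (@tpermD _ i0 a i1)// 1?eq_sym// tpermL.
pose f h := if h == 0%N then a./2 else if h == a./2 then 0%N else h.
have fi h h' : f h = f h' -> h = h' by rewrite /f; do ?case: eqP; lia.
have tauE x : odd (tau x) = odd x /\ (tau x)./2 = f x./2.
  have [->|x0] := eqVneq x i0; first by rewrite t0 /f /=; split; lia.
  have [->|x1] := eqVneq x i1; first by rewrite t1 /f /=; split; lia.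
  have [xa|xa] := eqVneq x a.
    have -> : tau x = i0 by rewrite xa permM tpermR tpermD// eq_sym.
    by rewrite xa /f /=; split; [lia|do ?case: eqP; lia].
  have [xb|xb] := eqVneq x b.
    have -> : tau x = i1.
      by rewrite xb permM (@tpermD _ i0 a b)// ?tpermR.
    by rewrite xb /f /=; split; [lia|do ?case: eqP; lia].
  have -> : tau x = x by rewrite permM !tpermD// eq_sym.
  split=> //; rewrite /f.
  have nx (y : 'I_(2 + N)) : x != y -> (x : nat) <> y by move=> /eqP H E; apply: H; apply/val_inj.
  have n0 : (x : nat) <> 0%N := nx _ x0; have n1 : (x : nat) <> 1%N := nx _ x1.
  have nb : (x : nat) <> (a./2).*2.+1 by rewrite -b2; exact: nx xb.
  have na : (x : nat) <> (a./2).*2 by rewrite -a2; exact: nx xa.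
  have -> : (x./2 == 0)%N = false by lia.
  by have -> : (x./2 == a./2)%N = false by lia.
have odd_tau : odd_perm tau = false.
  rewrite odd_permM !odd_tperm.
  have -> : (i1 != b) = (i0 != a).
    rewrite -!(inj_eq val_inj) /= b2 a2; lia.
  by rewrite addbb.
pose s' := (s * tau^-1)%g; pose v' x := v (tau x).
have vs x : v (s x) = v' (s' x) by rewrite /v' /s' permM permKV.
have s'0 : s' i0 = i0 by rewrite /s' permM Ea -t0 permK.
have s'1 : s' i1 = i1 by rewrite /s' permM Eb -t1 permK.
have odds' : odd_perm s = odd_perm s' by rewrite /s' odd_permM odd_permV odd_tau addbF.
have PS' : forall i j : 'I_(2 + N), (i./2 != j./2 -> w (v' i) (v' j) = 0) /\
    (i./2 = j./2 -> ~~ odd i -> odd j -> 0 < w (v' i) (v' j)).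
  move=> i j; have [Ei Hi] := tauE i; have [Ej Hj] := tauE j; split=> [ij|ij oi oj].
    by apply: (PS (tau i) (tau j)).1; rewrite Hi Hj; apply: contra_neq ij => /fi.
  by apply: (PS (tau i) (tau j)).2; rewrite ?Ei ?Ej// Hi Hj ij.
have [t st] : exists t, s' = ext_perm t.
  apply: ext_perm_ex => i.
  by have [->|->] : i = 0 \/ i = 1 by case: i => -[|[|//]] ?; [left|right]; apply/val_inj.
have -> : v a = v' i0 by rewrite -Ea vs s'0.
have -> : v b = v' i1 by rewrite -Eb vs s'1.
have -> : (fun j => v (s (rshift 2 j))) = (fun j => v' (rshift 2 (t j))).
  by apply/funext => j; rewrite vs st ext_perm_rshift.
rewrite odds' st ext_perm_odd mulrCA mulr_ge0//.
  by apply/ltW/(PS' i0 i1).2.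
apply: (IH (fun j => v' (rshift 2 j))) => i j; split=> [ij|ij oi oj].
  by apply: (PS' _ _).1; rewrite /= eqSS.
by apply: (PS' _ _).2; rewrite /= ?negbK ?ij.
Qed.

Lemma pair_prod_gt0 m v : symplectic_pairs v -> 0 < @pair_prod m v.
Proof.
elim: m v => [|m IH] v PS; first exact: ltr01.
rewrite -[pair_prod v]/(w (v (lshift (m * 2) (0 : 'I_2))) (v (lshift (m * 2) (1 : 'I_2))) *
  @pair_prod m (fun j => v (rshift 2 j))) mulr_gt0//.
  by apply: (PS _ _).2.
apply: IH => i j; split=> [ij|ij oi oj].
  by apply: (PS _ _).1; rewrite /= eqSS.
by apply: (PS _ _).2; rewrite /= ?negbK ?ij.
Qed.

Lemma alt_pow_gt0 m v : symplectic_pairs v -> 0 < @alt_pow m v.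
Proof.
move=> PS; rewrite alt_powE mulr_gt0 ?invr_gt0 ?ltr0n ?fact_gt0//.
rewrite /alt (bigD1 1%g)//= odd_perm1 mul1r ltr_pwDl//.
  have -> : (fun i => v ((1%g : 'S_(m * 2)) i)) = v by apply/funext => i; rewrite perm1.
  exact: pair_prod_gt0.
by apply: sumr_ge0 => s _; exact: pair_prod_ge0.
Qed.

End Alternating.

Section RankAtPoint.
Context {R : realType} {d : nat}.
Variables (G P : 'M[R]_d) (phi : 'M[R]_d) (xi : 'rV[R]_d) (h : R).
Hypothesis h0 : h != 0.
Hypothesis G_sym : G^T = G.
Hypothesis G_pos : forall v, v != 0 -> 0 < bil G v v.
Hypothesis P2 : P *m P = P.
Hypothesis P_sym : P *m G = G *m P^T.
Hypothesis P_phi : P *m phi = phi *m P.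
Hypothesis phi_skew : forall v w, bil G (v *m phi) w = - bil G v (w *m phi).
Hypothesis phi2 : forall v, bil G xi v = 0 -> v *m phi *m phi = - v.
Hypothesis xi_phi : xi *m phi = 0.
Hypothesis xi_P : xi *m P = xi.
Let w u v := bil (h *: (P *m G *m phi^T)) u v.
Let eta v := pairing (xi *m G) v.

Let wE u v : w u v = h * bil G (u *m P) (v *m phi).
Proof. by rewrite /w bilZ bilMT bilM. Qed.

Let bilGC u v : bil G u v = bil G v u.
Proof. by rewrite bilC G_sym. Qed.

Let P_symE u v : bil G (u *m P) v = bil G u (v *m P).
Proof. by rewrite -bilM P_sym bilMT. Qed.

Let w_skew u v : w u v = - w v u.
Proof.
by rewrite !wE (bilGC (u *m P)) phi_skew -mulmxA P_phi mulmxA -P_symE mulrN.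
Qed.

Let w_linl a u v z : w (a *: u + v) z = a * w u z + w v z.
Proof. by rewrite /w bilDl bilZl. Qed.

Let w_P u v : w u v = w (u *m P) (v *m P).
Proof. by rewrite !wE -[u *m P *m P]mulmxA P2 -mulmxA P_phi mulmxA -P_symE -mulmxA P2. Qed.

Let eta_P v : eta v = eta (v *m P).
Proof. by rewrite /eta -!bil_pairing -P_symE xi_P. Qed.

Lemma kernel_vector (A : 'M[R]_d) (n : nat) (C : 'M[R]_(d, n)) : (n < \rank A)%N ->
  exists2 v : 'rV[R]_d, v != 0 & v *m C = 0 /\ exists x, v = x *m A.
Proof.
move=> nA; have := mxrank_mul_ker A C => rk.
have : (0 < \rank (A :&: kermx C)%MS)%N.
  rewrite -(ltn_add2l (\rank (A *m C))) addn0 rk; apply: leq_ltn_trans nA; exact: rank_leq_col.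
rewrite lt0n mxrank_eq0 => K0.
have [i Ki] : exists i, row i (A :&: kermx C)%MS != 0.
  by apply/existsP; apply: contraNT K0 => /existsPn H; apply/eqP/row_matrixP => i;
    rewrite row0; apply/eqP; move: (H i); rewrite negbK.
exists (row i (A :&: kermx C)%MS) => //.
have := row_sub i (A :&: kermx C)%MS; rewrite sub_capmx => /andP[/submxP[x ->] /sub_kermxP ->].
by split=> //; exists x.
Qed.

Lemma orthogonal_pairs m : (2 * m <= \rank P)%N -> exists a : nat -> 'rV[R]_d,
  (forall i, (i < m)%N -> [/\ a i != 0, a i *m P = a i & bil G xi (a i) = 0]) /\
  (forall i j, (i < m)%N -> (j < m)%N -> i != j -> bil G (a i) (a j) = 0) /\
  (forall i j, (i < m)%N -> (j < m)%N -> bil G (a i) (a j *m phi) = 0).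
Proof.
elim: m => [|m IH] rk; first by exists (fun=> 0).
have [|a [a1 [a2 a3]]] := IH; first by lia.
pose C : 'M[R]_(d, 1 + (m + m)) := row_mx (G *m xi^T)
  (row_mx (\matrix_(i < d, j < m) (a j *m G) 0 i) (\matrix_(i < d, j < m) (a j *m phi *m G) 0 i)).
have [|v v0 [vC [x vx]]] := @kernel_vector P _ C; first by lia.
have sum0 (y : nat -> 'rV[R]_d) : v *m (\matrix_(i < d, j < m) (y j *m G) 0 i) = 0 ->
    forall j, (j < m)%N -> bil G v (y j) = 0.
  move=> H j jm; rewrite bilGC bilC G_sym; have /matrixP /(_ 0 (Ordinal jm)) := H.
  rewrite !mxE => <-; rewrite bilGC /bil mxE; apply: eq_bigr => i _.
  by rewrite !mxE mulrC.
have [vxi [va vb]] : bil G xi v = 0 /\ (forall j, (j < m)%N -> bil G v (a j) = 0) /\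
    (forall j, (j < m)%N -> bil G v (a j *m phi) = 0).
  move: vC; rewrite /C !mul_mx_row => vC; split; last split.
  - have := congr1 lsubmx vC; rewrite row_mxKl => /matrixP /(_ 0 0).
    by rewrite mulmxA !mxE => H; rewrite bilGC /bil mxE.
  - by apply: sum0; have := congr1 lsubmx (congr1 rsubmx vC); rewrite row_mxKr row_mxKl !linear0.
  - by apply: (sum0 (fun j => a j *m phi)); have := congr1 rsubmx (congr1 rsubmx vC);
      rewrite !row_mxKr !linear0.
exists (fun i => if (i < m)%N then a i else v).
have vP : v *m P = v by rewrite vx -mulmxA P2.
have self z : bil G z (z *m phi) = 0.
  have := phi_skew z z; rewrite bilGC => /eqP.
  by rewrite -addr_eq0 -mulr2n mulrn_eq0 => /eqP.
split; [|split].
- by move=> i _; case: ifP => [im|_]; [exact: a1|split].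
- move=> i j; rewrite !ltnS => im jm ij; case: ltnP => mi; case: ltnP => mj.
  + exact: a2.
  + by rewrite bilGC va.
  + by rewrite va.
  + by move: ij; rewrite (anti_leq (_ : i <= m <= i)%N) ?im// (anti_leq (_ : j <= m <= j)%N) ?jm// eqxx.
- move=> i j im jm; case: ltnP => mi; case: ltnP => mj.
  + exact: a3.
  + by rewrite bilGC phi_skew vb// oppr0.
  + exact: vb.
  + exact: self.
Qed.

Lemma symplectic_pairs_ex m : (2 * m <= \rank P)%N ->
  exists v : 'I_(m * 2) -> 'rV[R]_d, symplectic_pairs w v.
Proof.
move=> /orthogonal_pairs [a [a1 [a2 a3]]].
exists (fun i => if odd i then - (h *: (a i./2 *m phi)) else a i./2).
have wa i u : (i < m)%N -> w (a i) u = h * bil G (a i) (u *m phi).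
  by move=> /a1 [_ aP _]; rewrite wE aP.
have app i : (i < m)%N -> a i *m phi *m phi = - a i.
  by move=> /a1 [_ _ xa]; exact: phi2.
have wab i j : (i < m)%N -> (j < m)%N -> w (a i) (- (h *: (a j *m phi))) = h ^+ 2 * bil G (a i) (a j).
  move=> im jm; rewrite wa// mulNmx -scalemxAl app// scalerN opprK bilZr expr2.
  by rewrite mulrA.
have bound (i : 'I_(m * 2)) : (i./2 < m)%N by have := ltn_ord i; lia.
move=> i j; have im := bound i; have jm := bound j; split=> [ij|ij oi oj].
  case: ifP => oi; case: ifP => oj.
  - have [_ aP _] := a1 _ im; rewrite wE.
    have -> : - (h *: (a i./2 *m phi)) *m P = - (h *: (a i./2 *m phi)).
      by rewrite mulNmx -scalemxAl -mulmxA -P_phi mulmxA aP.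
    rewrite mulNmx -scalemxAl app// scalerN opprK bilNl bilZl bilZr bilGC a3//.
    by rewrite !mulr0 oppr0 mulr0.
  - by rewrite w_skew wab// a2 ?mulr0 ?oppr0// eq_sym.
  - by rewrite wab// a2 ?mulr0.
  - by rewrite wa// a3 ?mulr0.
rewrite (negbTE oi) oj -ij wab// mulr_gt0 ?exprn_even_gt0 ?h0//.
by apply: G_pos; have [] := a1 _ im.
Qed.

Lemma rank_le m : (forall v : 'I_(m.+1 * 2) -> 'rV[R]_d, alt_pow w v = 0) ->
  (\rank P <= (2 * m).+1)%N.
Proof.
move=> w0; rewrite leqNgt; apply/negP => rk.
have [|v PS] := @symplectic_pairs_ex m.+1; first by lia.
by have := alt_pow_gt0 w_skew PS; rewrite w0 ltxx.
Qed.

Definition alt_eta_pow m (v : 'I_(1 + m * 2) -> 'rV[R]_d) : R :=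
  alt (fun v : 'I_(1 + m * 2) -> 'rV[R]_d =>
    eta (v (lshift (m * 2) 0)) * alt_pow w (fun j => v (rshift 1 j))) v.

Let alt_pow_P m v : @alt_pow R _ w m v = alt_pow w (fun i => v i *m P).
Proof.
elim: m v => [//|m IH] v /=; congr (_ * _); apply: eq_bigr => s _.
by congr (_ * (_ * _)); [exact: w_P|exact: IH].
Qed.

Lemma rank_ge m v : @alt_eta_pow m v != 0 -> (2 * m < \rank P)%N.
Proof.
move=> v0; rewrite ltnNge; apply/negP => rk; move/eqP: v0; apply.
have -> : alt_eta_pow v = alt_eta_pow (fun i => v i *m P).
  apply: eq_bigr => s _; congr (_ * (_ * _)); [exact: eta_P|exact: alt_pow_P].
pose B : 'M[R]_(1 + m * 2, d) := \matrix_i (v i *m P).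
have : (\rank B <= 2 * m)%N.
  apply: leq_trans rk; apply: mxrankS; apply/row_subP => i.
  by rewrite rowK; exact: submxMl.
move=> rkB; have : kermx B != 0.
  by rewrite -mxrank_eq0 mxrank_ker -lt0n; lia.
move=> K0; have [i Ki] : exists i, row i (kermx B) != 0.
  by apply/existsP; apply: contraNT K0 => /existsPn H; apply/eqP/row_matrixP => i;
    rewrite row0; apply/eqP; move: (H i); rewrite negbK.
have [j xj] : exists j, row i (kermx B) 0 j != 0.
  by apply/existsP; apply: contraNT Ki => /existsPn H; apply/eqP/rowP => j;
    rewrite [RHS]mxE; apply/eqP; move: (H j); rewrite negbK.
apply: (@alt_dependent _ _ _ _ _ (fun j => row i (kermx B) 0 j) j _ xj).
  have le : slot_linear (fun u : 'I_1 -> 'rV[R]_d => eta (u 0)).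
    move=> u l a x y; rewrite /upd !ord1 eqxx /eta -!bil_pairing !(bilGC xi).
    by rewrite bilDl bilZl.
  have H := @slot_linear_prod R _ 1 (m * 2) _ _ le (slot_linear_alt_pow w_linl w_skew (m := m)).
  exact: H.
have : row i (kermx B) *m B = 0.
  by apply/sub_kermxP; exact: row_sub.
rewrite mulmx_sum_row => E; apply: etrans E; apply: eq_bigr => l _; by rewrite rowK.
Qed.

End RankAtPoint.

Section RankOfProjection.
Context {R : realType} {d : nat} {M : manifold R d} {g : riemannian_metric M}.
Variable (A : almost_contact_metric g) (p : M) (w : 'rV[R]_d -> 'rV[R]_d -> R).
Hypothesis d_etaE : forall X Y, smooth_field X -> smooth_field Y ->
  d_eta A X Y p = w (X p) (Y p).

Lemma wedge_powE m V : (forall i, smooth_field (V i)) ->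
  wedge_pow (d_eta_form A) m V p = alt_pow w (fun i => V i p).
Proof.
elim: m V => [//|m IH] V sV; rewrite /= /wedge /alt; congr (_ * _); apply: eq_bigr => s _.
congr (_ * (_ * _)); first exact: d_etaE.
exact: (IH (fun j => V (s (rshift 2 j)))).
Qed.

Lemma has_rank_alt r : has_rank A r -> exists m, [/\ r = (2 * m).+1,
  (exists v : 'I_(1 + m * 2) -> 'rV[R]_d, alt (fun v : 'I_(1 + m * 2) -> 'rV[R]_d =>
    acm_eta A p (v (lshift (m * 2) 0)) * alt_pow w (fun j => v (rshift 1 j))) v != 0) &
  forall v : 'I_(m.+1 * 2) -> 'rV[R]_d, alt_pow w v = 0].
Proof.
move=> [m [rm nz z]]; exists m; split=> //.
  have [V sV Vp] := nz p; exists (fun i => V i p).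
  apply/eqP => E; apply: Vp; rewrite /wedge; apply/eqP.
  rewrite mulf_eq0 invr_eq0; apply/orP; right; apply/eqP; rewrite -[RHS]E.
  apply: eq_bigr => s _; congr (_ * (_ * _)).
  exact: (wedge_powE (fun j => sV (s (rshift 1 j)))).
move=> v; have pp : chart_im p (chart_at p p) by exists p => //; exact: chart_at_dom.
have ex i : exists X, smooth_field X /\ X p = v i.
  have [X [sX [W [_ Wp _ WX]]]] := extend_cst (v i) pp; exists X; split=> //.
  by rewrite -(WX _ Wp) field_at.
have [V VE] := choice ex; have := z V (fun i => (VE i).1) p.
rewrite wedge_powE => [<-|i]; last exact: (VE i).1.
by congr (alt_pow w _); apply/funext => i; rewrite (VE i).2.
Qed.

End RankOfProjection.

Lemma projection_rank (R : realType) (d : nat) (M : manifold R d) (g : riemannian_metric M)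
    (S : 'I_3 -> almost_contact_metric g) (p : M) (i : 'I_3) (P : 'M[R]_d) (h : R) (r : nat) :
  almost_3_contact S -> (forall i, quasi_sasakian (S i)) -> has_rank (S i) r -> h != 0 ->
  let u := chart_at p p in
  P *m P = P -> P *m loc_g g p u = loc_g g p u *m P^T -> P *m loc_phi S p i u = loc_phi S p i u *m P ->
  loc_xi S p i u *m P = loc_xi S p i u ->
  curl (fun z => loc_xi S p i z *m loc_g g p z) u = h *: (P *m loc_g g p u *m (loc_phi S p i u)^T) ->
  \rank P = r.
Proof.
move=> S3 Q rk h0 u P2 Pg Pphi Pxi cu.
have pp : chart_im p u by exists p => //; exact: chart_at_dom.
have D := manifold_contact_data S3 p Q; have C := cd_contact D pp.
have d_etaE X Y (sX : smooth_field X) (sY : smooth_field Y) := @d_eta_at _ _ _ _ S p i X Y sX sY.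
have unit1 j := cd_unit D j pp.
have G_sym := cm_sym C.
have G_pos v : v != 0 -> 0 < bil (loc_g g p u) v v by exact: (c3_pos C).
have skew v w : bil (loc_g g p u) (v *m loc_phi S p i u) w = - bil (loc_g g p u) v (w *m loc_phi S p i u).
  exact: (c3_skew C).
have phi2 v : bil (loc_g g p u) (loc_xi S p i u) v = 0 -> v *m loc_phi S p i u *m loc_phi S p i u = - v.
  by move=> xv; rewrite (c3_phi2 C) xv scale0r addr0.
have := has_rank_alt (fun X Y sX sY => etrans (d_etaE X Y sX sY) (congr1 (fun B => bil B (X p) (Y p)) cu)) rk.
move=> [m [-> [v v0] w0]].
apply/eqP; rewrite eqn_leq (rank_le h0 G_sym G_pos P2 Pg Pphi skew phi2 w0)/=.
apply: (@rank_ge _ _ (loc_g g p u) P (loc_phi S p i u) (loc_xi S p i u) h h0 G_sym P2 Pg Pphi skew Pxi m v).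
move: v0; congr (_ != _); apply: eq_bigr => s _; congr (_ * (_ * _)).
by rewrite (@loc_eta _ _ _ _ S p i p _ (chart_at_dom p)) tangent_coord_id.
Qed.

(** * Pullback along an embedding *)

Section Contact3Pullback.
Context {R : realType} {V V' : lmodType R} (L : V' -> V).
Variables (g : V -> V -> R) (phi : 'I_3 -> V -> V) (xi : 'I_3 -> V).
Variables (g' : V' -> V' -> R) (phi' : 'I_3 -> V' -> V') (xi' : 'I_3 -> V').
Hypotheses (lL : linear L) (iL : injective L).
Hypothesis gg : forall v w, g' v w = g (L v) (L w).
Hypothesis pp : forall i v, L (phi' i v) = phi i (L v).

(* Either the characteristic vectors are tangent to the image of [L], or they
   are orthogonal to it and are replaced by zero. *)
Lemma contact3_pullback :
  (forall i, L (xi' i) = xi i) \/ (forall i, xi' i = 0 /\ forall v, g (xi i) (L v) = 0) ->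
  contact3 g phi xi -> contact3 g' phi' xi'.
Proof.
have LD u v : L (u + v) = L u + L v by have := lL 1 u v; rewrite !scale1r.
have L0 : L 0 = 0 by apply: (addrI (L 0)); rewrite -LD !addr0.
have LZ a v : L (a *: v) = a *: L v by have := lL a v 0; rewrite L0 !addr0.
have LN v : L (- v) = - L v by rewrite -scaleN1r LZ scaleN1r.
move=> xx C.
have ex i j v : L (g' (xi' i) v *: xi' j) = g (xi i) (L v) *: xi j.
  rewrite gg LZ; case: xx => [xx|xx]; first by rewrite !xx.
  by have [-> ->] := xx i; rewrite L0 (c3_0l C) !scale0r.
split.
- by move=> a u v w; rewrite !gg lL (c3_linl C).
- by move=> u v; rewrite !gg (c3_sym C).
- move=> u u0; rewrite gg; apply: (c3_pos C); apply: contra_neq u0 => E.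
  by apply: iL; rewrite E L0.
- by move=> i a u v; apply: iL; rewrite pp !lL !pp (c3_lin C).
- by move=> i v; apply: iL; rewrite !pp (c3_phi2 C) LD LN ex.
- by move=> i u v; rewrite !gg !pp (c3_skew C).
- move=> a b c abc; have [E F] := c3_xi C abc; case: xx => [xx|xx].
    by split; apply: iL; rewrite ?LN !pp !xx ?E ?F.
  by split; apply: iL; rewrite ?LN !pp !(xx _).1 L0 (c3_phi0 C) ?oppr0.
- move=> a b c abc v; have [E F] := c3_phi C abc (L v).
  by split; apply: iL; rewrite !pp ?E ?F LD ?LN !pp ex.
Qed.

End Contact3Pullback.

Lemma open_preim_smooth (R : realType) d e (U : set 'rV[R]_d) (V : set 'rV[R]_e)
    (F : 'rV[R]_d -> 'rV[R]_e) :
  open U -> open V -> smooth_on U F -> open [set z | U z /\ V (F z)].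
Proof.
move=> oU oV sF; rewrite openE => z [Uz Vz].
apply: filterI; first exact: open_nbhs_nbhs.
exact: (smooth_on_continuous sF Uz (open_nbhs_nbhs (conj oV Vz))).
Qed.

Section Pullback.
Context {R : realType} {d' d : nat}.
Variables (U' : set 'rV[R]_d') (U : set 'rV[R]_d).
Variables (F : 'rV[R]_d' -> 'rV[R]_d) (rho : 'rV[R]_d -> 'rV[R]_d').
Hypotheses (oU' : open U') (oU : open U) (sF : smooth_on U' F) (srho : smooth_on U rho).
Hypothesis FU : forall z, U' z -> U (F z).
Hypothesis FK : forall z, U' z -> rho (F z) = z.

Lemma jacobian_left_inverse z : U' z -> 'J F z *m 'J rho (F z) = 1%:M.
Proof.
move=> U'z; apply: mx_row_eq => v; rewrite mulmxA mulmx1.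
rewrite -(jacobianE v oU' sF U'z) -(jacobianE _ oU srho (FU U'z)).
apply: (etrans (esym (derive_chain v oU' oU sF srho U'z (FU U'z)))).
apply: (etrans (@derive_congr R d' _ _ (rho \o F) id z v oU' U'z FK)); exact: derive_id.
Qed.

Lemma derive_inj z v w : U' z -> 'D_v F z = 'D_w F z -> v = w.
Proof.
move=> U'z; rewrite !(jacobianE _ oU' sF U'z) => /(congr1 (mulmx^~ ('J rho (F z)))).
by rewrite -!mulmxA jacobian_left_inverse// !mulmx1.
Qed.

Definition pushf (X : 'rV[R]_d' -> 'rV[R]_d') w : 'rV[R]_d := 'D_(X (rho w)) F (rho w).

Lemma pushfE X z : U' z -> pushf X (F z) = 'D_(X z) F z.
Proof. by move=> U'z; rewrite /pushf FK. Qed.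

Section AtFields.
Variables (W' : set 'rV[R]_d').
Hypotheses (oW' : open W') (WU' : W' `<=` U').
Let W := [set w | U w /\ W' (rho w)].
Let oW : open W := open_preim_smooth oU oW' srho.
Let WU : W `<=` U. Proof. by move=> w []. Qed.
Let sFW : smooth_on W' F := @smooth_onS R d' _ W' U' F WU' sF.
Let FW z : W' z -> W (F z). Proof. by move=> Wz; split; [exact: FU (WU' Wz)|rewrite FK//; exact: WU']. Qed.

Lemma pushf_dom z : W' z -> [/\ open W, W `<=` U & W (F z)].
Proof. by move=> Wz; split=> //; exact: FW. Qed.

Lemma smooth_pushf X : smooth_on W' X -> smooth_on W (pushf X).
Proof.
move=> sX; have srW : smooth_on W rho := @smooth_onS R d _ W U rho WU srho.
exact: (smooth_on_comp oW oW' (smooth_on_derive oW' sFW sX) srW (fun _ H => H.2)).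
Qed.

Lemma lbr_pushf X Y z : smooth_on W' X -> smooth_on W' Y -> W' z ->
  lbr (pushf X) (pushf Y) (F z) = 'D_(lbr X Y z) F z.
Proof.
move=> sX sY Wz.
apply: (lbr_related oW' oW sFW FW sX sY (smooth_pushf sX) (smooth_pushf sY) _ _ Wz) => y Wy;
  exact: pushfE (WU' Wy).
Qed.

Lemma nijE_pushf (phi' : 'rV[R]_d' -> 'M[R]_d') (phi : 'rV[R]_d -> 'M[R]_d) X Y z :
  smooth_on U' phi' -> smooth_on U phi ->
  (forall y v, U' y -> 'D_(v *m phi' y) F y = 'D_v F y *m phi (F y)) ->
  smooth_on W' X -> smooth_on W' Y -> W' z ->
  'D_(nijE phi' X Y z) F z = nijE phi (pushf X) (pushf Y) (F z).
Proof.
move=> sphi' sphi rel sX sY Wz; have U'z := WU' Wz.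
have sp' : smooth_on W' phi' := @smooth_onS R d' _ W' U' phi' WU' sphi'.
have sp : smooth_on W phi := @smooth_onS R d _ W U phi WU sphi.
have R1 A : smooth_on W' A -> [/\ smooth_on W' (fun y => A y *m phi' y),
    smooth_on W (fun w => pushf A w *m phi w) &
    forall y, W' y -> pushf A (F y) *m phi (F y) = 'D_(A y *m phi' y) F y].
  move=> sA; split; first exact: (smooth_on_mulmx oW' sA sp').
    exact: (smooth_on_mulmx oW (smooth_pushf sA) sp).
  by move=> y Wy; rewrite (rel _ _ (WU' Wy)) (pushfE _ (WU' Wy)).
have E A y : W' y -> pushf A (F y) = 'D_(A y) F y by move=> Wy; exact: pushfE (WU' Wy).
have [X1 X2 X3] := R1 X sX; have [Y1 Y2 Y3] := R1 Y sY.
have L4 a b c e : 'D_(a + b - c - e) F z = 'D_a F z + 'D_b F z - 'D_c F z - 'D_e F z.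
  by rewrite !(jacobianE _ oU' sF U'z) !mulmxBl mulmxDl.
have c4 (a b c e a' b' c' e' : 'rV[R]_d) : a = a' -> b = b' -> c = c' -> e = e' ->
    a + b - c - e = a' + b' - c' - e' by move=> -> -> -> ->.
have rel2 v w : 'D_v F z = w -> 'D_(v *m phi' z) F z = w *m phi (F z).
  by move=> <-; exact: rel.
have sX' := smooth_pushf sX; have sY' := smooth_pushf sY.
have EX y (Wy : W' y) := E X y Wy; have EY y (Wy : W' y) := E Y y Wy.
apply: (etrans (L4 _ _ _ _)); apply: c4.
- exact: (rel2 _ _ (rel2 _ _ (esym (lbr_pushf sX sY Wz)))).
- exact: esym (lbr_related oW' oW sFW FW X1 Y1 X2 Y2 X3 Y3 Wz).
- exact: (rel2 _ _ (esym (lbr_related oW' oW sFW FW X1 sY X2 sY' X3 EY Wz))).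
- exact: (rel2 _ _ (esym (lbr_related oW' oW sFW FW sX Y1 sX' Y2 EX Y3 Wz))).
Qed.

Lemma d1E_pushf (a' : 'rV[R]_d' -> 'rV[R]_d' -> R) (n : 'rV[R]_d -> 'rV[R]_d) X Y z :
  smooth_on U n -> (forall y v, U' y -> a' y v = pairing (n (F y)) ('D_v F y)) ->
  smooth_on W' X -> smooth_on W' Y -> W' z ->
  d1E a' X Y z = d1E (fun w v => pairing (n w) v) (pushf X) (pushf Y) (F z).
Proof.
move=> sn rel sX sY Wz; have U'z := WU' Wz.
have snW : smooth_on W n := @smooth_onS R d _ W U n WU sn.
have E A B : smooth_on W' A -> smooth_on W' B ->
   'D_(A z) (fun y => a' y (B y)) z =
   'D_(pushf A (F z)) (fun w => pairing (n w) (pushf B w)) (F z).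
  move=> sA sB; rewrite (pushfE _ U'z).
  have sp : smooth_on W (fun w => pairing (n w) (pushf B w)).
    exact: (smooth_on_entry 0 0 oW (smooth_on_mulmx oW snW (smooth_on_trmx oW (smooth_pushf sB)))).
  apply: (etrans _ (derive_chain1 (A z) oW' oW sFW sp Wz (FW Wz))).
  apply: (derive_congr _ oW' Wz) => y Wy.
  by rewrite (rel _ _ (WU' Wy)) /= (pushfE _ (WU' Wy)).
apply: congr_d1; [exact: E|exact: E|].
apply: (etrans (rel _ _ U'z)); exact: (congr1 (pairing (n (F z))) (esym (lbr_pushf sX sY Wz))).
Qed.

Lemma d2E_pushf (a' : 'rV[R]_d' -> 'rV[R]_d' -> 'rV[R]_d' -> R)
    (g phi : 'rV[R]_d -> 'M[R]_d) X Y Z z :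
  smooth_on U g -> smooth_on U phi ->
  (forall y v w, U' y -> a' y v w = bil (g (F y)) ('D_v F y) ('D_w F y *m phi (F y))) ->
  smooth_on W' X -> smooth_on W' Y -> smooth_on W' Z -> W' z ->
  d2E a' X Y Z z =
  d2E (fun w v v' => bil (g w) v (v' *m phi w)) (pushf X) (pushf Y) (pushf Z) (F z).
Proof.
move=> sg sphi rel sX sY sZ Wz; have U'z := WU' Wz.
have sgW : smooth_on W g := @smooth_onS R d _ W U g WU sg.
have spW : smooth_on W phi := @smooth_onS R d _ W U phi WU sphi.
have E A B C : smooth_on W' A -> smooth_on W' B -> smooth_on W' C ->
   'D_(A z) (fun y => a' y (B y) (C y)) z =
   'D_(pushf A (F z)) (fun w => bil (g w) (pushf B w) (pushf C w *m phi w)) (F z).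
  move=> sA sB sC; rewrite (pushfE _ U'z).
  have sC' := smooth_on_trmx oW (smooth_on_mulmx oW (smooth_pushf sC) spW).
  have sp : smooth_on W (fun w => bil (g w) (pushf B w) (pushf C w *m phi w)).
    exact: (smooth_on_entry 0 0 oW (smooth_on_mulmx oW (smooth_on_mulmx oW (smooth_pushf sB) sgW) sC')).
  apply: (etrans _ (derive_chain1 (A z) oW' oW sFW sp Wz (FW Wz))).
  apply: (derive_congr _ oW' Wz) => y Wy.
  by rewrite (rel _ _ _ (WU' Wy)) /= !(pushfE _ (WU' Wy)).
have L A B C : smooth_on W' A -> smooth_on W' B -> a' z (lbr A B z) (C z) =
    bil (g (F z)) (lbr (pushf A) (pushf B) (F z)) (pushf C (F z) *m phi (F z)).
  move=> sA sB; apply: (etrans (rel _ _ _ U'z)).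
  exact: (congr2 (fun x y => bil (g (F z)) x (y *m phi (F z)))
    (esym (lbr_pushf sA sB Wz)) (esym (pushfE C U'z))).
by apply: congr_d2; [exact: E|exact: E|exact: E|exact: L|exact: L|exact: L].
Qed.

End AtFields.

Section ContactData.
Variables (g : 'rV[R]_d -> 'M[R]_d) (phi : 'I_3 -> 'rV[R]_d -> 'M[R]_d).
Variables (xi : 'I_3 -> 'rV[R]_d -> 'rV[R]_d).

Definition pb_g z : 'M[R]_d' := 'J F z *m g (F z) *m ('J F z)^T.
Definition pb_endo (A : 'rV[R]_d -> 'M[R]_d) z : 'M[R]_d' := 'J F z *m A (F z) *m 'J rho (F z).
Definition pb_field (X : 'rV[R]_d -> 'rV[R]_d) z : 'rV[R]_d' := X (F z) *m 'J rho (F z).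

Lemma bil_pb_g z v w : U' z -> bil (pb_g z) v w = bil (g (F z)) ('D_v F z) ('D_w F z).
Proof. by move=> U'z; rewrite /bil /pb_g !(jacobianE _ oU' sF U'z) trmx_mul !mulmxA. Qed.

Let sK : smooth_on U' (fun z => 'J rho (F z)).
Proof.
exact: (smooth_on_comp oU' oU (smooth_on_jacobian oU srho) sF FU).
Qed.

Lemma smooth_pb_g : smooth_on U g -> smooth_on U' pb_g.
Proof.
move=> sg; have sJ := smooth_on_jacobian oU' sF.
have sgF := smooth_on_comp oU' oU sg sF FU.
exact: (smooth_on_mulmx oU' (smooth_on_mulmx oU' sJ sgF) (smooth_on_trmx oU' sJ)).
Qed.

Lemma smooth_pb_endo A : smooth_on U A -> smooth_on U' (pb_endo A).
Proof.
move=> sA; have sJ := smooth_on_jacobian oU' sF.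
have sAF := smooth_on_comp oU' oU sA sF FU.
exact: (smooth_on_mulmx oU' (smooth_on_mulmx oU' sJ sAF) sK).
Qed.

Lemma smooth_pb_field X : smooth_on U X -> smooth_on U' (pb_field X).
Proof.
move=> sX; exact: (smooth_on_mulmx oU' (smooth_on_comp oU' oU sX sF FU) sK).
Qed.

Hypothesis C : contact_data U g phi xi.
Hypothesis phi_inv : forall i z, U' z -> pb_endo (phi i) z *m 'J F z = 'J F z *m phi i (F z).

Lemma pb_phiE i z v : U' z -> 'D_(v *m pb_endo (phi i) z) F z = 'D_v F z *m phi i (F z).
Proof.
by move=> U'z; rewrite !(jacobianE _ oU' sF U'z) -mulmxA phi_inv// mulmxA.
Qed.

Let lJ z : U' z -> linear (fun v : 'rV[R]_d' => 'D_v F z).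
Proof.
by move=> U'z a u v; rewrite !(jacobianE _ oU' sF U'z) mulmxDl scalemxAl.
Qed.

Lemma pb_contact3 z (xi' : 'I_3 -> 'rV[R]_d') : U' z ->
  (forall i, 'D_(xi' i) F z = xi i (F z)) \/
  (forall i, xi' i = 0 /\ forall v, bil (g (F z)) (xi i (F z)) ('D_v F z) = 0) ->
  contact3 (bil (pb_g z)) (fun i v => v *m pb_endo (phi i) z) xi'.
Proof.
move=> U'z xx.
apply: (@contact3_pullback R _ _ (fun v => 'D_v F z) (bil (g (F z)))
  (fun i v => v *m phi i (F z)) (xi^~ (F z))) (cd_contact C (FU U'z)).
- exact: lJ.
- by move=> v w; exact: derive_inj.
- by move=> v w; exact: bil_pb_g.
- by move=> i v; exact: pb_phiE.
- exact: xx.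
Qed.

Lemma pb_closed i W X Y Z z : open W -> W `<=` U' -> W z ->
  smooth_on W X -> smooth_on W Y -> smooth_on W Z ->
  d2E (fun z v w => bil (pb_g z) v (w *m pb_endo (phi i) z)) X Y Z z = 0.
Proof.
move=> oW WU Wz sX sY sZ; have [oV VU Vz] := pushf_dom oW WU Wz.
apply: (etrans (d2E_pushf oW WU (cd_g C) (cd_phi C i) _ sX sY sZ Wz)).
  by move=> y v w U'y; rewrite (bil_pb_g _ _ U'y) (pb_phiE _ _ U'y).
exact: (cd_closed C i oV VU Vz (smooth_pushf oW WU sX) (smooth_pushf oW WU sY) (smooth_pushf oW WU sZ)).
Qed.

Hypothesis xi_inv : forall i z, U' z -> pb_field (xi i) z *m 'J F z = xi i (F z).

Lemma pb_etaE i z v : U' z ->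
  pairing (pb_field (xi i) z *m pb_g z) v = pairing (xi i (F z) *m g (F z)) ('D_v F z).
Proof.
move=> U'z; rewrite -!bil_pairing (bil_pb_g _ _ U'z) (jacobianE _ oU' sF U'z).
by rewrite (xi_inv i U'z).
Qed.

Let sn i : smooth_on U (fun w => xi i w *m g w).
Proof. exact: (smooth_on_mulmx oU (cd_xi C i) (cd_g C)). Qed.

Lemma contact_data_pullback :
  contact_data U' pb_g (fun i => pb_endo (phi i)) (fun i => pb_field (xi i)).
Proof.
split.
- exact: smooth_pb_g (cd_g C).
- by move=> i; exact: smooth_pb_endo (cd_phi C i).
- by move=> i; exact: smooth_pb_field (cd_xi C i).
- move=> z U'z; apply: pb_contact3 => //; left=> i.
  by rewrite (jacobianE _ oU' sF U'z) xi_inv.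
- move=> z i U'z; rewrite (bil_pb_g _ _ U'z) !(jacobianE _ oU' sF U'z) xi_inv//.
  exact: (cd_unit C i (FU U'z)).
- move=> i W X Y z oW WU Wz sX sY; have U'z := WU _ Wz; have [oV VU Vz] := pushf_dom oW WU Wz.
  apply: (derive_inj U'z).
  have n1 := nijE_pushf oW WU (smooth_pb_endo (cd_phi C i)) (cd_phi C i) (@pb_phiE i) sX sY Wz.
  have d1 := d1E_pushf oW WU (sn i) (@pb_etaE i) sX sY Wz.
  have x1 : 'D_(pb_field (xi i) z) F z = xi i (F z).
    by rewrite (jacobianE _ oU' sF U'z) xi_inv.
  have E := cd_normal C i oV VU Vz (smooth_pushf oW WU sX) (smooth_pushf oW WU sY).
  have lin (s : R) a b : 'D_(a + s *: b) F z = 'D_a F z + s *: 'D_b F z.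
    by rewrite !(jacobianE _ oU' sF U'z) mulmxDl scalemxAl.
  apply: (etrans (lin _ _ _)); rewrite derive0; apply: etrans E.
  exact: (congr2 (fun a b => a + b) n1 (congr2 (fun a b => (2 * a) *: b) d1 x1)).
- by move=> i W X Y Z z; exact: pb_closed.
Qed.

Lemma curl_pullback i z v w : U' z ->
  bil (curl (fun z => pb_field (xi i) z *m pb_g z) z) v w =
  bil (curl (fun w => xi i w *m g w) (F z)) ('D_v F z) ('D_w F z).
Proof.
move=> U'z; have sc u := smooth_on_cst (u : 'rV[R]_d') oU'.
have sn' : smooth_on U' (fun z => pb_field (xi i) z *m pb_g z).
  exact: (smooth_on_mulmx oU' (smooth_pb_field (cd_xi C i)) (smooth_pb_g (cd_g C))).
have [oV VU Vz] := pushf_dom oU' (fun _ H => H) U'z.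
rewrite -(d1E_curl oU' sn' (sc v) (sc w) U'z).
apply: (etrans (d1E_pushf oU' (fun _ H => H) (sn i) (@pb_etaE i) (sc v) (sc w) U'z)).
have s1 := smooth_pushf oU' (fun _ H => H) (sc v); have s2 := smooth_pushf oU' (fun _ H => H) (sc w).
rewrite (d1E_curl oV (@smooth_onS R d _ _ U _ VU (sn i)) s1 s2 Vz).
by rewrite !(pushfE _ U'z).
Qed.

End ContactData.
End Pullback.

(** * Straightening an integrable distribution *)

Section LocalStraightening.
Context {R : realType}.

Lemma open_ball_norm d (U : set 'rV[R]_d) x : open U -> U x ->
  exists2 r, 0 < r & forall z, `|z - x| <= r -> U z.
Proof.
move=> oU Ux; have /nbhs_ballP[e /= e0 eU] := open_nbhs_nbhs (conj oU Ux).
exists (e / 2); first by rewrite divr_gt0.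
move=> u ue; apply: eU; rewrite mx_norm_ball /ball_ /= distrC.
by apply: le_lt_trans ue _; rewrite ltr_pdivrMr// ltr_pMr// ltr1n.
Qed.

Lemma ball_norm_open d (x : 'rV[R]_d) r : open [set z | `|z - x| < r].
Proof.
apply: (@open_comp _ _ (fun u : 'rV[R]_d => `|u - x|) [set t | t < r]).
  by move=> y _; exact: continuous_dist.
exact: open_lt.
Qed.

Lemma ball0_open d r : open [set z : 'rV[R]_d | `|z| < r].
Proof.
have -> : [set z : 'rV[R]_d | `|z| < r] = [set z | `|z - 0| < r].
  by apply/seteqP; split=> z /=; rewrite subr0.
exact: ball_norm_open.
Qed.

Lemma smooth_bounded_mx d m n (A : 'rV[R]_d -> 'M[R]_(m, n)) (rho : R) :
  smooth_on setT A -> exists2 K, 0 <= K & forall x, `|x| <= rho -> `|A x| <= K.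
Proof.
move=> sA.
have ex (p : 'I_m * 'I_n) : exists K, 0 <= K /\ forall x, `|x| <= rho -> `|A x p.1 p.2| <= K.
  by have [K K0 HK] := smooth_bounded_ball rho (smooth_on_entry p.1 p.2 openT sA); exists K.
have [K HK] := choice ex.
exists (\sum_p K p); first by apply: sumr_ge0 => p _; exact: (HK p).1.
move=> x xr; apply: mxnorm_le => [|i j]; first by apply: sumr_ge0 => p _; exact: (HK p).1.
apply: le_trans ((HK (i, j)).2 x xr) _; rewrite (bigD1 (i, j))//= lerDl.
by apply: sumr_ge0 => p _; exact: (HK p).1.
Qed.

Record diffeo d' d (F : 'rV[R]_d' -> 'rV[R]_d) (rho : 'rV[R]_d -> 'rV[R]_d') : Prop := Diffeo {
  df_smooth : smooth_on setT F;
  df_smoothV : smooth_on setT rho;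
  df_K : cancel F rho;
  df_VK : cancel rho F }.

Lemma diffeo_comp d1 d2 d3 (F : 'rV[R]_d1 -> 'rV[R]_d2) rho (G : 'rV[R]_d2 -> 'rV[R]_d3) rho' :
  diffeo F rho -> diffeo G rho' -> diffeo (G \o F) (rho \o rho').
Proof.
move=> [F1 F2 F3 F4] [G1 G2 G3 G4]; split.
- exact: (smooth_on_comp openT openT G1 F1 (fun _ _ => I)).
- exact: (smooth_on_comp openT openT F2 G2 (fun _ _ => I)).
- exact: can_comp.
- exact: can_comp.
Qed.

Lemma local_straightening k e (U : set 'rV[R]_(k + e)) (A : 'rV[R]_(k + e) -> 'M[R]_(k, e)) :
  open U -> U 0 -> smooth_on U A ->
  (forall z, U z -> forall u v : 'rV[R]_k,
    u *m 'D_(row_mx v (v *m A z)) A z = v *m 'D_(row_mx u (u *m A z)) A z) ->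
  exists Psi Psi' : 'rV[R]_(k + e) -> 'rV[R]_(k + e), diffeo Psi Psi' /\ [/\ forall z, lsubmx (Psi z) = lsubmx z, Psi 0 = 0 &
    exists2 r, 0 < r & forall z, `|z| < r -> U (Psi z) /\ forall v : 'rV[R]_k,
      'D_(row_mx v 0) Psi z = row_mx v (v *m A (Psi z))].
Proof.
move=> oU U0 sA Aint.
have [r0 r00 ballU] := open_ball_norm oU U0.
pose rho := r0 / 2; have rho0 : 0 < rho by rewrite divr_gt0.
have [chi [schi chi01 chi1 chi0]] := smooth_bump (0 : 'rV[R]_(k + e)) rho0.
have r2 : 2 * rho = r0 by rewrite /rho mulrCA divff ?mulr1// pnatr_eq0.
rewrite r2 in chi0.
pose B u := chi u *: A u.
have sB : smooth_on setT B := smooth_cutoff oU ballU schi chi0 sA.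
have BA z : `|z| <= rho -> B z = A z.
  by move=> zr; rewrite /B chi1 ?scale1r// subr0.
have [K K0 BK] := smooth_bounded_mx r0 sB.
have Bb z (x : 'rV[R]_k) : `|x *m B z| <= (k%:R * K) * `|x|.
  have [zr|zr] := leP `|z| r0.
    apply: le_trans (norm_mulmx _ _) _.
    by rewrite mulrAC ler_wpM2r// ler_wpM2l// BK.
  have -> : B z = 0.
    by rewrite /B; have [->|/chi0] := eqVneq (chi z) 0; rewrite ?scale0r// subr0 leNgt zr.
  by rewrite mulmx0 normr0 !mulr_ge0.
have rho20 : 0 < rho / 2 by rewrite divr_gt0.
have Bint z : `|z| <= rho / 2 -> forall u v : 'rV[R]_k,
    u *m 'D_(row_mx v (v *m B z)) B z = v *m 'D_(row_mx u (u *m B z)) B z.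
  move=> zr u v; have zr' : `|z| < rho.
    by apply: le_lt_trans zr _; rewrite ltr_pdivrMr// ltr_pMr// ltr1n.
  have DB w : 'D_w B z = 'D_w A z.
    apply: (@derive_congr R _ [set z | `|z| < rho] _ B A z w (@ball0_open _ rho) zr').
    by move=> y /ltW; exact: BA.
  rewrite (BA _ (ltW zr')) !DB; apply: Aint; apply: ballU; rewrite subr0.
  by apply: ltW; apply: lt_trans zr' _; rewrite /rho ltr_pdivrMr// ltr_pMr// ltr1n.
have [Psi [Psi' [[s1 s2 c1 c2] [lP P0 [r r_gt0 DP]]]]] :=
  frobenius_straightening sB (mulr_ge0 (ler0n _ _) K0) Bb rho20 Bint.
exists Psi, Psi'; split; first by split.
split=> //.
have oV : open [set z | setT z /\ [set z : 'rV[R]_(k + e) | `|z| < rho] (Psi z)].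
  exact: (open_preim_smooth openT (@ball0_open _ rho) s1).
have [|r3 r30 r3P] := @open_ball_norm _ _ 0 oV.
  by split=> //; rewrite /= P0 normr0.
exists (Num.min r r3); first by rewrite lt_min r_gt0.
move=> z; rewrite lt_min => /andP[zr zr3].
have [_ /= Pz] : [set z | setT z /\ [set z : 'rV[R]_(k + e) | `|z| < rho] (Psi z)] z.
  by apply: r3P; rewrite subr0 ltW.
split; last by move=> v; rewrite DP ?(ltW zr)// BA// ltW.
apply: ballU; rewrite subr0; apply: ltW; apply: lt_trans Pz _.
by rewrite /rho ltr_pdivrMr// ltr_pMr// ltr1n.
Qed.

Lemma mulmx_top_row k e (v : 'rV[R]_k) (M : 'M[R]_(k + e)) : ulsubmx M \in unitmx ->
  row_mx v (v *m (invmx (ulsubmx M) *m ursubmx M)) =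
  row_mx (v *m invmx (ulsubmx M)) (0 : 'rV[R]_e) *m M.
Proof.
move=> uM; rewrite -{4}[M]submxK mul_row_block !mul0mx !addr0 -mulmxA mulVmx//.
by rewrite mulmx1 mulmxA.
Qed.

Definition integrable_idem d (U : set 'rV[R]_d) (Q : 'rV[R]_d -> 'M[R]_d) :=
  forall W X Y u, open W -> W `<=` U -> W u -> smooth_on W X -> smooth_on W Y ->
  (forall z, W z -> X z *m Q z = X z) -> (forall z, W z -> Y z *m Q z = Y z) ->
  lbr X Y u *m Q u = lbr X Y u.

Lemma straighten_idem k e (U : set 'rV[R]_(k + e)) (Q : 'rV[R]_(k + e) -> 'M[R]_(k + e)) :
  open U -> U 0 -> smooth_on U Q -> (forall z, U z -> Q z *m Q z = Q z) ->
  ulsubmx (Q 0) \in unitmx -> drsubmx (1%:M - Q 0) \in unitmx -> integrable_idem U Q ->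
  exists F rho : 'rV[R]_(k + e) -> 'rV[R]_(k + e), diffeo F rho /\ [/\ forall z, lsubmx (F z) = lsubmx z, F 0 = 0 &
    exists2 r, 0 < r & forall z, `|z| < r -> [/\ U (F z),
      forall v : 'rV[R]_k, 'D_(row_mx v 0) F z *m Q (F z) = 'D_(row_mx v 0) F z &
      forall w : 'rV[R]_(k + e), w *m Q (F z) = w -> lsubmx w = 0 -> w = 0]].
Proof.
move=> oU U0 sQ QQ a0 c0 Qint.
have sa : smooth_on U (fun z => ulsubmx (Q z)).
  apply: (smooth_on_mx oU) => i j.
  apply: (smooth_on_eq oU _ (smooth_on_entry (lshift e i) (lshift e j) oU sQ)).
  by move=> z _; rewrite !mxE.
have sb : smooth_on U (fun z => ursubmx (Q z)).
  apply: (smooth_on_mx oU) => i j.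
  apply: (smooth_on_eq oU _ (smooth_on_entry (lshift e i) (rshift k j) oU sQ)).
  by move=> z _; rewrite !mxE.
have sc : smooth_on U (fun z => drsubmx (1%:M - Q z)).
  apply: (smooth_on_mx oU) => i j.
  have s1 := smooth_on_mxB oU (smooth_on_cst (1%:M : 'M[R]_(k + e)) oU) sQ.
  apply: (smooth_on_eq oU _ (smooth_on_entry (rshift k i) (rshift k j) oU s1)).
  by move=> z _; rewrite !mxE.
pose U1 := [set z | [/\ U z, ulsubmx (Q z) \in unitmx & drsubmx (1%:M - Q z) \in unitmx]].
have U1U : U1 `<=` U by move=> z [].
have oU1 : open U1.
  have sd : smooth_on U (fun z => \row_(j < 2) (if j == 0 then \det (ulsubmx (Q z)) else \det (drsubmx (1%:M - Q z)))).
    apply: (smooth_on_mx oU) => i j; have [j0|j0] := eqVneq j 0.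
      by apply: (smooth_on_eq oU _ (smooth_on_det oU sa)) => z _; rewrite mxE j0 eqxx.
    by apply: (smooth_on_eq oU _ (smooth_on_det oU sc)) => z _; rewrite mxE (negbTE j0).
  have oV : open [set v : 'rV[R]_2 | v 0 0 != 0 /\ v 0 1 != 0].
    have coord (j : 'I_2) : open [set v : 'rV[R]_2 | v 0 j != 0].
      apply: (@open_comp _ _ (fun v : 'rV[R]_2 => v 0 j) [set t | t != 0]).
        by move=> x _; exact: coord_continuous.
      exact: open_neq.
    exact: openI (coord 0) (coord 1).
  have -> : U1 = [set z | U z /\ [set v : 'rV[R]_2 | v 0 0 != 0 /\ v 0 1 != 0]
      (\row_(j < 2) (if j == 0 then \det (ulsubmx (Q z)) else \det (drsubmx (1%:M - Q z))))].
    apply/seteqP; split=> z /=; rewrite /U1 /= !mxE /= !unitmxE !unitfE.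
      by move=> [].
    by move=> [? []].
  exact: (open_preim_smooth oU oV sd).
have U10 : U1 0 by split.
pose A z := invmx (ulsubmx (Q z)) *m ursubmx (Q z).
have sA : smooth_on U1 A.
  have S m n (G : 'rV[R]_(k + e) -> 'M[R]_(m, n)) : smooth_on U G -> smooth_on U1 G.
    exact: (@smooth_onS R _ _ U1 U G U1U).
  apply: (smooth_on_mulmx oU1 _ (S _ _ _ sb)).
  by apply: (smooth_on_invmx oU1 _ (S _ _ _ sa)) => z [].
have graph z (v : 'rV[R]_k) : U1 z -> row_mx v (v *m A z) *m Q z = row_mx v (v *m A z).
  move=> [Uz ua _].
  have -> : row_mx v (v *m A z) = row_mx (v *m invmx (ulsubmx (Q z))) 0 *m Q z.
    exact: (mulmx_top_row v ua).
  by rewrite -mulmxA QQ.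
have graph0 z (w : 'rV[R]_(k + e)) : U1 z -> w *m Q z = w -> lsubmx w = 0 -> w = 0.
  move=> [_ _ uc] wQ w0; rewrite -[w]hsubmxK w0.
  have alg (y : 'rV[R]_e) (M : 'M[R]_(k + e)) : drsubmx M \in unitmx ->
      row_mx (0 : 'rV[R]_k) y *m M = 0 -> y = 0.
    move=> uM; rewrite -{1}[M]submxK mul_row_block !mul0mx !add0r -[RHS](row_mx0 _ 1 k e).
    move=> /eq_row_mx[_ E].
    by rewrite -[y](mulmxK uM) E mul0mx.
  rewrite (alg (rsubmx w) _ uc) ?row_mx0// -w0 hsubmxK.
  by rewrite mulmxBr mulmx1 wQ subrr.
have Aint z : U1 z -> forall u v : 'rV[R]_k,
    u *m 'D_(row_mx v (v *m A z)) A z = v *m 'D_(row_mx u (u *m A z)) A z.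
  move=> U1z u v; pose X (x : 'rV[R]_k) z := row_mx x (x *m A z).
  have sX x : smooth_on U1 (X x).
    apply: (smooth_on_row_mx oU1 (smooth_on_cst x oU1)).
    exact: (smooth_on_mulmx oU1 (smooth_on_cst x oU1) sA).
  have DX x w : 'D_w (X x) z = row_mx 0 (x *m 'D_w A z).
    have dA := smooth_is_derive w oU1 sA U1z.
    have d1 : is_derive z w (fun y => x *m A y) (0 *m A z + x *m 'D_w A z).
      exact: (is_derive_mulmx (is_derive_cst _ _ _) dA).
    have [_ ->] := is_derive_row_mx (is_derive_cst x z w) d1.
    by rewrite mul0mx add0r.
  have L : lbr (X u) (X v) z = row_mx 0 (v *m 'D_(X u z) A z - u *m 'D_(X v z) A z).
    by rewrite /lbr !DX opp_row_mx add_row_mx oppr0 addr0.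
  have := Qint U1 (X u) (X v) z oU1 U1U U1z (sX u) (sX v) (fun y Wy => graph y u Wy) (fun y Wy => graph y v Wy).
  move=> /(graph0 z _ U1z); rewrite L row_mxKl => /(_ erefl).
  have alg (a b : 'rV[R]_e) : row_mx (0 : 'rV[R]_k) (a - b) = 0 -> b = a.
    by rewrite -[RHS](row_mx0 _ 1 k e) => /eq_row_mx[_ /eqP]; rewrite subr_eq0 => /eqP ->.
  exact: alg.
have [F [rho [df [lF F0 [r r0 HF]]]]] := local_straightening oU1 U10 sA Aint.
exists F, rho; split=> //; split=> //; exists r => // z /HF [U1z DF].
split=> [|v|w]; first exact: U1U.
  by rewrite DF graph.
exact: graph0.
Qed.

End LocalStraightening.

(** * Integrability of the two distributions *)

Section ClosedForms.
Context {R : realType} {d : nat}.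
Implicit Types (U W : set 'rV[R]_d) (A B : 'rV[R]_d -> 'M[R]_d).

Definition closed2 A u : Prop := forall x y z : 'rV[R]_d,
  bil ('D_x A u) y z + bil ('D_y A u) z x + bil ('D_z A u) x y = 0.

Lemma pairing_eq0 (r : 'rV[R]_d) : (forall z, pairing r z = 0) -> r = 0.
Proof.
move=> H; apply/rowP => k; have := H (delta_mx 0 k).
by rewrite /pairing trmx_delta -colE !mxE.
Qed.

Lemma closed2_curl U n u : open U -> smooth_on U n -> U u -> closed2 (curl n) u.
Proof.
move=> oU sn Uu x y z; have sJ := smooth_on_jacobian oU sn; have sJT := smooth_on_trmx oU sJ.
have DJ (a : 'rV[R]_d) : 'D_a (curl n) u = 2^-1 *: ('D_a (fun z => 'J n z) u - ('D_a (fun z => 'J n z) u)^T).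
  rewrite [LHS](derive_scalemx _ _ oU (smooth_on_mxB oU sJ sJT) Uu).
  rewrite (derive_addmx _ oU sJ (smooth_on_mxN oU sJT) Uu) (derive_oppmx _ oU sJT Uu).
  by rewrite (derive_trmx _ oU sJ Uu).
have sym (a b : 'rV[R]_d) : b *m 'D_a (fun z => 'J n z) u = a *m 'D_b (fun z => 'J n z) u.
  have E (a' b' : 'rV[R]_d) : b' *m 'D_a' (fun z => 'J n z) u = 'D_a' (fun z => 'D_b' n z) u.
    have -> : 'D_a' (fun z => 'D_b' n z) u = 'D_a' (fun z => b' *m 'J n z) u.
      by apply: (derive_congr _ oU Uu) => w Uw; exact: jacobianE oU sn Uw.
    by rewrite (derive_mulmx _ oU (smooth_on_cst b' oU) sJ Uu) derive_cst mul0mx add0r.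
  exact: etrans (E _ _) (etrans (derive2_sym a b oU sn Uu) (esym (E _ _))).
have alg (D : 'rV[R]_d -> 'M[R]_d) : (forall a b, b *m D a = a *m D b) ->
    bil (2^-1 *: (D x - (D x)^T)) y z + bil (2^-1 *: (D y - (D y)^T)) z x +
    bil (2^-1 *: (D z - (D z)^T)) x y = 0.
  move=> sD; rewrite !bilZ !bil_asym (sD x y) (sD x z) (sD y z).
  by move: (pairing (x *m D y) z) (pairing (x *m D z) y) (pairing (y *m D z) x) => a b c; ring.
by rewrite !DJ; exact: alg sym.
Qed.

Lemma closed2B U A B a u : open U -> smooth_on U A -> smooth_on U B -> U u ->
  closed2 A u -> closed2 B u -> closed2 (fun z => A z - a *: B z) u.
Proof.
move=> oU sA sB Uu cA cB x y z.
have saB : smooth_on U (fun z => a *: B z) := smooth_on_mxZ oU (smooth_on_cst a oU) sB.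
have E w : 'D_w (fun z => A z - a *: B z) u = 'D_w A u - a *: 'D_w B u.
  rewrite (derive_addmx _ oU sA (smooth_on_mxN oU saB) Uu) (derive_oppmx _ oU saB Uu).
  by rewrite (derive_scalemx _ _ oU sB Uu).
have alg (M N : 'M[R]_d) v w : bil (M - a *: N) v w = bil M v w - a * bil N v w.
  by rewrite -scaleNr bilD bilZ mulNr.
have fin (DA DB D : 'rV[R]_d -> 'M[R]_d) : (forall w, D w = DA w - a *: DB w) ->
   bil (DA x) y z + bil (DA y) z x + bil (DA z) x y = 0 ->
   bil (DB x) y z + bil (DB y) z x + bil (DB z) x y = 0 ->
   bil (D x) y z + bil (D y) z x + bil (D z) x y = 0.
  move=> DE; rewrite !DE !alg.
  move: (bil (DA x) y z) (bil (DA y) z x) (bil (DA z) x y) => a1 a2 a3.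
  move: (bil (DB x) y z) (bil (DB y) z x) (bil (DB z) x y) => b1 b2 b3 Ha Hb.
  transitivity ((a1 + a2 + a3) - a * (b1 + b2 + b3)); first by ring.
  by rewrite Ha Hb mulr0 subr0.
exact: (fin (fun w => 'D_w A u) (fun w => 'D_w B u) _ E (cA x y z) (cB x y z)).
Qed.

Lemma kernel_integrable U A X Y u : open U -> U u -> smooth_on U A -> smooth_on U X -> smooth_on U Y ->
  (forall z, U z -> (A z)^T = - A z) -> closed2 A u ->
  (forall z, U z -> X z *m A z = 0) -> (forall z, U z -> Y z *m A z = 0) ->
  lbr X Y u *m A u = 0.
Proof.
move=> oU Uu sA sX sY skA cA XA YA.
have D0 (Z : 'rV[R]_d -> 'rV[R]_d) w : smooth_on U Z -> (forall z, U z -> Z z *m A z = 0) ->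
    'D_w Z u *m A u + Z u *m 'D_w A u = 0.
  move=> sZ ZA; rewrite -(derive_mulmx w oU sZ sA Uu).
  by rewrite (@derive_congr _ _ _ _ _ (fun=> 0) _ w oU Uu ZA) derive_cst.
have skD w : ('D_w A u)^T = - 'D_w A u.
  rewrite -(derive_trmx w oU sA Uu) -(derive_oppmx w oU sA Uu).
  exact: derive_congr oU Uu skA.
have := cA (X u) (Y u).
have := D0 X (Y u) sX XA; have := D0 Y (X u) sY YA; have := skD (Y u).
have := fun z => D0 X z sX XA; have := YA u Uu; have := skA u Uu.
rewrite /lbr.
have alg (DA : 'rV[R]_d -> 'M[R]_d) (M : 'M[R]_d) (x y dy dx : 'rV[R]_d) (Dx : 'rV[R]_d -> 'rV[R]_d) :
   M^T = - M -> y *m M = 0 -> (forall z, Dx z *m M + x *m DA z = 0) -> (DA y)^T = - DA y ->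
   dy *m M + y *m DA x = 0 -> dx *m M + x *m DA y = 0 ->
   (forall z, bil (DA x) y z + bil (DA y) z x + bil (DA z) x y = 0) -> (dy - dx) *m M = 0.
  move=> skM yM HDx skDy e1 e2 cl.
  have e3 z : bil (DA z) x y = 0.
    have := congr1 (fun r : 'rV[R]_d => pairing r y) (HDx z).
    rewrite /pairing mulmxDl mxE mul0mx [X in _ = X]mxE -/(bil _ _ _) -/(bil _ _ _).
    by rewrite bilC skM /bil mulmxN yM oppr0 mul0mx mxE add0r.
  apply: pairing_eq0 => z; have := cl z.
  have -> : bil (DA y) z x = - bil (DA y) x z.
    by rewrite bilC skDy /bil mulmxN mulNmx mxE.
  rewrite e3 addr0 => /eqP; rewrite subr_eq0 => /eqP e4.
  have -> : (dy - dx) *m M = x *m DA y - y *m DA x.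
    rewrite mulmxBl; move/eqP: e1; rewrite addr_eq0 => /eqP ->.
    by move/eqP: e2; rewrite addr_eq0 => /eqP ->; rewrite opprK addrC.
  by rewrite /pairing mulmxBl mxE [X in _ + X]mxE -/(bil _ _ _) -/(bil _ _ _) e4 subrr.
exact: alg.
Qed.

End ClosedForms.

(* Endomorphisms act on rows from the right, so [g phi^T] is the matrix of the
   fundamental form; [P] is the projection onto the distribution tangent to the
   Sasakian factor, along the one tangent to the hyper-Kaehler factor. *)
Record split_data (R : realType) d (U : set 'rV[R]_d) (g : 'rV[R]_d -> 'M[R]_d)
    (phi : 'I_3 -> 'rV[R]_d -> 'M[R]_d) (xi : 'I_3 -> 'rV[R]_d -> 'rV[R]_d)
    (P : 'rV[R]_d -> 'M[R]_d) (h : R) : Prop := SplitData {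
  sd_contact : contact_data U g phi xi;
  sd_smooth : smooth_on U P;
  sd_idem : forall u, U u -> P u *m P u = P u;
  sd_sym : forall u, U u -> P u *m g u = g u *m (P u)^T;
  sd_phi : forall u i, U u -> P u *m phi i u = phi i u *m P u;
  sd_xi : forall u i, U u -> xi i u *m P u = xi i u;
  sd_curl : forall u i, U u ->
    curl (fun z => xi i z *m g z) u = h *: (P u *m g u *m (phi i u)^T) }.

Section SplitIntegrable.
Context {R : realType} {d : nat}.
Variables (U : set 'rV[R]_d) (g : 'rV[R]_d -> 'M[R]_d).
Variables (phi : 'I_3 -> 'rV[R]_d -> 'M[R]_d) (xi : 'I_3 -> 'rV[R]_d -> 'rV[R]_d).
Variables (P : 'rV[R]_d -> 'M[R]_d) (h : R).
Hypotheses (oU : open U) (S : split_data U g phi xi P h).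
Let C := sd_contact S.

Let om i z := g z *m (phi i z)^T.

Lemma smooth_fundamental i : smooth_on U (om i).
Proof. exact: (smooth_on_mulmx oU (cd_g C) (smooth_on_trmx oU (cd_phi C i))). Qed.

Lemma fundamental_skew i z : U z -> (om i z)^T = - om i z.
Proof.
move=> Uz; have K := cd_contact C Uz.
by rewrite /om trmx_mul trmxK (cm_sym K) (cm_skew K).
Qed.

Lemma closed2_fundamental i u : U u -> closed2 (om i) u.
Proof.
move=> Uu x y z; have sc (v : 'rV[R]_d) := smooth_on_cst v oU.
have sO := smooth_fundamental i.
have D (a b e : 'rV[R]_d) : 'D_a (fun z => bil (g z) b (e *m phi i z)) u = bil ('D_a (om i) u) b e.
  have E : 'D_a (fun z => bil (om i z) b e) u = bil ('D_a (om i) u) b e.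
    by rewrite (derive_bil a oU sO (sc b) (sc e) Uu) !derive_cst bil0l bil0r !addr0.
  by apply: etrans E; apply: (derive_congr _ oU Uu) => w _; rewrite /om bilMT.
have := cd_closed C i oU (fun _ H => H) Uu (sc x) (sc y) (sc z).
have L a b : lbr (fun=> a) (fun=> b) u = 0 :> 'rV[R]_d by rewrite /lbr !derive_cst subrr.
rewrite /d2E !L !bil0l !subr0 (D x y z) (D y z x) (D z x y) => /eqP.
by rewrite mulf_eq0 invr_eq0 pnatr_eq0 => /eqP.
Qed.

Lemma phi_kernel i u (v : 'rV[R]_d) : U u -> v *m phi i u = 0 ->
  v = bil (g u) (xi i u) v *: xi i u.
Proof.
move=> Uu v0; have K := cd_contact C Uu.
have := c3_phi2 K i v; rewrite v0 mul0mx => /esym/eqP.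
by rewrite addrC subr_eq0 => /eqP.
Qed.

Lemma fundamental_kernel i u (v : 'rV[R]_d) : U u -> v *m om i u = 0 -> v *m phi i u = 0.
Proof.
move=> Uu v0; have K := cd_contact C Uu; apply: (row_free_inj _ (A := g u)).
  by rewrite row_free_unit (cm_unitmx K).
by rewrite mul0mx -mulmxA (cm_skew K) mulmxN v0 oppr0.
Qed.

Hypothesis h0 : h != 0.

Lemma split_integrable : integrable_idem U P.
Proof.
move=> W X Y u oW WU Wu sX sY XP YP; have Uu := WU _ Wu.
have sn : smooth_on U (fun z => xi 0 z *m g z) := smooth_on_mulmx oU (cd_xi C 0) (cd_g C).
pose A z := om 0 z - h^-1 *: curl (fun z => xi 0 z *m g z) z.
have AE z : U z -> A z = (1%:M - P z) *m om 0 z.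
  move=> Uz; rewrite /A (sd_curl S 0 Uz) scalerA mulVf// scale1r mulmxBl mul1mx.
  by rewrite /om mulmxA.
have sc := smooth_on_curl oU sn.
have sA : smooth_on U A.
  exact: (smooth_on_mxB oU (smooth_fundamental 0) (smooth_on_mxZ oU (smooth_on_cst h^-1 oU) sc)).
have cA : closed2 A u.
  apply: (closed2B _ oU (smooth_fundamental 0) sc Uu (closed2_fundamental 0 Uu)).
  exact: closed2_curl oU sn Uu.
have skA z : W z -> (A z)^T = - A z.
  move=> /WU Uz; rewrite /A linearB/= linearZ/= (fundamental_skew _ Uz) curl_tr.
  by rewrite scalerN opprD.
have ker (Z : 'rV[R]_d -> 'rV[R]_d) z : W z -> Z z *m P z = Z z -> Z z *m A z = 0.
  by move=> /WU Uz ZP; rewrite AE// mulmxA mulmxBr mulmx1 ZP subrr mul0mx.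
have sAW : smooth_on W A := @smooth_onS R d _ W U A WU sA.
have := kernel_integrable oW Wu sAW sX sY skA cA (fun z Wz => ker X z Wz (XP z Wz)) (fun z Wz => ker Y z Wz (YP z Wz)).
rewrite (AE _ Uu) mulmxA; move: (lbr X Y u) => w /(fundamental_kernel Uu) /(phi_kernel Uu).
rewrite (_ : bil _ _ _ = 0) ?scale0r => [/eqP|].
  by rewrite mulmxBr mulmx1 subr_eq0 => /eqP <-.
rewrite (c3_sym (cd_contact C Uu)) -bilM mulmxBl mul1mx (sd_sym S Uu).
by rewrite bilD -scaleN1r bilZ bilMT (sd_xi S 0 Uu) mulN1r subrr.
Qed.

Lemma split_integrableC : integrable_idem U (fun z => 1%:M - P z).
Proof.
move=> W X Y u oW WU Wu sX sY XP YP; have Uu := WU _ Wu; have K := cd_contact C Uu.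
have kerP (Z : 'rV[R]_d -> 'rV[R]_d) z : Z z *m (1%:M - P z) = Z z -> Z z *m P z = 0.
  by rewrite mulmxBr mulmx1 => /eqP; rewrite -subr_eq0 addrAC subrr sub0r oppr_eq0 => /eqP.
have ker i : lbr X Y u *m P u *m phi i u = 0.
  have sn : smooth_on U (fun z => xi i z *m g z) := smooth_on_mulmx oU (cd_xi C i) (cd_g C).
  have sc := smooth_on_curl oU sn.
  have sAW := @smooth_onS R d _ W U _ WU sc.
  have ann (Z : 'rV[R]_d -> 'rV[R]_d) z : W z -> Z z *m (1%:M - P z) = Z z -> Z z *m curl (fun z => xi i z *m g z) z = 0.
    by move=> /WU Uz /kerP ZP; rewrite (sd_curl S i Uz) -scalemxAr !mulmxA ZP !mul0mx scaler0.
  have := kernel_integrable oW Wu sAW sX sY (fun z _ => curl_tr _ z) (closed2_curl oU sn Uu)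
    (fun z Wz => ann X z Wz (XP z Wz)) (fun z Wz => ann Y z Wz (YP z Wz)).
  rewrite (sd_curl S i Uu) -scalemxAr => /eqP; rewrite scaler_eq0 (negbTE h0)/= => /eqP E.
  by apply: (fundamental_kernel Uu); rewrite /om -E !mulmxA.
move: (lbr X Y u) ker => w ker; rewrite mulmxBr mulmx1.
suff -> : w *m P u = 0 by rewrite subr0.
have E0 := phi_kernel Uu (ker 0); have E1 := phi_kernel Uu (ker 1).
rewrite E1 (_ : bil _ _ _ = 0) ?scale0r// E0 bilZr.
have abc : cyclic3 (0 : 'I_3) 1 2%:R by apply: Or31.
have o : bil (g u) (xi 1 u) (xi 0 u) = 0.
  by rewrite (c3_sym K); exact: c3_xi_ortho K (fun i => cd_unit C i Uu) _ _ _ abc.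
by rewrite o mulr0.
Qed.

End SplitIntegrable.

Section SplitPullback.
Context {R : realType} {d' d : nat}.
Variables (F : 'rV[R]_d' -> 'rV[R]_d) (rho : 'rV[R]_d -> 'rV[R]_d').
Hypothesis D : diffeo F rho.

Lemma diffeo_jacobian z : 'J F z *m 'J rho (F z) = 1%:M.
Proof.
exact: (jacobian_left_inverse openT openT (df_smooth D) (df_smoothV D)
  (fun _ _ => I) (fun z _ => df_K D z) (z := z) I).
Qed.

Lemma diffeo_jacobianV z : 'J rho (F z) *m 'J F z = 1%:M.
Proof.
rewrite -{2}(df_K D z).
exact: (jacobian_left_inverse openT openT (df_smoothV D) (df_smooth D)
  (fun _ _ => I) (fun z _ => df_VK D z) (z := F z) I).
Qed.

Lemma diffeo_open U : open U -> open (F @^-1` U).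
Proof.
move=> oU; have := open_preim_smooth openT oU (df_smooth D).
by congr open; apply/seteqP; split=> z; [case|split].
Qed.

Lemma split_data_pullback U g phi xi P h : open U -> split_data U g phi xi P h ->
  split_data (F @^-1` U) (pb_g F g) (fun i => pb_endo F rho (phi i))
    (fun i => pb_field F rho (xi i)) (pb_endo F rho P) h.
Proof.
move=> oU S; have C := sd_contact S; have oU' := diffeo_open oU.
have sF : smooth_on (F @^-1` U) F := @smooth_onS R _ _ _ setT F (@subsetT _ _) (df_smooth D).
have sr : smooth_on U rho := @smooth_onS R _ _ _ setT rho (@subsetT _ _) (df_smoothV D).
have FU z : (F @^-1` U) z -> U (F z) by [].
have FK z : (F @^-1` U) z -> rho (F z) = z by move=> _; exact: df_K D z.
have phi_inv i z : (F @^-1` U) z -> pb_endo F rho (phi i) z *m 'J F z = 'J F z *m phi i (F z).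
  by move=> _; rewrite /pb_endo -(mulmxA _ ('J rho (F z))) diffeo_jacobianV mulmx1.
have xi_inv i z : (F @^-1` U) z -> pb_field F rho (xi i) z *m 'J F z = xi i (F z).
  by move=> _; rewrite /pb_field -mulmxA diffeo_jacobianV mulmx1.
have KJ := diffeo_jacobianV.
split.
- exact: (contact_data_pullback oU' oU sF sr FU FK C phi_inv xi_inv).
- exact: (smooth_pb_endo oU' oU sF sr FU (sd_smooth S)).
- move=> z Uz; rewrite /pb_endo; have E := sd_idem S Uz; have := KJ z.
  move: ('J F z) ('J rho (F z)) (P (F z)) E => J K Q E KJz.
  by rewrite !mulmxA -(mulmxA _ K) KJz mulmx1 -(mulmxA J Q Q) E.
- move=> z Uz; rewrite /pb_endo /pb_g; have E := sd_sym S Uz; have := KJ z.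
  move: ('J F z) ('J rho (F z)) (P (F z)) (g (F z)) E => J K Q G E KJz.
  rewrite !trmx_mul !mulmxA -(mulmxA _ K) KJz mulmx1 -(mulmxA J Q G) E.
  by rewrite -[in RHS](mulmxA _ J^T K^T) -trmx_mul KJz trmx1 mulmx1 mulmxA.
- move=> z i Uz; rewrite /pb_endo; have E := sd_phi S i Uz; have := KJ z.
  move: ('J F z) ('J rho (F z)) (P (F z)) (phi i (F z)) E => J K Q G E KJz.
  by rewrite !mulmxA -!(mulmxA _ K) KJz !mulmx1 -!(mulmxA J) E.
- move=> z i Uz; rewrite /pb_endo /pb_field; have E := sd_xi S i Uz; have := KJ z.
  move: ('J F z) ('J rho (F z)) (P (F z)) (xi i (F z)) E => J K Q G E KJz.
  by rewrite !mulmxA -(mulmxA _ K) KJz mulmx1 E.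
- move=> z i Uz; apply: bil_eq => v w.
  apply: (etrans (curl_pullback oU' oU sF sr FU FK C xi_inv i v w Uz)).
  rewrite (sd_curl S i Uz) (jacobianE v oU' sF Uz) (jacobianE w oU' sF Uz) /pb_endo /pb_g.
  have := KJ z; move: ('J F z) ('J rho (F z)) (P (F z)) (g (F z)) (phi i (F z)) => J K Q G A KJz.
  rewrite !bilZ; congr (_ * _); rewrite !trmx_mul !mulmxA -(mulmxA _ K) KJz mulmx1.
  by rewrite -(mulmxA _ J^T) -trmx_mul KJz trmx1 mulmx1 /bil trmx_mul !mulmxA.
Qed.

End SplitPullback.

Lemma split_dataS (R : realType) d (U W : set 'rV[R]_d) g phi xi P h :
  W `<=` U -> split_data U g phi xi P h -> split_data W g phi xi P h.
Proof.
move=> WU [[c1 c2 c3 c4 c5 c6 c7] s1 s2 s3 s4 s5 s6].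
have S e m (f : 'rV[R]_d -> 'M[R]_(e, m)) : smooth_on U f -> smooth_on W f.
  exact: (@smooth_onS R _ _ W U f WU).
split.
- split.
  + exact: S c1.
  + by move=> i; exact: S (c2 i).
  + by move=> i; exact: S (c3 i).
  + by move=> u /WU; exact: c4.
  + by move=> u i /WU; exact: c5.
  + by move=> i V X Y u oV VW; exact: c6 oV (subset_trans VW WU).
  + by move=> i V X Y Z u oV VW; exact: c7 oV (subset_trans VW WU).
- exact: S s1.
- by move=> u /WU; exact: s2.
- by move=> u /WU; exact: s3.
- by move=> u i /WU; exact: s4.
- by move=> u i /WU; exact: s5.
- by move=> u i /WU; exact: s6.
Qed.

Lemma split_data_congr (R : realType) d (U : set 'rV[R]_d) g phi xi P P' h :
  open U -> (forall z, U z -> P z = P' z) ->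
  split_data U g phi xi P h -> split_data U g phi xi P' h.
Proof.
move=> oU PP [s0 s1 s2 s3 s4 s5 s6]; split; first exact: s0.
- exact: smooth_on_eq oU PP s1.
- by move=> u Uu; rewrite -PP// s2.
- by move=> u Uu; rewrite -PP// s3.
- by move=> u i Uu; rewrite -PP// s4.
- by move=> u i Uu; rewrite -PP// s5.
- by move=> u i Uu; rewrite -PP// s6.
Qed.

(** * Adapted coordinates *)

Lemma idem_basis (K : fieldType) D k e (M : 'M[K]_D) :
  M *m M = M -> \rank M = k -> D = (k + e)%N ->
  exists (B : 'M[K]_(k + e, D)) (B' : 'M[K]_(D, k + e)),
    [/\ B *m B' = 1%:M, B' *m B = 1%:M,
      forall x : 'rV[K]_k, row_mx x 0 *m B *m M = row_mx x 0 *m B &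
      forall y : 'rV[K]_e, row_mx 0 y *m B *m M = 0].
Proof.
move=> MM rk De.
have [B1 fB1 EB1] : exists2 B1 : 'M[K]_(k, D), row_free B1 & (B1 :=: M)%MS.
  by rewrite -rk; exists (row_base M); [exact: row_base_free|exact: eq_row_base].
have [B2 fB2 EB2] : exists2 B2 : 'M[K]_(e, D), row_free B2 & (B2 :=: kermx M)%MS.
  have -> : e = \rank (kermx M) by rewrite mxrank_ker rk De addnC addnK.
  by exists (row_base (kermx M)); [exact: row_base_free|exact: eq_row_base].
have B1M : B1 *m M = B1.
  have /submxP[A ->] : (B1 <= M)%MS by rewrite EB1.
  by rewrite -mulmxA MM.
have B2M : B2 *m M = 0 by apply/sub_kermxP; rewrite EB2.
have rB : \rank (col_mx B1 B2) = (k + e)%N.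
  rewrite -addsmxE mxrank_disjoint_sum; first by rewrite (eqP fB1) (eqP fB2).
  apply/eqP; rewrite -submx0; apply/rV_subP => v; rewrite sub_capmx => /andP[].
  by move=> /submxP[a ->] /submxP[b E]; rewrite -B1M mulmxA E -mulmxA B2M mulmx0 sub0mx.
have /row_freeP[B' BB'] : row_free (col_mx B1 B2) by rewrite /row_free rB.
have /row_fullP[B'' BB''] : row_full (col_mx B1 B2) by rewrite /row_full rB De.
have BE : B'' = B' by rewrite -[B'']mulmx1 -BB' mulmxA BB'' mul1mx.
exists (col_mx B1 B2), B'; split => //; first by rewrite -BE.
- by move=> x; rewrite mul_row_col mul0mx addr0 -mulmxA B1M.
- by move=> y; rewrite mul_row_col mul0mx add0r -mulmxA B2M mulmx0.
Qed.

Section NormalForm.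
Context {R : realType}.

Lemma pb_endo_eq n m (F : 'rV[R]_n -> 'rV[R]_m) rho P z v w : diffeo F rho ->
  'D_w F z = 'D_v F z *m P (F z) -> v *m pb_endo F rho P z = w.
Proof.
move=> D E; rewrite /pb_endo !mulmxA.
have JE u : 'D_u F z = u *m 'J F z := jacobianE u openT (df_smooth D) I.
by rewrite -JE -E JE -mulmxA (diffeo_jacobian D) mulmx1.
Qed.

Lemma diffeo_pb_g n m (F : 'rV[R]_n -> 'rV[R]_m) rho g (z v w : 'rV[R]_n) :
  diffeo F rho -> bil (pb_g F g z) v w = bil (g (F z)) ('D_v F z) ('D_w F z).
Proof.
move=> D; rewrite /bil /pb_g !(jacobianE _ openT (df_smooth D) (I : setT z)).
by rewrite trmx_mul !mulmxA.
Qed.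

Lemma linear_diffeo n m (B : 'M[R]_(n, m)) (B' : 'M[R]_(m, n)) (a : 'rV[R]_m) :
  B *m B' = 1%:M -> B' *m B = 1%:M ->
  diffeo (fun z : 'rV[R]_n => a + z *m B) (fun z => (z - a) *m B') /\
  forall z v, 'D_v (fun z : 'rV[R]_n => a + z *m B) z = v *m B.
Proof.
move=> BB BB'.
have sl p q (A : 'M[R]_(p, q)) : smooth_on setT (fun z : 'rV[R]_p => z *m A).
  by apply: (smooth_on_coord openT) => s u v; rewrite mulmxDl scalemxAl.
split; first split.
- exact: (smooth_on_mxD openT (smooth_on_cst a openT) (sl _ _ B)).
- apply: (smooth_on_eq openT _ (smooth_on_mxD openT (sl _ _ B') (smooth_on_cst (- (a *m B')) openT))).
  by move=> z _; rewrite mulmxBl.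
- by move=> z; rewrite addrAC subrr add0r -mulmxA BB mulmx1.
- by move=> z; rewrite -mulmxA BB' mulmx1 addrC subrK.
move=> z v.
have d : is_derive z v (fun z : 'rV[R]_n => z *m B) (v *m B).
  have := is_derive_mulmx (is_derive_id z v) (is_derive_cst B z v).
  by rewrite mulmx0 addr0.
have [_ ->] := is_deriveD (is_derive_cst a z v) d; exact: add0r.
Qed.

(* [O'] is the domain of coordinates, centred at [u0], in which the split
   structure has projection [P']. *)
Definition split_model D n (O : set 'rV[R]_D) (g : 'rV[R]_D -> 'M[R]_D) u0 h
    (O' : set 'rV[R]_n) (P' : 'rV[R]_n -> 'M[R]_n) : Prop :=
  exists F rho g' phi' xi', [/\ diffeo F rho, F 0 = u0, split_data O' g' phi' xi' P' h &
    forall z, O' z -> O (F z) /\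
      forall v w, bil (g' z) v w = bil (g (F z)) ('D_v F z) ('D_w F z)].

Lemma split_modelS D n (O : set 'rV[R]_D) g u0 h (O' W : set 'rV[R]_n) P' P'' :
  open W -> W `<=` O' -> (forall z, W z -> P' z = P'' z) ->
  split_model O g u0 h O' P' -> split_model O g u0 h W P''.
Proof.
move=> oW WO PP [F [rho [g' [phi' [xi' [D1 D2 D3 D4]]]]]].
exists F, rho, g', phi', xi'; split.
- exact: D1.
- exact: D2.
- exact: (split_data_congr oW PP (split_dataS WO D3)).
- by move=> z /WO; exact: D4.
Qed.

Lemma split_model_pullback D n m (O : set 'rV[R]_D) g u0 h (O' : set 'rV[R]_n) P'
    (F : 'rV[R]_m -> 'rV[R]_n) rho :
  diffeo F rho -> F 0 = 0 -> open O' -> split_model O g u0 h O' P' ->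
  split_model O g u0 h (F @^-1` O') (pb_endo F rho P').
Proof.
move=> dF F0 oO' [F1 [rho1 [g1 [phi1 [xi1 [D1 D2 D3 D4]]]]]].
exists (F1 \o F), (rho \o rho1), (pb_g F g1), (fun i => pb_endo F rho (phi1 i)), (fun i => pb_field F rho (xi1 i)).
split.
- exact: diffeo_comp dF D1.
- by rewrite /= F0.
- exact: split_data_pullback.
- move=> z Oz; have [OF E] := D4 _ Oz; split; first exact: OF.
  move=> v w.
  have ch u : 'D_u (F1 \o F) z = 'D_('D_u F z) F1 (F z).
    exact: (derive_chain u openT openT (df_smooth dF) (df_smooth D1) I I).
  rewrite (ch v) (ch w) -E.
  exact: diffeo_pb_g dF.
Qed.

Lemma split_model_smooth D n (O : set 'rV[R]_D) g u0 h (O' : set 'rV[R]_n) P' :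
  split_model O g u0 h O' P' -> smooth_on O' P' /\ forall z, O' z -> P' z *m P' z = P' z.
Proof.
move=> [F [rho [g' [phi' [xi' [_ _ S _]]]]]]; split; first exact: sd_smooth S.
exact: sd_idem S.
Qed.

Lemma split_model_integrable D n (O : set 'rV[R]_D) g u0 h (O' : set 'rV[R]_n) P' :
  h != 0 -> open O' -> split_model O g u0 h O' P' ->
  integrable_idem O' P' /\ integrable_idem O' (fun z => 1%:M - P' z).
Proof.
move=> h0 oO' [F [rho [g' [phi' [xi' [_ _ S _]]]]]]; split.
- exact: split_integrable oO' S h0.
- exact: split_integrableC oO' S h0.
Qed.

Lemma split_model_affine D k e (O : set 'rV[R]_D) g phi xi P h u0 :
  D = (k + e)%N -> open O -> O u0 -> split_data O g phi xi P h -> \rank (P u0) = k ->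
  exists (O' : set 'rV[R]_(k + e)) P', [/\ open O', O' 0,
    split_model O g u0 h O' P', forall x : 'rV[R]_k, row_mx x 0 *m P' 0 = row_mx x 0 &
    forall y : 'rV[R]_e, row_mx 0 y *m P' 0 = 0].
Proof.
move=> De oO Ou S rk.
have [B [B' [BB BB' B1 B2]]] := idem_basis (sd_idem S Ou) rk De.
have [D1 DE] := linear_diffeo u0 BB BB'.
set F := (fun z => _) in D1 DE; set rho := (fun z => _) in D1.
have F0 : F 0 = u0 by rewrite /F mul0mx addr0.
exists (F @^-1` O), (pb_endo F rho P); split.
- exact: (@diffeo_open R _ _ F rho D1 O oO).
- by rewrite /= F0.
- exists F, rho, (pb_g F g), (fun i => pb_endo F rho (phi i)), (fun i => pb_field F rho (xi i)).
  split=> //; first exact: split_data_pullback.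
  move=> z Oz; split; first exact: Oz.
  by move=> v w; exact: diffeo_pb_g D1.
- by move=> x; apply: (pb_endo_eq D1); rewrite !DE F0 B1.
- by move=> y; apply: (pb_endo_eq D1); rewrite !DE F0 B2 mul0mx.
Qed.

Lemma derive_lsubmx k e (F : 'rV[R]_(k + e) -> 'rV[R]_(k + e)) rho (z w : 'rV[R]_(k + e)) :
  diffeo F rho -> (forall z, lsubmx (F z) = lsubmx z) -> lsubmx ('D_w F z) = lsubmx w.
Proof.
move=> D lF.
have dF : is_derive z w F ('D_w F z) := smooth_is_derive w openT (df_smooth D) I.
have [_ <-] : is_derive z w (lsubmx \o F) (lsubmx ('D_w F z)) := is_derive_linear_mx lsubmx dF.
have [_ <-] : is_derive z w (lsubmx \o id) (lsubmx w) := is_derive_linear_mx lsubmx (is_derive_id z w).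
by apply: (derive_congr w openT I) => y _; exact: lF.
Qed.

Lemma lin_blocks k e (A B : 'M[R]_(k + e)) :
  (forall x : 'rV[R]_k, row_mx x 0 *m A = row_mx x 0 *m B) ->
  (forall y : 'rV[R]_e, row_mx 0 y *m A = row_mx 0 y *m B) -> A = B.
Proof.
move=> hx hy; apply: mx_row_eq => v; rewrite -[v]hsubmxK.
have -> : row_mx (lsubmx v) (rsubmx v) = row_mx (lsubmx v) 0 + row_mx 0 (rsubmx v) :> 'rV[R]_(k + e).
  by rewrite add_row_mx addr0 add0r.
by rewrite !mulmxDl hx hy.
Qed.

Lemma row_mx_ulsubmx k e (x : 'rV[R]_k) (A : 'M[R]_(k + e)) :
  row_mx x (0 : 'rV[R]_e) *m A = row_mx (x *m ulsubmx A) (x *m ursubmx A).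
Proof. by rewrite -{1}[A]submxK mul_row_block !mul0mx !addr0. Qed.

Lemma row_mx_drsubmx k e (y : 'rV[R]_e) (A : 'M[R]_(k + e)) :
  row_mx (0 : 'rV[R]_k) y *m A = row_mx (y *m dlsubmx A) (y *m drsubmx A).
Proof. by rewrite -{1}[A]submxK mul_row_block !mul0mx !add0r. Qed.

Lemma ulsubmx_drsubmx k e (A : 'M[R]_(k + e)) :
  (forall x : 'rV[R]_k, row_mx x 0 *m A = row_mx x 0) ->
  (forall y : 'rV[R]_e, rsubmx (row_mx 0 y *m A) = 0) ->
  ulsubmx A = 1%:M /\ drsubmx (1%:M - A) = 1%:M.
Proof.
move=> hx hy; split.
  apply: mx_row_eq => x; rewrite mulmx1; move: (hx x).
  by rewrite row_mx_ulsubmx => /eq_row_mx[].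
have -> : drsubmx (1%:M - A) = 1%:M - drsubmx A.
  by apply/matrixP => i j; rewrite !mxE eq_rshift.
have -> : drsubmx A = 0; last by rewrite subr0.
apply: mx_row_eq => y; rewrite mulmx0; move: (hy y).
by rewrite row_mx_drsubmx row_mxKr.
Qed.

(* The leaves tangent to [im P] become the horizontal slices. *)
Lemma split_model_straighten D k e (O : set 'rV[R]_D) g u0 h (O' : set 'rV[R]_(k + e)) P' :
  h != 0 -> open O' -> O' 0 -> split_model O g u0 h O' P' ->
  (forall x : 'rV[R]_k, row_mx x 0 *m P' 0 = row_mx x 0) ->
  (forall y : 'rV[R]_e, rsubmx (row_mx 0 y *m P' 0) = 0) ->
  exists (W : set 'rV[R]_(k + e)) P'', [/\ open W, W 0, split_model O g u0 h W P'',
    forall z (x : 'rV[R]_k), W z -> row_mx x 0 *m P'' z = row_mx x 0 &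
    forall z (w : 'rV[R]_(k + e)), W z -> rsubmx (w *m P'' z) = 0].
Proof.
move=> h0 oO O0 S hx hy; have [sP PP] := split_model_smooth S.
have [int _] := split_model_integrable h0 oO S.
have [ul1 dr1] := ulsubmx_drsubmx hx hy.
have [||F [rho [dF [lF F0 [r r0 HF]]]]] := straighten_idem oO O0 sP PP _ _ int.
- by rewrite ul1 unitmx1.
- by rewrite dr1 unitmx1.
pose W := [set z : 'rV[R]_(k + e) | `|z| < r].
have oW : open W by exact: ball0_open.
have WO : W `<=` F @^-1` O' by move=> z /HF[].
have S1 := split_model_pullback dF F0 oO S.
have S2 := split_modelS oW WO (fun _ _ => erefl) S1.
have fx z (x : 'rV[R]_k) : W z -> row_mx x 0 *m pb_endo F rho P' z = row_mx x 0.
  by move=> /HF[_ E _]; apply: (pb_endo_eq dF); rewrite E.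
exists W, (pb_endo F rho P'); split=> //; first by rewrite /W /= normr0.
move=> z w Wz; have [Oz _ H0] := HF _ Wz.
have [_ idem] := split_model_smooth S2.
set v := w *m _; have vv : v *m pb_endo F rho P' z = v by rewrite /v -mulmxA idem.
pose v1 : 'rV[R]_(k + e) := row_mx 0 (rsubmx v).
suff : v1 = 0 by move/(congr1 rsubmx); rewrite row_mxKr linear0.
have v1E : v1 = v - row_mx (lsubmx v) 0.
  have split (a : 'rV[R]_(k + e)) : row_mx 0 (rsubmx a) = a - row_mx (lsubmx a) 0.
    by rewrite -{2}[a]hsubmxK opp_row_mx add_row_mx subrr oppr0 addr0.
  exact: split.
have v1v1 : v1 *m pb_endo F rho P' z = v1 by rewrite v1E mulmxBl vv fx.
have DP : 'D_v1 F z *m P' (F z) = 'D_v1 F z.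
  have JE u : 'D_u F z = u *m 'J F z := jacobianE u openT (df_smooth dF) I.
  rewrite -[in RHS]v1v1 !JE /pb_endo !mulmxA -[RHS]mulmxA (diffeo_jacobianV dF) mulmx1.
  by [].
have D0 : 'D_v1 F z = 0.
  by apply: H0 => //; rewrite (derive_lsubmx _ _ dF lF) row_mxKl.
by rewrite -v1v1; apply: (pb_endo_eq dF); rewrite D0 mul0mx derive0.
Qed.

Definition swapmx m n : 'M[R]_(m + n, n + m) := block_mx 0 1%:M 1%:M 0.

Lemma swapmxK m n : swapmx m n *m swapmx n m = 1%:M.
Proof.
by rewrite mulmx_block !mul0mx !mulmx0 !mulmx1 !addr0 !add0r -scalar_mx_block.
Qed.

Lemma row_swapmx m n (a : 'rV[R]_m) (b : 'rV[R]_n) : row_mx a b *m swapmx m n = row_mx b a.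
Proof. by rewrite mul_row_block !mulmx0 !mulmx1 addr0 add0r. Qed.

(* Exchanging the blocks of coordinates, the leaves tangent to [ker P] become
   the vertical slices. *)
Lemma split_model_straightenC D k e (O : set 'rV[R]_D) g u0 h (O' : set 'rV[R]_(k + e)) P' :
  h != 0 -> open O' -> O' 0 -> split_model O g u0 h O' P' ->
  (forall z (x : 'rV[R]_k), O' z -> row_mx x 0 *m P' z = row_mx x 0) ->
  (forall z (w : 'rV[R]_(k + e)), O' z -> rsubmx (w *m P' z) = 0) ->
  exists W : set 'rV[R]_(k + e),
    [/\ open W, W 0 & split_model O g u0 h W (fun=> block_mx 1%:M 0 0 0)].
Proof.
move=> h0 oO O0 S hx hy.
have [dT DT] := linear_diffeo (0 : 'rV[R]_(k + e)) (swapmxK e k) (swapmxK k e).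
have [dT' DT'] := linear_diffeo (0 : 'rV[R]_(e + k)) (swapmxK k e) (swapmxK e k).
set T := (fun z => _) in dT DT; set T1 := (fun z => _) in dT.
set T' := (fun z => _) in dT' DT'; set T1' := (fun z => _) in dT'.
have T0 : T 0 = 0 by rewrite /T mul0mx addr0.
have T'0 : T' 0 = 0 by rewrite /T' mul0mx addr0.
pose O3 := T @^-1` O'; have oO3 : open O3 by exact: (@diffeo_open R _ _ T T1 dT O' oO).
have O30 : O3 0 by rewrite /O3 /= T0.
have S3 : split_model O g u0 h O3 (pb_endo T T1 P') := split_model_pullback dT T0 oO S.
pose P3 := pb_endo T T1 P'.
have P3x z (x : 'rV[R]_k) : O3 z -> row_mx 0 x *m P3 z = row_mx 0 x.
  by move=> Oz; apply: (pb_endo_eq dT); rewrite !DT row_swapmx (hx _ _ Oz).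
have P3l z (w : 'rV[R]_(e + k)) : O3 z -> lsubmx (w *m P3 z) = 0.
  move=> Oz; pose a : 'rV[R]_k := lsubmx (w *m swapmx e k *m P' (T z)).
  have -> : w *m P3 z = row_mx 0 a; last by rewrite row_mxKl.
  apply: (pb_endo_eq dT); rewrite !DT row_swapmx.
  by rewrite -[RHS]hsubmxK (hy _ _ Oz).
have [sP PP] := split_model_smooth S3.
have [_ int] := split_model_integrable h0 oO3 S3.
pose Q z := 1%:M - P3 z.
have sQ : smooth_on O3 Q := smooth_on_mxB oO3 (smooth_on_cst (1%:M : 'M[R]_(e + k)) oO3) sP.
have QQ z : O3 z -> Q z *m Q z = Q z.
  by move=> Oz; rewrite /Q mulmxBl !mulmxBr !mul1mx !mulmx1 (PP _ Oz) subrr subr0.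
have uQ : ulsubmx (Q 0) = 1%:M.
  have -> : ulsubmx (Q 0) = 1%:M - ulsubmx (P3 0).
    by apply/matrixP => i j; rewrite !mxE eq_lshift.
  suff -> : ulsubmx (P3 0) = 0 by rewrite subr0.
  apply: mx_row_eq => y; rewrite mulmx0; have := P3l 0 (row_mx y 0) O30.
  by rewrite row_mx_ulsubmx row_mxKl.
have dQ : drsubmx (1%:M - Q 0) = 1%:M.
  rewrite /Q opprB addrC subrK; apply: mx_row_eq => x; rewrite mulmx1.
  by have := P3x 0 x O30; rewrite row_mx_drsubmx => /eq_row_mx[].
have [||F [rho [dF [lF F0 [r r0 HF]]]]] := straighten_idem oO3 O30 sQ QQ _ _ int.
- by rewrite uQ unitmx1.
- by rewrite dQ unitmx1.
pose W := [set z : 'rV[R]_(e + k) | `|z| < r].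
have oW : open W by exact: ball0_open.
have WO : W `<=` F @^-1` O3 by move=> z /HF[].
have S5 := split_model_pullback dT' T'0 oW (split_modelS oW WO (fun _ _ => erefl) (split_model_pullback dF F0 oO3 S3)).
have oW' : open (T' @^-1` W) by exact: (@diffeo_open R _ _ T' T1' dT' W oW).
exists (T' @^-1` W); split=> //; first by rewrite /W /= T'0 normr0.
apply: split_modelS S5 => // z Wz; have [Oz FQ _] := HF _ Wz.
have P4y (y : 'rV[R]_e) : row_mx y 0 *m pb_endo F rho P3 (T' z) = 0.
  apply: (pb_endo_eq dF); have := FQ y; rewrite /Q mulmxBr mulmx1 derive0.
  move: ('D_(row_mx y 0) F (T' z)) (P3 (F (T' z))) => a A.
  by rewrite -[in X in _ = X](subr0 a) => /addrI/oppr_inj ->.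
have P4x (x : 'rV[R]_k) : row_mx 0 x *m pb_endo F rho P3 (T' z) = row_mx 0 x.
  apply: (pb_endo_eq dF); have l0 : lsubmx ('D_(row_mx 0 x) F (T' z)) = 0.
    by rewrite (derive_lsubmx _ _ dF lF) row_mxKl.
  have gen (a : 'rV[R]_(e + k)) : lsubmx a = 0 -> a *m P3 (F (T' z)) = a.
    by move=> a0; rewrite -[a]hsubmxK a0 P3x.
  by rewrite gen.
apply: lin_blocks => [x|y].
- rewrite mul_row_block !mul0mx mulmx1 mulmx0 !addr0; apply: (pb_endo_eq dT').
  by rewrite !DT' row_swapmx P4x.
- rewrite mul_row_block !mul0mx !mulmx0 !addr0 row_mx0; apply: (pb_endo_eq dT').
  by rewrite !DT' row_swapmx P4y mul0mx.
Qed.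

Lemma split_normal_form D k e (O : set 'rV[R]_D) g phi xi P h u0 :
  D = (k + e)%N -> h != 0 -> open O -> O u0 -> split_data O g phi xi P h -> \rank (P u0) = k ->
  exists2 r, 0 < r & split_model O g u0 h [set z : 'rV[R]_(k + e) | `|z| < r]
    (fun=> block_mx 1%:M 0 0 0).
Proof.
move=> De h0 oO Ou S rk.
have [V1 [P1 [oV1 V10 S1 x1 y1]]] := split_model_affine De oO Ou S rk.
have [|V2 [P2 [oV2 V20 S2 x2 y2]]] := split_model_straighten h0 oV1 V10 S1 x1.
  by move=> y; rewrite y1 linear0.
have [W [oW W0 S3]] := split_model_straightenC h0 oV2 V20 S2 x2 y2.
have [r r0 rW] := open_ball_norm oW W0.
exists r => //; apply: split_modelS S3 => //; first exact: ball0_open.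
by move=> z /= zr; apply: rW; rewrite subr0 ltW.
Qed.

End NormalForm.

(** * Splitting of the metric *)

Lemma const_along (R : realType) d (r : R) (f : 'rV[R]_d -> R) (u v : 'rV[R]_d) :
  smooth_on [set z | `|z| < r] f -> `|u| < r -> `|u + v| < r ->
  (forall z, `|z| < r -> 'D_v f z = 0) -> f (u + v) = f u.
Proof.
move=> sf ur uvr D0.
have seg t : 0 <= t <= 1 -> `|u + t *: v| < r.
  move=> /andP[t0 t1]; have -> : u + t *: v = (1 - t) *: u + t *: (u + v).
    by rewrite scalerBl scale1r scalerDr addrA subrK.
  apply: (le_lt_trans (ler_normD _ _)); rewrite !normrZ (ger0_norm t0) ger0_norm ?subr_ge0//.
  have [->|t0'] := eqVneq t 0; first by rewrite subr0 mul1r mul0r addr0.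
  have tp : 0 < t by rewrite lt_neqAle eq_sym t0' t0.
  have -> : r = (1 - t) * r + t * r by rewrite -mulrDl subrK mul1r.
  by rewrite ler_ltD// ?ler_wpM2l ?subr_ge0 ?(ltW ur)// ltr_pM2l.
have df t : 0 <= t <= 1 -> derivable f (u + t *: v) v.
  move=> tP; apply: diff_derivable.
  exact: (smooth_on_diff (@ball0_open R d r) sf (seg t tP)).
have [t /seg tr E] := mean_value_line df.
by apply/eqP; rewrite -subr_eq0 E D0.
Qed.

Definition horizontal (R : realType) k e (a : 'rV[R]_k) : 'rV[R]_(k + e) := row_mx a 0.
Definition vertical (R : realType) k e (b : 'rV[R]_e) : 'rV[R]_(k + e) := row_mx 0 b.

Section Splitting.
Context {R : realType} {k e : nat}.
Variables (r : R) (g : 'rV[R]_(k + e) -> 'M[R]_(k + e)).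
Variables (phi : 'I_3 -> 'rV[R]_(k + e) -> 'M[R]_(k + e)) (xi : 'I_3 -> 'rV[R]_(k + e) -> 'rV[R]_(k + e)).
Variable h : R.
Hypothesis h0 : h != 0.
Let B := [set z : 'rV[R]_(k + e) | `|z| < r].
Hypothesis S : split_data B g phi xi (fun=> block_mx 1%:M 0 0 0) h.
Let C := sd_contact S.
Let oB : open B := @ball0_open R _ r.
Let P : 'M[R]_(k + e) := block_mx 1%:M 0 0 0.
Local Notation lE := (@horizontal R k e).
Local Notation lF := (@vertical R k e).

Let lEP a : lE a *m P = lE a.
Proof. by rewrite /horizontal /P mul_row_block mulmx1 !mulmx0 !addr0. Qed.

Let lFP b : lF b *m P = 0.
Proof. by rewrite /vertical /P mul_row_block !mulmx0 !mul0mx !addr0 row_mx0. Qed.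

Let fixE v : v *m P = v -> v = lE (lsubmx v).
Proof.
rewrite /horizontal -{1 2}[v]hsubmxK mul_row_block !mulmx0 mulmx1 !addr0.
by move=> /eq_row_mx[_ E]; rewrite -{1}[v]hsubmxK -E.
Qed.

Let fixF v : v *m P = 0 -> v = lF (rsubmx v).
Proof.
rewrite /vertical -{1}[v]hsubmxK mul_row_block !mulmx0 mulmx1 !addr0 -[RHS](row_mx0 _ 1 k e).
by move=> /eq_row_mx[E _]; rewrite -{1}[v]hsubmxK E.
Qed.

Lemma split_phiE i z a : B z -> lE a *m phi i z = lE (lsubmx (lE a *m phi i z)).
Proof. by move=> Bz; apply: fixE; rewrite -mulmxA -(sd_phi S i Bz) mulmxA lEP. Qed.

Lemma split_phiF i z b : B z -> lF b *m phi i z = lF (rsubmx (lF b *m phi i z)).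
Proof. by move=> Bz; apply: fixF; rewrite -mulmxA -(sd_phi S i Bz) mulmxA lFP mul0mx. Qed.

Lemma split_xiE i z : B z -> xi i z = lE (lsubmx (xi i z)).
Proof. by move=> Bz; apply: fixE; apply: etrans (sd_xi S i Bz). Qed.

Lemma split_ortho z a b : B z -> bil (g z) (lE a) (lF b) = 0.
Proof. by move=> Bz; rewrite -lEP -bilM (sd_sym S Bz) bilMT lFP bil0r. Qed.

Lemma split_orthoC z a b : B z -> bil (g z) (lF b) (lE a) = 0.
Proof. by move=> Bz; rewrite (c3_sym (cd_contact C Bz)) split_ortho. Qed.

Let n i z := xi i z *m g z.
Let sn i : smooth_on B (n i). Proof. exact: (smooth_on_mulmx oB (cd_xi C i) (cd_g C)). Qed.

Let curlE i z v w : B z -> bil (curl (n i) z) v w = h * bil (g z) (v *m P) (w *m phi i z).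
Proof. by move=> Bz; rewrite (sd_curl S i Bz) bilZ bilMT bilM. Qed.

Let curl_skew i z v w : bil (curl (n i) z) v w = - bil (curl (n i) z) w v.
Proof. by rewrite bilC curl_tr /bil mulmxN mulNmx mxE. Qed.

Let curlF i z b w : B z -> bil (curl (n i) z) (lF b) w = 0.
Proof. by move=> Bz; rewrite curlE// lFP bil0l mulr0. Qed.

Let Dbil (A : 'rV[R]_(k + e) -> 'M[R]_(k + e)) z x v w : smooth_on B A -> B z ->
  'D_x (fun z => bil (A z) v w) z = bil ('D_x A z) v w.
Proof.
move=> sA Bz; have sc (u : 'rV[R]_(k + e)) := smooth_on_cst u oB.
by rewrite (derive_bil x oB sA (sc v) (sc w) Bz) !derive_cst bil0l bil0r !addr0.
Qed.

Let Dbil0 (A : 'rV[R]_(k + e) -> 'M[R]_(k + e)) z x v w : smooth_on B A -> B z ->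
  (forall y, B y -> bil (A y) v w = 0) -> bil ('D_x A z) v w = 0.
Proof.
move=> sA Bz A0; rewrite -(Dbil x v w sA Bz).
by rewrite (@derive_congr _ _ _ _ _ (fun=> 0) _ x oB Bz A0) derive_cst.
Qed.

Let smooth_bil (A : 'rV[R]_(k + e) -> 'M[R]_(k + e)) v w : smooth_on B A ->
  smooth_on B (fun z => bil (A z) v w).
Proof.
move=> sA; have sc p q (u : 'M[R]_(p, q)) := smooth_on_cst u oB.
exact: (smooth_on_entry 0 0 oB (smooth_on_mulmx oB (smooth_on_mulmx oB (sc _ _ v) sA) (sc _ _ w^T))).
Qed.

Let eta_constant i z a b : B z -> 'D_(lF b) (fun z => pairing (n i z) (lE a)) z = 0.
Proof.
move=> Bz; have sc (u : 'rV[R]_(k + e)) := smooth_on_cst u oB.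
have := d1E_curl oB (sn i) (sc (lF b)) (sc (lE a)) Bz.
rewrite (curlF _ _ _ Bz) /d1E.
have -> : lbr (fun=> lF b) (fun=> lE a) z = 0 by rewrite /lbr !derive_cst subrr.
have -> : 'D_(lE a) (fun z => pairing (n i z) (lF b)) z = 0.
  have E y : B y -> pairing (n i y) (lF b) = 0.
    by move=> By; rewrite -bil_pairing (split_xiE i By) split_ortho.
  by rewrite (@derive_congr _ _ _ _ _ (fun=> 0) _ _ oB Bz E) derive_cst.
have -> : pairing (n i z) 0 = 0 by rewrite /pairing trmx0 mulmx0 mxE.
by rewrite !subr0 => /eqP; rewrite mulf_eq0 invr_eq0 pnatr_eq0 => /eqP.
Qed.

Let vanish3 (x y z : R) : y = 0 -> z = 0 -> x + y + z = 0 -> x = 0.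
Proof. by move=> -> ->; rewrite !addr0. Qed.

Let omegaE_constant i z a a' b : B z ->
  'D_(lF b) (fun z => bil (curl (n i) z) (lE a) (lE a')) z = 0.
Proof.
move=> Bz; have sc := smooth_on_curl oB (sn i).
rewrite (Dbil _ _ _ sc Bz); apply: (vanish3 _ _ (closed2_curl oB (sn i) Bz (lF b) (lE a) (lE a'))).
  by apply: (Dbil0 _ sc Bz) => y By; rewrite curl_skew curlF// oppr0.
by apply: (Dbil0 _ sc Bz) => y By; rewrite curlF.
Qed.

Let omegaF_constant i z a b b' : B z ->
  'D_(lE a) (fun z => bil (g z *m (phi i z)^T) (lF b) (lF b')) z = 0.
Proof.
move=> Bz; have sO := smooth_fundamental oB S i.
rewrite (Dbil _ _ _ sO Bz).
apply: (vanish3 _ _ (closed2_fundamental oB S i Bz (lE a) (lF b) (lF b'))).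
  by apply: (Dbil0 _ sO Bz) => y By; rewrite bilMT (split_phiE i _ By) split_orthoC.
by apply: (Dbil0 _ sO Bz) => y By; rewrite bilMT (split_phiF i _ By) split_ortho.
Qed.

Let lE_norm z : B z -> B (lE (lsubmx z)).
Proof.
rewrite /B /= => zr; apply: le_lt_trans zr; rewrite /horizontal norm_row_mx normr0 normr_ge0 andbT.
by have := lexx `|z|; rewrite -{1}[z]hsubmxK norm_row_mx => /andP[].
Qed.

Let lF_norm z : B z -> B (lF (rsubmx z)).
Proof.
rewrite /B /= => zr; apply: le_lt_trans zr; rewrite /vertical norm_row_mx normr0 normr_ge0 /=.
by have := lexx `|z|; rewrite -{1}[z]hsubmxK norm_row_mx => /andP[].
Qed.

Let splitz z : z = lE (lsubmx z) + lF (rsubmx z).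
Proof. by rewrite /horizontal /vertical add_row_mx addr0 add0r hsubmxK. Qed.

Let contactE z : B z -> contact3 (fun a a' => bil (g z) (lE a) (lE a'))
  (fun i a => lsubmx (lE a *m phi i z)) (fun i => lsubmx (xi i z)).
Proof.
move=> Bz; apply: (contact3_pullback (L := lE)) (cd_contact C Bz) => //.
- by move=> s u v; rewrite /horizontal scale_row_mx scaler0 add_row_mx addr0.
- by move=> u v /eq_row_mx[].
- by move=> i v; rewrite -split_phiE.
- by left=> i; rewrite -split_xiE.
Qed.

Let contactF z : B z -> contact3 (fun b b' => bil (g z) (lF b) (lF b'))
  (fun i b => rsubmx (lF b *m phi i z)) (fun=> 0).
Proof.
move=> Bz; apply: (contact3_pullback (L := lF)) (cd_contact C Bz) => //.
- by move=> s u v; rewrite /vertical scale_row_mx scaler0 add_row_mx addr0.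
- by move=> u v /eq_row_mx[].
- by move=> i v; rewrite -split_phiF.
- by right=> i; split=> // v; rewrite (split_xiE i Bz) split_ortho.
Qed.

Lemma split_metricE z a a' : B z ->
  bil (g z) (lE a) (lE a') = bil (g (lE (lsubmx z))) (lE a) (lE a').
Proof.
move=> Bz; have Bz0 := lE_norm Bz.
have cst (f : 'rV[R]_(k + e) -> R) : smooth_on B f ->
    (forall y b, B y -> 'D_(lF b) f y = 0) -> f z = f (lE (lsubmx z)).
  move=> sf D0; rewrite {1}(splitz z); apply: (const_along sf Bz0); first by rewrite -splitz.
  by move=> y By; exact: D0.
apply: (c3_unique (contactE Bz) (contactE Bz0)) => [i v|i u v].
- rewrite -!split_xiE// !bil_pairing.
  apply: (cst (fun z => pairing (n i z) (lE v))); last by move=> *; exact: eta_constant.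
  have sc (w : 'cV[R]_(k + e)) := smooth_on_cst w oB.
  exact: (smooth_on_entry 0 0 oB (smooth_on_mulmx oB (sn i) (sc (lE v)^T))).
- have om y : B y -> h * bil (g y) (lE u) (lE (lsubmx (lE v *m phi i y))) =
      bil (curl (n i) y) (lE u) (lE v).
    by move=> By; rewrite -(split_phiE i v By); apply: etrans (esym (curlE i _ _ By)); rewrite lEP.
  apply: (mulfI h0); apply: etrans (om _ Bz) (etrans _ (esym (om _ Bz0))).
  apply: (cst (fun z => bil (curl (n i) z) (lE u) (lE v))); last by move=> *; exact: omegaE_constant.
  exact: smooth_bil (smooth_on_curl oB (sn i)).
Qed.

Lemma split_metricF z b b' : B z ->
  bil (g z) (lF b) (lF b') = bil (g (lF (rsubmx z))) (lF b) (lF b').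
Proof.
move=> Bz; have Bz0 := lF_norm Bz.
have cst (f : 'rV[R]_(k + e) -> R) : smooth_on B f ->
    (forall y a, B y -> 'D_(lE a) f y = 0) -> f z = f (lF (rsubmx z)).
  move=> sf D0; rewrite {1}(splitz z) addrC; apply: (const_along sf Bz0).
    by rewrite addrC -splitz.
  by move=> y By; exact: D0.
apply: (c3_unique (contactF Bz) (contactF Bz0)) => [i v|i u v].
- by rewrite /vertical row_mx0 !bil0l.
- rewrite -!split_phiF// -!bilMT.
  apply: (cst (fun z => bil (g z *m (phi i z)^T) (lF u) (lF v))); last by move=> *; exact: omegaF_constant.
  exact: smooth_bil (smooth_fundamental oB S i).
Qed.

Lemma split_metric z v w : B z -> bil (g z) v w =
  bil (g (lE (lsubmx z))) (lE (lsubmx v)) (lE (lsubmx w)) +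
  bil (g (lF (rsubmx z))) (lF (rsubmx v)) (lF (rsubmx w)).
Proof.
move=> Bz; rewrite {1}(splitz v) {1}(splitz w) bilDl !bilDr.
rewrite split_ortho// split_orthoC// addr0 add0r.
by rewrite (split_metricE _ _ Bz) (split_metricF _ _ Bz).
Qed.

End Splitting.

(** * The structures on the slices *)

Section Slices.
Context {R : realType} {k e : nat}.
Variables (r : R) (g : 'rV[R]_(k + e) -> 'M[R]_(k + e)).
Variables (phi : 'I_3 -> 'rV[R]_(k + e) -> 'M[R]_(k + e)) (xi : 'I_3 -> 'rV[R]_(k + e) -> 'rV[R]_(k + e)).
Variable h : R.
Let B := [set z : 'rV[R]_(k + e) | `|z| < r].
Hypothesis S : split_data B g phi xi (fun=> block_mx 1%:M 0 0 0) h.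
Let C := sd_contact S.
Let oB : open B := @ball0_open R _ r.
Let P : 'M[R]_(k + e) := block_mx 1%:M 0 0 0.
Local Notation lE := (@horizontal R k e).
Local Notation lF := (@vertical R k e).
Let BE := [set z : 'rV[R]_k | `|z| < r].
Let BF := [set z : 'rV[R]_e | `|z| < r].
Let oBE : open BE := @ball0_open R _ r.
Let oBF : open BF := @ball0_open R _ r.

Let linl : linear lE.
Proof. by move=> s u v; rewrite /horizontal scale_row_mx scaler0 add_row_mx addr0. Qed.

Let linr : linear lF.
Proof. by move=> s u v; rewrite /vertical scale_row_mx scaler0 add_row_mx addr0. Qed.

Let sE : smooth_on BE lE := smooth_on_coord oBE linl.
Let sF : smooth_on BF lF := smooth_on_coord oBF linr.

Let sl : smooth_on B (fun z => lsubmx z).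
Proof. by apply: (smooth_on_coord oB) => s u v; exact: linearP. Qed.

Let sr : smooth_on B (fun z => rsubmx z).
Proof. by apply: (smooth_on_coord oB) => s u v; exact: linearP. Qed.

Let EB z : BE z -> B (lE z).
Proof. by rewrite /B /BE /= => zr; apply: le_lt_trans zr; rewrite norm_row_mx normr0 normr_ge0 lexx. Qed.

Let FB z : BF z -> B (lF z).
Proof. by rewrite /B /BF /= => zr; apply: le_lt_trans zr; rewrite norm_row_mx normr0 normr_ge0 lexx. Qed.

Let EK z : BE z -> lsubmx (lE z) = z.
Proof. by move=> _; exact: row_mxKl. Qed.

Let FK z : BF z -> rsubmx (lF z) = z.
Proof. by move=> _; exact: row_mxKr. Qed.

Let DE z v : 'D_v lE z = lE v.
Proof.
have [_ ->] := is_derive_row_mx (is_derive_id z v) (is_derive_cst (0 : 'rV[R]_e) z v).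
by [].
Qed.

Let DF z v : 'D_v lF z = lF v.
Proof.
have [_ ->] := is_derive_row_mx (is_derive_cst (0 : 'rV[R]_k) z v) (is_derive_id z v).
by [].
Qed.

Let Dl (z v : 'rV[R]_(k + e)) : 'D_v (fun z : 'rV[R]_(k + e) => lsubmx z) z = lsubmx v.
Proof.
by have [_ ->] : is_derive z v (lsubmx \o id) (lsubmx v) := is_derive_linear_mx lsubmx (is_derive_id z v).
Qed.

Let Dr (z v : 'rV[R]_(k + e)) : 'D_v (fun z : 'rV[R]_(k + e) => rsubmx z) z = rsubmx v.
Proof.
by have [_ ->] : is_derive z v (rsubmx \o id) (rsubmx v) := is_derive_linear_mx rsubmx (is_derive_id z v).
Qed.

Let JE z v : BE z -> v *m 'J lE z = lE v.
Proof. by move=> Bz; rewrite -(jacobianE v oBE sE Bz) DE. Qed.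

Let JF z v : BF z -> v *m 'J lF z = lF v.
Proof. by move=> Bz; rewrite -(jacobianE v oBF sF Bz) DF. Qed.

Let Jl (z v : 'rV[R]_(k + e)) : B z -> v *m 'J (fun z : 'rV[R]_(k + e) => lsubmx z) z = lsubmx v.
Proof. by move=> Bz; rewrite -(jacobianE v oB sl Bz) Dl. Qed.

Let Jr (z v : 'rV[R]_(k + e)) : B z -> v *m 'J (fun z : 'rV[R]_(k + e) => rsubmx z) z = rsubmx v.
Proof. by move=> Bz; rewrite -(jacobianE v oB sr Bz) Dr. Qed.

Let Einv i z : BE z ->
  pb_endo lE (fun z => lsubmx z) (phi i) z *m 'J lE z = 'J lE z *m phi i (lE z).
Proof.
move=> Bz; apply: mx_row_eq => v; rewrite /pb_endo !mulmxA (JE v Bz).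
by rewrite (Jl _ (EB Bz)) (JE _ Bz) -(split_phiE S i v (EB Bz)).
Qed.

Let Finv i z : BF z ->
  pb_endo lF (fun z => rsubmx z) (phi i) z *m 'J lF z = 'J lF z *m phi i (lF z).
Proof.
move=> Bz; apply: mx_row_eq => v; rewrite /pb_endo !mulmxA (JF v Bz).
by rewrite (Jr _ (FB Bz)) (JF _ Bz) -(split_phiF S i v (FB Bz)).
Qed.

Let Exi i z : BE z -> pb_field lE (fun z => lsubmx z) (xi i) z *m 'J lE z = xi i (lE z).
Proof.
by move=> Bz; rewrite /pb_field (Jl _ (EB Bz)) (JE _ Bz) -(split_xiE S i (EB Bz)).
Qed.

Lemma horizontal_slice : exists gE phiE xiE,
  [/\ contact_data BE gE phiE xiE,
   forall z, BE z -> forall v w, bil (gE z) v w = bil (g (lE z)) (lE v) (lE w) &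
   forall i z v w, BE z -> bil (curl (fun z => xiE i z *m gE z) z) v w = h * bil (gE z) v (w *m phiE i z)].
Proof.
exists (pb_g lE g), (fun i => pb_endo lE (fun z => lsubmx z) (phi i)),
  (fun i => pb_field lE (fun z => lsubmx z) (xi i)); split.
- exact: (contact_data_pullback oBE oB sE sl EB EK C Einv Exi).
- by move=> z Bz v w; rewrite (bil_pb_g oBE sE g v w Bz) !DE.
- move=> i z v w Bz; rewrite (curl_pullback oBE oB sE sl EB EK C Exi i v w Bz).
  rewrite (bil_pb_g oBE sE g _ _ Bz) (pb_phiE oBE sE Einv i w Bz) !DE.
  rewrite (sd_curl S i (EB Bz)) bilZ bilMT bilM; congr (h * bil _ _ _).
  by rewrite /horizontal mul_row_block mulmx1 !mulmx0 !addr0.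
Qed.

Lemma vertical_slice : exists gF phiF,
  [/\ [/\ smooth_on BF gF, forall i, smooth_on BF (phiF i) &
     forall z, BF z -> contact3 (bil (gF z)) (fun i v => v *m phiF i z) (fun=> 0)],
   forall z, BF z -> forall v w, bil (gF z) v w = bil (g (lF z)) (lF v) (lF w),
   forall i X Y z, smooth_on BF X -> smooth_on BF Y -> BF z -> nijE (phiF i) X Y z = 0 &
   forall i X Y Z z, smooth_on BF X -> smooth_on BF Y -> smooth_on BF Z -> BF z ->
     d2E (fun z v w => bil (gF z) v (w *m phiF i z)) X Y Z z = 0].
Proof.
have sp i := smooth_pb_endo oBF oB sF sr FB (cd_phi C i).
exists (pb_g lF g), (fun i => pb_endo lF (fun z => rsubmx z) (phi i)); split.
- split=> [|i|z Bz]; [exact: (smooth_pb_g oBF oB sF FB (cd_g C))|exact: sp|].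
  apply: (pb_contact3 oBF oB sF sr FB FK C Finv Bz); right=> i; split=> // v.
  by rewrite DF (split_xiE S i (FB Bz)) (split_ortho S _ _ (FB Bz)).
- by move=> z Bz v w; rewrite (bil_pb_g oBF sF g v w Bz) !DF.
- move=> i X Y z sX sY Bz; apply: (derive_inj oBF oB sF sr FB FK Bz); rewrite derive0.
  apply: (etrans (nijE_pushf oBF oB sF sr FB FK oBF (fun _ H => H) (sp i) (cd_phi C i)
    (fun y v => pb_phiE oBF sF Finv i v) sX sY Bz)).
  have [oV VB Vz] := pushf_dom oB sr FB FK oBF (fun _ H => H) Bz.
  have sX' := smooth_pushf oB sF sr oBF (fun _ H => H) sX.
  have sY' := smooth_pushf oB sF sr oBF (fun _ H => H) sY.
  have sn : smooth_on B (fun z => xi i z *m g z) := smooth_on_mulmx oB (cd_xi C i) (cd_g C).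
  have E0 : d1E (fun z v => pairing (xi i z *m g z) v) (pushf lF (fun z => rsubmx z) X)
      (pushf lF (fun z => rsubmx z) Y) (lF z) = 0.
    apply: (etrans (d1E_curl oV (@smooth_onS R _ _ _ B _ VB sn) sX' sY' Vz)).
    rewrite (sd_curl S i (FB Bz)) bilZ bilMT bilM /pushf DF.
    by rewrite {1}/vertical mul_row_block !mulmx0 !mul0mx !addr0 row_mx0 bil0l mulr0.
  have := cd_normal C i oV VB Vz sX' sY'.
  by rewrite E0 mulr0 scale0r addr0.
- move=> i X Y Z z sX sY sZ Bz.
  exact: (pb_closed oBF oB sF sr FB FK C Finv i oBF (fun _ H => H) Bz sX sY sZ).
Qed.

End Slices.

(** * A ball as a manifold *)

Section RowVectors.
Context {R : realType} {d : nat}.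

Lemma rV_second_countable : @second_countable 'rV[R]_d.
Proof.
pose box (p : 'rV[rat]_d * nat) := [set x : 'rV[R]_d | `|x - map_mx ratr p.1| < p.2.+1%:R^-1].
exists (range box); first by apply: card_le_trans (card_image_le _ _) _; exact: countableP.
split=> [_ [p _ <-]|x V /nbhs_ballP[eps /= eps0 xV]]; first exact: ball_norm_open.
have [n nP] : exists n, 2 * n.+1%:R^-1 < eps.
  exists (Num.truncn (2 / eps)).
  rewrite ltr_pdivrMr// mulrC -ltr_pdivrMr//; exact: truncnS_gt.
have n0 : (0 : R) < n.+1%:R^-1 by rewrite invr_gt0.
have ex j : exists q : rat, `|x 0 j - ratr q| < n.+1%:R^-1 / 2.
  have /rat_in_itvoo[q] : x 0 j - n.+1%:R^-1 / 2 < x 0 j + n.+1%:R^-1 / 2.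
    by rewrite ltrBlDr -addrA ltrDl addr_gt0// divr_gt0.
  by rewrite in_itv/= => qP; exists q; rewrite ltr_distlC.
have [q qP] := choice ex.
pose y : 'rV[rat]_d := \row_j q j.
have xy : `|x - map_mx ratr y| < n.+1%:R^-1.
  apply: (@le_lt_trans _ _ (n.+1%:R^-1 / 2)); last by rewrite ltr_pdivrMr// ltr_pMr// ltr1n.
  apply: mxnorm_le => [|i j]; first by rewrite divr_ge0// ltW.
  by rewrite ord1 !mxE ltW.
exists (box (y, n)); first by split; [exists (y, n)|].
move=> z /= zy; apply: xV; rewrite mx_norm_ball /ball_ /=.
have -> : x - z = (x - map_mx ratr y) - (z - map_mx ratr y) by rewrite opprB addrA subrK.
apply: le_lt_trans (ler_normB _ _) _; apply: lt_trans _ nP.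
by rewrite mulr2n mulrDl !mul1r ltrD.
Qed.

End RowVectors.

Section BallManifold.
Context {R : realType} {d : nat} (r : R).
Hypothesis r0 : 0 < r.
Let B := [set y : 'rV[R]_d | `|y| < r].

Definition ball_coord (x : 'rV[R]_d) : 'rV[R]_d := (r / (1 + `|x|)) *: x.
Definition ball_point (y : 'rV[R]_d) : 'rV[R]_d := (r - `|y|)^-1 *: y.

Let n1 (x : 'rV[R]_d) : 0 < 1 + `|x|.
Proof. by rewrite ltr_pwDl. Qed.

Lemma ball_coord_norm x : `|ball_coord x| < r.
Proof.
rewrite normrZ ger0_norm ?divr_ge0 ?ltW// mulrAC ltr_pdivrMr// ltr_pM2l//.
by rewrite ltrDr.
Qed.

Lemma ball_coordK : cancel ball_coord ball_point.
Proof.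
move=> x; rewrite /ball_point {2}/ball_coord scalerA normrZ ger0_norm ?divr_ge0 ?ltW//.
have -> : r - r / (1 + `|x|) * `|x| = r / (1 + `|x|) by field; rewrite gt_eqF.
by rewrite mulVf ?scale1r// gt_eqF// divr_gt0.
Qed.

Lemma ball_pointK y : `|y| < r -> ball_coord (ball_point y) = y.
Proof.
move=> yr; have ry : 0 < r - `|y| by rewrite subr_gt0.
rewrite /ball_coord /ball_point scalerA normrZ gtr0_norm ?invr_gt0//.
have -> : 1 + (r - `|y|)^-1 * `|y| = r / (r - `|y|) by field; rewrite gt_eqF.
have -> : r / (r / (r - `|y|)) * (r - `|y|)^-1 = 1; last by rewrite scale1r.
by field; rewrite !gt_eqF.
Qed.

Lemma ball_coord_im : ball_coord @` setT = B.
Proof.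
apply/seteqP; split=> [_ [x _ <-]|y By]; first exact: ball_coord_norm.
by exists (ball_point y) => //; exact: ball_pointK.
Qed.

Lemma ball_coord_continuous x : {for x, continuous ball_coord}.
Proof.
apply: continuousZ; last exact: cvg_id.
apply: continuousM; first exact: cst_continuous.
apply: continuousV; first by rewrite gt_eqF.
by apply: continuousD; [exact: cst_continuous|exact: norm_continuous].
Qed.

Lemma ball_point_continuous y : (ball_coord @` setT) y -> {for y, continuous ball_point}.
Proof.
rewrite ball_coord_im => By.
apply: continuousZ; last exact: cvg_id.
apply: continuousV; first by rewrite gt_eqF// subr_gt0.
by apply: continuousB; [exact: cst_continuous|exact: norm_continuous].
Qed.

Lemma ball_coord_im_open : open (ball_coord @` setT).
Proof. by rewrite ball_coord_im; exact: ball0_open. Qed.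

Definition ball_chart : chart R 'rV[R]_d d :=
  @Chart R 'rV[R]_d d ball_coord ball_point setT openT ball_coord_im_open
   (fun x _ => ball_coordK x) (fun x _ => @ball_coord_continuous x) ball_point_continuous.

Lemma ball_chart_compat : smooth_on (ball_chart @` (setT `&` setT)) (ball_chart \o chart_inv ball_chart).
Proof.
rewrite setIT.
have sid : smooth_on (ball_coord @` setT) (fun y : 'rV[R]_d => y).
  by apply: (smooth_on_coord ball_coord_im_open) => a u v.
by apply: (smooth_on_eq ball_coord_im_open _ sid) => _ [x _ <-]; rewrite /= ball_coordK.
Qed.

Definition ball_manifold : manifold R d :=
  @Manifold R d 'rV[R]_d (fun=> ball_chart) (fun=> I) (fun _ _ => ball_chart_compat)
    (@norm_hausdorff _ _) rV_second_countable.

End BallManifold.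

Section Bundles.
Context {R : realType} {d : nat}.

Lemma bil_bilinear (G : 'M[R]_d) : bilinear_for *%R *%R (bil G).
Proof. by split=> w a u v /=; rewrite ?bilDl ?bilDr ?bilZl ?bilZr. Qed.

HB.instance Definition _ (G : 'M[R]_d) :=
  bilinear_isBilinear.Build R 'rV[R]_d 'rV[R]_d R *%R *%R (bil G) (bil_bilinear G).

Lemma pairing_linear (n : 'rV[R]_d) : linear_for *%R (pairing n).
Proof. by move=> a u v; rewrite !pairingE mulmxDl -scalemxAl !mxE. Qed.

HB.instance Definition _ (n : 'rV[R]_d) :=
  GRing.isLinear.Build R 'rV[R]_d R *%R (pairing n) (pairing_linear n).

End Bundles.

Section BallStructures.
Context {R : realType} {d : nat} (r : R).
Hypothesis r0 : 0 < r.
Let B := [set y : 'rV[R]_d | `|y| < r].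
Let oB : open B := @ball0_open R d r.
Let N : manifold R d := @ball_manifold R d r r0.
Local Notation bc := (@ball_coord R d r).
Local Notation bp := (@ball_point R d r).
Implicit Types (p q : N) (X Y Z : N -> 'rV[R]_d).

Let bcB x : B (bc x). Proof. exact: ball_coord_norm r0 x. Qed.

Lemma ball_tangent_coord p q v : tangent_coord p q v = v.
Proof. exact: (tangent_coord_id q v). Qed.

Lemma ball_field_in_chart p X u : field_in_chart p X u = X (bp u).
Proof. exact: ball_tangent_coord. Qed.

Lemma ball_chart_im p : chart_im p = B.
Proof. exact: (@ball_coord_im R d r r0). Qed.

Lemma ball_smooth_field X : smooth_field X <-> smooth_on B (X \o bp).
Proof.
have E p : field_in_chart p X = X \o bp by apply/funext => u; exact: ball_field_in_chart.
split=> [sX|sX p]; last by rewrite ball_chart_im E.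
by have := sX (0 : 'rV[R]_d); rewrite ball_chart_im E.
Qed.

Lemma ball_smooth_fun (f : N -> R) : smooth_fun f <-> smooth_on B (f \o bp).
Proof.
split=> [sf|sf p]; last by rewrite ball_chart_im; exact: sf.
by have := sf (0 : 'rV[R]_d); rewrite ball_chart_im.
Qed.

Section Metric.
Variable G : 'rV[R]_d -> 'M[R]_d.
Hypothesis sG : smooth_on B G.
Hypothesis G_sym : forall z, B z -> forall v w, bil (G z) v w = bil (G z) w v.
Hypothesis G_pos : forall z, B z -> forall v, v != 0 -> 0 < bil (G z) v v.

Definition ball_bil (x : N) : {biscalar 'rV[R]_d} := bil (G (bc x)).

Lemma ball_smooth_metric : smooth_metric ball_bil.
Proof.
move=> X Y /ball_smooth_field sX /ball_smooth_field sY; apply/ball_smooth_fun.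
have s := smooth_on_entry 0 0 oB (smooth_on_mulmx oB (smooth_on_mulmx oB sX sG) (smooth_on_trmx oB sY)).
by apply: (smooth_on_eq oB _ s) => z Bz; rewrite /= ball_pointK.
Qed.

Definition ball_riemannian : riemannian_metric N :=
  @RiemannianMetric R d N ball_bil ball_smooth_metric
    (fun x => G_sym (bcB x)) (fun x => G_pos (bcB x)).

Definition ball_endo (A : 'rV[R]_d -> 'M[R]_d) (x : N) : {linear 'rV[R]_d -> 'rV[R]_d} :=
  mulmxr (A (bc x)).

Lemma ball_smooth_endo A : smooth_on B A -> smooth_endo (ball_endo A).
Proof.
move=> sA X /ball_smooth_field sX; apply/ball_smooth_field.
apply: (smooth_on_eq oB _ (smooth_on_mulmx oB sX sA)) => z Bz.
by rewrite /= ball_pointK.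
Qed.

Lemma ball_nijenhuis A X Y q : smooth_on B A -> smooth_field X -> smooth_field Y ->
  nijenhuis (ball_endo A) X Y q = nijE A (X \o bp) (Y \o bp) (bc q).
Proof.
move=> sA sX sY; have qq : chart_dom (chart_at q) q by [].
have E := nijenhuis_in_chart (p := q) (P := A) _ (ball_smooth_endo sA) sX sY qq.
rewrite -[LHS](ball_tangent_coord q q); apply: etrans (E _) _.
  by move=> x v _; rewrite !ball_tangent_coord.
have F Z z : B z -> field_in_chart q Z z = (Z \o bp) z by move=> _; exact: ball_field_in_chart.
exact: (nijE_congr oB (bcB q) (fun _ _ => erefl) (F X) (F Y)).
Qed.

Lemma ball_fundamental A X Y Z q : smooth_on B A ->
  smooth_field X -> smooth_field Y -> smooth_field Z ->
  d_form2 (fun x u v => ball_riemannian x u (ball_endo A x v)) X Y Z q =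
  d2E (fun z v w => bil (G z) v (w *m A z)) (X \o bp) (Y \o bp) (Z \o bp) (bc q).
Proof.
move=> sA sX sY sZ; have qq : chart_dom (chart_at q) q by [].
have E := d_form2_in_chart (p := q) (w := fun x u v => ball_riemannian x u (ball_endo A x v))
  (a := fun z v w => bil (G z) v (w *m A z)) _ _ sX sY sZ qq.
apply: etrans (E _ _) _.
- by move=> x v v' _; rewrite !ball_tangent_coord.
- by move=> V W sV sW; exact: (ball_smooth_metric sV (ball_smooth_endo sA sW)).
have F V z : B z -> field_in_chart q V z = (V \o bp) z by move=> _; exact: ball_field_in_chart.
exact: (d2E_congr oB (bcB q) (fun _ _ _ _ => erefl) (F X) (F Y) (F Z)).
Qed.

Lemma ball_hyper_kahler (phi : 'I_3 -> 'rV[R]_d -> 'M[R]_d) :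
  (forall i, smooth_on B (phi i)) ->
  (forall z, B z -> contact3 (bil (G z)) (fun i v => v *m phi i z) (fun=> 0)) ->
  (forall i X Y z, smooth_on B X -> smooth_on B Y -> B z -> nijE (phi i) X Y z = 0) ->
  (forall i X Y Z z, smooth_on B X -> smooth_on B Y -> smooth_on B Z -> B z ->
     d2E (fun z v w => bil (G z) v (w *m phi i z)) X Y Z z = 0) ->
  hyper_kahler ball_riemannian.
Proof.
move=> sphi C nij closed; exists (fun i => ball_endo (phi i)); split.
- move=> i.
  have phi2 x (v : 'rV[R]_d) : v *m phi i (bc x) *m phi i (bc x) = - v.
    by rewrite (c3_phi2 (C _ (bcB x))) scaler0 addr0.
  split.
  + exact: ball_smooth_endo (sphi i).
  + exact: phi2.
  + move=> x u v; have := c3_skew (C _ (bcB x)) i u (v *m phi i (bc x)).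
    by rewrite phi2 bilNr opprK.
  + move=> X Y sX sY q; rewrite (ball_nijenhuis q (sphi i) sX sY).
    exact: nij ((ball_smooth_field X).1 sX) ((ball_smooth_field Y).1 sY) (bcB q).
  + move=> X Y Z sX sY sZ q; apply: etrans (ball_fundamental q (sphi i) sX sY sZ) _.
    exact: closed ((ball_smooth_field X).1 sX) ((ball_smooth_field Y).1 sY)
      ((ball_smooth_field Z).1 sZ) (bcB q).
- apply/even_perm_cyclic3 => a b c abc x v; have [E F] := c3_phi (C _ (bcB x)) abc v.
  rewrite /ball_endo /= E F !scaler0 !addr0 opprK.
  by split.
Qed.

Section ThreeAlpha.
Variables (phi : 'I_3 -> 'rV[R]_d -> 'M[R]_d) (xi : 'I_3 -> 'rV[R]_d -> 'rV[R]_d) (h : R).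
Hypothesis C : contact_data B G phi xi.
Hypothesis h0 : h != 0.
Hypothesis curlE : forall i z v w, B z ->
  bil (curl (fun z => xi i z *m G z) z) v w = h * bil (G z) v (w *m phi i z).

Definition ball_xi i (x : N) : 'rV[R]_d := xi i (bc x).

Definition ball_eta i (x : N) : {scalar 'rV[R]_d} := pairing (xi i (bc x) *m G (bc x)).

Lemma ball_smooth_xi i : smooth_field (ball_xi i).
Proof.
apply/ball_smooth_field; apply: (smooth_on_eq oB _ (cd_xi C i)) => z Bz.
by rewrite /ball_xi /= ball_pointK.
Qed.

Lemma ball_smooth_eta i : smooth_one_form (ball_eta i).
Proof.
move=> X /ball_smooth_field sX; apply/ball_smooth_fun.
have s := smooth_on_entry 0 0 oB (smooth_on_mulmx oB (smooth_on_mulmx oB (cd_xi C i) sG) (smooth_on_trmx oB sX)).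
by apply: (smooth_on_eq oB _ s) => z Bz; rewrite /= ball_pointK.
Qed.

Let C3 x := cd_contact C (bcB x).
Let unit1 x i := cd_unit C i (bcB x).

Definition ball_contact i : almost_contact_metric ball_riemannian :=
  @AlmostContactMetric R d N ball_riemannian (ball_endo (phi i)) (ball_xi i) (ball_eta i)
    (ball_smooth_endo (cd_phi C i)) (ball_smooth_xi i) (@ball_smooth_eta i)
    (fun x v => c3_phi2 (C3 x) i v) (fun x => unit1 x i)
    (fun x u v => c3_compat (C3 x) i u v).

Lemma ball_d_eta i X Y q : smooth_field X -> smooth_field Y ->
  d_eta (ball_contact i) X Y q =
  d1E (fun z v => pairing (xi i z *m G z) v) (X \o bp) (Y \o bp) (bc q).
Proof.
move=> sX sY; have qq : chart_dom (chart_at q) q by [].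
have E := d_form1_in_chart (p := q) (w := fun x u => ball_eta i x u)
  (a := fun z v => pairing (xi i z *m G z) v) _ (@ball_smooth_eta i) sX sY qq.
apply: etrans (E _) _.
  by move=> x v _; rewrite !ball_tangent_coord.
have F V z : B z -> field_in_chart q V z = (V \o bp) z by move=> _; exact: ball_field_in_chart.
exact: (d1E_congr oB (bcB q) (fun _ _ _ => erefl) (F X) (F Y)).
Qed.

Lemma ball_three_alpha_sasakian : three_alpha_sasakian h ball_contact.
Proof.
split.
  apply/even_perm_cyclic3 => a b c abc x; split.
  - move=> v; have [E F] := c3_phi (C3 x) abc v; split; rewrite /= /ball_endo /=.
      by rewrite E addrK.
    by rewrite F opprD opprK subrK.
  - have [E F] := c3_xi (C3 x) abc; split; rewrite /= /ball_endo /ball_xi /= ?E//.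
    by rewrite F opprK.
  - move=> v; split; first exact: esym (c3_eta_phir (C3 x) v abc).
    by have := c3_eta_phil (C3 x) v abc => /(congr1 -%R); rewrite opprK => /esym.
move=> i; have bpX X : smooth_field X -> smooth_on B (X \o bp) := (ball_smooth_field X).1.
split; first exact: h0.
- move=> X Y sX sY q; rewrite (ball_d_eta i q sX sY).
  apply: etrans (cd_normal C i oB (fun _ H => H) (bcB q) (bpX _ sX) (bpX _ sY)).
  exact: (congr1 (fun a => a + _) (ball_nijenhuis q (cd_phi C i) sX sY)).
- move=> X Y sX sY q; rewrite (ball_d_eta i q sX sY).
  have sn : smooth_on B (fun z => xi i z *m G z) := smooth_on_mulmx oB (cd_xi C i) sG.
  apply: (etrans (d1E_curl oB sn (bpX _ sX) (bpX _ sY) (bcB q))).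
  by rewrite (curlE _ _ _ (bcB q)) /= !ball_coordK.
Qed.

End ThreeAlpha.
End Metric.
End BallStructures.

(** * The local isometry *)

Section ProductIsometry.
Context {R : realType} {d k e : nat} {M : manifold R d} (g : riemannian_metric M) (p : M).
Variables (r : R) (F : 'rV[R]_(k + e) -> 'rV[R]_d) (rho : 'rV[R]_d -> 'rV[R]_(k + e)).
Hypotheses (r0 : 0 < r) (D : diffeo F rho) (F0 : F 0 = chart_at p p).
Let N1 : manifold R k := @ball_manifold R k r r0.
Let N2 : manifold R e := @ball_manifold R e r r0.
Variables (g1 : riemannian_metric N1) (g2 : riemannian_metric N2).
Let B := [set z : 'rV[R]_(k + e) | `|z| < r].
Let oB : open B := @ball0_open R _ r.
Hypothesis FO : forall z, B z -> chart_im p (F z).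
Hypothesis gF : forall z, B z -> forall v w,
  bil (loc_g g p (F z)) ('D_v F z) ('D_w F z) =
  g1 (ball_point r (lsubmx z)) (lsubmx v) (lsubmx w) +
  g2 (ball_point r (rsubmx z)) (rsubmx v) (rsubmx w).

Let z_of (q : M) := rho (chart_at p q).
Let U := [set q | chart_dom (chart_at p) q /\ B (z_of q)].
Let to_prod (q : M) : prod_manifold N1 N2 :=
  (ball_point r (lsubmx (z_of q)), ball_point r (rsubmx (z_of q))).
Let of_prod (x : prod_manifold N1 N2) : M :=
  chart_inv (chart_at p) (F (row_mx (ball_coord r x.1) (ball_coord r x.2))).

Let B_row a b : `|a| < r -> `|b| < r -> B (row_mx a b).
Proof.
move=> ar br; rewrite /B /=.
have : `|row_mx a b| <= Num.max `|a| `|b| by rewrite norm_row_mx !le_max !lexx orbT.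
by move=> /le_lt_trans; apply; rewrite gt_max ar br.
Qed.

Let B_sub z : B z -> `|lsubmx z| < r /\ `|rsubmx z| < r.
Proof.
move=> Bz; have : `|z| <= `|z| by [].
by rewrite -{1}[z]hsubmxK norm_row_mx => /andP[l1 l2]; split; apply: le_lt_trans Bz.
Qed.

Let coordsK z : B z ->
  row_mx (ball_coord r (ball_point r (lsubmx z))) (ball_coord r (ball_point r (rsubmx z))) = z.
Proof. by move=> /B_sub[l1 l2]; rewrite !ball_pointK ?hsubmxK. Qed.

Let U_open : open U.
Proof.
rewrite openE => q [pq Bq].
have oW : open [set w | setT w /\ B (rho w)] := open_preim_smooth openT oB (df_smoothV D).
have Wq : [set w | setT w /\ B (rho w)] (chart_at p q) by split.
have := chart_continuous pq (open_nbhs_nbhs (conj oW Wq)).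
have := open_nbhs_nbhs (conj (@chart_dom_open R M d (chart_at p)) pq).
by apply: filterS2 => x px [_ Bx].
Qed.

Let U_p : U p.
Proof.
split; first exact: chart_at_dom.
by rewrite /z_of /B /= -F0 (df_K D) normr0.
Qed.

Let of_prod_z x : let z := row_mx (ball_coord r x.1) (ball_coord r x.2) in
  [/\ B z, chart_dom (chart_at p) (of_prod x) & z_of (of_prod x) = z].
Proof.
move=> z; have Bz : B z by apply: B_row; exact: ball_coord_norm.
split=> //; first exact: chart_im_dom (FO Bz).
by rewrite /z_of /of_prod (chart_invK (FO Bz)) (df_K D).
Qed.

Let of_prodU x : U (of_prod x).
Proof. by have [Bz px E] := of_prod_z x; split=> //; rewrite E. Qed.

Let of_prodK x : to_prod (of_prod x) = x.
Proof.
have [_ _ E] := of_prod_z x; rewrite /to_prod E row_mxKl row_mxKr !ball_coordK//.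
by case: x {E}.
Qed.

Let to_prodK q : U q -> of_prod (to_prod q) = q.
Proof.
move=> [pq Bq]; rewrite /of_prod /to_prod /= coordsK//.
by rewrite /z_of (df_VK D) chartK.
Qed.

Let prod_coords (q' x : prod_manifold N1 N2) :
  chart_at q' x = row_mx (ball_coord r x.1) (ball_coord r x.2) :> 'rV[R]_(k + e).
Proof. by []. Qed.

Let to_prod_coords q' q : U q -> chart_at q' (to_prod q) = z_of q.
Proof. by move=> [_ Bq]; rewrite prod_coords coordsK. Qed.

Let oUp p' : open (chart_at p' @` (chart_dom (chart_at p') `&` U)).
Proof. exact: (@chart_im_openS R M d (chart_at p') U U_open). Qed.

Let smooth_to p' (q' : prod_manifold N1 N2) : smooth_on (chart_at p' @` (chart_dom (chart_at p') `&` U))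
  (chart_at q' \o to_prod \o chart_inv (chart_at p')).
Proof.
have s1 : smooth_on (chart_at p' @` (chart_dom (chart_at p') `&` U)) (trans p' p).
  apply: (@smooth_onS R d _ _ (trans_dom p' p)); last exact: smooth_trans.
  by move=> _ [x [p'x [px _]] <-]; exists x.
have s2 := smooth_on_comp (@oUp p') openT (df_smoothV D) s1 (fun _ _ => I).
apply: (smooth_on_eq (@oUp p') _ s2) => _ [x [p'x Ux] <-].
rewrite /= (chartK p'x); apply: etrans (esym (to_prod_coords q' Ux)).
by rewrite (trans_chart p p'x).
Qed.

Let smooth_map_to : smooth_map_on U to_prod.
Proof.
split=> [q [pq Bq]|p' q'].
  have cz : {for q, continuous z_of}.
    apply: (@continuous_comp _ _ _ (chart_at p) rho); first exact: chart_continuous.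
    exact: (smooth_on_continuous (df_smoothV D) I).
  have [l1 l2] := B_sub Bq.
  have c1 : {for q, continuous (fun x => ball_point r (lsubmx (z_of x)))}.
    apply: (@continuous_comp _ _ _ (fun x => lsubmx (z_of x)) (ball_point r)).
      by apply: (continuous_comp cz); exact: continuous_lsubmx.
    by apply: (ball_point_continuous r0); rewrite ball_coord_im.
  have c2 : {for q, continuous (fun x => ball_point r (rsubmx (z_of x)))}.
    apply: (@continuous_comp _ _ _ (fun x => rsubmx (z_of x)) (ball_point r)).
      by apply: (continuous_comp cz); exact: continuous_rsubmx.
    by apply: (ball_point_continuous r0); rewrite ball_coord_im.
  exact: (cvg_pair c1 c2).
have s := @smooth_to p' q'.
apply: (@smooth_onS R d _ _ _ _ _ s) => _ [x [[p'x Ux] _] <-].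
by exists x.
Qed.

Let smooth_map_of : smooth_map_on setT of_prod.
Proof.
split=> [x _|x0 q'].
  have [Bz px E] := of_prod_z x.
  have cr : {for x, continuous (fun x : N1 * N2 => row_mx (ball_coord r x.1) (ball_coord r x.2))}.
    apply: cvg_row_mx.
      apply: (@continuous_comp _ _ _ fst (ball_coord r)); first exact: cvg_fst.
      exact: ball_coord_continuous.
    apply: (@continuous_comp _ _ _ snd (ball_coord r)); first exact: cvg_snd.
    exact: ball_coord_continuous.
  apply: (@continuous_comp _ _ _ (fun x : N1 * N2 => F (row_mx (ball_coord r x.1) (ball_coord r x.2)))
    (chart_inv (chart_at p))).
    by apply: (continuous_comp cr); exact: (smooth_on_continuous (df_smooth D) I).
  exact: chart_inv_continuous (FO Bz).
pose A := [set z : 'rV[R]_(k + e) | B z /\ trans_dom p q' (F z)].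
have sFB : smooth_on B F := @smooth_onS R _ _ B setT F (fun _ _ => I) (df_smooth D).
have oA : open A := open_preim_smooth oB (@trans_dom_open _ _ _ p q') sFB.
have sFA : smooth_on A F := @smooth_onS R _ _ A setT F (fun _ _ => I) (df_smooth D).
have s := smooth_on_comp oA (@trans_dom_open _ _ _ p q') (@smooth_trans _ _ _ p q') sFA (fun z Az => Az.2).
apply: (@smooth_onS R _ _ _ A).
  move=> _ [x [[_ _] /= q'x] <-]; have [Bz px E] := of_prod_z x; split; first exact: Bz.
  by apply/trans_domE; split; [exact: FO|exact: q'x].
apply: (smooth_on_eq oA _ s) => z [Bz _].
by rewrite /trans /= /of_prod /= coordsK.
Qed.

Let metric_to q : U q -> forall u v,
  prod_metric g1 g2 (to_prod q) (tangent_map to_prod q u) (tangent_map to_prod q v) = g q u v.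
Proof.
move=> Uq u v; have [pq Bq] := Uq; have qq := chart_at_dom q.
have TE w : tangent_map to_prod q w = 'D_(tangent_coord p q w) rho (chart_at p q).
  have oV := @oUp q; have Vq : (chart_at q @` (chart_dom (chart_at q) `&` U)) (chart_at q q) by exists q.
  have E : 'D_w (rho \o trans q p) (chart_at q q) = 'D_(tangent_coord p q w) rho (chart_at p q).
    have := derive_chain w (@trans_dom_open _ _ _ q p) openT (@smooth_trans _ _ _ q p) (df_smoothV D) (trans_dom_self pq) I.
    by rewrite trans_chart.
  apply: etrans _ E; apply: (derive_congr w oV Vq) => _ [x [qx Ux] <-].
  apply: etrans (congr1 (fun y => chart_at (to_prod q) (to_prod y)) (chartK qx)) _.
  apply: etrans (@to_prod_coords (to_prod q) x Ux) _.
  by rewrite /= (trans_chart p qx).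
have DK w : 'D_('D_w rho (chart_at p q)) F (z_of q) = w.
  rewrite (jacobianE _ openT (df_smooth D) (I : setT (z_of q))).
  rewrite (jacobianE _ openT (df_smoothV D) (I : setT (chart_at p q))).
  have := diffeo_jacobianV D (z_of q); rewrite /z_of (df_VK D) => E.
  by rewrite -mulmxA E mulmx1.
apply: etrans (congr2 (fun a b => prod_metric g1 g2 (to_prod q) a b) (TE u) (TE v)) _.
apply: etrans (esym (gF Bq _ _)) _.
apply: etrans (congr2 (fun a b => bil (loc_g g p (F (z_of q))) a b) (DK _) (DK _)) _.
apply: etrans (congr1 (fun y => bil (loc_g g p y) _ _) (df_VK D _)) _.
exact: esym (loc_bilE g u v pq).
Qed.

Lemma ball_product_isometry : exists (V : set M) (H : M -> prod_manifold N1 N2),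
  [/\ open V, V p & @isometry_of_open R d (k + e) M (prod_manifold N1 N2)
    (fun q u v => g q u v) (@prod_metric R k e N1 N2 g1 g2) V H].
Proof.
exists U, to_prod; split; [exact: U_open|exact: U_p|].
split; [exact: smooth_map_to| |exact: metric_to].
by exists of_prod; split; [exact: smooth_map_of|exact: of_prodU|exact: of_prodK|exact: to_prodK].
Qed.

End ProductIsometry.

Theorem corollary5p7 (R : realType) (n l : nat) (hl : (l <= n)%N)
    (M : manifold R (4 * n + 3)) (g : riemannian_metric M)
    (S : 'I_3 -> almost_contact_metric g) (c : R)
    (hS : three_quasi_sasakian S)
    (hrank : three_rank S (4 * l + 3))
    (hbracket : reeb_bracket_constant S c)
    (hc : c != 0) :
  @locally_riemannian_product R (4 * n + 3) M g (4 * l + 3) (4 * (n - l))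
    (fun N1 g1 => exists S1 : 'I_3 -> almost_contact_metric g1,
       three_alpha_sasakian (c / 2) S1)
    (fun N2 g2 => hyper_kahler g2).
Proof.
move=> p; have [S3 Q] := hS; have oO := @chart_im_open' _ _ _ p.
have h0 : c / 2 != 0 by rewrite mulf_neq0// invr_neq0// pnatr_eq0.
have C := manifold_contact_data S3 p Q.
have [P [sP HP]] := quasi_sasakian_projection oO C hc
  (fun a b e abe u Ou => loc_reeb_bracket hbracket abe Ou).
have Op : chart_im p (chart_at p p) by exists p => //; exact: chart_at_dom.
have D : split_data (chart_im p) (loc_g g p) (loc_phi S p) (loc_xi S p) P (c / 2).
  split; [exact: C|exact: sP|..].
  - by move=> u /HP[].
  - by move=> u /HP[].
  - by move=> u i /HP[].
  - by move=> u i /HP[].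
  - by move=> u i /HP[].
have rk : \rank (P (chart_at p p)) = (4 * l + 3)%N.
  have [P1 P2 P3 P4 P5] := HP _ Op.
  exact: (projection_rank S3 Q (hrank 0) h0 P1 P2 (P3 0) (P4 0) (P5 0)).
have De : (4 * n + 3 = (4 * l + 3) + 4 * (n - l))%N by lia.
have [r r0 [F [rho [g' [phi' [xi' [dF F0 D' FO]]]]]]] := split_normal_form De h0 oO Op D rk.
have [gE [phiE [xiE [CE gEE curlE]]]] := horizontal_slice D'.
have [gF [phiF [[sgF sphiF CF] gFE nijF clF]]] := vertical_slice D'.
have symE z (Bz : `|z| < r) v w := c3_sym (cd_contact CE Bz) v w.
have posE z (Bz : `|z| < r) v : v != 0 -> 0 < bil (gE z) v v by exact: (c3_pos (cd_contact CE Bz)).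
have symF z (Bz : `|z| < r) v w := c3_sym (CF z Bz) v w.
have posF z (Bz : `|z| < r) v : v != 0 -> 0 < bil (gF z) v v by exact: (c3_pos (CF z Bz)).
pose g1 := ball_riemannian r0 (cd_g CE) symE posE.
pose g2 := ball_riemannian r0 sgF symF posF.
have [||V [H [oV Vp iso]]] := @ball_product_isometry _ _ _ _ _ g p r F rho r0 dF F0 g1 g2.
- by move=> z Bz; exact: (FO z Bz).1.
- move=> z Bz v w; rewrite -(FO z Bz).2 (split_metric h0 D' v w Bz).
  have [Bl Br] : `|lsubmx z| < r /\ `|rsubmx z| < r.
    have : `|z| <= `|z| by [].
    by rewrite -{1}[z]hsubmxK norm_row_mx => /andP[l1 l2]; split; apply: le_lt_trans Bz.
  by rewrite -gEE// -gFE// /g1 /g2 /= !ball_pointK.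
exists V, (ball_manifold r0), g1, (ball_manifold r0), g2, H; split; [exact: oV|exact: Vp| | |exact: iso].
- exists (ball_contact r0 (cd_g CE) symE posE CE).
  exact: (ball_three_alpha_sasakian r0 (cd_g CE) symE posE CE h0 curlE).
- exact: (ball_hyper_kahler sgF symF posF sphiF CF nijF clF).
Qed.
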